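(* Let $M$ be a closed, oriented, irreducible, atoroidal 3-manifold and let $\varphi$ be an Anosov flow on $M$ with orientable weak stable and unstable foliations $W^s,W^u$, adapted to $W^u$. Let $\mathcal{O}$ be its flow space with foliations $\mathcal{O}^s,\mathcal{O}^u$, let $\mathcal{L}^u$ be the leaf space of $\widetilde W^u$, let $E_\infty$ be the circle bundle at infinity over $\mathcal{L}^u$, let $\theta_\lambda\in\partial_\infty\lambda$ be the common backward endpoint of orbits in $\lambda\in\mathcal{L}^u$ and let $s_{\mathbf{nm}}(\lambda)=\theta_\lambda$ be the nonmarker section. Let $\Phi:\mathcal{O}\to E_\infty$ be the stitching map, induced by the map $\widetilde M\to E_\infty$ sending $p$ in the leaf $\lambda$ of $\widetilde W^u$ to the endpoint in $\partial_\infty\lambda$ of the forward orbit $(\widetilde\varphi_t(p))_{t\ge 0}$. Then $\Phi$ is onto the complement of (the image of) the nonmarker section and induces a $\pi_1(M)$-equivariant homeomorphism $\Phi:\mathcal{O}\to E_\infty\smallsetminus s_{\mathbf{nm}}$. Further, $\Phi$ identifies the stable foliation $\mathcal{O}^s$ with the foliation of $E_\infty\smallsetminus s_{\mathbf{nm}}$ by markers, and identifies the unstable foliation $\mathcal{O}^u$ with the foliation of $E_\infty\smallsetminus s_{\mathbf{nm}}$ by the open arcs $\partial_\infty\lambda\smallsetminus\theta_\lambda$, $\lambda\in\mathcal{L}^u$.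
   Context: $M$ is atoroidal: $\mathbb{Z}\oplus\mathbb{Z}\nleq\pi_1(M)$. A topological Anosov flow $\varphi$ preserves a pair of topologically transverse 2-dimensional foliations $W^s,W^u$ whose leaves intersect along orbits, such that for all small $\epsilon>0$, writing $W^{s/u}_\epsilon(x)$ for the component containing $x$ of the intersection of the leaf through $x$ with the $\epsilon$-ball: (i) if $y\in W^s_\epsilon(x)$ (resp. $W^u_\epsilon(x)$) there is an increasing homeomorphism $\sigma$ of $\mathbb{R}$ fixing $0$ with $d(\varphi_t(x),\varphi_{\sigma(t)}(y))\to 0$ as $t\to+\infty$ (resp. $-\infty$); (ii) there is $\delta>0$ such that if such $y$ is not on the same $\epsilon$-local orbit as $x$, then for every such $\sigma$ there is $t<0$ (resp. $t>0$) with $d(\varphi_t(x),\varphi_{\sigma(t)}(y))>\delta$. Adapted to $W^u$ (always achievable up to orbit equivalence, and assumed throughout): there is a continuous metric on $M$ restricting to a hyperbolic metric on each leaf of $W^u$, orbits of $\varphi$ are geodesics in leaves of $W^u$, and strong unstable leaves are projections of horocycles. Tildes denote lifts to the universal cover $\widetilde M$. $\mathcal{O}=\widetilde M/\widetilde\varphi$ is a plane with induced $\pi_1(M)$-action, $\Theta:\widetilde M\to\mathcal{O}$ is the projection, and $\mathcal{O}^{s/u}=\Theta(\widetilde W^{s/u})$ are transverse 1-dimensional foliations. $\mathcal{L}^u=\widetilde M/\widetilde W^u$ is a simply connected, possibly non-Hausdorff 1-manifold. Each leaf $\lambda$ of $\widetilde W^u$ is isometric to $\mathbb{H}^2$ with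 ideal circle $\partial_\infty\lambda$. $E_\infty=\bigcup_{\lambda\in\mathcal{L}^u}\partial_\infty\lambda$, topologized so that for each transversal $\tau$ to $\widetilde W^u$ the map from the unit tangent bundle to the leaves along $\tau$ to $E_\infty|_\tau$, sending $(p,v)$ to the forward endpoint of the leafwise geodesic through $p$ tangent to $v$, is a homeomorphism. Markers. Let $\delta$ be the separation constant (the largest number such that each leaf is quasi-isometrically embedded in its $\delta$-neighborhood). For $\epsilon<\delta$, an $\epsilon$-marker is an embedding $m:[0,1]\times[0,\infty)\to\widetilde M$ such that each $m(t,[0,\infty))$ is a geodesic ray in a leaf of $\widetilde W^u$ and each $m([0,1],x)$ is a transversal of height less than $\epsilon/3$. Its horizontal rays limit onto an embedded interval in $E_\infty$ transverse to the circle fibers, also called a marker ($\epsilon$ is fixed and sufficiently small). Markers in $E_\infty$ do not cross and are amalgamated along endpoints; a maximal amalgamation is a maximal marker, also called a marker, and the leaves of the foliation by markers are these maximal ones. *)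

(* Defs.v *)
From HB Require Import structures.
From Stdlib Require Import Relation_Operators.
From mathcomp Require Import all_boot all_order all_algebra generic_quotient.
From mathcomp Require Import all_classical all_reals all_analysis.

Set Implicit Arguments.
Unset Strict Implicit.
Unset Printing Implicit Defensive.

Import Order.TTheory GRing.Theory Num.Theory.
Import numFieldNormedType.Exports.

Local Open Scope classical_set_scope.
Local Open Scope ring_scope.
Local Open Scope quotient_scope.

(** * Quotients by the equivalence relation generated by a relation *)

Section GeneratedQuotient.
Context {T : choiceType} (r : T -> T -> Prop).

Definition gen_rel : rel T := fun x y => `[< clos_refl_sym_trans T r x y >].

Lemma gen_rel_class : equiv_class_of gen_rel.
Proof.
split=> [x|x y|y x z].
- by apply/asboolP; apply: rst_refl.
- by apply/asboolP/asboolP; apply: rst_sym.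
- by move=> /asboolP xy /asboolP yz; apply/asboolP; apply: (rst_trans _ _ _ y).
Qed.

Canonical gen_equiv := EquivRelPack gen_rel_class.

End GeneratedQuotient.

Notation gen_quot r := {eq_quot (gen_equiv r)}.

Definition quot_space (X : topologicalType) (r : X -> X -> Prop) :=
  quotient_topology (gen_quot r).

Definition quot_map (X : topologicalType) (r : X -> X -> Prop) (x : X) :
  quot_space r := \pi_(gen_quot r) x.

(** * Manifolds *)

(* Charts are onto the whole model space, so that the plaques of the foliated
   charts below are connected. *)
Record chart (X E : topologicalType) := Chart {
  dom : set X;
  cmap :> X -> E;
  cinv : E -> X;
  dom_open : open dom;
  cmap_continuous : {within dom, continuous cmap};
  cinv_continuous : continuous cinv;
  cinv_dom : forall e, dom (cinv e);
  cmapK : forall x, dom x -> cinv (cmap x) = x;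
  cinvK : cancel cinv cmap
}.

Section Orientation.
Context {R : realType}.

Definition unit_sphere (E : normedModType R) : set E := [set v | `|v| = 1].

(* Local degree 1 at e, by Hopf's theorem: the image of every small sphere about
   e is homotopic, in the complement of h e, to the standard sphere. *)
Definition orient_pres_at (E : normedModType R) (h : E -> E) (e : E) :=
  \forall r \near (0 : R)^'+, exists H : R * E -> E,
    [/\ {within `[0, 1] `*` @unit_sphere E, continuous H},
        forall v, unit_sphere v -> H (0, v) = v,
        forall v, unit_sphere v -> H (1, v) = h (e + r *: v) - h e &
        forall t v, 0 <= t <= 1 -> unit_sphere v -> H (t, v) != 0].

Definition closed_manifold (M E : topologicalType) :=
  [/\ hausdorff_space M, compact [set: M], connected [set: M] &
      forall x : M, exists c : chart M E, dom c x].

Definition orientable_manifold (M : topologicalType) (E : normedModType R) :=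
  exists A : set (chart M E),
    (forall x, exists2 c, A c & dom c x) /\
    (forall c c' x, A c -> A c' -> dom c x -> dom c' x ->
      orient_pres_at (c' \o cinv c) (c x)).

(* Spheres are collared (equivalently, locally flat); a spherical shell in R^3
   serves as the collar, the middle sphere being the sphere in question. The
   unit sphere of the norm of R * R * R is the boundary of a cube. *)
Definition irreducible_3manifold (M : topologicalType) :=
  let R3 := (R * R * R)%type in
  forall f : R3 -> M,
    let shell := [set v : R3 | 1/2 <= `|v| <= 2] in
    {within shell, continuous f} -> {in shell &, injective f} ->
    exists b : R3 -> M, let B := [set v : R3 | `|v| <= 1] in
      [/\ {within B, continuous b}, {in B &, injective b} &
          b @` unit_sphere (E := R3) = f @` unit_sphere (E := R3)].

End Orientation.

(** * The universal cover and its deck group *)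

Section UniversalCover.
Context {R : realType}.

Definition simply_connected (X : topologicalType) :=
  (forall x y : X, exists f : R -> X,
    [/\ {within `[0, 1], continuous f}, f 0 = x & f 1 = y]) /\
  (forall f : R -> X, {within `[0, 1], continuous f} -> f 0 = f 1 ->
    exists H : R * R -> X,
      [/\ {within `[0, 1] `*` `[0, 1], continuous H},
          forall t, 0 <= t <= 1 -> H (0, t) = f t,
          forall t, 0 <= t <= 1 -> H (1, t) = f 0 &
          forall s, 0 <= s <= 1 -> H (s, 0) = f 0 /\ H (s, 1) = f 0]).

Definition covering_map (X M : topologicalType) (p : X -> M) :=
  [/\ continuous p, (forall y, exists x, p x = y) &
    forall y, exists2 U, open U /\ U y &
      exists V : set (set X),
        [/\ p @^-1` U = \bigcup_(W in V) W,
            (forall W W', V W -> V W' -> W `&` W' !=set0 -> W = W') &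
            forall W, V W -> [/\ open W, {in W &, injective p}, p @` W = U &
              forall O, open O -> O `<=` W -> open (p @` O)]]].

Definition universal_cover (X M : topologicalType) (p : X -> M) :=
  covering_map p /\ simply_connected X.

(* The fundamental group of M is taken to be the deck group of its universal
   cover. *)
Definition deck (X M : topologicalType) (p : X -> M) : set (X -> X) :=
  [set g | [/\ continuous g, p \o g = p &
    exists g', [/\ continuous g', cancel g g' & cancel g' g]]].

Definition atoroidal (X M : topologicalType) (p : X -> M) :=
  ~ exists h : int * int -> X -> X,
    [/\ forall k, deck p (h k), forall k l, h (k + l) = h k \o h l &
        injective h].

(* The metric of X is the lift of the metric of M. *)
Definition lifted_metric (X M : metricType R) (p : X -> M) :=
  (forall x : X, exists2 U, nbhs x U &
     forall y z, U y -> U z -> mdist (p y) (p z) = mdist y z) /\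
  (forall g, deck p g -> forall y z, mdist (g y) (g z) = mdist y z).

End UniversalCover.

(** * Foliations *)

Section Foliations.
Context {R : realType} {E F : normedModType R}.

(* A foliated chart has leaf coordinate in E and transverse coordinate in F;
   its plaques are the level sets of the transverse coordinate. *)
Definition fchart (X : topologicalType) := chart X (E * F)%type.

Context {X : topologicalType}.
Implicit Types (A : set (fchart X)) (c : fchart X).

Definition coherent c c' := forall x, dom c x -> dom c' x ->
  exists2 U, nbhs x U & forall y z, U y -> U z ->
    [/\ dom c y, dom c' y & (c y).2 = (c z).2 <-> (c' y).2 = (c' z).2].

(* A foliation is given by a foliated atlas, not necessarily maximal. *)
Definition foliated_atlas A :=
  (forall x, exists2 c, A c & dom c x) /\
  (forall c c', A c -> A c' -> coherent c c').

Definition compatible A c := forall c', A c' -> coherent c c'.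

Definition same_plaque A x y := exists c,
  [/\ A c, dom c x, dom c y & (c x).2 = (c y).2].

Definition leaf A x : set X :=
  [set y | clos_refl_sym_trans X (same_plaque A) x y].

Definition leaf_space A := quot_space (same_plaque A).

Definition orientable_foliation A := exists A' : set (fchart X),
  [/\ foliated_atlas A', forall c, A' c -> compatible A c &
    forall c c' x, A' c -> A' c' -> dom c x -> dom c' x ->
      orient_pres_at (fun e : E => (c' (cinv c (e, (c x).2))).1) (c x).1].

Definition transversal A (I : set R) (tau : R -> X) :=
  {within I, continuous tau} /\
  forall t, I t -> exists2 c, A c & exists2 e : R, 0 < e &
    forall s, I s -> `|s - t| < e -> dom c (tau s) /\
      forall s', I s' -> `|s' - t| < e ->
        (c (tau s)).2 = (c (tau s')).2 -> s = s'.

End Foliations.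
Arguments fchart {R} E F X.

Definition lift_atlas (R : realType) (E F : normedModType R)
    (X M : topologicalType) (p : X -> M) (A : set (fchart E F M)) :
    set (fchart E F X) :=
  [set c' | exists2 c, A c &
    forall x, dom c' x -> dom c (p x) /\ c' x = c (p x)].

(** * Topological Anosov flows *)

Section Flows.
Context {R : realType}.

Definition is_flow (X : topologicalType) (phi : R -> X -> X) :=
  [/\ continuous (fun tx : R * X => phi tx.1 tx.2), phi 0 = id &
      forall s t, phi (s + t) = phi s \o phi t].

Definition on_orbit (X : Type) (phi : R -> X -> X) (x y : X) :=
  exists t, y = phi t x.

Definition orbit_space (X : topologicalType) (phi : R -> X -> X) :=
  quot_space (on_orbit phi).

Definition incr_homeo (sigma : R -> R) :=
  [/\ continuous sigma, {homo sigma : s t / s < t} &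
      forall y, exists x, sigma x = y].

Context {M : metricType R}.

Definition local_leaf (L : M -> set M) (e : R) (x : M) : set M :=
  connected_component (L x `&` [set y | mdist x y < e]) x.

Definition fwd_asymptotic (phi : R -> M -> M) (sigma : R -> R) x y :=
  [/\ incr_homeo sigma, sigma 0 = 0 &
      (fun t : R => mdist (phi t x) (phi (sigma t) y)) @ +oo --> (0 : R)].

Definition stable_at_scale (phi : R -> M -> M) (L : M -> set M) (e : R) :=
  (forall x y, local_leaf L e x y -> exists sigma, fwd_asymptotic phi sigma x y)
  /\
  (exists2 delta : R, 0 < delta & forall x y, local_leaf L e x y ->
     ~ local_leaf (on_orbit phi) e x y ->
     forall sigma, fwd_asymptotic phi sigma x y ->
     exists2 t, t < 0 & delta < mdist (phi t x) (phi (sigma t) y)).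

Notation fchart3 := (fchart (R * R)%type R).

(* Around every point there are coordinates (a, b, t) in which the plaques of
   the two foliations are the level sets of a and of b, and the lines on which
   a and b are constant lie on orbits. *)
Definition transverse_along_orbits (phi : R -> M -> M)
    (As Au : set (fchart3 M)) :=
  forall x, exists cs cu : fchart3 M,
    [/\ compatible As cs, compatible Au cu, dom cs x, dom cs = dom cu &
      (forall y, dom cs y -> exists a b t, cs y = (b, t, a) /\ cu y = (a, t, b))
      /\ (forall y z, dom cs y -> dom cs z ->
            (cs y).2 = (cs z).2 -> (cu y).2 = (cu z).2 -> on_orbit phi y z)].

(* The condition on the unstable foliation is the condition on the stable
   foliation for the reversed flow. *)
Definition topological_anosov (phi : R -> M -> M) (As Au : set (fchart3 M)) :=
  [/\ is_flow phi,
      foliated_atlas As /\ foliated_atlas Au,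
      (forall t x y, leaf As x y -> leaf As (phi t x) (phi t y)) /\
      (forall t x y, leaf Au x y -> leaf Au (phi t x) (phi t y)),
      transverse_along_orbits phi As Au &
      exists2 e0 : R, 0 < e0 & forall e, 0 < e < e0 ->
        stable_at_scale phi (leaf As) e /\
        stable_at_scale (fun t => phi (- t)) (leaf Au) e].

Definition strong_unstable (phi : R -> M -> M) (x : M) : set M :=
  [set y | (fun t : R => mdist (phi t x) (phi t y)) @ -oo --> (0 : R)].

End Flows.
Notation fchart3 R := (fchart (R * R)%type R).

(** * Leafwise geometry and the circle bundle at infinity *)

Section LeafwiseGeometry.
Context {R : realType} {X : metricType R}.
Context (A : set (fchart3 R X)).

Definition path_length (g : R -> X) : \bar R :=
  ereal_sup [set l | exists (n : nat) (s : nat -> R),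
    [/\ {homo s : i j / (i <= j)%N >-> i <= j}, forall i, 0 <= s i <= 1 &
        l = (\sum_(i < n) mdist (g (s i)) (g (s i.+1)))%:E]].

(* The restriction of the metric to the leaves, as an intrinsic metric; it is
   +oo between points of distinct leaves. *)
Definition leaf_dist (x y : X) : \bar R :=
  ereal_inf [set path_length g | g in [set g : R -> X |
    [/\ {within `[0, 1], continuous g}, g 0 = x, g 1 = y &
        forall t, 0 <= t <= 1 -> leaf A x (g t)]]].

Definition half_plane : set (R * R) := [set p | 0 < p.2].

(* arcosh (1 + |p - q|^2 / (2 Im p Im q)) *)
Definition hyp_dist (p q : R * R) : R :=
  let c := 1 + ((p.1 - q.1) ^+ 2 + (p.2 - q.2) ^+ 2) / (2 * p.2 * q.2) in
  ln (c + Num.sqrt (c ^+ 2 - 1)).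

(* Each leaf is isometric to the hyperbolic plane, and the isometries can be
   chosen continuously along a transversal through any given point. *)
Definition leafwise_hyperbolic := forall x : X,
  exists F : (R * R) * R -> X,
    [/\ {within half_plane `*` `]-1, 1[, continuous F},
        F ((0, 1), 0) = x,
        transversal A `]-1, 1[ (fun t => F ((0, 1), t)) &
        forall t, -1 < t < 1 ->
          [set F (p, t) | p in half_plane] = leaf A (F ((0, 1), t)) /\
          forall p q, half_plane p -> half_plane q ->
            leaf_dist (F (p, t)) (F (q, t)) = (hyp_dist p q)%:E].

Definition geodesic : set (R -> X) :=
  [set g | forall s t, leaf_dist (g s) (g t) = `|s - t|%:E].

(* Complete unit-speed geodesics; since the leaves are complete, g stands for
   the unit tangent vector (g 0, g' 0), and the compact-open topology is the
   topology of the leafwise unit tangent bundle. *)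
Definition geod : Type := set_type geodesic.

HB.instance Definition _ := Choice.on geod.

Definition gval (g : geod) : R -> X := \val g.
Coercion gval : geod >-> Funclass.

Definition asymptotic (g h : geod) := exists C : R,
  forall t, 0 <= t -> (leaf_dist (g t) (h t) <= C%:E)%E.

Definition Einf : Type := gen_quot asymptotic.

HB.instance Definition _ := Choice.on Einf.

Definition endpt (g : geod) : Einf := \pi_(gen_quot asymptotic) g.

(* For every transversal tau, the endpoint map on the unit tangent bundle to
   the leaves along tau is continuous; Einf carries the finest such topology,
   for which it is a homeomorphism onto Einf restricted to tau. *)
Definition Einf_open (U : set Einf) :=
  forall tau, transversal A `[0, 1] tau ->
    exists2 V : set {compact-open, R -> X}, open V &
      forall g : geod, (tau @` `[0, 1]) (g 0) -> (U (endpt g) <-> V (gval g)).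

Lemma Einf_openT : Einf_open setT.
Proof. by move=> tau _; exists setT => //; exact: openT. Qed.

Lemma Einf_openI : setI_closed Einf_open.
Proof.
move=> U U' oU oU' tau ttau.
have [V oV UV] := oU _ ttau; have [V' oV' UV'] := oU' _ ttau.
exists (V `&` V'); first exact: openI.
move=> g g0; have [a b] := UV g g0; have [c d] := UV' g g0.
by split=> -[x y]; split; auto.
Qed.

Lemma Einf_open_bigU (I : Type) (f : I -> set Einf) :
  (forall i, Einf_open (f i)) -> Einf_open (\bigcup_i f i).
Proof.
move=> oF tau ttau.
have /choice[V fV] : forall i, exists V : set {compact-open, R -> X},
    open V /\ forall g : geod, (tau @` `[0, 1]) (g 0) ->
      (f i (endpt g) <-> V (gval g)).
  by move=> i; have [V oV fV] := oF i _ ttau; exists V.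
exists (\bigcup_i V i); first by apply: bigcup_open => i _; have [] := fV i.
move=> g g0; split=> -[i _ fi]; exists i => //;
  by have [_ /(_ g g0)[h1 h2]] := fV i; auto.
Qed.

HB.instance Definition _ :=
  isOpenTopological.Build Einf Einf_openT Einf_openI Einf_open_bigU.

Definition circle_at_infinity (l : leaf_space A) : set Einf :=
  [set e | exists2 g : geod, l = quot_map (same_plaque A) (g 0) & e = endpt g].

Definition horocycle (h : set X) := exists g : geod,
  h = [set x | (fun t : R => (leaf_dist x (g t) - t%:E)%E) @ +oo --> 0%E].

(** ** Markers *)

Definition embedding_on (T U : topologicalType) (D : set T) (f : T -> U) :=
  [/\ {within D, continuous f}, {in D &, injective f} &
      forall O, open O -> exists2 V, open V & D `&` O = D `&` f @^-1` V].

Definition ray (g : R -> X) : set X := g @` [set s : R | 0 <= s].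

Definition marker (eps : R) (m : R * R -> X) :=
  [/\ embedding_on (T := (R * R)%type) (`[0, 1] `*` [set s : R | 0 <= s]) m,
      forall t, 0 <= t <= 1 -> exists g : geod,
        ray (fun s => m (t, s)) = ray g,
      forall s, 0 <= s -> transversal A `[0, 1] (fun t => m (t, s)) &
      forall s t t', 0 <= s -> 0 <= t <= 1 -> 0 <= t' <= 1 ->
        mdist (m (t, s)) (m (t', s)) < eps / 3].

Definition marker_end (m : R * R -> X) (t : R) (e : Einf) :=
  exists2 g : geod, ray (fun s => m (t, s)) = ray g & e = endpt g.

Definition marker_arc (m : R * R -> X) : set Einf :=
  [set e | exists2 t : R, 0 <= t <= 1 & marker_end m t e].

(* [amalgam eps a b K]: K is an arc from a to b in Einf obtained by amalgamating
   finitely many markers along endpoints. *)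
Inductive amalgam (eps : R) : Einf -> Einf -> set Einf -> Prop :=
| amalgam_marker m a b : marker eps m ->
    marker_end m 0 a -> marker_end m 1 b -> amalgam eps a b (marker_arc m)
| amalgam_glue a b c K L : amalgam eps a b K -> amalgam eps b c L ->
    K `&` L = [set b] -> amalgam eps a c (K `|` L).

Definition amalgams_through (eps : R) (e : Einf) : set (set Einf) :=
  [set K | K e /\ exists a b, amalgam eps a b K].

Definition maximal_markers (eps : R) : set (set Einf) :=
  [set \bigcup_(K in amalgams_through eps e) K |
     e in [set e | amalgams_through eps e !=set0]].

(** ** Orbits as leafwise geodesics *)

Context (phi : R -> X -> X).

Definition orbit_geod (x : X) (g : geod) :=
  exists2 sigma, incr_homeo sigma & forall t, phi t x = g (sigma t).

Definition forward_end (x : X) (e : Einf) :=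
  exists2 g, orbit_geod x g & e = endpt g.

Definition backward_end (x : X) (e : Einf) :=
  exists g h : geod,
    [/\ orbit_geod x g, forall t, h t = g (- t) & e = endpt h].

End LeafwiseGeometry.
Arguments maximal_markers {R X} A eps.

Section StitchingMap.
Context {R : realType} {M X : metricType R}.

Definition lifted_flow (p : X -> M) (phi : R -> M -> M) (phi' : R -> X -> X) :=
  is_flow phi' /\ forall t x, p (phi' t x) = phi t (p x).

Definition adapted (p : X -> M) (phi : R -> M -> M) (phi' : R -> X -> X)
    (Au : set (fchart3 R M)) :=
  let A := lift_atlas p Au in
  [/\ leafwise_hyperbolic A,
      forall x, exists g : geod A, orbit_geod phi' x g &
      forall y, exists2 h, horocycle A h & strong_unstable phi y = p @` h].

Definition homeo_onto (S T : topologicalType) (f : S -> T) (D : set T) :=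
  [/\ continuous f, injective f, range f = D &
      forall U, open U -> exists2 V, open V & f @` U = V `&` D].

(* The leaves of the foliation induced on the orbit space. *)
Definition orbit_space_leaves (phi : R -> X -> X) (A : set (fchart3 R X)) :
    set (set (orbit_space phi)) :=
  [set quot_map (on_orbit phi) @` leaf A x | x in setT].

(* f carries the leaves of the first foliation to those of the second. *)
Definition identifies (S T : Type) (f : S -> T) (L : set (set S))
    (L' : set (set T)) := [set f @` l | l in L] = L'.

End StitchingMap.
Arguments orbit_space_leaves {R X} phi A.

(* Main.v *)
(** Uniformity comes from compactness of M: a local property of pairs of points holds at a uniform
scale as soon as it holds along sequences that converge inside one foliated box, since the deck group
acts cocompactly on X. With expansivity this yields, for every short arc in a leaf, continuous
reparametrizations under which all orbits of the arc stay together in the contracting direction and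
get closer at a uniform rate.

Applied to unstable leaves in backward time, this shows that the orbits of a leaf share their backward
end. In the hyperbolic plane every other ideal point is joined to it by exactly one geodesic, which is
then an orbit; so the stitching map is a bijection onto the complement of the nonmarker section. Its
continuity and openness are read off the null vectors that represent ideal points in the hyperboloid
model.

Two orbits of a stable leaf get close in forward time, and the forward orbits of a short stable arc
between them form a marker; hence the ends of a stable leaf all lie on markers through any one of them.
Conversely, if one ray of a marker follows an orbit x0, then each of its rays follows an orbit in
the stable leaf of x0, because a bounded leafwise distance can be kept small along orbits that are
close in X. The remaining possibility, that all rays end at nonmarker points, is excluded by expansivity
in backward time. *)

Require Import Defs.
From Stdlib Require Import Relation_Operators.
From mathcomp Require Import all_boot all_order all_algebra.
From mathcomp Require Import all_classical all_reals all_analysis.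
From mathcomp Require Import ring lra.
Set Implicit Arguments.
Unset Strict Implicit.
Unset Printing Implicit Defensive.

Import Order.TTheory GRing.Theory Num.Theory.
Import numFieldNormedType.Exports.
Local Open Scope classical_set_scope.
Local Open Scope ring_scope.

(** The hypotheses are pointwise: the reparametrization that makes two points of a local leaf
    asymptotic comes without continuity or rate, and leaves are mere equivalence classes of plaques.
    Nothing is differentiable, so expansivity has to replace contraction rates. In
    [unique_shadowing] a reparametrization that tracks in the expanding direction is glued to the
    given asymptotic one; expansivity excludes the result unless both points share a local orbit.
    Three gaps shape the rest. The definition does not say that orbits stay in stable leaves
    ([orbit_leafS]). It is not known beforehand that a leaf of X cannot come back close to itself,
    so closeness in X gives closeness in the leaf only under a bound on the leafwise distance
    ([ld_small]), which long arguments carry along by induction over time steps. And orbits of X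
    must be kept from returning close to themselves, which would destroy the embedding of markers
    ([no_return]). Only unstable leaves carry hyperbolic geometry; their geodesics are treated as
    pairs of null vectors, and having a common end becomes the vanishing of a product. *)

Section Reals.
Context {R : realType}.
Implicit Types (s t : R).

(** * Clamped paths and connectedness of the real line *)

Lemma cvg_minr (T : Type) (F : set_system T) (FF : Filter F) (f g : T -> R) (a b : R) :
  f @ F --> a -> g @ F --> b -> (fun x => Num.min (f x) (g x)) @ F --> Num.min a b.
Proof.
move=> fa gb; rewrite minr_absE.
under eq_fun do rewrite minr_absE.
apply: cvgM; last exact: cvg_cst.
by apply: cvgB; [exact: cvgD|apply: cvg_norm; exact: cvgB].
Qed.

Lemma cvg_maxr (T : Type) (F : set_system T) (FF : Filter F) (f g : T -> R) (a b : R) :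
  f @ F --> a -> g @ F --> b -> (fun x => Num.max (f x) (g x)) @ F --> Num.max a b.
Proof.
move=> fa gb; rewrite maxr_absE.
under eq_fun do rewrite maxr_absE.
apply: cvgM; last exact: cvg_cst.
by apply: cvgD; [exact: cvgD|apply: cvg_norm; exact: cvgB].
Qed.

(** Precomposition with [clamp] extends a path on [0, 1] continuously, so that paths can be treated
    as maps on all of R. *)
Definition clamp t : R := Num.max 0 (Num.min t 1).

Lemma clamp_itv t : 0 <= clamp t <= 1.
Proof. by rewrite /clamp le_max lexx /= ge_max ler01 /= ge_min lexx orbT. Qed.

Lemma clamp_id t : 0 <= t <= 1 -> clamp t = t.
Proof. by move=> /andP[t0 t1]; rewrite /clamp min_l // max_r. Qed.

Lemma clamp0 : clamp 0 = 0. Proof. by apply: clamp_id; lra. Qed.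
Lemma clamp1 : clamp 1 = 1. Proof. by apply: clamp_id; lra. Qed.

Lemma clamp_continuous : continuous clamp.
Proof.
move=> t; apply: cvg_maxr; first exact: cvg_cst.
by apply: cvg_minr; [exact: cvg_id|exact: cvg_cst].
Qed.

Lemma within_clamp (T : topologicalType) (f : R -> T) :
  {within `[0, 1], continuous f} -> continuous (f \o clamp).
Proof.
move=> /subspace_continuousP cf t.
have ct : `[0, 1]%classic (clamp t) by rewrite /= in_itv /=; exact: clamp_itv.
apply: cvg_comp (cf _ ct); move=> A /= [e e0 eA].
have /cvgrPdist_lt /(_ e e0) := @clamp_continuous t.
apply: filterS => s ds; apply: eA => //=.
by rewrite in_itv /=; exact: clamp_itv.
Qed.

Lemma nbhsRP (t : R) (A : set R) :
  nbhs t A <-> exists2 e, 0 < e & forall s, `|s - t| < e -> A s.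
Proof.
split=> [/nbhs_ballP[e e0 eA]|[e e0 eA]].
  by exists e => // s st; apply: eA; rewrite /ball /= distrC.
by apply/nbhs_ballP; exists e => // s; rewrite /ball /= distrC; exact: eA.
Qed.

(** The condition is symmetric in s and s', so P and its complement are both open and connectedness
    of R applies. This is the continuation argument behind most extensions along a path or in
    time. *)
Lemma loc_const (P : R -> Prop) :
  (forall t, exists2 e, 0 < e & forall s s', `|s - t| < e -> `|s' - t| < e ->
     P s -> P s') ->
  forall s t, P s -> P t.
Proof.
move=> lP s t Ps.
have cR : connected [set: R] by apply/connected_intervalP => ? ? ? ? ?.
suff : P = setT by move=> ->.
apply: cR; first by exists s.
- exists P; last by rewrite setTI.
  rewrite openE => x Px; have [e e0 eP] := lP x.
  apply/nbhsRP; exists e => // y yx; apply: eP Px => //.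
  by rewrite subrr normr0.
- exists P; last by rewrite setTI.
  rewrite -[P]setCK; apply: open_closedC.
  rewrite openE => x Px; have [e e0 eP] := lP x.
  apply/nbhsRP; exists e => // y yx Py; apply: Px; apply: eP Py => //.
  by rewrite subrr normr0.
Qed.

Lemma pw_continuous (T : topologicalType) (f g : R -> T) (a : R) :
  continuous f -> continuous g -> f a = g a ->
  continuous (fun t => if t <= a then f t else g t).
Proof.
move=> cf cg fg t A /=.
case: (ltgtP t a) => [ta|at_|->].
- move=> /cf /nbhsRP[e e0 eA]; apply/nbhsRP.
  exists (Num.min e (a - t)); first by rewrite lt_min e0 subr_gt0.
  move=> s; rewrite lt_min => /andP[se]; rewrite ltr_norml => /andP[_ sa].
  by rewrite /= ifT; [exact: eA|lra].
- move=> /cg /nbhsRP[e e0 eA]; apply/nbhsRP.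
  exists (Num.min e (t - a)); first by rewrite lt_min e0 subr_gt0.
  move=> s; rewrite lt_min => /andP[se]; rewrite ltr_norml => /andP[sa _].
  by rewrite /= ifF; [exact: eA|apply/negbTE; rewrite -ltNge; lra].
- move=> fA; move: (fA) => /cf /nbhsRP[e e0 eA].
  rewrite fg in fA; move: fA => /cg /nbhsRP[e' e'0 eA'].
  apply/nbhsRP; exists (Num.min e e'); first by rewrite lt_min e0.
  move=> s; rewrite lt_min => /andP[se se'].
  by rewrite /=; case: ifP => _; [exact: eA|exact: eA'].
Qed.

End Reals.

Lemma ccompat (A B C : topologicalType) (f : A -> B) (g : B -> C) x :
  {for x, continuous f} -> {for f x, continuous g} -> {for x, continuous (fun z => g (f z))}.
Proof. exact: continuous_comp. Qed.

Lemma ccomp (A B C : topologicalType) (f : A -> B) (g : B -> C) :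
  continuous f -> continuous g -> continuous (fun z => g (f z)).
Proof. by move=> cf cg x; exact: (continuous_comp (cf x) (cg (f x))). Qed.

Lemma cpairat (A B C : topologicalType) (f : A -> B) (g : A -> C) (x : A) :
  {for x, continuous f} -> {for x, continuous g} -> {for x, continuous (fun z => (f z, g z))}.
Proof. by move=> cf cg; apply: (@cvg_pair _ _ _ (nbhs x) (nbhs (f x)) (nbhs (g x))). Qed.

Lemma pairl_continuous (S T : topologicalType) (x : S) : continuous (fun y : T => (x, y)).
Proof. by move=> y; apply: (@cvg_pair _ _ _ (nbhs y) (nbhs x)  (nbhs y)); [exact: cvg_cst|exact: cvg_id]. Qed.

Lemma pairr_continuous (S T : topologicalType) (y : T) : continuous (fun x : S => (x, y)).
Proof. by move=> x; apply: (@cvg_pair _ _ _ (nbhs x) (nbhs x) (nbhs y)); [exact: cvg_id|exact: cvg_cst]. Qed.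

Lemma chart_at (X E : topologicalType) (c : chart X E) y : dom c y -> {for y, continuous c}.
Proof.
move=> dy; have := @cmap_continuous _ _ c.
rewrite continuous_open_subspace; last exact: dom_open.
by apply; rewrite inE.
Qed.

Lemma chart_snd (X E F : topologicalType) (c : chart X (E * F)%type) y : dom c y ->
  {for y, continuous (fun z => (c z).2)}.
Proof. by move=> dy; apply: cvg_comp (chart_at dy) _; exact: cvg_snd. Qed.

Lemma chart_fst (X E F : topologicalType) (c : chart X (E * F)%type) y : dom c y ->
  {for y, continuous (fun z => (c z).1)}.
Proof. by move=> dy; apply: cvg_comp (chart_at dy) _; exact: cvg_fst. Qed.

Lemma chart_nbhs (X E : topologicalType) (c : chart X E) y : dom c y -> nbhs y (dom c).
Proof. by move=> dy; apply: open_nbhs_nbhs; split => //; exact: dom_open. Qed.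

(** * Covering spaces *)

Section Lifting.
Context {R : realType} {X M : topologicalType} (p : X -> M).
Hypothesis pcov : covering_map p.

Let pc : continuous p. Proof. by case: pcov. Qed.

(** [sec] is the inverse of p on W. Openness of the rest of the preimage of U is part of the data
    because it keeps a path over U from leaving W ([path_stays]). *)
Definition sheet (U : set M) (W : set X) (sec : M -> X) :=
  [/\ open W, open (p @^-1` U `\` W), (forall x, W x -> U (p x)),
      (forall y, U y -> [/\ W (sec y), p (sec y) = y & {for y, continuous sec}]) &
      forall x, W x -> sec (p x) = x].

Lemma sheetP (y : M) : exists2 U, open U /\ U y &
  forall x, U (p x) -> exists W sec, sheet U W sec /\ W x.
Proof.
case: pcov => _ _ /(_ y) [U [oU Uy] [V [pU dV sV]]]; exists U => // x Ux.
have : (p @^-1` U) x by []; rewrite pU => -[W VW Wx].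
have [oW iW pW opW] := sV _ VW.
have /choice[sec secP] : forall y', exists x', U y' -> W x' /\ p x' = y'.
  move=> y'; have [Uy'|nU] := pselect (U y'); last by exists x.
  by move: Uy'; rewrite -pW => -[x' Wx' <-]; exists x'.
exists W, sec; split=> //; split=> //.
- have -> : p @^-1` U `\` W = \bigcup_(W' in V `&` [set W' | W' <> W]) W'.
    rewrite pU; apply/seteqP; split=> z.
      by move=> [[W' VW' W'z] nW]; exists W' => //; split=> // e; rewrite -e in nW.
    move=> [W' [VW' neq] W'z]; split; first by exists W'.
    by move=> Wz; apply: neq; apply: dV => //; exists z.
  by apply: bigcup_open => W' [VW' _]; case: (sV _ VW').
- by move=> z Wz; rewrite -pW; exists z.
- move=> y' Uy'; have [Wy' py'] := secP _ Uy'; split=> // A /=.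
  rewrite nbhsE => -[V' [oV' V'y'] V'A].
  have oOW : open (V' `&` W) by exact: openI.
  have /open_nbhs_nbhs : open_nbhs y' (p @` (V' `&` W)).
    by split; [apply: opW => // z []|exists (sec y')].
  apply: filterS => z [x' [Vx' Wx'] <-]; apply: V'A.
  suff -> : sec (p x') = x' by [].
  have Upx' : U (p x') by rewrite -pW; exists x'.
  by apply: iW; rewrite ?inE //; case: (secP _ Upx').
- move=> z Wz; have Upz : U (p z) by rewrite -pW; exists z.
  by have [? ?] := secP _ Upz; apply: iW; rewrite ?inE.
Qed.

(** Near t the second lift either lies in the sheet of [f t], and then both are the section of the
    same path, or in the rest of the preimage, and then the lifts differ throughout. Agreement at 0
    therefore propagates. *)
Lemma lift_unique (f g : R -> X) : continuous f -> continuous g ->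
  p \o f =1 p \o g -> f 0 = g 0 -> f = g.
Proof.
move=> cf cg pfg fg0; apply/funext => t.
apply: (@loc_const R (fun t => f t = g t) _ 0) => // {}t.
have [U [oU Uy] /(_ (f t)) [//|W [sec [[oW oW' WU secU secK] Wx]]]] := sheetP (p (f t)).
have [Wg|nWg] := pselect (W (g t)).
  have : nbhs t (f @^-1` W `&` g @^-1` W).
    by apply: filterI; [apply: cf|apply: cg]; apply: open_nbhs_nbhs; split.
  move=> /nbhsRP[e e0 eA]; exists e => // s s' _ s't _.
  have [Wf Wg'] := eA _ s't; rewrite -[f s']secK // -[g s']secK //.
  by have /= -> := pfg s'.
have W'g : (p @^-1` U `\` W) (g t) by split => //=; have /= <- := pfg t.
have : nbhs t (f @^-1` W `&` g @^-1` (p @^-1` U `\` W)).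
  by apply: filterI; [apply: cf|apply: cg]; apply: open_nbhs_nbhs; split.
move=> /nbhsRP[e e0 eA]; exists e => // s s' st s't fgs.
by have [Wf [_]] := eA _ st; rewrite -fgs.
Qed.

Lemma path_stays (U : set M) (W : set X) sec (f : R -> X) (a b : R) :
  sheet U W sec -> continuous f -> (forall t, a < t < b -> U (p (f t))) ->
  forall s t, a < s < b -> a < t < b -> W (f s) -> W (f t).
Proof.
move=> [oW oW' WU _ _] cf fU s t sab tab Wfs.
have cI : connected `]a, b[%classic.
  by apply/connected_intervalP => x y xI yI z zI; move: xI yI; rewrite /= !in_itv /=; lra.
suff : `]a, b[%classic `&` f @^-1` W = `]a, b[%classic.
  by move=> /seteqP[_ /(_ t)] []; rewrite /= ?in_itv.
apply: cI; first by exists s; split=> //=; rewrite in_itv.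
  by exists (f @^-1` W) => //; apply: open_comp => // ? _; exact: cf.
exists (~` (f @^-1` (p @^-1` U `\` W))).
  by apply: open_closedC; apply: open_comp => // ? _; exact: cf.
apply/seteqP; split=> x [xI /= h]; split=> //=; first by case.
by apply: contrapT => nW; apply: h; split=> //; apply: fU; rewrite /= in_itv in xI.
Qed.

Lemma path_lift (g : R -> M) (x0 : X) : continuous g -> p x0 = g 0 ->
  g \o clamp = g ->
  exists f : R -> X, [/\ continuous f, f 0 = x0 & p \o f = g].
Proof.
move=> cg pg gcl.
(* A lift up to time t; the truncation at 0 makes negative times harmless, so that [loc_const] can
   run over R. *)
pose S t := exists f : R -> X, [/\ continuous f, f 0 = x0 &
  forall s, 0 <= s <= Num.max t 0 -> p (f s) = g s].
have Smono s t : Num.max s 0 <= Num.max t 0 -> S t -> S s.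
  by move=> st [f [? ? h]]; exists f; split=> // ? ?; apply: h; lra.
have S0 : S 0.
  exists (fun=> x0); split=> [? |//|s]; first exact: cvg_cst.
  by rewrite maxxx => ?; rewrite pg; congr g; lra.
have [f [cf f0 pf]] : S 1.
  apply: (@loc_const R S _ 0 1 S0) => t; set t' := Num.max t 0.
  have [U [oU Ut] Usheet] := sheetP (g t').
  have : nbhs t' (g @^-1` U) by apply: cg; exact: open_nbhs_nbhs.
  move=> /nbhsRP[e e0 eU]; exists e => // s s' st s't Ss.
  have [|ss'] := leP (Num.max s' 0) (Num.max s 0); first by move/Smono; apply.
  have max_near r : `|r - t| < e -> `|Num.max r 0 - t'| < e.
    move=> rt; apply: le_lt_trans rt; rewrite /t'.
    have := ler_norm (r - t); have := ler_norm (- (r - t)); rewrite normrN.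
    by have := normr_ge0 (r - t); case: (leP r 0) => ?; case: (leP t 0) => ?;
      rewrite ler_norml; lra.
  move: (max_near _ st) (max_near _ s't) ss' => {}st {}s't.
  have m0 : 0 <= Num.max s 0 by rewrite le_max lexx orbT.
  case: Ss => f [cf f0 pf]; rewrite /S.
  move: (Num.max s 0) (Num.max s' 0) st s't m0 pf => m m' mt m't m0 pf mm'.
  have mI : forall r, `|Num.max m (Num.min r m') - t'| < e.
    move=> r; rewrite ltr_norml; move: mt m't; rewrite !ltr_norml.
    have h1 : m <= Num.max m (Num.min r m') by rewrite le_max lexx.
    have h2 : Num.max m (Num.min r m') <= m' by rewrite ge_max (ltW mm') ge_min lexx orbT.
    by lra.
  have [|W [sec [[oW oW' WU secU secK] Wx]]] := Usheet (f m).
    by rewrite pf ?m0 ?lexx //; exact: eU.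
  (* Beyond m the lift is the section over g, frozen from m' on so that it stays over U. *)
  exists (fun r => if r <= m then f r else sec (g (Num.max m (Num.min r m')))).
  split; last 2 first.
  - by rewrite m0.
  - move=> r /andP[r0 rm']; case: leP => rm; first by rewrite pf // r0.
    rewrite min_l // max_r ?ltW //; apply (secU (g r)); apply: eU.
    by have := mI r; rewrite min_l // max_r // ltW.
  - apply: (@pw_continuous R X f (fun r => sec (g (Num.max m (Num.min r m'))))) => //.
      move=> r; have [_ _ cs] := secU _ (eU _ (mI r)).
      apply: (@continuous_comp _ _ _ (fun r => g (Num.max m (Num.min r m'))) sec) => //.
      apply: (@ccompat R R M (fun r => Num.max m (Num.min r m')) g); last exact: cg.
      apply: cvg_maxr; first exact: cvg_cst.
      by apply: cvg_minr; [exact: cvg_id|exact: cvg_cst].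
    by rewrite min_l ?ltW // maxxx -pf ?m0 ?lexx // secK.
exists (f \o clamp); split; last 2 first.
- by rewrite /= clamp0.
- by rewrite -[RHS]gcl; apply/funext => t /=; apply: pf; rewrite max_l ?ler01 ?clamp_itv.
- by move=> t; apply: continuous_comp; [exact: clamp_continuous|exact: cf].
Qed.

(** Every path is lifted on its own, and joint continuity is propagated in t: once a single time
    slice is continuous at z, the lifts near z lie in one sheet at all nearby times and are its
    section composed with F. *)
Lemma homotopy_lift (T : topologicalType) (F : T -> R -> M) (f0 : T -> X) :
  (forall z t, {for (z, t), continuous (fun zt : T * R => F zt.1 zt.2)}) ->
  (forall z, F z \o clamp = F z) ->
  (forall z, p (f0 z) = F z 0) -> continuous f0 ->
  exists L : T -> R -> X,
    [/\ forall z t, {for (z, t), continuous (fun zt : T * R => L zt.1 zt.2)},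
        forall z, continuous (L z),
        forall z, L z 0 = f0 z & forall z t, p (L z t) = F z t].
Proof.
move=> cF Fcl pf0 cf0.
have cFz z : continuous (F z).
  move=> t; apply: (@continuous_comp _ _ _ (fun t => (z, t)) (fun zt : T * R => F zt.1 zt.2)).
    exact: pairl_continuous.
  exact: cF.
have /choice[L LP] : forall z, exists l : R -> X,
    [/\ continuous l, l 0 = f0 z & p \o l = F z].
  by move=> z; apply: path_lift => //; exact: cFz.
have pL z t : p (L z t) = F z t by have [_ _ <-] := LP z.
have cL z : continuous (L z) by have [] := LP z.
have L0 z : L z 0 = f0 z by have [] := LP z.
exists L; split=> // z.
have key t U : open U -> U (F z t) -> exists2 e, 0 < e & exists2 N, nbhs z N &
    forall z' s, N z' -> `|s - t| < e -> U (F z' s).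
  move=> oU Ut; have : nbhs (z, t) ((fun zt : T * R => F zt.1 zt.2) @^-1` U).
    by apply: cF; exact: open_nbhs_nbhs.
  move=> [[A B] [/= nA /nbhsRP[e e0 eB]] AB]; exists e => //; exists A => // z' s Az' st.
  by apply: (AB (z', s)); split => //=; exact: eB.
have main t : exists2 e, 0 < e & forall s s', `|s - t| < e -> `|s' - t| < e ->
    {for z, continuous (L ^~ s)} -> {for (z, s'), continuous (fun zt : T * R => L zt.1 zt.2)}.
  have [U [oU Ut] Usheet] := sheetP (F z t).
  have [|W [sec [sW Wx]]] := Usheet (L z t); first by rewrite pL.
  have [oW oW' WU secU secK] := sW.
  have [e e0 [N nN NU]] := key _ _ oU Ut.
  exists e => // s s' st s't cs.
  have WL s1 s2 z' : N z' -> `|s1 - t| < e -> `|s2 - t| < e -> W (L z' s1) -> W (L z' s2).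
    move=> Nz'; rewrite !ltr_norml => ? ?.
    apply: (@path_stays U W sec _ (t - e) (t + e)) => //; try lra.
    by move=> r ?; rewrite pL; apply: NU => //; rewrite ltr_norml; lra.
  have Wzs : W (L z s).
    by apply: (WL t) => //; [exact: nbhs_singleton|rewrite subrr normr0].
  have nW : nbhs z (N `&` (L ^~ s) @^-1` W).
    by apply: filterI => //; apply: cs; exact: open_nbhs_nbhs.
  have LE z' r : (N `&` (L ^~ s) @^-1` W) z' -> `|r - t| < e -> L z' r = sec (F z' r).
    by move=> [Nz' Wz'] re; rewrite -pL secK //; exact: (WL s).
  have nE : \forall zt \near (z, s'), sec (F zt.1 zt.2) = L zt.1 zt.2.
    exists (N `&` (L ^~ s) @^-1` W, [set r | `|r - t| < e]).
      split=> //=; apply/nbhsRP; exists (e - `|s' - t|); first by rewrite subr_gt0.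
      move=> r rs /=; apply: le_lt_trans (ler_distD s' _ _) _; lra.
    by move=> [z' r] [/= ? ?]; rewrite LE.
  have -> : {for (z, s'), continuous (fun zt : T * R => L zt.1 zt.2)} =
      ((fun zt : T * R => L zt.1 zt.2) @ (z, s') --> L z s') by [].
  apply: cvg_trans (near_eq_cvg nE) _; rewrite LE //; last exact: nbhs_singleton.
  apply: (cvg_comp _ _ (cF z s')).
  by have [] := secU (F z s') (NU _ _ (nbhs_singleton nN) s't).
have slice s : {for (z, s), continuous (fun zt : T * R => L zt.1 zt.2)} ->
    {for z, continuous (L ^~ s)}.
  move=> cs; apply: (@continuous_comp _ _ _ (fun z => (z, s)) (fun zt : T * R => L zt.1 zt.2)).
    exact: pairr_continuous.
  exact: cs.
have L00 : {for z, continuous (L ^~ 0)}.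
  by rewrite (_ : L ^~ 0 = f0); [exact: cf0|apply/funext => z'; exact: L0].
have [e0 e00 m0] := main 0.
move=> t; apply: (@loc_const R (fun t => {for (z, t), continuous (fun zt : T * R => L zt.1 zt.2)}) _ 0).
  move=> s; have [e ep m] := main s; exists e => // r r' rs r's cr.
  by apply: (m r) => //; exact: slice.
by apply: (m0 0) => //; rewrite subrr normr0.
Qed.

(** Lifting all straight segments of the chart that start at [c (p x)] gives a section of p over the
    whole chart domain; the lifted segments are kept as paths from x to its values. *)
Lemma homotopy_lift_end (E : normedModType R) (c : chart M E) (x : X) : dom c (p x) ->
  exists s : E -> X, [/\ continuous s, s (c (p x)) = x, forall e, p (s e) = cinv c e &
    forall e, exists f : R -> X, [/\ continuous f, f 0 = x, f 1 = s e &
      forall t, p (f t) = cinv c (c (p x) + clamp t *: (e - c (p x)))]].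
Proof.
move=> dx; set e0 := c (p x).
pose F (e : E) (t : R) := cinv c (e0 + clamp t *: (e - e0)).
have cF e t : {for (e, t), continuous (fun zt : E * R => F zt.1 zt.2)}.
  apply: (@continuous_comp _ _ _ (fun zt : E * R => e0 + clamp zt.2 *: (zt.1 - e0)) (cinv c));
    last exact: cinv_continuous.
  apply: cvgD; first exact: cvg_cst.
  apply: cvgZ.
    by apply: (@continuous_comp _ _ _ (fun zt : E * R => zt.2) clamp);
      [exact: cvg_snd|exact: clamp_continuous].
  by apply: cvgB; [exact: cvg_fst|exact: cvg_cst].
have Fcl e : F e \o clamp = F e.
  by apply/funext => t; rewrite /F /= clamp_id // clamp_itv.
have F0 e : F e 0 = p x by rewrite /F clamp0 scale0r addr0 cmapK.
have [||L [cL cLe L0 pL]] := @homotopy_lift E F (fun=> x) cF Fcl.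
- by move=> e; rewrite F0.
- by move=> e; exact: cvg_cst.
exists (fun e => L e 1); split.
- apply: (@ccomp E (E * R)%type X (fun e => (e, 1)) (fun zt : E * R => L zt.1 zt.2)).
    exact: pairr_continuous.
  by case=> e t; exact: cL.
- have -> : L e0 = fun=> x; last by [].
  apply: lift_unique => //; first by move=> t; exact: cvg_cst.
  by move=> t; rewrite /= pL /F subrr scaler0 addr0 cmapK.
- by move=> e; rewrite pL /F clamp1 scale1r addrCA subrr addr0.
- by move=> e; exists (L e); split=> // t; rewrite pL.
Qed.

(** * Transitivity of the deck group on fibres *)

Section Deck.
Hypothesis Xsc : @simply_connected R X.

(** f and f' lift the same path of M, so z' is what the deck transformation sending x to x' has to
    do to z. *)
Definition path_pair (x x' z z' : X) := exists f f' : R -> X,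
  [/\ continuous f /\ continuous f', f 0 = x /\ f' 0 = x', f 1 = z /\ f' 1 = z' &
      p \o f = p \o f'].

Lemma path_pair_sym x x' z z' : path_pair x x' z z' -> path_pair x' x z' z.
Proof. by move=> [f [f' [[? ?] [? ?] [? ?] ?]]]; exists f', f; split. Qed.

Lemma path_pair_total x x' z : p x = p x' -> exists z', path_pair x x' z z'.
Proof.
move=> pxx'; have [/(_ x z) [f [/within_clamp cf f0 f1]] _] := Xsc.
have [|||f' [cf' f'0 pf']] := @path_lift (p \o (f \o clamp)) x'.
- by move=> t; apply: continuous_comp; [exact: cf|exact: pc].
- by rewrite /= clamp0 f0.
- by apply/funext => t; rewrite /= [clamp (clamp t)]clamp_id // clamp_itv.
by exists (f' 1), (f \o clamp), f'; split=> //=; rewrite ?clamp0 ?clamp1.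
Qed.

(** The loop l runs along f and back along h. Projecting a contraction of it and lifting from x'
    gives a loop again, whose halves are f' and the reverse of h' by uniqueness of lifts; both end
    at its midpoint. *)
Lemma path_pair_fun x x' z z1 z2 : p x = p x' ->
  path_pair x x' z z1 -> path_pair x x' z z2 -> z1 = z2.
Proof.
move=> pxx' [f [f' [[cf cf'] [f0 f'0] [f1 f'1] pf]]] [h [h' [[ch ch'] [h0 h'0] [h1 h'1] ph]]].
pose l t := if t <= 1 / 2 then f (2 * t) else h (2 * (1 - t)).
have c2 : continuous (fun t : R => 2 * t).
  by move=> t; apply: cvgM; [exact: cvg_cst|exact: cvg_id].
have c2' : continuous (fun t : R => 2 * (1 - t)).
  move=> t; apply: cvgM; [exact: cvg_cst|].
  by apply: cvgB; [exact: cvg_cst|exact: cvg_id].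
have cl : continuous l.
  apply: (@pw_continuous R X (fun t => f (2 * t)) (fun t => h (2 * (1 - t)))).
  - exact: (@ccomp R R X (fun t => 2 * t) f).
  - exact: (@ccomp R R X (fun t => 2 * (1 - t)) h).
  - have -> : 2 * (1 / 2 : R) = 1 by field.
    have -> : 2 * (1 - 1 / 2 : R) = 1 by field.
    by rewrite f1 h1.
have l0 : l 0 = x by rewrite /l mulr0 f0 ifT //; lra.
have l1 : l 1 = x by rewrite /l subrr mulr0 h0 ifF //; apply/negbTE; rewrite -ltNge; lra.
have [_ /(_ l)] := Xsc.
move=> [||H [/subspace_continuousP cH H0 H1 Hs]]; first by apply: continuous_subspaceT.
  by rewrite l0 l1.
pose F s t := p (H (clamp s, clamp t)).
have cF s t : {for (s, t), continuous (fun st : R * R => F st.1 st.2)}.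
  apply: (@continuous_comp _ _ _ (fun st : R * R => H (clamp st.1, clamp st.2)) p);
    last exact: pc.
  have /cH cHst : (`[0, 1] `*` `[0, 1])%classic (clamp s, clamp t).
    by split; rewrite /= in_itv /= clamp_itv.
  apply: cvg_comp cHst => A /= [[B C] [/= nB nC]] BC.
  have : nbhs (s, t) ((clamp @^-1` B) `*` (clamp @^-1` C)).
    exists (clamp @^-1` B, clamp @^-1` C) => //; split.
      exact: (@clamp_continuous R s B nB).
    exact: (@clamp_continuous R t C nC).
  apply: filterS => -[s' t'] [/= Bs Ct]; apply: BC => //=.
  by split; rewrite /= in_itv /= clamp_itv.
have [|||L [cL2 cL L0 pL]] := @homotopy_lift R F (fun=> x') cF.
- by move=> s; apply/funext => t; rewrite /F /= [clamp (clamp t)]clamp_id // clamp_itv.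
- by move=> s; rewrite /F clamp0; have [-> _] := Hs (clamp s) (clamp_itv s); rewrite l0 pxx'.
- by move=> s; exact: cvg_cst.
(* The lifted homotopy is constant on three sides of the square, so its fourth side is a loop at
   x'. *)
have L1 t : L 1 t = x'.
  suff -> : L 1 = fun=> x' by [].
  apply: lift_unique; [exact: cL|by move=> ?; exact: cvg_cst| |exact: L0].
  by move=> r; rewrite /= pL /F clamp1 H1 ?clamp_itv // l0 pxx'.
have L01 : L 0 1 = x'.
  have /(congr1 (@^~ 1)) /= : (fun s => L s 1) = (fun=> L 0 1).
    apply: lift_unique => //.
    - apply: (@ccomp R (R * R)%type X (fun s => (s, 1)) (fun zt => L zt.1 zt.2)).
        exact: pairr_continuous.
      by case=> ? ?; exact: cL2.
    - by move=> ?; exact: cvg_cst.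
    - move=> s /=; rewrite !pL /F clamp1.
      by have [_ ->] := Hs (clamp s) (clamp_itv s); have [_ ->] := Hs (clamp 0) (clamp_itv 0).
  by rewrite L1.
have ch2 : continuous (fun t : R => clamp t / 2).
  by move=> t; apply: cvgM; [exact: clamp_continuous|exact: cvg_cst].
have F0 t : 0 <= t <= 1 -> p (L 0 t) = p (l t).
  by move=> t01; rewrite pL /F clamp0 H0 ?clamp_itv // clamp_id.
have E1 : L 0 (1 / 2) = z1.
  have /(congr1 (@^~ 1)) /= : (fun t => L 0 (clamp t / 2)) = f' \o clamp.
    apply: lift_unique.
    - exact: (@ccomp R R X (fun t => clamp t / 2) (L 0)).
    - exact: (@ccomp R R X clamp f' clamp_continuous).
    - move=> t /=; have := clamp_itv t => ct; rewrite F0; last lra.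
      rewrite /l ifT; last lra.
      have -> : 2 * (clamp t / 2) = clamp t by field.
      by have /(congr1 (@^~ (clamp t))) := pf.
    - by rewrite /= clamp0 mul0r f'0.
  by rewrite clamp1 => ->.
have E2 : L 0 (1 / 2) = z2.
  have /(congr1 (@^~ 1)) /= : (fun t => L 0 (1 - clamp t / 2)) = h' \o clamp.
    apply: lift_unique.
    - apply: (@ccomp R R X (fun t => 1 - clamp t / 2) (L 0)) => //.
      by move=> t; apply: cvgB; [exact: cvg_cst|exact: ch2].
    - exact: (@ccomp R R X clamp h' clamp_continuous).
    - move=> t /=; have := clamp_itv t => ct; rewrite F0; last lra.
      have /(congr1 (@^~ (clamp t))) /= <- := ph.
      rewrite /l; case: ifP => t12.
        have -> : clamp t = 1 by lra.
        by rewrite h1 -f1; congr (p (f _)); field.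
      by congr (p (h _)); field.
    - by rewrite /= clamp0 mul0r subr0 h'0.
  by rewrite clamp1 h'1 => <-; congr (L 0 _); lra.
by rewrite -E1 -E2.
Qed.

Lemma path_pair_trans x x' z z' w w' :
  path_pair x x' z z' -> path_pair z z' w w' -> path_pair x x' w w'.
Proof.
move=> [f [f' [[cf cf'] [f0 f'0] [f1 f'1] pf]]] [h [h' [[ch ch'] [h0 h'0] [h1 h'1] ph]]].
have c2 : continuous (fun t : R => 2 * t).
  by move=> t; apply: cvgM; [exact: cvg_cst|exact: cvg_id].
have c2' : continuous (fun t : R => 2 * t - 1).
  by move=> t; apply: cvgB; [exact: c2|exact: cvg_cst].
have e1 : 2 * (1 / 2 : R) = 1 by field.
have e2 : 2 * (1 / 2) - 1 = 0 :> R by field.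
have e3 : 2 * 1 - 1 = 1 :> R by ring.
have e4 : (1 <= 1 / 2 :> R) = false by apply/negbTE; rewrite -ltNge; lra.
have e5 : (0 <= 1 / 2 :> R) by lra.
pose l (f h : R -> X) t := if t <= 1 / 2 then f (2 * t) else h (2 * t - 1).
have cl (f'' h'' : R -> X) : continuous f'' -> continuous h'' -> f'' 1 = h'' 0 -> continuous (l f'' h'').
  move=> cf'' ch'' fh; apply: (@pw_continuous R X (fun t => f'' (2 * t)) (fun t => h'' (2 * t - 1))).
  - exact: (@ccomp R R X (fun t => 2 * t) f'').
  - exact: (@ccomp R R X (fun t => 2 * t - 1) h'').
  - by rewrite [X in _ = h'' X]e2 e1.
exists (l f h), (l f' h'); split.
- by split; apply: cl => //; rewrite ?f1 ?h0 ?f'1 ?h'0.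
- by rewrite /l e5 mulr0.
- by rewrite /l e4 e3.
- apply/funext => t; rewrite /l /=; case: ifP => _.
    by have /(congr1 (@^~ (2 * t))) := pf.
  by have /(congr1 (@^~ (2 * t - 1))) := ph.
Qed.

(** The transformation sends z to the end of the lift from x' of a projected path from x to z. It
    carries the section s of a chart through z to the section s' through the image, which gives
    continuity; exchanging x and x' gives the inverse. *)
Lemma deck_transitive (E : normedModType R) x x' :
  (forall y : M, exists c : chart M E, dom c y) -> p x = p x' ->
  exists2 g, deck p g & g x = x'.
Proof.
move=> charts pxx'.
have build y y' : p y = p y' -> exists g : X -> X,
    [/\ continuous g, p \o g = p & forall z, path_pair y y' z (g z)].
  move=> pyy'; have /choice[g gP] : forall z, exists z', path_pair y y' z z' by move=> z; exact: path_pair_total.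
  have pg z : p (g z) = p z.
    by have [f [f' [_ _ [<- <-] /(congr1 (@^~ 1))]]] := gP z.
  exists g; split=> //; last by apply/funext => z; exact: pg.
  move=> z; have [c dc] := charts (p z).
  have dc' : dom c (p (g z)) by rewrite pg.
  have [s [cs s0 ps sf]] := homotopy_lift_end dc.
  have [s' [cs' s'0 ps' s'f]] := homotopy_lift_end dc'.
  have gs e : g (s e) = s' e.
    apply: (path_pair_fun pyy' (gP (s e))); apply: path_pair_trans (gP z) _.
    have [f [cf f0 f1 pf]] := sf e; have [f' [cf' f'0 f'1 pf']] := s'f e.
    exists f, f'; split=> //; apply/funext => t /=.
    by rewrite pf pf' pg.
  have cscp : {for z, continuous (fun w => s (c (p w)))}.
    apply: (@ccompat X E X (fun w => c (p w)) s); last exact: cs.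
    by apply: (@ccompat X M E p c); [exact: pc|exact: chart_at].
  have cscp' : {for z, continuous (fun w => s' (c (p w)))}.
    apply: (@ccompat X E X (fun w => c (p w)) s'); last exact: cs'.
    by apply: (@ccompat X M E p c); [exact: pc|exact: chart_at].
  have [U [oU Uz] /(_ z Uz) [W [sec [[oW oW' WU secU secK] Wz]]]] := sheetP (p z).
  have nE : \forall w \near z, s' (c (p w)) = g w.
    have nW : nbhs z W by exact: open_nbhs_nbhs.
    have nW' : nbhs z ((fun w => s (c (p w))) @^-1` W).
      by apply: cscp; rewrite s0.
    have nD : nbhs z (p @^-1` dom c) by apply: pc; exact: chart_nbhs.
    near=> w; rewrite -gs; congr g.
    have Ww : W w by near: w.
    have Wsw : W (s (c (p w))) by near: w.
    rewrite -[RHS]secK // -[LHS]secK // ps cmapK //.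
    by near: w.
  have s'z : s' (c (p z)) = g z by rewrite -(pg z).
  have : (fun w => s' (c (p w))) @ z --> g z by rewrite -s'z; exact: cscp'.
  by move=> h; apply: cvg_trans h; exact: near_eq_cvg.
have [g [cg pg gP]] := build _ _ pxx'.
have [g' [cg' pg' g'P]] := build _ _ (esym pxx').
exists g.
  split=> //; exists g'; split=> // z.
    by apply: (path_pair_fun (esym pxx') (g'P (g z))); exact: path_pair_sym.
  by apply: (path_pair_fun pxx' (gP (g' z))); exact: path_pair_sym.
apply: (path_pair_fun pxx' (gP x)); exists (fun=> x), (fun=> x'); split=> //.
  by split=> ?; exact: cvg_cst.
by apply/funext => t /=.
Unshelve. all: by end_near. Qed.

End Deck.

End Lifting.

(** * Limits along a free ultrafilter *)

Lemma free_ultrafilter : exists U : set_system nat, UltraFilter U /\ \oo `<=` U.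
Proof. exact: ultraFilterLemma. Qed.

(* Limits along uf replace the extraction of subsequences. *)
Definition uf : set_system nat := sval (cid free_ultrafilter).

#[global] Instance uf_ultra : UltraFilter uf.
Proof. by rewrite /uf; case: cid => U []. Qed.

#[global] Instance uf_proper : ProperFilter uf.
Proof. exact: ultra_proper. Qed.

Lemma uf_oo : \oo `<=` uf.
Proof. by rewrite /uf; case: cid => U []. Qed.

Lemma uf_ge (N : nat) : \forall n \near uf, (N <= n)%N.
Proof. by apply: uf_oo; exists N. Qed.

Lemma ufN (P : nat -> Prop) : ~ (\forall n \near uf, P n) -> \forall n \near uf, ~ P n.
Proof. by have [] := in_ultra_setVsetC [set n | P n] uf_ultra. Qed.

Lemma compact_uf (T : topologicalType) (K : set T) (x : nat -> T) : compact K ->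
  (\forall n \near uf, K (x n)) -> exists2 l, K l & x @ uf --> l.
Proof.
move=> cK Kx; have [l [Kl cl]] := cK (x @ uf) _ Kx; exists l => // A nA.
apply: contrapT => /ufN nxA.
by have [y []] := cl (~` A) A nxA nA.
Qed.

Lemma cts_uf (S T : topologicalType) (f : S -> T) (x : nat -> S) l :
  {for l, continuous f} -> x @ uf --> l -> (fun n => f (x n)) @ uf --> f l.
Proof. by move=> cf xl; apply: cvg_comp xl cf. Qed.

Lemma uf_const (T : topologicalType) (a : T) : (fun=> a) @ uf --> a.
Proof. exact: cvg_cst. Qed.

Lemma uf_congr (T : topologicalType) (x y : nat -> T) (l : T) :
  (\forall n \near uf, x n = y n) -> x @ uf --> l -> y @ uf --> l.
Proof.
move=> xy xl; apply: cvg_trans xl; apply: near_eq_cvg.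
by apply: filterS xy => n ->.
Qed.

Lemma uf_pair (S T : topologicalType) (x : nat -> S) (y : nat -> T) (a : S) (b : T) :
  x @ uf --> a -> y @ uf --> b -> (fun n => (x n, y n)) @ uf --> (a, b).
Proof. by move=> xa yb; apply: cvg_pair. Qed.

Lemma uf_open (T : topologicalType) (A : set T) (x : nat -> T) (l : T) :
  nbhs l A -> x @ uf --> l -> \forall n \near uf, A (x n).
Proof. by move=> nA xl; exact: xl. Qed.

Section UltraReal.
Context {R : realType}.

Lemma uf_invn : (fun n => n.+1%:R^-1 : R) @ uf --> (0 : R).
Proof. exact: (cvg_trans (cvg_app _ uf_oo) (@cvg_harmonic R)). Qed.

Lemma ufRP (x : nat -> R) (l : R) : x @ uf --> l <->
  forall e, 0 < e -> \forall n \near uf, `|x n - l| < e.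
Proof.
split=> [/cvgrPdist_lt h e /h|h]; first by apply: filterS => n; rewrite distrC.
by apply/cvgrPdist_lt => e /h; apply: filterS => n; rewrite distrC.
Qed.

Lemma uf_bounded (x : nat -> R) (a b : R) : (\forall n \near uf, a <= x n <= b) ->
  exists2 l, a <= l <= b & x @ uf --> l.
Proof.
move=> h; have [||l] := @compact_uf R `[a, b] x; first exact: segment_compact.
  by apply: filterS h => n; rewrite /= in_itv.
by rewrite /= in_itv => ? ?; exists l.
Qed.

Lemma uf_le (x y : nat -> R) (a b : R) : x @ uf --> a -> y @ uf --> b ->
  (\forall n \near uf, x n <= y n) -> a <= b.
Proof. by move=> xa yb xy; apply: ler_cvg_to xa yb xy. Qed.

Lemma uf_uniq (x : nat -> R) (a b : R) : x @ uf --> a -> x @ uf --> b -> a = b.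
Proof. by move=> xa xb; apply: cvg_unique xa xb; exact: norm_hausdorff. Qed.

Lemma uf_squeeze (x y : nat -> R) : (\forall n \near uf, 0 <= x n <= y n) ->
  y @ uf --> 0 -> x @ uf --> 0.
Proof.
move=> xy /ufRP y0; apply/ufRP => e /y0; apply: filterS2 xy => n /andP[x0 xy].
by rewrite !subr0 !ger0_norm //; [exact: le_lt_trans|exact: le_trans xy].
Qed.

(** The contradiction scheme for uniform constants: counterexamples at the scales 1/(n+1) are handed
    to the second hypothesis. Together with [cocompact] it turns statements about one limit point
    into uniform ones. *)
Lemma eps_seq (T : Type) (d : T -> R) (P : T -> Prop) : (forall x, 0 <= d x) ->
  (forall x : nat -> T, (fun n => d (x n)) @ uf --> 0 -> (forall n, ~ P (x n)) -> False) ->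
  exists2 e, 0 < e & forall x, d x < e -> P x.
Proof.
move=> d0 h; apply: contrapT => nex.
have /choice[x xP] : forall n : nat, exists x, d x < n.+1%:R^-1 /\ ~ P x.
  move=> n; apply: contrapT => nx; apply: nex; exists n.+1%:R^-1.
    by rewrite invr_gt0 ltr0n.
  by move=> x dx; apply: contrapT => nPx; apply: nx; exists x.
apply: (h x); last by move=> n; case: (xP n).
apply: (uf_squeeze _ uf_invn); apply: nearW => n.
by rewrite d0 ltW //; case: (xP n).
Qed.

Lemma nbhs_seq (T : pseudoMetricType R) (l : T) (P : T -> Prop) :
  (forall x : nat -> T, x @ uf --> l -> (forall n, ~ P (x n)) -> False) -> nbhs l P.
Proof.
move=> h; apply: contrapT => nP.
have /choice[x xP] : forall n : nat, exists x, ball l (n.+1%:R^-1 : R) x /\ ~ P x.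
  move=> n; apply: contrapT => nx; apply: nP; apply/nbhs_ballP; exists (n.+1%:R^-1).
    by rewrite /= invr_gt0 ltr0n.
  by move=> x lx; apply: contrapT => nPx; apply: nx; exists x.
apply: (h x); last by move=> n; case: (xP n).
move=> A /nbhs_ballP[e e0 eA].
have /ufRP /(_ e e0) := uf_invn; apply: filterS => n; rewrite subr0 ger0_norm ?invr_ge0 //.
by move=> ne; apply: eA; case: (xP n) => + _; apply: le_ball; exact: ltW.
Qed.

Lemma uf_cts (S : pseudoMetricType R) (T : topologicalType) (f : S -> T) (l : S) :
  (forall x : nat -> S, x @ uf --> l -> (fun n => f (x n)) @ uf --> f l) -> {for l, continuous f}.
Proof.
move=> h A nA; apply: nbhs_seq => x xl nx.
have hA : \forall n \near uf, A (f (x n)) := h _ xl _ nA.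
by have [n An] := filter_ex hA; exact: (nx n An).
Qed.

Section UltraMetric.
Context {T : metricType R}.

Lemma nbhsMP (x : T) (A : set T) :
  nbhs x A <-> exists2 e : R, 0 < e & forall y : T, mdist x y < e -> A y.
Proof.
split=> [/nbhs_ballP[e e0]|[e e0 h]].
  by rewrite ballEmdist => h; exists e.
by apply/nbhs_ballP; exists e => //; rewrite ballEmdist.
Qed.

Lemma ufMP (x : nat -> T) (l : T) : x @ uf --> l <-> (fun n => mdist (x n) l) @ uf --> (0 : R).
Proof.
split=> [xl|/ufRP h A /nbhsMP[e e0 eA]].
  apply/ufRP => e e0.
  have : nbhs l [set y : T | mdist y l < e].
    by apply/nbhsMP; exists e => // y; rewrite /= metric_sym.
  move=> /(uf_open) /(_ xl); apply: filterS => n /=; by rewrite subr0 ger0_norm // mdist_ge0.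
have := h e e0; apply: filterS => n; rewrite subr0 ger0_norm ?mdist_ge0 // metric_sym.
exact: eA.
Qed.

Lemma uf_mdist (x y : nat -> T) (a b : T) : x @ uf --> a -> y @ uf --> b ->
  (fun n => mdist (x n) (y n)) @ uf --> mdist a b.
Proof.
move=> /ufMP /ufRP xa /ufMP /ufRP yb; apply/ufRP => e e0.
have e20 : 0 < e / 2 by lra.
near=> n.
have : `|mdist (x n) a - 0| < e / 2 by near: n; exact: xa.
rewrite subr0 ger0_norm ?mdist_ge0 // => h1.
have : `|mdist (y n) b - 0| < e / 2 by near: n; exact: yb.
rewrite subr0 ger0_norm ?mdist_ge0 // => h2.
have := metric_triangle (x n) a (y n); have := metric_triangle a b (y n).
have := metric_triangle a (x n) b; have := metric_triangle (x n) (y n) b.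
rewrite ltr_norml (metric_sym a (x n)) (metric_sym b (y n)); lra.
Unshelve. all: by end_near. Qed.

Lemma uf_uniqM (x : nat -> T) (a b : T) : x @ uf --> a -> x @ uf --> b -> a = b.
Proof. by move=> xa xb; apply: cvg_unique xa xb; exact: metric_hausdorff. Qed.

Lemma uf_close (x y : nat -> T) (a : T) : (fun n => mdist (x n) (y n)) @ uf --> (0 : R) -> x @ uf --> a -> y @ uf --> a.
Proof.
move=> xy /ufMP xa; apply/ufMP; 
apply: (@uf_squeeze _ (fun n => mdist (x n) (y n) + mdist (x n) a)); last first.
  by rewrite -(addr0 0); exact: cvgD.
apply: nearW => n; rewrite mdist_ge0 /= [mdist (x n) (y n)]metric_sym.
exact: metric_triangle.
Qed.

Lemma uf_mdist0 (x y : nat -> T) (a b : T) : x @ uf --> a -> y @ uf --> b ->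
  (fun n => mdist (x n) (y n)) @ uf --> (0 : R) -> a = b.
Proof. by move=> xa yb xy; apply: uf_uniqM (uf_close xy xa) yb. Qed.

End UltraMetric.
End UltraReal.

(** * The universal cover as a metric space *)

Section Cover.
Context {R : realType} {M X : metricType R} (p : X -> M).
Hypothesis hM : closed_manifold M (R * R * R)%type.
Hypothesis hcov : @universal_cover R X M p.
Hypothesis hmet : lifted_metric p.

Let pcov : covering_map p. Proof. by case: hcov. Qed.
Lemma cover_cts : continuous p. Proof. by case: pcov. Qed.

Lemma deck_tr x x' : p x = p x' -> exists2 g, deck p g & g x = x'.
Proof.
apply: (@deck_transitive R X M p pcov _ (R * R * R)%type); first by case: hcov.
by case: hM.
Qed.

Lemma deck_iso g : deck p g -> forall y z, mdist (g y) (g z) = mdist y z.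
Proof. by case: hmet => _; apply. Qed.

Lemma deck_p g x : deck p g -> p (g x) = p x.
Proof. by move=> [_ /(congr1 (@^~ x))]. Qed.

Lemma deck_inv g : deck p g -> exists g', [/\ deck p g', cancel g g' & cancel g' g].
Proof.
move=> [cg pg [g' [cg' gK g'K]]]; exists g'; split=> //; split=> //; last by exists g.
by apply/funext => x /=; rewrite -{2}(g'K x) -[p (g _)]/((p \o g) _) pg.
Qed.

Definition local_iso (e : R) (x : X) :=
  (forall y z, mdist x y < e -> mdist x z < e -> mdist (p y) (p z) = mdist y z) /\
  (forall w, mdist (p x) w < e -> exists2 y, mdist x y < e & p y = w).

(** A Lebesgue number: a deck transformation carries the radius found at one point of a fibre to the
    others, and compactness of M makes it uniform. *)
Lemma cover_eta : exists2 e : R, 0 < e & forall x, local_iso e x.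
Proof.
have loc x0 : exists2 r : R, 0 < r & forall x, mdist (p x0) (p x) < r -> local_iso r x.
  have [/(_ x0) [U /nbhsMP[r r0 rU] Uiso] _] := hmet.
  have [V [oV Vx] /(_ x0 Vx) [W [sec [[oW oW' WU secU secK] Wx]]]] := sheetP pcov (p x0).
  have [Wsec psec csec] := secU _ Vx.
  have /nbhsMP[r' r'0 r'V] : nbhs (p x0) (V `&` sec @^-1` [set y | mdist x0 y < r]).
    apply: filterI; first exact: open_nbhs_nbhs.
    by apply: csec; rewrite secK //; apply/nbhsMP; exists r.
  pose q := Num.min r r' / 2.
  have q0 : 0 < q by rewrite divr_gt0 // lt_min r0.
  have qr : 2 * q <= r by rewrite /q mulrC divfK // ge_min lexx.
  have qr' : 2 * q <= r' by rewrite /q mulrC divfK // ge_min lexx orbT.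
  have iso0 y z : mdist x0 y < r -> mdist x0 z < r -> mdist (p y) (p z) = mdist y z.
    by move=> yr zr; apply: Uiso; exact: rU.
  have near_iso x : mdist x0 x < q -> local_iso q x.
    move=> xq; split=> [y z xy xz|w xw].
      by apply: iso0; [have := metric_triangle x0 x y|have := metric_triangle x0 x z]; lra.
    have x0x : mdist (p x0) (p x) = mdist x0 x by apply: iso0; rewrite ?mdistxx //; lra.
    have [|Vw wr] := r'V w; first by have := metric_triangle (p x0) (p x) w; lra.
    have [_ pw _] := secU _ Vw; exists (sec w) => //.
    by rewrite -iso0 ?pw //; lra.
  exists q => // x xq.
  (* x may lie in another sheet than x0; x' is the point of its fibre next to x0. *)
  have [Vx' x'r] : (V `&` sec @^-1` [set y | mdist x0 y < r]) (p x) by apply: r'V; lra.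
  have [_ px' _] := secU _ Vx'; set x' := sec (p x) in x'r px'.
  have x'q : mdist x0 x' < q by rewrite -iso0 ?mdistxx // px'.
  have [i1 i2] := near_iso _ x'q.
  have [g dg gx'] := deck_tr px'; have giso := deck_iso dg.
  rewrite -gx'; split=> [y z|w].
    have [g' [dg' gK g'K]] := deck_inv dg.
    rewrite -(g'K y) -(g'K z) !giso !(deck_p _ dg); exact: i1.
  rewrite (deck_p _ dg) => /i2 [y x'y pyw]; exists (g y); first by rewrite giso.
  by rewrite (deck_p _ dg).
(* [eps_seq] is applied to the radii themselves: the absolute value makes their size nonnegative,
   and the radius 0 is exempted. *)
have [||e e0 h] := @eps_seq R R (fun e => `|e|) (fun e => e = 0 \/ forall x, local_iso `|e| x).
- by move=> e.
- move=> e e0 ne.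
  have /choice[x nx] : forall n, exists x, ~ local_iso `|e n| x.
    move=> n; apply: contrapT => nex; apply: (ne n); right=> x.
    by apply: contrapT => nx; apply: nex; exists x.
  have cM : compact [set: M] by case: hM.
  have [|l _ pl] := compact_uf (x := fun n => p (x n)) cM; first exact: nearW.
  have [_ /(_ l) [x0 px0] _] := pcov; rewrite -px0 in pl.
  have [r r0 hr] := loc x0.
  have /filter_ex[n [en pxn]] : \forall n \near uf, `|e n| < r /\ mdist (p x0) (p (x n)) < r.
    near=> n; split; near: n.
      by move/ufRP: e0 => /(_ _ r0); apply: filterS => n; rewrite subr0 normr_id.
    by apply: (@uf_open _ [set m | mdist (p x0) m < r] _ _ _ pl); apply/nbhsMP; exists r.
  apply: (nx n); have [i1 i2] := hr _ pxn; split=> [y z xy xz|w xw].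
    by apply: i1; lra.
  have [|y xy pyw] := i2 w; first by lra.
  exists y => //; rewrite -i1 ?pyw //; rewrite mdistxx; lra.
exists (e / 2); first by lra.
have [||] := h (e / 2); rewrite ?gtr0_norm //; lra.
Unshelve. all: by end_near. Qed.

(** Since M is compact, [p (x n)] converges along [uf]; the local isometry at a point l above the
    limit selects the deck translates that converge to l. *)
Lemma cocompact (x : nat -> X) : exists (g : nat -> X -> X) (l : X),
  (forall n, deck p (g n)) /\ (fun n => g n (x n)) @ uf --> l.
Proof.
have [e e0 iso] := cover_eta.
have cM : compact [set: M] by case: hM.
have [|m _ pm] := compact_uf (x := fun n => p (x n)) cM; first exact: nearW.
have [_ /(_ m) [l pl] _] := pcov; rewrite -pl in pm.
have [i1 i2] := iso l.
have /choice[g gP] : forall n, exists g, deck p g /\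
    (mdist (p l) (p (x n)) < e -> mdist l (g (x n)) < e).
  move=> n; have [lx|nlx] := pselect (mdist (p l) (p (x n)) < e); last first.
    by have [g dg _] := deck_tr (erefl (p l)); exists g.
  have [y ly py] := i2 _ lx; have [g dg gx] := deck_tr (esym py).
  by exists g; rewrite gx.
exists g, l; split; first by move=> n; case: (gP n).
move/ufMP/ufRP: pm => pm; apply/ufMP/ufRP => d d0.
near=> n.
have h : `|mdist (p (x n)) (p l) - 0| < Num.min d e by near: n; apply: pm; rewrite lt_min d0.
move: h; rewrite !subr0 !ger0_norm ?mdist_ge0 // metric_sym lt_min => /andP[hd he].
have [dg /(_ he) lg] := gP n.
by rewrite metric_sym -i1 ?mdistxx // (deck_p _ dg).
Unshelve. all: by end_near. Qed.

End Cover.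

(** * Leaves meet charts in countably many plaques *)

Section RealAux.
Context {R : realType}.

Lemma countable_itvN (A : set R) (a b : R) : countable A -> a < b ->
  (forall v, a <= v <= b -> A v) -> False.
Proof.
move=> cA ab h; have := @countable_lebesgue_measure0 R (`[a, b]%classic).
rewrite lebesgue_measure_itv /= lte_fin ab => /(_ _).
have h2 : countable (`[a, b]%classic : set R).
  by apply: sub_countable cA; apply: subset_card_le => v; rewrite /= in_itv /=; exact: h.
by move=> /(_ h2) /eqP; rewrite -EFinB eqe; lra.
Qed.

Lemma ivt (f : R -> R) (s t v : R) : s <= t ->
  (forall r, s <= r <= t -> {for r, continuous f}) ->
  f s <= v <= f t \/ f t <= v <= f s -> exists2 r, s <= r <= t & f r = v.
Proof.
move=> st cf fv; have [|||r] := @IVT R f s t v; first by [].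
- by apply: continuous_in_subspaceT => r; rewrite inE /= in_itv; exact: cf.
- by case: (leP (f s) (f t)) => ?; case: fv; lra.
- by rewrite in_itv => ? ?; exists r.
Qed.

(** By the intermediate value theorem a continuous function that is not constant takes all values of
    an interval, which is uncountable. *)
Lemma countable_const (f : R -> R) (s t : R) (A : set R) : countable A -> s <= t ->
  (forall r, s <= r <= t -> {for r, continuous f}) ->
  (forall r, s <= r <= t -> A (f r)) -> f s = f t.
Proof.
move=> cA st cf fA; case: (ltgtP (f s) (f t)) => // fst; exfalso.
  apply: (countable_itvN cA fst) => v fv.
  by have [|r rst <-] := ivt st cf (v := v); [left|exact: fA].
apply: (countable_itvN cA fst) => v fv.
by have [|r rst <-] := ivt st cf (v := v); [right|exact: fA].
Qed.

Lemma rat2_dense (e : R * R) (N : set (R * R)) : nbhs e N ->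
  exists q : rat * rat, N (ratr q.1, ratr q.2).
Proof.
move=> [[A B] [/= /nbhsRP[a a0 aA] /nbhsRP[b b0 bB]] AB].
have /rat_in_itvoo[q /itvP hq] : e.1 < e.1 + a by rewrite ltrDl.
have /rat_in_itvoo[r /itvP hr] : e.2 < e.2 + b by rewrite ltrDl.
have q1 : e.1 < ratr q < e.1 + a by rewrite !hq.
have r1 : e.2 < ratr r < e.2 + b by rewrite !hr.
exists (q, r); apply: AB; split=> /=.
  by apply: aA; rewrite ltr_norml; lra.
by apply: bB; rewrite ltr_norml; lra.
Qed.

End RealAux.

Section Plaques.
Context {R : realType} {M : topologicalType}.
Implicit Types (A : set (fchart3 R M)) (c : fchart3 R M).

Lemma coherent_sym c c' : coherent c c' -> coherent c' c.
Proof.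
move=> h x d' d; have [U nU UP] := h x d d'; exists U => // y z Uy Uz.
by have [? ? [? ?]] := UP y z Uy Uz.
Qed.

Lemma cinv_near c (y : M) (N : set M) : dom c y -> nbhs y N ->
  nbhs (c y).1 [set e | N (cinv c (e, (c y).2))].
Proof.
move=> dy nN; have := @pairr_continuous (R * R)%type R (c y).2 (c y).1.
have cc : {for (c y), continuous (cinv c)} by exact: cinv_continuous.
move=> h; have nN' : nbhs (cinv c (c y)) N by rewrite cmapK.
have := cc _ nN'; rewrite {1}[c y]surjective_pairing => /h; exact.
Qed.

Lemma plaque_path A x y : same_plaque A x y -> exists c (g : R -> M),
  [/\ A c, continuous g, g 0 = x, g 1 = y & forall t, dom c (g t) /\ (c (g t)).2 = (c x).2].
Proof.
move=> [c [Ac dx dy cxy]]; exists c.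
pose e (t : R) : R * R := ((c x).1.1 + clamp t * ((c y).1.1 - (c x).1.1),
                           (c x).1.2 + clamp t * ((c y).1.2 - (c x).1.2)).
exists (fun t => cinv c (e t, (c x).2)); split=> //.
- apply: (@ccomp R (R * R * R)%type M (fun t => (e t, (c x).2)) (cinv c)); last exact: cinv_continuous.
  move=> t; apply: (@cpairat R (R * R)%type R); last exact: cvg_cst.
  by apply: (@cpairat R R R); (apply: cvgD; [exact: cvg_cst|]);
    apply: cvgM; [exact: clamp_continuous|exact: cvg_cst|exact: clamp_continuous|exact: cvg_cst].
- by rewrite /e clamp0 !mul0r !addr0 -!surjective_pairing cmapK.
- by rewrite /e clamp1 !mul1r !(addrC _ (_ - _)) !subrK cxy -!surjective_pairing cmapK.
- by move=> t; split; [exact: cinv_dom|rewrite cinvK].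
Qed.

Section Countable.
Variables (A : set (fchart3 R M)) (hA : foliated_atlas A) (cM : compact [set: M]).

Lemma finite_charts : exists (S : set M) (K : M -> fchart3 R M),
  [/\ countable S, forall s, A (K s) & forall y, exists2 s, S s & dom (K s) y].
Proof.
have /choice[K KP] : forall y : M, exists c, A c /\ dom c y.
  by move=> y; have [c] := hA.1 y; exists c.
(* The filter of finite lists ordered by inclusion turns the near-covering form of compactness into
   a finite subcover. *)
pose F := filter_from setT (fun D : seq M => [set D' : seq M | {subset D <= D'}]).
have FF : Filter F.
  apply: filter_from_filter; first by exists [::].
  move=> D1 D2 _ _; exists (D1 ++ D2) => // D' /= h.
  by split=> x xD; apply: h; rewrite mem_cat xD ?orbT.
have : \forall D \near F, [set: M] `<=` [set y | exists2 s, s \in D & dom (K s) y].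
  move: (cM) => /compact_near_coveringP; apply=> y _.
  exists (dom (K y), [set D' : seq M | {subset [:: y] <= D'}]).
    split=> /=; first by apply: chart_nbhs; case: (KP y).
    by exists [:: y].
  by move=> [z D] /= [dz Dy]; exists y => //; apply: Dy; rewrite mem_head.
move=> [D _ /(_ D (fun x h => h)) DM].
exists [set` D], K; split=> //; last by move=> y; exact: DM.
  exact/finite_set_countable/finite_seq.
by move=> s; case: (KP s).
Qed.

(** A plaque is coded by a chart s and a transverse value v. Every plaque that meets it contains one
    of its points with rational leaf coordinates, so each plaque has countably many successors, and
    a leaf is exhausted by countably many generations [T n]. *)
Lemma leaf_countable c x : compatible A c ->
  countable [set v | exists y, [/\ leaf A x y, dom c y & (c y).2 = v]].
Proof.
move=> Ac; have [S [K [cS AK SK]]] := finite_charts.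
pose pt s (v : R) (q : rat * rat) := cinv (K s) ((ratr q.1, ratr q.2), v).
pose step (T : set (M * R)) := [set sv : M * R | exists s v q,
  [/\ T (s, v), S sv.1 & sv.2 = (K sv.1 (pt s v q)).2]].
pose T n := iter n step [set sv | S sv.1 /\ sv.2 = (K sv.1 x).2].
have cT n : countable (T n).
  elim: n => [|n IH].
    apply: (@sub_countable _ _ _ ((fun s => (s, (K s x).2)) @` S)).
      by apply: subset_card_le => -[s v] /= [Ss ->]; exists s.
    exact: (sub_countable (card_image_le _ _)).
  pose D := (T n `*` S) `*` [set: rat * rat].
  pose f (u : (M * R) * M * (rat * rat)) := (u.1.2, (K u.1.2 (pt u.1.1.1 u.1.1.2 u.2)).2).
  apply: (@sub_countable _ _ _ (f @` D)).
    apply: subset_card_le => -[s' v'] [s [v [q [/= Tsv Ss' ->]]]].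
    by exists ((s, v), s', q).
  apply: (sub_countable (card_image_le _ _)); apply: countableX => //.
  exact: countableX.
pose TT := \bigcup_n T n.
(* By coherence the transverse coordinate of c' is constant on the plaque of [K s] near y, so a
   point with rational leaf coordinates can replace y. *)
have approx c' y s v : coherent (K s) c' -> dom (K s) y -> v = (K s y).2 -> dom c' y ->
    exists q, (c' y).2 = (c' (pt s v q)).2.
  move=> cc dy -> d'y; have [U nU UP] := cc y dy d'y.
  have [q Uq] := rat2_dense (cinv_near dy nU).
  exists q; have [_ _ [+ _]] := UP _ _ (nbhs_singleton nU) Uq.
  by apply; rewrite cinvK.
have step' y s s' : S s -> S s' -> dom (K s) y -> dom (K s') y ->
    TT (s, (K s y).2) -> TT (s', (K s' y).2).
  move=> Ss Ss' dy dy' [n _ Tn].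
  have [q qP] := approx (K s') y s _ (hA.2 _ _ (AK s) (AK s')) dy erefl dy'.
  by exists n.+1 => //; exists s, (K s y).2, q.
pose P y := exists s, [/\ S s, dom (K s) y & TT (s, (K s y).2)].
have Px : P x.
  by have [s Ss ds] := SK x; exists s; split=> //; exists 0%N.
have Pstep y z : same_plaque A y z -> P y -> P z.
  move=> /plaque_path[c' [g [Ac' cg <- <- gP]]].
  apply: (@loc_const R (fun t => P (g t))) => t.
  have [s Ss ds] := SK (g t).
  have [U nU UP] := hA.2 _ _ (AK s) Ac' _ ds (gP t).1.
  have /nbhsRP[e e0 eP] : nbhs t (g @^-1` U) by exact: cg.
  exists e => // r r' rt r't [s' [Ss' ds' Ts']].
  have [dr _ _] := UP _ _ (eP _ rt) (eP _ rt).
  have [_ dr' [_ E]] := UP _ _ (eP _ rt) (eP _ r't).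
  exists s; split=> //.
    by have [+ _ _] := UP _ _ (eP _ r't) (eP _ r't).
  by rewrite -E; [exact: (step' (g r) s' s)|rewrite !(gP _).2].
have Pleaf y : leaf A x y -> P y.
  rewrite /leaf /=; suff h : forall x y, clos_refl_sym_trans M (same_plaque A) x y -> P x <-> P y.
    by move=> /h [+ _]; apply.
  move=> {Px}x' {}y; elim=> {x' y}.
  - move=> y z yz; split; apply: Pstep => //.
    by case: yz => c' [? ? ? ?]; exists c'; split.
  - by [].
  - by move=> ? ? _ [? ?]; split.
  - by move=> ? ? ? _ [? ?] _ [? ?]; split; auto.
have cTT : countable TT by apply: bigcup_countable.
pose f (u : (M * R) * (rat * rat)) := (c (pt u.1.1 u.1.2 u.2)).2.
apply: (@sub_countable _ _ _ (f @` (TT `*` [set: rat * rat]))).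
  apply: subset_card_le => _ [y [/Pleaf[s [Ss ds Ts]] dy <-]].
  have [q qP] := approx c y s _ (coherent_sym (Ac _ (AK s))) ds erefl dy.
  by exists ((s, (K s y).2), q).
by apply: (sub_countable (card_image_le _ _)); exact: countableX.
Qed.

(** A path inside a leaf cannot jump between plaques: its transverse coordinate is continuous and
    has only countably many values. This is the bridge from leaves as equivalence classes to local
    product structure. *)
Lemma leaf_path_const c (g : R -> M) x a b : compatible A c -> continuous g ->
  (forall t, a < t < b -> leaf A x (g t) /\ dom c (g t)) ->
  forall s t, a < s < b -> a < t < b -> (c (g s)).2 = (c (g t)).2.
Proof.
move=> Ac cg gP s t sab tab; wlog st : s t sab tab / s <= t.
  by move=> h; case: (leP s t) => [|/ltW]; [exact: h|move=> ?; apply/esym/h].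
have cl := leaf_countable x Ac.
have := @countable_const R (fun t => (c (g t)).2) s t _ cl st; apply=> r rst.
  apply: (@ccompat R M R g (fun y => (c y).2)); first exact: cg.
  by apply: chart_snd; have [|_ +] := gP r; first lra.
by have [|gl gd] := gP r; [lra|exists (g r)].
Qed.

(** c is only compatible with A and need not belong to it, so the path is followed through charts of
    A. *)
Lemma plaque_in_leaf c (g : R -> M) : compatible A c -> continuous g ->
  (forall t, dom c (g t) /\ (c (g t)).2 = (c (g 0)).2) -> forall t, leaf A (g 0) (g t).
Proof.
move=> Ac cg gP t; apply: (@loc_const R (fun t => leaf A (g 0) (g t)) _ 0); last exact: rst_refl.
move=> {}t; have [c' Ac' d'] := hA.1 (g t).
have [U nU UP] := Ac _ Ac' _ (gP t).1 d'.
have /nbhsRP[e e0 eP] : nbhs t (g @^-1` U) by exact: cg.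
exists e => // s s' st s't gs; apply: (rst_trans _ _ _ (g s)) => //; apply: rst_step.
have [_ ds [E _]] := UP _ _ (eP _ st) (eP _ s't).
have [_ ds' _] := UP _ _ (eP _ s't) (eP _ st).
by exists c'; split=> //; apply: E; rewrite !(gP _).2.
Qed.

End Countable.
End Plaques.

(** * Charts and leaves in the universal cover *)

Section LiftLeaves.
Context {R : realType} {M X : metricType R} (p : X -> M).
Hypothesis hM : closed_manifold M (R * R * R)%type.
Hypothesis hcov : @universal_cover R X M p.

Let pcov : covering_map p. Proof. by case: hcov. Qed.
Let pc : continuous p. Proof. by case: pcov. Qed.
Let cM : compact [set: M]. Proof. by case: hM. Qed.

(** The section of [homotopy_lift_end] becomes the inverse of the lifted chart, and its range the
    domain. *)
Lemma lift_chart (c : fchart3 R M) (x : X) : dom c (p x) ->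
  exists c' : fchart3 R X, dom c' x /\ forall y, dom c' y -> dom c (p y) /\ c' y = c (p y).
Proof.
move=> dx; have [s [cs s0 ps _]] := homotopy_lift_end pcov dx.
have cE y : dom c (p y) -> {for y, continuous (fun y => c (p y))}.
  by move=> dy; apply: (@ccompat X M _ p c); [exact: pc|exact: chart_at].
have oD : open (range s).
  rewrite openE => _ [e _ <-]; set z := s e.
  have dz : dom c (p z) by rewrite ps; exact: cinv_dom.
  have [U [oU Uz] /(_ z Uz) [W [sec [[oW oW' WU secU secK] Wz]]]] := sheetP pcov (p z).
  have nW : nbhs z W by exact: open_nbhs_nbhs.
  have cscp : {for z, continuous (fun w => s (c (p w)))}.
    by apply: (@ccompat X _ X (fun w => c (p w)) s); [exact: cE|exact: cs].
  have nW' : nbhs z ((fun w => s (c (p w))) @^-1` W).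
    by apply: cscp; rewrite ps cinvK.
  have nD : nbhs z (p @^-1` dom c) by apply: pc; exact: chart_nbhs.
  near=> w; exists (c (p w)) => //.
  have Ww : W w by near: w.
  have Wsw : W (s (c (p w))) by near: w.
  rewrite -[RHS]secK // -[LHS]secK // ps cmapK //.
  by near: w.
have dD y : range s y -> dom c (p y) by move=> [e _ <-]; rewrite ps; exact: cinv_dom.
have cD : {within range s, continuous (fun y => c (p y))}.
  by apply: continuous_in_subspaceT => y; rewrite inE => /dD /cE.
have sD e : range s (s e) by exists e.
have K1 y : range s y -> s (c (p y)) = y by move=> [e _ <-]; rewrite ps cinvK.
have K2 : cancel s (fun y => c (p y)) by move=> e; rewrite ps cinvK.
exists (Chart oD cD cs sD K1 K2) => /=; split; first by exists (c (p x)).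
by move=> y Dy; split=> //; exact: dD.
Unshelve. all: by end_near. Qed.

Section Atlas.
Variables (A : set (fchart3 R M)) (hA : foliated_atlas A).
Notation A' := (lift_atlas p A).

Lemma lift_atlasP x : exists c c', [/\ A c, A' c', dom c (p x), dom c' x &
  forall y, dom c' y -> dom c (p y) /\ c' y = c (p y)].
Proof.
have [c Ac dx] := hA.1 (p x); have [c' [dx' cc']] := lift_chart dx.
by exists c, c'; split=> //; exists c.
Qed.

Lemma leaf_proj x y : leaf A' x y -> leaf A (p x) (p y).
Proof.
rewrite /leaf /=; elim.
- move=> {}x {}y [c' [[c Ac cc'] dx dy xy]]; apply: rst_step.
  have [[dpx cx] [dpy cy]] := (cc' _ dx, cc' _ dy).
  by exists c; split=> //; rewrite -cx -cy.
- by move=> ?; exact: rst_refl.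
- by move=> ? ? _; exact: rst_sym.
- by move=> ? ? ? _ + _; exact: rst_trans.
Qed.

(** With [leaf_joined] this describes lifted leaves by paths: two points share a leaf iff they are
    joined by a path whose projection stays in one leaf. [leaf_path_const] keeps such a path in one
    plaque of a lifted chart at a time. *)
Lemma leaf_lift (g : R -> X) : continuous g ->
  (forall t, leaf A (p (g 0)) (p (g t))) -> forall t, leaf A' (g 0) (g t).
Proof.
move=> cg gl t; apply: (@loc_const R (fun t => leaf A' (g 0) (g t)) _ 0); last exact: rst_refl.
move=> {}t; have [c [c' [Ac A'c' dc dc' cc']]] := lift_atlasP (g t).
have /nbhsRP[e e0 eP] : nbhs t (g @^-1` dom c') by apply: cg; exact: chart_nbhs.
exists e => // s s' st s't ls; apply: (rst_trans _ _ _ (g s)) => //.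
have inI r : t - e < r < t + e -> dom c' (g r) by move=> ?; apply: eP; rewrite ltr_norml; lra.
have Es : (c (p (g s))).2 = (c (p (g s'))).2.
  apply: (@leaf_path_const R M A hA cM c (fun t => p (g t)) (p (g 0)) (t - e) (t + e)).
  - by move=> c'' ?; exact: hA.2.
  - exact: (@ccomp R X M g p).
  - by move=> r /inI /cc' [].
  - by move: st; rewrite ltr_norml; lra.
  - by move: s't; rewrite ltr_norml; lra.
by apply: rst_step; exists c'; split=> //; [exact: eP|exact: eP|
  rewrite (cc' _ (eP _ st)).2 (cc' _ (eP _ s't)).2].
Qed.

Lemma leaf_joined x y : leaf A' x y -> exists g : R -> X,
  [/\ continuous g, g 0 = x, g 1 = y & forall t, leaf A (p x) (p (g t))].
Proof.
rewrite /leaf /=; elim.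
- move=> {}x {}y /plaque_path[c' [g [A'c' cg g0 g1 gP]]]; exists g; split=> // t.
  apply: leaf_proj; apply: rst_step; exists c'; rewrite -g0; split=> //.
  + by case: (gP 0).
  + by case: (gP t).
  + by rewrite (gP 0).2 (gP t).2.
- move=> {}x; exists (fun=> x); split=> // [? |_]; [exact: cvg_cst|exact: rst_refl].
- move=> {}x {}y _ [g [cg g0 g1 gP]]; exists (fun t => g (1 - t)); split.
  + apply: (@ccomp R R X (fun t => 1 - t) g) => // t.
    by apply: cvgB; [exact: cvg_cst|exact: cvg_id].
  + by rewrite subr0.
  + by rewrite subrr.
  + by move=> t; apply: (rst_trans _ _ _ (p x)); [apply: rst_sym; rewrite -g1; exact: gP|exact: gP].
- move=> {}x {}y z _ [f [cf f0 f1 fP]] _ [h [ch h0 h1 hP]].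
  exists (fun t => if t <= 1 / 2 then f (2 * t) else h (2 * t - 1)).
  have c2 : continuous (fun t : R => 2 * t).
    by move=> t; apply: cvgM; [exact: cvg_cst|exact: cvg_id].
  have e1 : 2 * (1 / 2 : R) = 1 by field.
  split.
  + apply: (@pw_continuous R X (fun t => f (2 * t)) (fun t => h (2 * t - 1))).
    * exact: (@ccomp R R X (fun t => 2 * t) f).
    * apply: (@ccomp R R X (fun t => 2 * t - 1) h) => // t.
      by apply: cvgB; [exact: c2|exact: cvg_cst].
    * by rewrite e1 subrr f1 h0.
  + by rewrite ifT ?mulr0 //; lra.
  + rewrite ifF; last by apply/negbTE; rewrite -ltNge; lra.
    by rewrite (_ : 2 * 1 - 1 = 1) //; lra.
  + move=> t; case: ifP => _ //; apply: (rst_trans _ _ _ (p y)) => //.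
    by rewrite -f1; exact: fP.
Qed.

End Atlas.
End LiftLeaves.

(** * The hyperbolic plane in Minkowski coordinates *)

Section Minkowski.
Context {R : realType}.
Local Notation V := (R * R * R)%type.
Implicit Types (P Q N : V) (p q : R * R) (s t : R).

(* The quadratic form A C - B^2 on triples (A, B, C). *)
Definition mform P Q : R := (P.1.1 * Q.2 + P.2 * Q.1.1) / 2 - P.1.2 * Q.1.2.

Definition lin a P b Q : V :=
  (a * P.1.1 + b * Q.1.1, a * P.1.2 + b * Q.1.2, a * P.2 + b * Q.2).

(* The hyperboloid model: mform (mk p) (mk q) is the hyperbolic cosine of the distance of p and q. *)
Definition mk p : V := (p.2^-1, p.1 / p.2, (p.1 ^+ 2 + p.2 ^+ 2) / p.2).
Definition mki P : R * R := (P.1.2 / P.1.1, P.1.1^-1).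

Definition hyperboloid P := 0 < P.1.1 /\ P.1.1 * P.2 - P.1.2 ^+ 2 = 1.
(** The nonzero vectors on the boundary of the forward light cone. Up to a positive factor they are
    the ideal points, and two of them give the same ideal point iff their product vanishes
    ([null_prop]). *)
Definition null N := [/\ N.1.1 * N.2 = N.1.2 ^+ 2, 0 <= N.1.1, 0 <= N.2 & 0 < N.1.1 + N.2].

Lemma mformC P Q : mform P Q = mform Q P. Proof. by rewrite /mform; ring. Qed.

Lemma form_lin a P b Q N : mform (lin a P b Q) N = a * mform P N + b * mform Q N.
Proof. by rewrite /mform /lin /=; field. Qed.

Lemma form_lin2 a P b Q N : mform N (lin a P b Q) = a * mform N P + b * mform N Q.
Proof. by rewrite /mform /lin /=; field. Qed.

Lemma mk_hyperboloid p : half_plane p -> hyperboloid (mk p).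
Proof.
rewrite /half_plane /= => p0; split; rewrite /mk /=; first by rewrite invr_gt0.
by field; lra.
Qed.

Lemma mkK p : half_plane p -> mki (mk p) = p.
Proof.
case: p => u v; rewrite /half_plane /mki /mk /= => v0.
by rewrite invrK divfK //; lra.
Qed.

Lemma mki_half P : hyperboloid P -> half_plane (mki P).
Proof. by move=> [A0 _]; rewrite /half_plane /mki /= invr_gt0. Qed.

Lemma mkiK P : hyperboloid P -> mk (mki P) = P.
Proof.
case: P => -[A B] C [/= A0 h]; rewrite /mk /mki /= invrK divfK; last lra.
congr (_, _, _).
have -> : C = (1 + B ^+ 2) / A by rewrite -h; field; lra.
by field; lra.
Qed.

Lemma form_hyperboloid P : hyperboloid P -> mform P P = 1.
Proof. by move=> [_ <-]; rewrite /mform; field. Qed.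

Lemma null_form N : null N -> mform N N = 0.
Proof. by move=> [h _ _ _]; rewrite /mform; nra. Qed.

Lemma form_ge1 P Q : hyperboloid P -> hyperboloid Q -> 1 <= mform P Q.
Proof.
case: P => -[A B] C; case: Q => -[A' B'] C' [/= A0 h] [/= A'0 h']; rewrite /mform /=.
have -> : (A * C' + C * A') / 2 - B * B' =
   1 + ((A - A') ^+ 2 + (A * B' - A' * B) ^+ 2) / (2 * (A * A')).
  have -> : C = (1 + B ^+ 2) / A by rewrite -h; field; lra.
  have -> : C' = (1 + B' ^+ 2) / A' by rewrite -h'; field; lra.
  by field; lra.
rewrite lerDl divr_ge0 ?addr_ge0 ?sqr_ge0 // mulr_ge0 //; nra.
Qed.

Lemma form_mk p q : half_plane p -> half_plane q ->
  1 + ((p.1 - q.1) ^+ 2 + (p.2 - q.2) ^+ 2) / (2 * p.2 * q.2) = mform (mk p) (mk q).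
Proof. by rewrite /half_plane /mform /mk /= => ? ?; field; lra. Qed.

Definition ch s : R := (expR s + expR (- s)) / 2.

Lemma expRVK s : expR s * expR (- s) = 1.
Proof. by rewrite -expRD subrr expR0. Qed.

Lemma ch_ge1 s : 1 <= ch s.
Proof.
rewrite /ch; have := expRVK s; have := expR_gt0 (- s); move: (expR s) (expR (- s)) => a b b0 ab.
have : 0 <= b * (a - 1) ^+ 2 by rewrite mulr_ge0 ?sqr_ge0 // ltW.
have -> : b * (a - 1) ^+ 2 = a * (a * b) - 2 * (a * b) + b by ring.
by rewrite ab; lra.
Qed.

Lemma chN s : ch (- s) = ch s.
Proof. by rewrite /ch opprK addrC. Qed.

Lemma ch_norm s : ch `|s| = ch s.
Proof. by have [s0|s0] := leP 0 s; [rewrite ger0_norm|rewrite ltr0_norm // chN]. Qed.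

Lemma ch_lt s t : 0 <= s -> s < t -> ch s < ch t.
Proof.
move=> s0 st; have := expRVK s; have := expRVK t.
have : expR s < expR t by rewrite ltr_expR.
have : 1 <= expR s by rewrite -expR0 ler_expR.
have := expR_gt0 (- s); have := expR_gt0 (- t); rewrite /ch.
move: (expR s) (expR t) (expR (- s)) (expR (- t)) => a b c d d0 c0 a1 ab bd ac.
have -> : c = a^-1 by rewrite -[LHS]mul1r -(mulVf (x := a)) -?mulrA ?ac ?mulr1 //; lra.
have -> : d = b^-1 by rewrite -[LHS]mul1r -(mulVf (x := b)) -?mulrA ?bd ?mulr1 //; lra.
rewrite ltr_pM2r // -subr_gt0.
have -> : b + b^-1 - (a + a^-1) = (b - a) * (a * b - 1) / (a * b) by field; lra.
by rewrite divr_gt0 ?mulr_gt0 //; nra.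
Qed.

Lemma ch_le s t : 0 <= s -> 0 <= t -> (ch s <= ch t) = (s <= t).
Proof.
move=> s0 t0; apply/idP/idP; last by rewrite le_eqVlt => /predU1P[->//|/(ch_lt s0) /ltW].
by move=> h; rewrite leNgt; apply/negP => /(ch_lt t0); lra.
Qed.

Lemma ch_inj s t : 0 <= s -> 0 <= t -> ch s = ch t -> s = t.
Proof. by move=> s0 t0 h; apply/le_anti; rewrite -(ch_le s0 t0) -(ch_le t0 s0) h lexx. Qed.

Lemma arch c (d := ln (c + Num.sqrt (c ^+ 2 - 1))) : 1 <= c -> 0 <= d /\ ch d = c.
Proof.
move=> c1; have h : 0 <= c ^+ 2 - 1 by nra.
have r0 : 0 <= Num.sqrt (c ^+ 2 - 1) by exact: sqrtr_ge0.
have r2 : Num.sqrt (c ^+ 2 - 1) ^+ 2 = c ^+ 2 - 1 by exact: sqr_sqrtr.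
rewrite /d /ch; move: (Num.sqrt _) r0 r2 => r r0 r2.
split; first by apply: ln_ge0; lra.
rewrite expRN lnK ?posrE; last lra.
have -> : (c + r)^-1 = c - r.
  have e : (c - r) * (c + r) = 1 by rewrite -subr_sqr r2; ring.
  by rewrite -[RHS](mulfK (x := c + r)) ?e ?mul1r //; lra.
by field.
Qed.

Lemma hyp_dist_ge0 p q : half_plane p -> half_plane q -> 0 <= hyp_dist p q.
Proof.
move=> hp hq; rewrite /hyp_dist form_mk //.
by have [] := arch (form_ge1 (mk_hyperboloid hp) (mk_hyperboloid hq)).
Qed.

Lemma ch_hyp_dist p q : half_plane p -> half_plane q -> ch (hyp_dist p q) = mform (mk p) (mk q).
Proof.
move=> hp hq; rewrite /hyp_dist form_mk //.
by have [] := arch (form_ge1 (mk_hyperboloid hp) (mk_hyperboloid hq)).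
Qed.

Lemma hyp_distE p q s : half_plane p -> half_plane q ->
  mform (mk p) (mk q) = ch s -> hyp_dist p q = `|s|.
Proof.
move=> hp hq h; apply: ch_inj => //; first exact: hyp_dist_ge0.
by rewrite ch_hyp_dist // ch_norm.
Qed.

Lemma hyp_dist_le p q s : half_plane p -> half_plane q -> 0 <= s ->
  (hyp_dist p q <= s) = (mform (mk p) (mk q) <= ch s).
Proof. by move=> hp hq s0; rewrite -ch_hyp_dist // ch_le // hyp_dist_ge0. Qed.

Lemma hyp_distC p q : hyp_dist p q = hyp_dist q p.
Proof.
rewrite /hyp_dist; suff -> : ((p.1 - q.1) ^+ 2 + (p.2 - q.2) ^+ 2) / (2 * p.2 * q.2) =
  ((q.1 - p.1) ^+ 2 + (q.2 - p.2) ^+ 2) / (2 * q.2 * p.2) by [].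
by congr (_ / _); ring.
Qed.

Lemma null_form_ge0 N Q : null N -> null Q -> 0 <= mform N Q.
Proof.
case: N => -[A B] C; case: Q => -[A' B'] C' [/= h A0 C0 _] [/= h' A'0 C'0 _].
rewrite /mform /= leNgt; apply/negP => neg.
have h1 : 0 <= A * C' + C * A' by rewrite addr_ge0 ?mulr_ge0.
have : (A * C' + C * A') ^+ 2 < 4 * (B * B') ^+ 2 by nra.
rewrite exprMn -h -h'; have := sqr_ge0 (A * C' - C * A'); nra.
Qed.

Lemma null_prop N Q : null N -> null Q -> mform N Q = 0 ->
  exists2 c, 0 < c & Q = lin c N 0 N.
Proof.
case: N => -[A B] C; case: Q => -[A' B'] C' [/= h A0 C0 AC] [/= h' A'0 C'0 AC'].
rewrite /mform /lin /= => h0.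
have e1 : A * C' + C * A' = 2 * (B * B') by lra.
have e2 : A * C' = C * A'.
  have : (A * C' - C * A') ^+ 2 = 0.
    have -> : (A * C' - C * A') ^+ 2 = (A * C' + C * A') ^+ 2 - 4 * (A * C) * (A' * C') by ring.
    by rewrite e1 h h'; ring.
  by move/eqP; rewrite sqrf_eq0 subr_eq0 => /eqP.
have e3 : B * B' = C * A' by lra.
(* A = 0 is the ideal point at infinity of the half plane. *)
have [A1|A1] := ltP 0 A.
  have A'1 : 0 < A'.
    rewrite lt_neqAle A'0 andbT eq_sym; apply/eqP => A'z; move: e2 AC'.
    rewrite A'z mulr0 add0r => /eqP; rewrite mulf_eq0 => /orP[] /eqP; lra.
  exists (A' / A); first exact: divr_gt0.
  rewrite !mul0r !addr0 divfK; last lra.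
  have E2 : C' = A' / A * C by rewrite -mulrA (mulrC _ C) mulrA (mulrC A') -e2; field; lra.
  rewrite -E2; congr (_, _, _).
  have [B0|B0] := eqVneq B 0.
    rewrite B0 mulr0; apply/eqP; rewrite -sqrf_eq0 -h' mulf_eq0; apply/orP; right.
    by rewrite E2; move: h; rewrite B0 expr0n => /eqP; rewrite mulf_eq0 => /orP[] /eqP hh; apply/eqP; nra.
  apply: (mulfI B0); rewrite e3.
  have -> : B * (A' / A * B) = A' / A * B ^+ 2 by ring.
  by rewrite -h; field; lra.
have Az : A = 0 by lra.
have Bz : B = 0 by apply/eqP; rewrite -sqrf_eq0 -h Az mul0r.
have A'z : A' = 0.
  by apply/eqP; move: e2; rewrite Az mul0r => /esym/eqP; rewrite mulf_eq0 => /orP[/eqP|//]; lra.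
have B'z : B' = 0 by apply/eqP; rewrite -sqrf_eq0 -h' A'z mul0r.
exists (C' / C); first by apply: divr_gt0; lra.
by rewrite Az Bz A'z B'z !mulr0 !addr0 mul0r addr0 divfK //; lra.
Qed.

(** The form has signature (1, 2), so it is negative definite on the orthogonal complement of P.
    Applied to a difference of vectors this is a test for equality. *)
Lemma form_orth0 P Q : hyperboloid P -> mform Q P = 0 -> mform Q Q = 0 -> Q = (0, 0, 0).
Proof.
case: P => -[A B] C; case: Q => -[x y] z [/= A0 h]; rewrite /mform /= => h1 h2.
have e1 : x * C + z * A = 2 * (y * B) by lra.
have e2 : x * z = y ^+ 2 by rewrite expr2; lra.
have e3 : (x * C - z * A) ^+ 2 + 4 * y ^+ 2 = 0.
  have -> : (x * C - z * A) ^+ 2 = (x * C + z * A) ^+ 2 - 4 * (x * z) * (A * C) by ring.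
  have -> : A * C = 1 + B ^+ 2 by lra.
  by rewrite e1 e2; ring.
have y0 : y = 0.
  by apply/eqP; rewrite -sqrf_eq0; apply/eqP; have := sqr_ge0 (x * C - z * A); have := sqr_ge0 y; lra.
have e4 : x * C - z * A = 0.
  by apply/eqP; rewrite -sqrf_eq0; apply/eqP; have := sqr_ge0 (x * C - z * A); have := sqr_ge0 y; lra.
have z0 : z = 0.
  have zA : z * A = 0 by rewrite y0 mul0r in e1; lra.
  by apply/eqP; move/eqP: zA; rewrite mulf_eq0 => /orP[//|/eqP]; lra.
have x0 : x * C = 0 by rewrite z0 mul0r in e4; lra.
congr (_, _, _) => //; apply/eqP; move/eqP: x0; rewrite mulf_eq0 => /orP[//|/eqP C0].
by move: h; rewrite C0 mulr0; have := sqr_ge0 B; lra.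
Qed.

(** ** Geodesics *)

Definition hgeod (k : R -> R * R) :=
  (forall s, half_plane (k s)) /\ forall s t, hyp_dist (k s) (k t) = `|s - t|.

(* Solves e^s N + e^(-s) N' = P(s) for N, N' from P(0) and P(1). *)
Definition nplus (k : R -> R * R) : V :=
  let e := expR 1 in lin (e - e^-1)^-1 (mk (k 1)) (- (e^-1 / (e - e^-1))) (mk (k 0)).
Definition nminus (k : R -> R * R) : V :=
  let e := expR 1 in lin (e / (e - e^-1)) (mk (k 0)) (- (e - e^-1)^-1) (mk (k 1)).

Lemma hgeod_form k s t : hgeod k -> mform (mk (k s)) (mk (k t)) = ch (s - t).
Proof. by move=> [k0 kd]; rewrite -ch_hyp_dist // kd ch_norm. Qed.

Lemma e1_gt : 1 < expR (1 : R). Proof. by rewrite -expR0 ltr_expR. Qed.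

(** No differential equation is needed: the products of [mk (k s)], [mk (k 0)] and [mk (k 1)] are
    known from the distances, and they show that the difference D of the two sides is null and
    orthogonal to [mk (k 0)], hence zero. *)
Lemma hgeodE k s : hgeod k -> mk (k s) = lin (expR s) (nplus k) (expR (- s)) (nminus k).
Proof.
move=> hk; have k0 := hk.1; have e1 := e1_gt; set e := expR 1 in e1.
have eV : e^-1 < 1 by rewrite invf_lt1; lra.
have eV0 : 0 < e^-1 by rewrite invr_gt0; lra.
pose a := expR s; pose b := expR (- s); have ab : a * b = 1 by exact: expRVK.
pose D := lin 1 (mk (k s)) (-1) (lin a (nplus k) b (nminus k)).
have E : mform (mk (k 0)) (mk (k 0)) = 1 by rewrite form_hyperboloid //; exact: mk_hyperboloid.
have E1 : mform (mk (k 1)) (mk (k 1)) = 1 by rewrite form_hyperboloid //; exact: mk_hyperboloid.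
have Es : mform (mk (k s)) (mk (k s)) = 1 by rewrite form_hyperboloid //; exact: mk_hyperboloid.
have E01 : mform (mk (k 0)) (mk (k 1)) = (e + e^-1) / 2.
  by rewrite hgeod_form // sub0r chN /ch expRN.
have Es0 : mform (mk (k s)) (mk (k 0)) = (a + b) / 2 by rewrite hgeod_form // subr0.
have Es1 : mform (mk (k s)) (mk (k 1)) = (a / e + b * e) / 2.
  by rewrite hgeod_form // /ch opprB [expR (s - 1)]expRD [expR (1 - s)]expRD [expR (- 1)]expRN -/e -/a -/b (mulrC e).
have ee : e - e^-1 != 0 by lra.
have D0 : mform D (mk (k 0)) = 0.
  rewrite /D /nplus /nminus -/e !form_lin Es0 E (mformC (mk (k 1))) E01; field.
  by rewrite -/e; apply/andP; split; nra.
have D1 : mform D (mk (k 1)) = 0.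
  rewrite /D /nplus /nminus -/e !form_lin Es1 E1 E01; field.
  by rewrite -/e; apply/andP; split; nra.
have DD : mform D D = 0.
  have DDE : mform D D = mform D (mk (k s)).
    rewrite {2}/D /nplus /nminus -/e !form_lin2 D0 D1; field.
    by rewrite -/e; apply/andP; split; nra.
  rewrite DDE /D /nplus /nminus -/e !form_lin !(mformC _ (mk (k s))) Es Es0 Es1.
  transitivity (1 - a * b); last by rewrite ab subrr.
  by field; rewrite -/e; apply/andP; split; nra.
have D00 := form_orth0 (mk_hyperboloid (k0 0)) D0 DD.
move: D00; rewrite /D -/a -/b; move: (mk (k s)) (lin a _ b _) => -[[x y] z] [[x' y'] z'].
by rewrite /lin /= => -[h1 h2 h3]; congr (_, _, _); lra.
Qed.

Lemma hgeod_null k : hgeod k -> [/\ null (nplus k), null (nminus k) & mform (nplus k) (nminus k) = 1 / 2].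
Proof.
move=> hk; have k0 := hk.1; have e1 := e1_gt; set e := expR 1 in e1.
have eV : e^-1 < 1 by rewrite invf_lt1; lra.
have eV0 : 0 < e^-1 by rewrite invr_gt0; lra.
have ee : e - e^-1 != 0 by lra.
have E : mform (mk (k 0)) (mk (k 0)) = 1 by rewrite form_hyperboloid //; exact: mk_hyperboloid.
have E1 : mform (mk (k 1)) (mk (k 1)) = 1 by rewrite form_hyperboloid //; exact: mk_hyperboloid.
have E01 : mform (mk (k 0)) (mk (k 1)) = (e + e^-1) / 2.
  by rewrite hgeod_form // sub0r chN /ch expRN.
have F0 : mform (nplus k) (nplus k) = 0.
  rewrite /nplus -/e !(form_lin, form_lin2) E E1 (mformC (mk (k 1))) E01; field.
  by rewrite -/e; apply/andP; split; nra.
have F1 : mform (nminus k) (nminus k) = 0.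
  rewrite /nminus -/e !(form_lin, form_lin2) E E1 (mformC (mk (k 1))) E01; field.
  by rewrite -/e; apply/andP; split; nra.
have F01 : mform (nplus k) (nminus k) = 1 / 2.
  rewrite /nplus /nminus -/e !(form_lin, form_lin2) E E1 (mformC (mk (k 1))) E01; field.
  by rewrite -/e; apply/andP; split; nra.
(* The coordinates A and C of every point e^s N + e^(-s) N' are positive. *)
have pos (f : V -> R) : (forall a P b Q, f (lin a P b Q) = a * f P + b * f Q) ->
    (forall s, 0 < f (mk (k s))) -> 0 <= f (nplus k) /\ 0 <= f (nminus k).
  move=> flin fpos; have h s : 0 < expR s * f (nplus k) + expR (- s) * f (nminus k).
    by rewrite -flin -hgeodE.
  move: (f (nplus k)) (f (nminus k)) h => x y h.
  have gen x' y' : (forall s, 0 < expR s * x' + expR (- s) * y') -> 0 <= x'.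
    move=> h'; rewrite leNgt; apply/negP => xneg.
    have y0 : 0 < y' by have := h' 0; rewrite oppr0 expR0; lra.
    pose z := 1 + y' / (- x'); have z0 : 0 < y' / (- x') by rewrite divr_gt0 ?oppr_gt0.
    have z1 : 1 <= z by rewrite /z; lra.
    have := h' (ln z); rewrite expRN lnK ?posrE; last lra.
    have : z * (- x') = - x' + y' by rewrite /z mulrDl mul1r divfK //; lra.
    have zV : z^-1 <= 1 by rewrite invf_le1; lra.
    have : z^-1 * y' <= y' by rewrite ger_pMl.
    lra.
  split; first exact: gen h.
  by apply: (gen y x) => s; have := h (- s); rewrite opprK addrC.
have [A0 A1] : 0 <= (nplus k).1.1 /\ 0 <= (nminus k).1.1.
  by apply: (pos (fun P => P.1.1)) => // s; case: (mk_hyperboloid (k0 s)).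
have [C0 C1] : 0 <= (nplus k).2 /\ 0 <= (nminus k).2.
  apply: (pos (fun P => P.2)) => // s; have [a0 ac] := mk_hyperboloid (k0 s).
  by rewrite -(pmulr_rgt0 _ a0); have := sqr_ge0 (mk (k s)).1.2; lra.
have nz N N' : 0 <= N.1.1 -> 0 <= N.2 -> mform N N = 0 -> mform N N' = 1 / 2 -> null N.
  move=> a0 c0; rewrite {1}/mform => f0 f1.
  have AC : N.1.1 * N.2 = N.1.2 ^+ 2 by rewrite expr2; lra.
  split=> //; rewrite lt_neqAle addr_ge0 // andbT eq_sym; apply/eqP => ac0.
  have a00 : N.1.1 = 0 by lra.
  have c00 : N.2 = 0 by lra.
  have b0 : N.1.2 = 0 by apply/eqP; rewrite -sqrf_eq0 -AC a00 mul0r.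
  by move: f1; rewrite /mform a00 b0 c00; lra.
split=> //; first exact: nz A0 C0 F0 F01.
by apply: (nz _ (nplus k) A1 C1 F1); rewrite mformC.
Qed.

Definition geod_of N N' s : R * R := mki (lin (expR s) N (expR (- s)) N').

Lemma lin_hyperboloid N N' a b : null N -> null N' -> mform N N' = 1 / 2 -> 0 < a -> 0 < b ->
  a * b = 1 -> hyperboloid (lin a N b N').
Proof.
case: N => -[A B] C; case: N' => -[A' B'] C'; rewrite /mform.
move=> [/= h A0 C0 AC] [/= h' A'0 C'0 AC'] hf a0 b0 ab; split=> /=.
  have [A1|A1] := ltP 0 A; first by rewrite ltr_pwDl ?mulr_gt0 ?mulr_ge0 // ltW.
  have [A1'|A1'] := ltP 0 A'; first by rewrite ltr_wpDl ?mulr_gt0 ?mulr_ge0 // ltW.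
  have Az : A = 0 by lra.
  have A'z : A' = 0 by lra.
  have Bz : B = 0 by apply/eqP; rewrite -sqrf_eq0 -h Az mul0r.
  by move: hf; rewrite Az A'z Bz; lra.
transitivity (a ^+ 2 * (A * C - B ^+ 2) + b ^+ 2 * (A' * C' - B' ^+ 2) +
  2 * (a * b) * ((A * C' + C * A') / 2 - B * B')); first by field.
by rewrite ab hf h h'; field.
Qed.

Lemma geod_of_mk N N' s : null N -> null N' -> mform N N' = 1 / 2 ->
  half_plane (geod_of N N' s) /\ mk (geod_of N N' s) = lin (expR s) N (expR (- s)) N'.
Proof.
move=> nN nN' f; have h : hyperboloid (lin (expR s) N (expR (- s)) N').
  by apply: lin_hyperboloid; rewrite ?expR_gt0 ?expRVK.
by split; [exact: mki_half|exact: mkiK].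
Qed.

Lemma geod_ofP N N' : null N -> null N' -> mform N N' = 1 / 2 -> hgeod (geod_of N N').
Proof.
move=> nN nN' f; have H s := geod_of_mk s nN nN' f.
split=> [s|s t]; first by case: (H s).
apply: hyp_distE; [by case: (H s)|by case: (H t)|].
rewrite (H s).2 (H t).2 !(form_lin, form_lin2) !null_form // (mformC N') f /ch.
by rewrite opprB !expRD; field.
Qed.

Lemma nplus_geod_of N N' : null N -> null N' -> mform N N' = 1 / 2 ->
  nplus (geod_of N N') = N /\ nminus (geod_of N N') = N'.
Proof.
move=> nN nN' f; have H s := geod_of_mk s nN nN' f.
have e1 := e1_gt; set e := expR 1 in e1.
have eV : e^-1 < 1 by rewrite invf_lt1; lra.
have ee : e - e^-1 != 0 by lra.
have E1 := (H 1).2; have E0 := (H 0).2.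
rewrite oppr0 expR0 in E0; rewrite expRN -/e in E1.
rewrite /nplus /nminus -/e E0 E1.
case: N {nN f H E1 E0} => -[A B] C; case: N' {nN'} => -[A' B'] C'; rewrite /lin /=.
by split; congr (_, _, _); field; rewrite -/e; apply/andP; split; nra.
Qed.

Lemma form_pos Q P : null Q -> hyperboloid P -> 0 < mform Q P.
Proof.
case: P => -[A B] C; case: Q => -[x y] z [/= h x0 z0 xz] [/= A0 hP]; rewrite /mform /=.
have C0 : 0 < C by rewrite -(pmulr_rgt0 _ A0); have := sqr_ge0 B; lra.
have S : 0 < x * C + z * A.
  have [x1|x1] := ltP 0 x; first by rewrite ltr_pwDl ?mulr_gt0 ?mulr_ge0 // ltW.
  by rewrite ltr_wpDl ?mulr_gt0 ?mulr_ge0 ?(ltW C0) //; lra.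
rewrite ltNge; apply/negP => neg.
have : (x * C + z * A) ^+ 2 <= 4 * (y * B) ^+ 2 by nra.
have -> : 4 * (y * B) ^+ 2 = 4 * (x * z) * (A * C) - 4 * y ^+ 2.
  by rewrite h (_ : A * C = 1 + B ^+ 2); [ring|lra].
have := sqr_ge0 (x * C - z * A) => s1 s2.
have y0 : y ^+ 2 = 0 by have := sqr_ge0 y; nra.
have e0 : (x * C - z * A) ^+ 2 = 0 by have := sqr_ge0 y; nra.
move/eqP: e0; rewrite sqrf_eq0 subr_eq0 => /eqP e0.
have xz0 : x * z = 0 by rewrite h.
have : (x * C + z * A) ^+ 2 <= 0 by nra.
by rewrite leNgt exprn_gt0.
Qed.

Lemma null_cone Q P : mform Q Q = 0 -> hyperboloid P -> 0 < mform Q P -> null Q.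
Proof.
case: P => -[A B] C; case: Q => -[x y] z + [/= A0 hP]; rewrite /mform /= => q0 qP.
have C0 : 0 < C by rewrite -(pmulr_rgt0 _ A0); have := sqr_ge0 B; lra.
have h : x * z = y ^+ 2 by rewrite expr2; lra.
have S : 0 < x * C + z * A.
  rewrite ltNge; apply/negP => neg.
  have yB : y * B <= 0 by lra.
  have h1 : (x * C + z * A) ^+ 2 < 4 * (y * B) ^+ 2 by nra.
  have h2 : (x * C + z * A) ^+ 2 = (x * C - z * A) ^+ 2 + 4 * (x * z) * (A * C) by ring.
  have h3 : A * C = 1 + B ^+ 2 by lra.
  move: h1; rewrite h2 h3 h; have := sqr_ge0 (x * C - z * A); have := sqr_ge0 y.
  by rewrite exprMn; nra.
have xz : 0 <= x * z by rewrite h sqr_ge0.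
have x0 : 0 <= x.
  rewrite leNgt; apply/negP => xneg; have z0 : z <= 0 by rewrite -(nmulr_rge0 _ xneg).
  have : x * C < 0 by rewrite nmulr_rlt0.
  have : z * A <= 0 by rewrite mulr_le0_ge0 // ltW.
  lra.
have z0 : 0 <= z.
  rewrite leNgt; apply/negP => zneg; have x1 : x <= 0 by rewrite -(nmulr_lge0 _ zneg).
  have : z * A < 0 by rewrite nmulr_rlt0.
  have : x * C <= 0 by rewrite mulr_le0_ge0 // ltW.
  lra.
split=> //=; rewrite lt_neqAle addr_ge0 // andbT eq_sym; apply/eqP => e.
have xe : x = 0 by lra.
have ze : z = 0 by lra.
by move: S; rewrite xe ze !mul0r; lra.
Qed.

Lemma hgeod_opp k : hgeod k -> hgeod (fun s => k (- s)).
Proof. by move=> [k0 kd]; split=> // s t; rewrite kd -opprB opprK addrC -normrN; congr `|_|; lra. Qed.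

Lemma mk_inj p q : half_plane p -> half_plane q -> mk p = mk q -> p = q.
Proof. by move=> hp hq e; rewrite -(mkK hp) e mkK. Qed.

Lemma lin_inj N N' Q Q' : (forall s, lin (expR s) N (expR (- s)) N' = lin (expR s) Q (expR (- s)) Q') ->
  N = Q /\ N' = Q'.
Proof.
move=> h; have := h 0; have := h 1; rewrite oppr0 expR0 expRN.
have e1 := e1_gt; set e := expR 1 in e1 *.
have eV : e^-1 < 1 by rewrite invf_lt1; lra.
case: N {h} => -[A B] C; case: N' => -[A' B'] C'; case: Q => -[x y] z; case: Q' => -[x' y'] z'.
rewrite /lin /= => -[h1 h2 h3] [g1 g2 g3].
have key a a' b b' : e * a + e^-1 * a' = e * b + e^-1 * b' -> 1 * a + 1 * a' = 1 * b + 1 * b' -> a = b.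
  rewrite !mul1r => f1 f2; have : (e - e^-1) * (a - b) = 0.
    have -> : a = b + b' - a' by lra.
    by rewrite (_ : e * a = e * (b + b' - a')) in f1; [nra|congr (e * _); lra].
  by move/eqP; rewrite mulf_eq0 => /orP[] /eqP; lra.
have k1 := key _ _ _ _ h1 g1; have k2 := key _ _ _ _ h2 g2; have k3 := key _ _ _ _ h3 g3.
by split; congr (_, _, _); lra.
Qed.

Lemma lin_inj2 N N' Q Q' d : d != 0 -> lin 1 N 1 N' = lin 1 Q 1 Q' ->
  lin (expR d) N (expR (- d)) N' = lin (expR d) Q (expR (- d)) Q' -> N = Q /\ N' = Q'.
Proof.
move=> d0; have ne : expR d - expR (- d) != 0.
  by rewrite subr_eq0; apply: contra d0 => /eqP/expR_inj; move=> ?; apply/eqP; lra.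
move: (expR d) (expR (- d)) ne => e f ef.
case: N => -[A B] C; case: N' => -[A' B'] C'; case: Q => -[x y] z; case: Q' => -[x' y'] z'.
rewrite /lin /= => -[g1 g2 g3] [h1 h2 h3].
have key a a' b b' : e * a + f * a' = e * b + f * b' -> 1 * a + 1 * a' = 1 * b + 1 * b' -> a = b.
  rewrite !mul1r => f1 f2; apply: (mulfI ef).
  have -> : (e - f) * a = (e * a + f * a') - f * (a + a') by ring.
  have -> : (e - f) * b = (e * b + f * b') - f * (b + b') by ring.
  by rewrite f1 f2.
have k1 := key _ _ _ _ h1 g1; have k2 := key _ _ _ _ h2 g2; have k3 := key _ _ _ _ h3 g3.
by split; congr (_, _, _); lra.
Qed.

Lemma hgeod_shift k a : hgeod k -> hgeod (fun s => k (a + s)).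
Proof. by move=> [k0 kd]; split=> // s t; rewrite kd; congr `|_|; ring. Qed.

Lemma hgeod_eq2 k k' d : hgeod k -> hgeod k' -> d != 0 -> k 0 = k' 0 -> k d = k' d -> k =1 k'.
Proof.
move=> hk hk' d0 e0 ed s.
have := hgeodE 0 hk; have := hgeodE d hk; rewrite e0 ed !(hgeodE _ hk') oppr0 expR0 => E2 E1.
have [E E'] := lin_inj2 d0 (esym E1) (esym E2).
by apply: mk_inj; [exact: hk.1|exact: hk'.1|rewrite !hgeodE // E E'].
Qed.

Lemma hgeod_meet k m s s' t t' : hgeod k -> hgeod m -> m s = k t -> m s' = k t' -> s != s' ->
  forall r, exists r', m r = k r'.
Proof.
move=> hk hm e e' ss r.
have : `|s' - s| = `|t' - t| by rewrite -hm.2 -hk.2 e e'.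
have d0 : s' - s != 0 by rewrite subr_eq0 eq_sym.
have hm' := hgeod_shift s hm.
move/eqP; rewrite eqr_norm2 => /orP[] /eqP st.
  have h := @hgeod_eq2 _ _ (s' - s) hm' (hgeod_shift t hk) d0.
  have E : m (s + (r - s)) = k (t + (r - s)).
    by apply: h; rewrite ?addr0 //= {2}st !(addrC _ (_ - _)) !subrK.
  by exists (t + (r - s)); rewrite -E addrC subrK.
have h := @hgeod_eq2 _ _ (s' - s) hm' (hgeod_opp (hgeod_shift t hk)) d0.
have E : m (s + (r - s)) = k (t + - (r - s)).
  apply: h; first by rewrite oppr0 !addr0.
  by rewrite addrC subrK e'; congr k; lra.
by exists (t + - (r - s)); rewrite -E addrC subrK.
Qed.

Lemma nplus_opp k : hgeod k ->
  nplus (fun s => k (- s)) = nminus k /\ nminus (fun s => k (- s)) = nplus k.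
Proof.
move=> hk; apply: lin_inj => s; rewrite -(hgeodE s (hgeod_opp hk)) hgeodE // opprK.
by rewrite /lin; congr (_, _, _); rewrite addrC.
Qed.

Lemma hgeod_pair_form k k' s r : hgeod k -> hgeod k' ->
  mform (mk (k s)) (mk (k' r)) = expR (s + r) * mform (nplus k) (nplus k') +
    expR (s - r) * mform (nplus k) (nminus k') + expR (r - s) * mform (nminus k) (nplus k') +
    expR (- (s + r)) * mform (nminus k) (nminus k').
Proof.
move=> hk hk'; rewrite !hgeodE // !(form_lin, form_lin2) opprD !expRD; ring.
Qed.

(** All four terms of [hgeod_pair_form] are nonnegative, and the one with the factor e^(s + r) is
    bounded only if the product of the forward vectors is 0. Only the sum of the two times has to
    grow, so the times need not be matched. *)
Lemma asym_of_bounded k k' (s r : nat -> R) C : hgeod k -> hgeod k' ->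
  (forall c, \forall n \near uf, c <= s n + r n) ->
  (\forall n \near uf, hyp_dist (k (s n)) (k' (r n)) <= C) ->
  mform (nplus k) (nplus k') = 0.
Proof.
move=> hk hk' sr hC; have [n1 n2 _] := hgeod_null hk; have [n1' n2' _] := hgeod_null hk'.
apply/eqP; rewrite eq_le null_form_ge0 // andbT leNgt; apply/negP => f0.
set f := mform _ _ in f0.
(* Chosen so that K f = [ch C] + f, just above the bound. *)
pose K := ch C / f + 1; have chC : 0 < ch C by have := ch_ge1 C; lra.
have K0 : 1 <= K by rewrite /K; have := divr_gt0 chC f0; lra.
have /filter_ex[n [h1 h2]] : \forall n \near uf, ln K <= s n + r n /\ hyp_dist (k (s n)) (k' (r n)) <= C.
  by near=> n; split; near: n.
have C0 : 0 <= C by apply: le_trans h2; apply: hyp_dist_ge0; [exact: hk.1|exact: hk'.1].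
have : mform (mk (k (s n))) (mk (k' (r n))) <= ch C.
  by rewrite -hyp_dist_le //; [exact: hk.1|exact: hk'.1].
rewrite hgeod_pair_form // -/f.
have p1 : 0 <= expR (s n - r n) * mform (nplus k) (nminus k').
  by rewrite mulr_ge0 ?expR_ge0 ?null_form_ge0.
have p2 : 0 <= expR (r n - s n) * mform (nminus k) (nplus k').
  by rewrite mulr_ge0 ?expR_ge0 ?null_form_ge0.
have p3 : 0 <= expR (- (s n + r n)) * mform (nminus k) (nminus k').
  by rewrite mulr_ge0 ?expR_ge0 ?null_form_ge0.
have : K <= expR (s n + r n) by rewrite -[K]lnK ?posrE ?ler_expR //; lra.
move=> hK; have : K * f <= expR (s n + r n) * f by rewrite ler_pM2r.
have -> : K * f = ch C + f by rewrite /K mulrDl divfK ?mul1r //; lra.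
lra.
Unshelve. all: by end_near. Qed.

(* With N(k') = c N(k), shifting k' by - ln c makes the two rays asymptotic. *)
Lemma asym_close k k' : hgeod k -> hgeod k' -> mform (nplus k) (nplus k') = 0 ->
  exists2 c, 0 < c & nplus k' = lin c (nplus k) 0 (nplus k) /\
  forall s, mform (mk (k s)) (mk (k' (s - ln c))) =
     1 + expR (- (2 * s)) * c * mform (nminus k) (nminus k').
Proof.
move=> hk hk' f0; have [n1 n2 f] := hgeod_null hk; have [n1' n2' f'] := hgeod_null hk'.
have [c c0 E] := null_prop n1 n1' f0; exists c => //; split=> // s.
have g1 : mform (nplus k) (nminus k') = 1 / (2 * c).
  move: f'; rewrite E form_lin mul0r addr0 => f'.
  by apply: (mulfI (x := c)); [lra|rewrite f'; field; lra].
have g2 : mform (nminus k) (nplus k') = c / 2 by rewrite E form_lin2 mul0r addr0 mformC f; field.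
rewrite hgeod_pair_form // f0 g1 g2 mulr0 add0r.
have -> : s - (s - ln c) = ln c by ring.
have -> : s - ln c - s = - ln c by ring.
have -> : - (s + (s - ln c)) = - (2 * s) + ln c by ring.
rewrite expRD expRN lnK ?posrE //; field; lra.
Qed.

(** After the shift of [asym_close] the product of corresponding points is 1, that is, their
    distance is 0. *)
Lemma same_ends k k' : hgeod k -> hgeod k' -> mform (nplus k) (nplus k') = 0 ->
  mform (nminus k) (nminus k') = 0 -> exists c, forall s, k' s = k (s + c).
Proof.
move=> hk hk' f0 f1; have [c c0 [_ h]] := asym_close hk hk' f0; exists (ln c) => s.
have := h (s + ln c); rewrite addrK f1 mulr0 addr0 => E.
have [k0 kd] := hk; have [k'0 _] := hk'; apply: mk_inj => //.
have : mform (lin 1 (mk (k' s)) (-1) (mk (k (s + ln c)))) (mk (k' s)) = 0.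
  by rewrite form_lin E form_hyperboloid; [ring|exact: mk_hyperboloid].
move=> /(form_orth0 (mk_hyperboloid (k'0 s))).
rewrite form_lin !form_lin2 (mformC (mk (k' s)) (mk (k _))) E !form_hyperboloid; try exact: mk_hyperboloid.
have h0 : 1 * (1 * 1 + -1 * 1) + -1 * (1 * 1 + -1 * 1) = 0 :> R by ring.
move=> /(_ h0); move: (mk (k' s)) (mk (k _)) => -[[x y] z] [[x' y'] z']; rewrite /lin /= => -[h1 h2 h3].
by congr (_, _, _); lra.
Qed.

Lemma nplus_lin0 N c P : mform P (lin c N 0 N) = c * mform P N.
Proof. by rewrite form_lin2 mul0r addr0. Qed.

Lemma null_scale N c : null N -> 0 < c -> null (lin c N 0 N).
Proof.
case: N => -[A B] C [/= h A0 C0 AC] c0; split; rewrite /= !mul0r !addr0.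
- by rewrite exprMn -h; ring.
- by rewrite mulr_ge0 // ltW.
- by rewrite mulr_ge0 // ltW.
- by rewrite -mulrDr mulr_gt0.
Qed.

(** [mk p] is split as the sum of a multiple of N and a second null vector; these span the geodesic
    from p towards N. The factor makes the product with [mk p] equal to 1/2. *)
Definition ray_minus p N : V := lin 1 (mk p) (- (2 * mform N (mk p))^-1) N.
Definition ray_plus p N : V := lin (2 * mform N (mk p))^-1 N 0 N.

Lemma ray_to p N : half_plane p -> null N ->
  [/\ hgeod (geod_of (ray_plus p N) (ray_minus p N)), geod_of (ray_plus p N) (ray_minus p N) 0 = p,
    nplus (geod_of (ray_plus p N) (ray_minus p N)) = ray_plus p N & mform (ray_plus p N) N = 0].
Proof.
move=> hp nN; have hP := mk_hyperboloid hp; have f := form_pos nN hP.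
pose c := (2 * mform N (mk p))^-1; have c0 : 0 < c by rewrite invr_gt0; lra.
have cf : c * mform N (mk p) = 1 / 2 by rewrite /c; field; lra.
have nc : null (ray_plus p N) := null_scale nN c0.
have E0 : mform (ray_minus p N) (ray_minus p N) = 0.
  rewrite /ray_minus -/c form_lin !form_lin2 (mformC (mk p) N) (null_form nN) form_hyperboloid //.
  by transitivity (1 - 2 * (c * mform N (mk p))); [ring|rewrite cf; field].
have E1 : mform (ray_minus p N) (mk p) = 1 / 2.
  by rewrite /ray_minus -/c form_lin form_hyperboloid // mulNr cf; field.
have nm : null (ray_minus p N) by apply: (null_cone E0 hP); rewrite E1.
have E : mform (ray_plus p N) (ray_minus p N) = 1 / 2.
  rewrite /ray_plus /ray_minus -/c form_lin !form_lin2 (null_form nN).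
  by transitivity (c * mform N (mk p)); [ring|rewrite cf].
split; [exact: geod_ofP| |by case: (nplus_geod_of nc nm E)|].
  have [h0 m0] := geod_of_mk 0 nc nm E; apply: mk_inj => //; rewrite m0 oppr0 expR0.
  rewrite /ray_plus /ray_minus -/c; case: (mk p) => -[x y] z; rewrite /lin /=.
  by congr (_, _, _); ring.
by rewrite /ray_plus mformC nplus_lin0 null_form // mulr0.
Qed.

(** m is aimed from [k 0] at an ideal point that is neither end of k; one of any three distinct
    ideal points will do. It later supplies the direction transverse to the flow inside an unstable
    leaf. *)
Lemma transverse_geod k : hgeod k -> exists m, [/\ hgeod m, m 0 = k 0 & forall s t, m s = k t -> s = 0].
Proof.
move=> hk; have [n1 n2 _] := hgeod_null hk.
have two N a b : null N -> null a -> null b -> mform N a = 0 -> mform N b = 0 -> mform a b = 0.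
  move=> nN na nb /(null_prop nN na)[c _ ->] /(null_prop nN nb)[c' _ ->].
  by rewrite nplus_lin0 mformC nplus_lin0 null_form // !mulr0.
(* The ideal points 0, infinity and 1. *)
pose a : V := (1, 0, 0); pose b : V := (0, 0, 1); pose d : V := (1, 1, 1).
have na : null a by split; rewrite /=; lra.
have nb : null b by split; rewrite /=; lra.
have nd : null d by split; rewrite /=; lra.
have ab : mform a b != 0.
  by rewrite (_ : mform a b = 1 / 2); [apply: lt0r_neq0; lra|rewrite /mform /=; field].
have ad : mform a d != 0.
  by rewrite (_ : mform a d = 1 / 2); [apply: lt0r_neq0; lra|rewrite /mform /=; field].
have bd : mform b d != 0.
  by rewrite (_ : mform b d = 1 / 2); [apply: lt0r_neq0; lra|rewrite /mform /=; field].
have [N [nN N1 N2]] : exists N, [/\ null N, 0 < mform (nplus k) N & 0 < mform (nminus k) N].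
  have try N : null N -> (mform (nplus k) N == 0) || (mform (nminus k) N == 0) \/
      exists N, [/\ null N, 0 < mform (nplus k) N & 0 < mform (nminus k) N].
    move=> nN; have [|f1] := eqVneq (mform (nplus k) N) 0; first by left.
    have [|f2] := eqVneq (mform (nminus k) N) 0; first by left; rewrite orbT.
    by right; exists N; split=> //; rewrite lt_neqAle eq_sym ?f1 ?f2 null_form_ge0.
  have [/orP ha|//] := try _ na; have [/orP hb|//] := try _ nb; have [/orP hd|//] := try _ nd.
  exfalso; move: ab ad bd.
  case: ha => /eqP ha; case: hb => /eqP hb; case: hd => /eqP hd;
    by rewrite ?(two _ _ _ n1 na nb ha hb) ?(two _ _ _ n1 na nd ha hd) ?(two _ _ _ n1 nb nd hb hd)
      ?(two _ _ _ n2 na nb ha hb) ?(two _ _ _ n2 na nd ha hd) ?(two _ _ _ n2 nb nd hb hd) ?eqxx.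
have [hm m0 mp mN] := ray_to (hk.1 0) nN; move: (geod_of _ _) hm m0 mp => m hm m0 mp.
exists m; split=> // s t mst.
(* Pairing with N kills the forward vector of m, so a common point gives a single equation in s and
   t; with |s| = |t| it forces s = 0. *)
have E0 : mform (nminus m) N = mform (nplus k) N + mform (nminus k) N.
  have := hgeodE 0 hm; rewrite m0 hgeodE // oppr0 expR0 => /(congr1 (mform ^~ N)).
  by rewrite 2!form_lin mp mN; lra.
have Es : expR (- s) * mform (nminus m) N = expR t * mform (nplus k) N + expR (- t) * mform (nminus k) N.
  have := hgeodE s hm; rewrite mst hgeodE // => /(congr1 (mform ^~ N)).
  by rewrite 2!form_lin mp mN mulr0 add0r.
have : `|s| = `|t|.
  have := hm.2 s 0; have := hk.2 t 0; rewrite mst m0 !subr0 => -> ->; by [].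
have e0 r : expR r = expR (- r) -> r = 0 by move/expR_inj; lra.
rewrite E0 in Es; move: (mform (nplus k) N) (mform (nminus k) N) N1 N2 Es => x y x0 y0 Es.
move/eqP; rewrite eqr_norm2 => /orP[] /eqP st; move: Es; rewrite -?st.
  move=> Es; apply: e0; apply: (mulIf (x := x)); lra.
rewrite st opprK => Es; suff -> : t = 0 by rewrite oppr0.
apply: e0; apply: (mulIf (x := y)); lra.
Qed.

End Minkowski.

(** * Piecewise linear interpolation *)

Section Interpolation.
Context {R : realType}.
Implicit Types (r : nat -> R) (s : R) (N n : nat).

Lemma clamp_ge1 s : 1 <= s -> clamp s = 1.
Proof. by move=> s1; rewrite /clamp; have /min_idPr -> := s1; apply/max_idPr. Qed.

Lemma clamp_le0 s : s <= 0 -> clamp s = 0.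
Proof.
move=> s0; rewrite /clamp; have /min_idPl -> : s <= 1 by apply: le_trans s0 _.
by apply/max_idPl.
Qed.

Lemma clamp_mono s s' : s <= s' -> clamp s <= clamp s'.
Proof.
move=> h; rewrite /clamp ge_max !le_max lexx /=; apply/orP; right.
by rewrite le_min !ge_min h lexx orbT.
Qed.

(** Linear interpolation of r between integers, written as a finite sum of ramps so that limits in r
    and s can be taken term by term ([uf_pl]). [pl] lets N depend on s; near a given s one N
    suffices. *)
Definition pln N r s : R := r 0%N + \sum_(k < N) clamp (s - k%:R) * (r k.+1 - r k).
Definition pl r s : R := pln (Num.bound s) r s.

Lemma plnE N r s n v : (n < N)%N -> 0 <= v <= 1 -> s = n%:R + v ->
  pln N r s = r n + v * (r n.+1 - r n).
Proof.
move=> nN v01 ->; rewrite /pln.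
have tel m : (m <= n)%N -> r 0%N + \sum_(k < m) clamp (n%:R + v - k%:R) * (r k.+1 - r k) = r m.
  elim: m => [|m IH] mn; first by rewrite big_ord0 addr0.
  rewrite big_ord_recr /= addrA IH 1?ltnW // clamp_ge1 ?mul1r ?subrKC //.
  have : m.+1%:R <= n%:R :> R by rewrite ler_nat.
  by rewrite -natr1; lra.
have -> : \sum_(k < N) clamp (n%:R + v - k%:R) * (r k.+1 - r k) =
    \sum_(k < n.+1) clamp (n%:R + v - k%:R) * (r k.+1 - r k).
  rewrite -!(big_mkord xpredT (fun k => clamp (n%:R + v - k%:R) * (r k.+1 - r k))).
  rewrite (@big_cat_nat _ _ _ n.+1) //= [X in _ + X]big_nat_cond [X in _ + X]big1 ?addr0 //.
  move=> k /andP[/andP[nk _] _]; rewrite clamp_le0 ?mul0r //.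
  by move: nk; rewrite -(ler_nat R) -natr1; lra.
by rewrite big_ord_recr /= addrA tel // [n%:R + v]addrC addrK clamp_id.
Qed.

Lemma natP s : 0 <= s -> exists n v, [/\ 0 <= v <= 1, v < 1 & s = n%:R + v].
Proof.
move=> s0; exists (Num.truncn s), (s - (Num.truncn s)%:R).
have /andP[h1 h2] := Num.Theory.truncn_itv s0; rewrite -natr1 in h2.
by split; rewrite ?subrKC //; lra.
Qed.

Lemma pln_eq N r s : 0 <= s < N%:R -> pln N r s = pl r s.
Proof.
move=> /andP[s0 sN]; have [n [v [v01 v1 e]]] := natP s0; case/andP: (v01) => v0 _.
have lt (m : nat) : s < m%:R -> (n < m)%N.
  by move=> h; rewrite -(ltr_nat R); apply: le_lt_trans h; rewrite e lerDl.
by rewrite /pl !(@plnE _ r s n v) // lt // archi_boundP.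
Qed.

Lemma plE r n v : 0 <= v <= 1 -> pl r (n%:R + v) = r n + v * (r n.+1 - r n).
Proof.
move=> v01; have v0 : 0 <= v by case/andP: v01.
have lt : 0 <= n%:R + v < n.+2%:R.
  by rewrite addr_ge0 ?ler0n //= -!natr1; lra.
by rewrite -(pln_eq _ lt); exact: plnE.
Qed.

Lemma pl0 r : pl r 0 = r 0%N.
Proof. by have := @plE r 0 0; rewrite addr0 mul0r addr0; apply; rewrite lexx ler01. Qed.

Lemma pln_incr N r (a b : R) s s' : (forall n, a <= r n.+1 - r n <= b) -> 0 <= s -> s <= s' -> s' < N%:R ->
  a * (s' - s) <= pln N r s' - pln N r s <= b * (s' - s).
Proof.
move=> ab s0 ss' s'N.
have id_ (t : R) : 0 <= t < N%:R -> \sum_(k < N) clamp (t - k%:R) = t.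
  move=> tN; have t0 : 0 <= t by case/andP: tN.
  have h := pln_eq (fun k => k%:R) tN; have [n [v [v01 _ e]]] := natP t0.
  rewrite e plE // -e -natr1 [_ + 1]addrC addrK mulr1 -e in h.
  rewrite -[RHS]h /pln add0r; apply: eq_bigr => k _.
  by rewrite -natr1 [_ + 1]addrC addrK mulr1.
have E : pln N r s' - pln N r s = \sum_(k < N) (clamp (s' - k%:R) - clamp (s - k%:R)) * (r k.+1 - r k).
  by rewrite /pln opprD addrACA subrr add0r -sumrB; apply: eq_bigr => k _; rewrite mulrBl.
have E' : s' - s = \sum_(k < N) (clamp (s' - k%:R) - clamp (s - k%:R)).
  by rewrite sumrB !id_ ?s0 ?(le_trans s0 ss') //= (le_lt_trans ss').
have c0 (k : nat) : 0 <= clamp (s' - k%:R) - clamp (s - k%:R).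
  by rewrite subr_ge0; apply: clamp_mono; rewrite lerD2r.
rewrite E E' !mulr_sumr; apply/andP; split; apply: ler_sum => k _; have /andP[h1 h2] := ab k.
  by rewrite mulrC ler_wpM2l.
by rewrite [leRHS]mulrC ler_wpM2l.
Qed.

Lemma pl_incr r (a b : R) s s' : (forall n, a <= r n.+1 - r n <= b) -> 0 <= s -> s <= s' ->
  a * (s' - s) <= pl r s' - pl r s <= b * (s' - s).
Proof.
move=> ab s0 ss'; have h := archi_boundP (le_trans s0 ss').
rewrite -!(@pln_eq (Num.bound s')) ?s0 ?(le_trans s0 ss') //=; last exact: le_lt_trans h.
exact: pln_incr ab s0 ss' h.
Qed.

Lemma uf_pl (r : nat -> nat -> R) (r0 : nat -> R) (s : nat -> R) (s0 : R) :
  (forall k, (fun n => r n k) @ uf --> r0 k) -> (forall n, 0 <= s n) -> s @ uf --> s0 ->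
  (fun n => pl (r n) (s n)) @ uf --> pl r0 s0.
Proof.
move=> rr s_ge0 ss; have s00 : 0 <= s0.
  by apply: (uf_le (@uf_const _ (0 : R)) ss); apply: nearW.
have h := archi_boundP s00; set N := Num.bound s0 in h.
have E : \forall n \near uf, pln N (r n) (s n) = pl (r n) (s n).
  have N1 : -1 < s0 < N%:R by lra.
  have /ufRP/(_ (N%:R - s0)) : s @ uf --> s0 by [].
  rewrite subr_gt0 => /(_ h); apply: filterS => n; rewrite ltr_norml => hn.
  by apply: pln_eq; rewrite s_ge0 /=; lra.
apply: uf_congr E _; rewrite -(@pln_eq N) ?s00 //.
have S m : (fun n => \sum_(k < m) clamp (s n - k%:R) * (r n k.+1 - r n k)) @ uf -->
    \sum_(k < m) clamp (s0 - k%:R) * (r0 k.+1 - r0 k).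
  elim: m => [|m IH].
    by rewrite big_ord0; apply: uf_congr (@uf_const _ (0 : R)); apply: nearW => n; rewrite big_ord0.
  have E1 : \forall n \near uf, \sum_(k < m) clamp (s n - k%:R) * (r n k.+1 - r n k) +
      clamp (s n - m%:R) * (r n m.+1 - r n m) = \sum_(k < m.+1) clamp (s n - k%:R) * (r n k.+1 - r n k).
    by apply: nearW => n; rewrite big_ord_recr.
  apply: uf_congr E1 _; rewrite big_ord_recr /=; apply: cvgD => //; apply: cvgM.
    apply: (@cts_uf _ _ (@clamp R) (fun n => s n - m%:R) (s0 - m%:R)); first exact: clamp_continuous.
    by apply: cvgB => //; exact: uf_const.
  exact: cvgB.
exact: cvgD.
Qed.

(** A selection up to time s is continued by sliding linearly from its value at s to a value v
    admissible near t. The slide ends while the old value is still admissible, so convexity covers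
    all values in between. *)
Lemma selection (C : R -> R -> Prop) (u0 : R) : C 0 u0 -> (forall t, exists u, C t u) ->
  (forall t u, C t u -> exists2 e, 0 < e & forall t', `|t' - t| < e -> C t' u) ->
  (forall t u v w, C t u -> C t w -> u <= v <= w -> C t v) ->
  forall T : R, exists u : R -> R, [/\ continuous u, u 0 = u0 & forall t, 0 <= t <= T -> C t (u t)].
Proof.
move=> C0 Cne Copen Cconv T.
have mix t u w v : C t u -> C t w -> 0 <= v <= 1 -> C t (u + v * (w - u)).
  move=> cu cw v01; have [uw|wu] := leP u w.
    by apply: (Cconv _ u _ w) => //; nra.
  by apply: (Cconv _ w _ u) => //; nra.
pose P T := exists u : R -> R, [/\ continuous u, u 0 = u0 & forall t, 0 <= t <= T -> C t (u t)].
suff : P T by [].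
apply: (@loc_const R P _ 0 T); last first.
  exists (fun=> u0); split=> //; first by move=> ?; exact: cvg_cst.
  by move=> t /andP[t0 t1]; have -> : t = 0 by apply/eqP; rewrite eq_le t0 t1.
move=> t; have [v Cv] := Cne t; have [e e0 eP] := Copen _ _ Cv.
exists e => // s s' st s't [u [cu u0E uC]].
have [s's|ss'] := leP s' s.
  by exists u; split=> // r /andP[r0 r1]; apply: uC; rewrite r0 (le_trans r1).
(* For s < 0 only the value u0 at time 0 is available, so the slide starts there. *)
have [s0|s0] := ltP s 0.
  have [s'0|s'0] := ltP s' 0.
    by exists u; split=> // r /andP[r0 r1]; have := le_lt_trans (le_trans r0 r1) s'0; rewrite ltxx.
  have [d d0 dP] := Copen _ _ C0.
  exists (fun x : R => u0 + clamp (x / (d / 2)) * (v - u0)); split.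
  - move=> x; apply: cvgD; first exact: cvg_cst.
    apply: cvgM; last exact: cvg_cst.
    apply: (@ccompat R R R (fun x : R => x / (d / 2)) clamp); last exact: clamp_continuous.
    by apply: cvgM; [exact: cvg_id|exact: cvg_cst].
  - by rewrite mul0r clamp_le0 // mul0r addr0.
  - move=> r /andP[r0 r1].
    have Cr : C r v by apply: eP; move: st s't; rewrite !ltr_norml; lra.
    have [rd|rd] := ltP r (d / 2).
      by apply: mix => //; [apply: dP; rewrite subr0 ger0_norm //; lra|exact: clamp_itv].
    by rewrite clamp_ge1 ?mul1r ?subrKC // ler_pdivlMr ?mul1r //; lra.
have Cs : C s (u s) by apply: uC; rewrite s0 lexx.
have [d d0 dP] := Copen _ _ Cs.
exists (fun x : R => if x <= s then u x else u s + clamp ((x - s) / (d / 2)) * (v - u s)); split.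
- apply: pw_continuous => //; last by rewrite subrr mul0r clamp_le0 // mul0r addr0.
  move=> x; apply: cvgD; first exact: cvg_cst.
  apply: cvgM; last exact: cvg_cst.
  apply: (@ccompat R R R (fun x : R => (x - s) / (d / 2)) clamp); last exact: clamp_continuous.
  by apply: cvgM; [apply: cvgB; [exact: cvg_id|exact: cvg_cst]|exact: cvg_cst].
- by rewrite s0.
- move=> r /andP[r0 r1]; have [rs|rs] := leP r s; first by apply: uC; rewrite r0.
  have Cr : C r v by apply: eP; move: st s't; rewrite !ltr_norml; lra.
  have [rd|rd] := ltP (r - s) (d / 2).
    by apply: mix => //; [apply: dP; rewrite ger0_norm ?subr_ge0 ?ltW //; lra|exact: clamp_itv].
  by rewrite clamp_ge1 ?mul1r ?subrKC // ler_pdivlMr ?mul1r //; lra.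
Qed.

End Interpolation.

(** * Limits in the hyperbolic plane *)

Section HyperbolicLimits.
Context {R : realType}.
Implicit Types (q : R * R).

Lemma half_plane01 : half_plane ((0, 1) : R * R).
Proof. by rewrite /half_plane /= ltr01. Qed.

Lemma hyp_distxx q : half_plane q -> hyp_dist q q = 0.
Proof.
move=> hq; rewrite (@hyp_distE _ q q 0) ?normr0 // form_hyperboloid; last exact: mk_hyperboloid.
by rewrite /ch oppr0 expR0; field.
Qed.

Lemma hyp_dist_eq0 q q' : half_plane q -> half_plane q' -> hyp_dist q q' = 0 -> q = q'.
Proof.
move=> hq hq' e; apply: mk_inj => //.
have f : mform (mk q) (mk q') = 1 by rewrite -ch_hyp_dist // e /ch oppr0 expR0; field.
have := mk_hyperboloid hq; have := mk_hyperboloid hq' => h' h.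
have f1 := form_hyperboloid h; have f2 := form_hyperboloid h'.
have : mform (lin 1 (mk q) (-1) (mk q')) (mk q) = 0.
  by rewrite form_lin f1 (mformC (mk q')) f; ring.
move/(form_orth0 h); rewrite form_lin !form_lin2 f1 f2 (mformC (mk q')) f.
have h0 : 1 * (1 * 1 + -1 * 1) + -1 * (1 * 1 + -1 * 1) = 0 :> R by ring.
move=> /(_ h0); move: (mk q) (mk q') => -[[x y] z] [[x' y'] z']; rewrite /lin /= => -[h1 h2 h3].
by congr (_, _, _); lra.
Qed.

Lemma uf_fst (S T : topologicalType) (x : nat -> S * T) (l : S * T) : x @ uf --> l ->
  (fun n => (x n).1) @ uf --> l.1.
Proof. by move=> xl; apply: cvg_comp xl _; exact: cvg_fst. Qed.

Lemma uf_snd (S T : topologicalType) (x : nat -> S * T) (l : S * T) : x @ uf --> l ->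
  (fun n => (x n).2) @ uf --> l.2.
Proof. by move=> xl; apply: cvg_comp xl _; exact: cvg_snd. Qed.

Lemma uf_inv (x : nat -> R) (l : R) : l != 0 -> x @ uf --> l -> (fun n => (x n)^-1) @ uf --> l^-1.
Proof. by move=> l0 xl; exact: cvgV. Qed.

Lemma uf_mk (q : nat -> R * R) (l : R * R) : half_plane l -> q @ uf --> l ->
  (fun n => mk (q n)) @ uf --> mk l.
Proof.
rewrite /half_plane /= => hl ql; have q1 := uf_fst ql; have q2 := uf_snd ql.
have l0 : l.2 != 0 by exact: lt0r_neq0.
have qi := uf_inv l0 q2.
apply: uf_pair; first apply: uf_pair => //; first exact: cvgM.
by apply: cvgM => //; apply: cvgD; apply: cvgM.
Qed.

Lemma uf_form (P Q : nat -> R * R * R) (a b : R * R * R) : P @ uf --> a -> Q @ uf --> b ->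
  (fun n => mform (P n) (Q n)) @ uf --> mform a b.
Proof.
move=> Pa Qb; have P2 := uf_snd Pa; have Q2 := uf_snd Qb.
have P11 := uf_fst (uf_fst Pa); have P12 := uf_snd (uf_fst Pa).
have Q11 := uf_fst (uf_fst Qb); have Q12 := uf_snd (uf_fst Qb).
apply: cvgB; last exact: cvgM.
by apply: cvgM; [apply: cvgD; apply: cvgM|exact: uf_const].
Qed.

Lemma uf_mki (P : nat -> R * R * R) (a : R * R * R) : a.1.1 != 0 -> P @ uf --> a ->
  (fun n => mki (P n)) @ uf --> mki a.
Proof.
move=> a0 Pa; have P1 := uf_fst Pa; apply: uf_pair; last by apply: uf_inv => //; exact: uf_fst P1.
by apply: cvgM; [exact: uf_snd P1|apply: uf_inv => //; exact: uf_fst P1].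
Qed.

Lemma uf_lin (a b : nat -> R) (P Q : nat -> R * R * R) a0 b0 (P0 Q0 : R * R * R) :
  a @ uf --> (a0 : R) -> b @ uf --> (b0 : R) -> P @ uf --> P0 -> Q @ uf --> Q0 ->
  (fun n => lin (a n) (P n) (b n) (Q n)) @ uf --> lin a0 P0 b0 Q0.
Proof.
move=> aa bb Pa Qb; have P2 := uf_snd Pa; have Q2 := uf_snd Qb.
have P11 := uf_fst (uf_fst Pa); have P12 := uf_snd (uf_fst Pa).
have Q11 := uf_fst (uf_fst Qb); have Q12 := uf_snd (uf_fst Qb).
by apply: uf_pair; [apply: uf_pair|]; apply: cvgD; exact: cvgM.
Qed.

Lemma uf_expR (s : nat -> R) (l : R) : s @ uf --> l -> (fun n => expR (s n)) @ uf --> expR l.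
Proof. by move=> sl; apply: cvg_comp sl _; exact: continuous_expR. Qed.

Lemma uf_hyp_dist (q q' : nat -> R * R) (l l' : R * R) : half_plane l -> half_plane l' ->
  q @ uf --> l -> q' @ uf --> l' -> (\forall n \near uf, half_plane (q n) /\ half_plane (q' n)) ->
  (fun n => hyp_dist (q n) (q' n)) @ uf --> hyp_dist l l'.
Proof.
move=> hl hl' ql q'l' hq.
have f := uf_form (uf_mk hl ql) (uf_mk hl' q'l').
rewrite /hyp_dist form_mk //.
have E : \forall n \near uf, ln (mform (mk (q n)) (mk (q' n)) +
   Num.sqrt (mform (mk (q n)) (mk (q' n)) ^+ 2 - 1)) = hyp_dist (q n) (q' n).
  by apply: filterS hq => n [? ?]; rewrite /hyp_dist form_mk.
apply: uf_congr E _.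
have f1 := form_ge1 (mk_hyperboloid hl) (mk_hyperboloid hl').
move: (mform (mk l) (mk l')) f f1 => c f c1.
have g : (fun n => mform (mk (q n)) (mk (q' n)) + Num.sqrt (mform (mk (q n)) (mk (q' n)) ^+ 2 - 1)) @ uf
    --> c + Num.sqrt (c ^+ 2 - 1).
  have g2 : (fun n => mform (mk (q n)) (mk (q' n)) ^+ 2 - 1) @ uf --> c ^+ 2 - 1.
    by apply: cvgB; [exact: cvgM|exact: uf_const].
  by apply: cvgD => //; exact: (cvg_comp _ _ g2 (@sqrt_continuous R (c ^+ 2 - 1))).
apply: cvg_comp g _; apply: continuous_ln.
by rewrite ltr_pwDl ?sqrtr_ge0 //; lra.
Qed.

Lemma uf_between (u : nat -> R) (t a b : R) : u @ uf --> t -> a < t < b ->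
  \forall n \near uf, a < u n < b.
Proof.
move=> /ufRP ut tab; have := ut (Num.min (t - a) (b - t)); rewrite lt_min !subr_gt0 tab => /(_ isT).
by apply: filterS => n; rewrite lt_min !ltr_norml; lra.
Qed.

Lemma uf_lt (u v : nat -> R) (a b : R) : u @ uf --> a -> v @ uf --> b -> a < b ->
  \forall n \near uf, u n < v n.
Proof.
move=> /ufRP ua /ufRP vb ab; have e0 : 0 < (b - a) / 2 by lra.
by apply: filterS2 (ua _ e0) (vb _ e0) => n; rewrite !ltr_norml; lra.
Qed.

(** The bound on the hyperbolic cosine confines q to a box away from the boundary of the half
    plane. *)
Lemma hcompact (q : nat -> R * R) C : (\forall n \near uf, half_plane (q n) /\ hyp_dist (q n) (0, 1) <= C) ->
  exists2 l, half_plane l & q @ uf --> l.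
Proof.
move=> h.
have C0 : 0 <= C.
  by have [n [hq]] := filter_ex h; apply: le_trans; apply: hyp_dist_ge0 => //; exact: half_plane01.
have K1 := ch_ge1 C; set K := ch C in K1.
have bd : \forall n \near uf, (2 * K)^-1 <= (q n).2 <= 2 * K /\ `|(q n).1| <= 2 * K.
  apply: filterS h => n [hq]; rewrite hyp_dist_le //; last exact: half_plane01.
  move: hq; case: (q n) => u v; rewrite /half_plane /mform /mk /= -/K => v0.
  move=> hh0; have hh : (v^-1 + (u ^+ 2 / v + v)) / 2 <= K.
    by apply: le_trans hh0; rewrite le_eqVlt; apply/orP; left; apply/eqP; field; lra.
  have a1 : 0 < v^-1 by rewrite invr_gt0.
  have a2 : 0 <= u ^+ 2 / v by rewrite divr_ge0 ?sqr_ge0 // ltW.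
  have v2 : v <= 2 * K by lra.
  have vK : (2 * K)^-1 <= v by rewrite -[v]invrK lef_pV2 ?posrE; lra.
  split; first by rewrite vK.
  rewrite -(ler_pXn2r (n := 2)) ?nnegrE ?normr_ge0 //; last lra.
  rewrite real_normK ?num_real //.
  have -> : u ^+ 2 = u ^+ 2 / v * v by field; lra.
  rewrite expr2; apply: ler_pM => //; [exact: ltW|lra].
have [v0 vP vl] := uf_bounded (filterS (fun n => @proj1 _ _) bd).
have [u0 uP ul] : exists2 l, - (2 * K) <= l <= 2 * K & (fun n => (q n).1) @ uf --> l.
  by apply: uf_bounded; apply: filterS bd => n [_]; rewrite ler_norml.
exists (u0, v0).
  rewrite /half_plane /=; apply: lt_le_trans (andP vP).1; rewrite invr_gt0; lra.
apply: uf_congr (uf_pair ul vl); apply: nearW => n; exact/esym/surjective_pairing.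
Qed.

End HyperbolicLimits.

(** * The lifted flow *)

Section Main.
Context {R : realType} {M X : metricType R} (p : X -> M).
Context (phi : R -> M -> M) (phi' : R -> X -> X) (Ws Wu : set (fchart3 R M)).
Hypothesis hM : closed_manifold M (R * R * R)%type.
Hypothesis hcov : @universal_cover R X M p.
Hypothesis hmet : lifted_metric p.
Hypothesis hanosov : topological_anosov phi Ws Wu.
Hypothesis hphi : lifted_flow p phi phi'.
Hypothesis hadapt : adapted p phi phi' Wu.
Notation A := (lift_atlas p Wu).

Lemma atlasWs : foliated_atlas Ws. Proof. by case: hanosov => _ []. Qed.
Lemma atlasWu : foliated_atlas Wu. Proof. by case: hanosov => _ []. Qed.
Lemma compactM : compact [set: M]. Proof. by case: hM. Qed.

Lemma fl0 x : phi' 0 x = x. Proof. by case: hphi => -[_ -> _]. Qed.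
Lemma flD s t x : phi' (s + t) x = phi' s (phi' t x). Proof. by case: hphi => -[_ _ ->]. Qed.
Lemma flK t x : phi' (- t) (phi' t x) = x. Proof. by rewrite -flD addNr fl0. Qed.
Lemma pfl t x : p (phi' t x) = phi t (p x). Proof. by case: hphi => _ ->. Qed.

Lemma fl_cts : continuous (fun tx : R * X => phi' tx.1 tx.2). Proof. by case: hphi => -[]. Qed.

Lemma uf_fl (t : nat -> R) (x : nat -> X) (t0 : R) (x0 : X) : t @ uf --> t0 -> x @ uf --> x0 ->
  (fun n => phi' (t n) (x n)) @ uf --> phi' t0 x0.
Proof. by move=> tt0 xx0; exact: (@cts_uf _ _ (fun tx : R * X => phi' tx.1 tx.2) _ (t0, x0) (@fl_cts _) (uf_pair tt0 xx0)). Qed.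

Lemma flt_cts x : continuous (fun t => phi' t x).
Proof. by apply: (@ccomp R (R * X)%type X (fun t => (t, x)) (fun tx => phi' tx.1 tx.2)); [exact: pairr_continuous|exact: fl_cts]. Qed.

Lemma flx_cts t : continuous (phi' t).
Proof. by apply: (@ccomp X (R * X)%type X (fun x => (t, x)) (fun tx => phi' tx.1 tx.2)); [exact: pairl_continuous|exact: fl_cts]. Qed.

Lemma deck_fl g t x : deck p g -> phi' t (g x) = g (phi' t x).
Proof.
move=> dg; have [cg _ _] := dg; have [pcov _] := hcov.
have /(congr1 (@^~ t)) : (fun t => phi' t (g x)) = (fun t => g (phi' t x)); last by [].
apply: (lift_unique pcov); [exact: flt_cts|exact: (@ccomp R X X (fun t => phi' t x) g (@flt_cts x) cg)| |by rewrite !fl0].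
by move=> s /=; rewrite pfl !(deck_p _ dg) pfl.
Qed.

(** ** Leafwise distance *)

Lemma leaf_refl (B : set (fchart3 R X)) x : leaf B x x. Proof. exact: rst_refl. Qed.
Lemma leaf_sym (B : set (fchart3 R X)) x y : leaf B x y -> leaf B y x. Proof. exact: rst_sym. Qed.
Lemma leaf_trans (B : set (fchart3 R X)) y x z : leaf B x y -> leaf B y z -> leaf B x z.
Proof. exact: rst_trans. Qed.

Lemma ld_leaf x y (r : R) : leaf_dist A x y = r%:E -> leaf A x y.
Proof.
move=> e; apply: contrapT => nl; suff : leaf_dist A x y = +oo%E by rewrite e.
rewrite /leaf_dist (_ : [set _ | _ in _] = set0) ?ereal_inf0 //.
apply/seteqP; split=> // l [g [_ _ g1 gl] _]; apply: nl; rewrite -g1; apply: gl; lra.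
Qed.

Lemma mdist_path_length (g : R -> X) : ((mdist (g 0) (g 1))%:E <= path_length g)%E.
Proof.
apply: ereal_sup_ubound; exists 1%N, (fun n => (0 < n)%N%:R); split.
- by case=> [|m] [|n] //= _; rewrite ?lexx ?ler01.
- by case=> [|n] /=; rewrite lexx ler01.
- by rewrite big_ord1.
Qed.

Lemma mdist_ld x y (r : R) : leaf_dist A x y = r%:E -> mdist x y <= r.
Proof.
move=> e; rewrite -lee_fin -e; apply: le_ereal_inf_tmp => _ [g [_ g0 g1 _] <-].
by rewrite -g0 -g1; exact: mdist_path_length.
Qed.

Definition fol_coord (F : (R * R) * R -> X) :=
  [/\ {within half_plane `*` `]-1, 1[, continuous F},
      Defs.transversal A `]-1, 1[ (fun t => F ((0, 1), t)) &
      forall t, -1 < t < 1 ->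
        [set F (q, t) | q in half_plane] = leaf A (F ((0, 1), t)) /\
        forall q q', half_plane q -> half_plane q' ->
          leaf_dist A (F (q, t)) (F (q', t)) = (hyp_dist q q')%:E].

Lemma fol_coordP x : exists F, fol_coord F /\ F ((0, 1), 0) = x.
Proof. by have [/(_ x) [F [? ? ? ?]] _ _] := hadapt; exists F. Qed.

Section Coord.
Variables (F : (R * R) * R -> X) (hF : fol_coord F).

Lemma F_leaf t q : -1 < t < 1 -> half_plane q -> leaf A (F ((0, 1), t)) (F (q, t)).
Proof. by move=> t1 hq; have [_ _ /(_ t t1) [<- _]] := hF; exists q. Qed.

Lemma F_onto t y : -1 < t < 1 -> leaf A (F ((0, 1), t)) y -> exists2 q, half_plane q & F (q, t) = y.
Proof. by move=> t1; have [_ _ /(_ t t1) [<- _]] := hF. Qed.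

Lemma F_ld t q q' : -1 < t < 1 -> half_plane q -> half_plane q' ->
  leaf_dist A (F (q, t)) (F (q', t)) = (hyp_dist q q')%:E.
Proof. by move=> t1; have [_ _ /(_ t t1) [_]] := hF; apply. Qed.

Lemma F_inj t q q' : -1 < t < 1 -> half_plane q -> half_plane q' -> F (q, t) = F (q', t) -> q = q'.
Proof.
move=> t1 hq hq' e; apply: hyp_dist_eq0 => //.
by have := F_ld t1 hq hq'; rewrite e F_ld // hyp_distxx // => -[].
Qed.

Lemma F_cts (q : R * R) t : half_plane q -> -1 < t < 1 -> {for (q, t), continuous F}.
Proof.
move=> hq t1; have [/subspace_continuousP cF _ _] := hF.
have D : (half_plane `*` `]-1, 1[)%classic (q, t) by split; rewrite //= in_itv.
move=> B /(cF _ D) h; have h' : within (half_plane `*` `]-1, 1[) (nbhs (q, t)) (F @^-1` B) := h.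
rewrite /within /= in h'; suff nD : nbhs (q, t) (half_plane `*` `]-1, 1[)%classic.
  by apply: filterS2 h' nD => z; apply.
exists (half_plane, `]-1, 1[%classic); last by move=> [].
split=> /=; last by apply: near_in_itvoo; rewrite in_itv.
rewrite /half_plane /= in hq *.
exists (setT, [set v : R | 0 < v]); last by move=> [u v] [].
split=> /=; [exact: filterT|apply/nbhsRP; exists q.2 => // v /=].
by rewrite ltr_norml; lra.
Qed.

Lemma F_uf (q : nat -> R * R) (t : nat -> R) (l : R * R) (s : R) : half_plane l -> -1 < s < 1 ->
  q @ uf --> l -> t @ uf --> s -> (fun n => F (q n, t n)) @ uf --> F (l, s).
Proof. by move=> hl s1 ql ts; apply: cts_uf (uf_pair ql ts); exact: F_cts. Qed.

Lemma F_geod t (g : geod A) : -1 < t < 1 -> leaf A (F ((0, 1), t)) (g 0) ->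
  exists k, hgeod k /\ forall s, g s = F (k s, t).
Proof.
move=> t1 lg; have gP : geodesic A g := set_mem (valP g).
have /choice[k kP] : forall s, exists q, half_plane q /\ F (q, t) = g s.
  move=> s; have [|q hq e] := @F_onto t (g s) t1; last by exists q.
  by apply: leaf_trans lg _; apply: ld_leaf (gP _ _).
exists k; split; last by move=> s; case: (kP s).
split=> [s|s r]; first by case: (kP s).
have [h1 e1] := kP s; have [h2 e2] := kP r.
by have := F_ld t1 h1 h2; rewrite e1 e2 gP => -[].
Qed.

Lemma geod_F t k : -1 < t < 1 -> hgeod k -> exists g : geod A, forall s, g s = F (k s, t).
Proof.
move=> t1 [k0 kd].
have gP : geodesic A (fun s => F (k s, t)) by move=> s r; rewrite F_ld // kd.
by exists (exist _ (fun s => F (k s, t)) (mem_set gP)).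
Qed.

End Coord.

(** ** Orbits as unit speed geodesics *)

Lemma orbit_geodP x : exists (g : geod A) (s : R -> R),
  [/\ incr_homeo s, s 0 = 0, g 0 = x & forall t, phi' t x = g (s t)].
Proof.
have [_ /(_ x) [g [s [cs hs ss] gs]] _] := hadapt.
have gP : geodesic A g := set_mem (valP g).
have g'P : geodesic A (fun t => g (t + s 0)) by move=> t r; rewrite gP; congr (`|_|%:E); ring.
exists (exist _ (fun t => g (t + s 0)) (mem_set g'P)), (fun t => s t - s 0); split.
- split; first by move=> t; apply: cvgB; [exact: cs|exact: cvg_cst].
    by move=> t r tr; rewrite ltrD2r; exact: hs.
  by move=> y; have [t e] := ss (y + s 0); exists t; rewrite e addrK.
- by rewrite subrr.
- by rewrite -[LHS]/(g (0 + s 0)) add0r -gs fl0.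
- by move=> t; rewrite -[RHS]/(g (s t - s 0 + s 0)) subrK.
Qed.

(** The unit speed geodesic that runs along the orbit of x and starts at x; [os x] is the change of
    time from the flow to arclength. *)
Definition og x : geod A := sval (cid (orbit_geodP x)).
Definition os x : R -> R := sval (cid (svalP (cid (orbit_geodP x)))).

Lemma osP x : [/\ incr_homeo (os x), os x 0 = 0, og x 0 = x & forall t, phi' t x = og x (os x t)].
Proof. exact: svalP (cid (svalP (cid (orbit_geodP x)))). Qed.

Lemma geodP (g : geod A) s t : leaf_dist A (g s) (g t) = `|s - t|%:E.
Proof. exact: (set_mem (valP g)). Qed.

Lemma ld_fl x s t : leaf_dist A (phi' s x) (phi' t x) = `|os x s - os x t|%:E.
Proof. by have [_ _ _ h] := osP x; rewrite !h geodP. Qed.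

Lemma fl_leafU x t : leaf A x (phi' t x).
Proof. by rewrite -{1}(fl0 x); apply: ld_leaf (ld_fl x 0 t). Qed.

Lemma os_inj x : injective (os x).
Proof.
move=> s t e; have [[_ hs _] _ _ _] := osP x.
by case: (ltgtP s t) => // /hs; rewrite e ltxx.
Qed.

(** Orbits of X are geodesics of their leaves, so none of them closes up. *)
Lemma fl_inj x s t : phi' s x = phi' t x -> s = t.
Proof.
move=> e; apply: (@os_inj x); have := ld_fl x s t; rewrite e ld_fl subrr normr0 => -[/esym/eqP].
by rewrite normr_eq0 subr_eq0 => /eqP.
Qed.

(** ** Uniform estimates for the flow *)

(** Model of the uniform estimates below: deck transformations commute with the flow and are
    isometries, so counterexamples can be moved until they converge, and then contradict continuity
    at the limit. *)
Lemma displacement (e : R) : 0 < e -> exists2 d : R, 0 < d & forall t x, `|t| < d -> mdist x (phi' t x) < e.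
Proof.
move=> e0; have [||d d0 h] := @eps_seq R (R * X)%type (fun tx => `|tx.1|)
    (fun tx => mdist tx.2 (phi' tx.1 tx.2) < e); first by move=> ?.
- move=> u u0 nu; have [g [l [dg gl]]] := cocompact hM hcov hmet (fun n => (u n).2).
  have t0 : (fun n => (u n).1) @ uf --> (0 : R).
    by apply/ufRP => d d0; move/ufRP: u0 => /(_ d d0); apply: filterS => n; rewrite !subr0 normr_id.
  have h : (fun n => mdist (g n (u n).2) (phi' (u n).1 (g n (u n).2))) @ uf --> mdist l l.
    have -> : mdist l l = mdist l (phi' 0 l) by rewrite fl0.
    by apply: uf_mdist => //; exact: uf_fl.
  rewrite mdistxx in h; have [n] := filter_ex ((ufRP _ _).1 h e e0).
  rewrite subr0 ger0_norm ?mdist_ge0 // deck_fl // (deck_iso hmet) //; exact: (nu n).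
by exists d => // t x td; exact: (h (t, x)).
Qed.

Lemma fl_unif (T e : R) : 0 < e -> exists2 d : R, 0 < d &
  forall t x y, `|t| <= T -> mdist x y < d -> mdist (phi' t x) (phi' t y) < e.
Proof.
move=> e0; have [||d d0 h] := @eps_seq R (R * (X * X))%type (fun u => mdist u.2.1 u.2.2)
    (fun u => `|u.1| <= T -> mdist (phi' u.1 u.2.1) (phi' u.1 u.2.2) < e).
- by move=> u; exact: mdist_ge0.
- move=> u u0 nu.
  have nu' n : `|(u n).1| <= T /\ ~ mdist (phi' (u n).1 (u n).2.1) (phi' (u n).1 (u n).2.2) < e.
    by split; [apply: contrapT => h; apply: (nu n)|move=> h; apply: (nu n)].
  have [g [l [dg gl]]] := cocompact hM hcov hmet (fun n => (u n).2.1).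
  have gl2 : (fun n => g n (u n).2.2) @ uf --> l.
    by apply: uf_close gl; apply: uf_congr u0; apply: nearW => n; rewrite (deck_iso hmet).
  have [s _ us] : exists2 l, - T <= l <= T & (fun n => (u n).1) @ uf --> l.
    by apply: uf_bounded; apply: nearW => n; have [+ _] := nu' n; rewrite ler_norml.
  have h := uf_mdist (uf_fl us gl) (uf_fl us gl2); rewrite mdistxx in h.
  have [n] := filter_ex ((ufRP _ _).1 h e e0).
  rewrite subr0 ger0_norm ?mdist_ge0 // !deck_fl // (deck_iso hmet) //; exact: (nu' n).2.
by exists d => // t x y tT xy; exact: (h (t, (x, y))).
Qed.

(** ** Boxes *)

(* c has coordinates ((a, tau), b); the stable plaques are the level sets of a,
   the unstable ones those of b, and the flow lines those of (a, b). *)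
Definition xbox (c : fchart3 R X) := exists cs cu : fchart3 R M,
  [/\ compatible Ws cs, compatible Wu cu,
      forall y, dom c y -> [/\ dom cs (p y), dom cu (p y), c y = cu (p y) & (cs (p y)).2 = (c y).1.1] &
      forall y z, dom c y -> dom c z -> (c y).1.1 = (c z).1.1 -> (c y).2 = (c z).2 ->
        on_orbit phi (p y) (p z)].

Lemma xboxP x : exists2 c, xbox c & dom c x.
Proof.
have [_ _ _ /(_ (p x)) [cs [cu [Cs Cu ds E [co lines]]]] _] := hanosov.
have [|c [dx cP]] := @lift_chart R M X p hcov cu x; first by rewrite -E.
exists c => //; exists cs, cu; split=> //.
  move=> y /cP [du cE]; have dsy : dom cs (p y) by rewrite E.
  have [a [b [t [e1 e2]]]] := co _ dsy; split=> //.
  by rewrite cE e1 e2.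
move=> y z /cP [dy cy] /cP [dz cz] a b.
have [dy' dz'] : dom cs (p y) /\ dom cs (p z) by rewrite E.
apply: lines => //; last by rewrite -cy -cz.
have [a1 [b1 [t1 [e1 e1']]]] := co _ dy'; have [a2 [b2 [t2 [e2 e2']]]] := co _ dz'.
by move: a; rewrite cy cz e1' e2' e1 e2.
Qed.

Section Box.
Variables (c : fchart3 R X) (hc : xbox c).

Lemma box_U (g : R -> X) y a b : continuous g ->
  (forall t, a < t < b -> leaf Wu y (p (g t)) /\ dom c (g t)) ->
  forall s t, a < s < b -> a < t < b -> (c (g s)).2 = (c (g t)).2.
Proof.
move=> cg gP s t sab tab; have [cs [cu [_ Cu dP _]]] := hc.
have [_ _ -> _] := dP _ (gP _ sab).2; have [_ _ -> _] := dP _ (gP _ tab).2.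
apply: (@leaf_path_const R M Wu atlasWu compactM cu (fun t => p (g t)) y a b) => //.
  exact: (@ccomp R X M g p cg (cover_cts hcov)).
by move=> r /gP [? dr]; have [_ ? _ _] := dP _ dr.
Qed.

Lemma box_S (g : R -> X) y a b : continuous g ->
  (forall t, a < t < b -> leaf Ws y (p (g t)) /\ dom c (g t)) ->
  forall s t, a < s < b -> a < t < b -> (c (g s)).1.1 = (c (g t)).1.1.
Proof.
move=> cg gP s t sab tab; have [cs [cu [Cs _ dP _]]] := hc.
have [_ _ _ <-] := dP _ (gP _ sab).2; have [_ _ _ <-] := dP _ (gP _ tab).2.
apply: (@leaf_path_const R M Ws atlasWs compactM cs (fun t => p (g t)) y a b) => //.
  exact: (@ccomp R X M g p cg (cover_cts hcov)).
by move=> r /gP [? dr]; have [? _ _ _] := dP _ dr.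
Qed.

Lemma box_leafU (g : R -> X) : continuous g ->
  (forall t, dom c (g t) /\ (c (g t)).2 = (c (g 0)).2) -> forall t, leaf Wu (p (g 0)) (p (g t)).
Proof.
move=> cg gP t; have [cs [cu [_ Cu dP _]]] := hc.
apply: (@plaque_in_leaf R M Wu atlasWu cu (fun t => p (g t)) Cu).
  exact: (@ccomp R X M g p cg (cover_cts hcov)).
move=> s; have [_ ds e _] := dP _ (gP s).1; have [_ d0 e0 _] := dP _ (gP 0).1.
by split=> //; rewrite -e -e0; case: (gP s).
Qed.

Lemma box_leafS (g : R -> X) : continuous g ->
  (forall t, dom c (g t) /\ (c (g t)).1.1 = (c (g 0)).1.1) -> forall t, leaf Ws (p (g 0)) (p (g t)).
Proof.
move=> cg gP t; have [cs [cu [Cs _ dP _]]] := hc.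
apply: (@plaque_in_leaf R M Ws atlasWs cs (fun t => p (g t)) Cs).
  exact: (@ccomp R X M g p cg (cover_cts hcov)).
move=> s; have [ds _ _ e] := dP _ (gP s).1; have [d0 _ _ e0] := dP _ (gP 0).1.
by split=> //; rewrite e e0; case: (gP s).
Qed.

End Box.

Lemma leafS_phi t x y : leaf Ws x y -> leaf Ws (phi t x) (phi t y).
Proof. by have [_ _ [h _] _ _] := hanosov; exact: h. Qed.

(* The times w with phi_w(y) in the stable leaf of y form a subgroup of R; by
   Baire's theorem it contains an interval. *)
Lemma orbit_leafS x v0 : leaf Ws (p x) (p (phi' v0 x)).
Proof.
pose G w := leaf Ws (p x) (p (phi' w x)).
have GD s t : G s -> G t -> G (s + t).
  rewrite /G => Gs Gt; rewrite flD pfl; apply: (rst_trans _ _ _ (phi s (p x))).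
    by rewrite -pfl.
  by apply: leafS_phi.
have GN s : G s -> G (- s).
  rewrite /G => /(leafS_phi (- s)); rewrite -!pfl flK; exact: rst_sym.
have [eta eta0 iso] := cover_eta hM hcov hmet.
have [d d0 disp] := displacement eta0.
(* Orbits of M can be periodic, but not with a period below d: over such times the orbit of X stays
   in a ball on which p is isometric. *)
have pinj s t : p (phi' s x) = p (phi' t x) -> `|s - t| < d -> s = t.
  move=> e st; apply: (@fl_inj x); have [i1 _] := iso (phi' t x).
  have h : mdist (phi' t x) (phi' s x) < eta.
    by have := disp (s - t) (phi' t x) st; rewrite -flD subrK.
  apply: mdist_positivity; rewrite metric_sym -i1 ?mdistxx // e; exact: mdistxx.
have [c hc dx] := xboxP x; have [cs [cu [_ _ dP lines]]] := hc.
(* The line of the box through x. It lies in the stable leaf of x and, as a set, on its orbit, but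
   nothing is known about how the flow time varies along it. *)
pose l (t : R) := cinv c (((c x).1.1, t), (c x).2).
have cl : continuous l.
  apply: (@ccomp R _ X (fun t => (((c x).1.1, t), (c x).2)) (cinv c)); last exact: cinv_continuous.
  move=> t; apply: (@cpairat R _ R); last exact: cvg_cst.
  by apply: (@cpairat R R R); [exact: cvg_cst|exact: cvg_id].
have dl t : dom c (l t) by exact: cinv_dom.
have cE t : c (l t) = (((c x).1.1, t), (c x).2) by rewrite cinvK.
have l0 : l (c x).1.2 = x by rewrite /l -!surjective_pairing cmapK.
have lG t : leaf Ws (p x) (p (l t)).
  have h := @box_leafS c hc l cl _.
  have l00 s : leaf Ws (p (l 0)) (p (l s)) by apply: h => r; rewrite !cE.
  have := l00 (c x).1.2; rewrite l0 => h1.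
  by apply: (rst_trans _ _ _ (p (l 0))); [exact: rst_sym|exact: l00].
have lo t : exists w, p (l t) = p (phi' w x).
  by have [||w e] := lines x (l t) dx (dl t); rewrite ?cE //; exists w; rewrite pfl.
(* Parameters whose point is reached at a time in the j-th interval of length d / 2. These sets are
   closed and cover R, so one contains an interval, and there [pinj] makes the time w continuous. *)
pose K (j : int) := [set t | exists2 w, j%:~R * (d / 2) <= w <= (j + 1)%:~R * (d / 2) & p (l t) = p (phi' w x)].
have cp := cover_cts hcov.
have cK j (t : nat -> R) t0 : t @ uf --> (t0 : R) -> (\forall n \near uf, K j (t n)) -> K j t0.
  move=> tt0 Kt.
  have /choice[w wP] : forall n, exists w, K j (t n) -> j%:~R * (d / 2) <= w <= (j + 1)%:~R * (d / 2) /\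
      p (l (t n)) = p (phi' w x).
    by move=> n; have [[w ? ?]|nK] := pselect (K j (t n)); [exists w|exists 0].
  have [w0 w0P ww0] : exists2 l, j%:~R * (d / 2) <= l <= (j + 1)%:~R * (d / 2) & w @ uf --> l.
    by apply: uf_bounded; apply: filterS Kt => n /wP [].
  exists w0 => //; have h1 := cts_uf (@ccomp _ _ _ _ _ cl cp t0) tt0.
  have h2 := cts_uf (@cp _) (uf_fl ww0 (@uf_const _ x)).
  apply: uf_uniqM h1 _; apply: uf_congr h2.
  by apply: filterS Kt => n /wP [].
have [j [a [b [ab Kab]]]] : exists j a b, a < b /\ forall t, a < t < b -> K j t.
  apply: contrapT => nex.
  pose f (i : nat) := ~` K (odflt 0 (unpickle i)).
  have of_ i : open (f i) /\ dense (f i).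
    rewrite /f; set j := odflt _ _; split.
      rewrite openE => t nK; apply: nbhs_seq => u ut nu.
      by apply: nK; apply: (cK j u t) => //; apply: nearW => n; exact: contrapT (nu n).
    move=> D [t0 Dt0] oD; apply: contrapT => nD; apply: nex.
    have /nbhsRP[e e0 eD] : nbhs t0 D by exact: open_nbhs_nbhs.
    exists j, (t0 - e), (t0 + e); split; first lra.
    move=> t tI; apply: contrapT => nK; apply: nD; exists t; split=> //.
    by apply: eD; rewrite ltr_norml; lra.
  have [||t [_ ft]] := @Baire R R f of_ setT; [by exists 0|exact: openT|].
  have [w e] := lo t; pose i := Num.floor (w / (d / 2)).
  have /(_ (pickle i) I) := ft; rewrite /f pickleK /=; apply; exists w => //.
  have /andP[h1 h2] := Num.Theory.floor_itv (w / (d / 2)).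
  have d2 : 0 < d / 2 by lra.
  by rewrite -ler_pdivlMr // h1 /= -ler_pdivrMr // ltW.
have /choice[w wP] : forall t, exists w, a < t < b -> j%:~R * (d / 2) <= w <= (j + 1)%:~R * (d / 2) /\
      p (l t) = p (phi' w x).
  by move=> t; have [/Kab[w ? ?]|nK] := pselect (a < t < b); [exists w|exists 0].
have wide s t : j%:~R * (d / 2) <= s <= (j + 1)%:~R * (d / 2) ->
    j%:~R * (d / 2) <= t <= (j + 1)%:~R * (d / 2) -> `|s - t| < d.
  by rewrite intrD mulrDl mul1r ltr_norml => ? ?; lra.
have cw t : a < t < b -> {for t, continuous w}.
  move=> tab; apply: uf_cts => u ut.
  have uab : \forall n \near uf, a < u n < b.
    exact: uf_between ut tab.
  have [w0 w0P ww0] : exists2 l, j%:~R * (d / 2) <= l <= (j + 1)%:~R * (d / 2) & (fun n => w (u n)) @ uf --> l.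
    by apply: uf_bounded; apply: filterS uab => n /wP [].
  suff <- : w0 = w t by [].
  have [wt et] := wP _ tab; apply: pinj; last exact: wide.
  rewrite -et; have h1 := cts_uf (@ccomp _ _ _ _ _ cl cp t) ut.
  have h2 := cts_uf (@cp _) (uf_fl ww0 (@uf_const _ x)).
  apply: uf_uniqM h2 _; apply: uf_congr h1.
  by apply: filterS uab => n /wP [].
pose t1 := a + (b - a) / 3; pose t2 := a + 2 * (b - a) / 3.
have t1P : a < t1 < b by rewrite /t1; lra.
have t2P : a < t2 < b by rewrite /t2; lra.
have t12 : t1 < t2 by rewrite /t1 /t2; lra.
have w12 : w t1 != w t2.
  apply/eqP => e; have [_ e1] := wP _ t1P; have [_ e2] := wP _ t2P.
  have : p (l t1) = p (l t2) by rewrite e1 e2 e.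
  have [_ _ c1 _] := dP _ (dl t1); have [_ _ c2 _] := dP _ (dl t2).
  move=> /(congr1 cu); rewrite -c1 -c2 !cE => -[]; lra.
have GI v : w t1 <= v <= w t2 \/ w t2 <= v <= w t1 -> G v.
  move=> hv; have [|r r12 <-] := ivt (ltW t12) _ hv.
    by move=> r r12; apply: cw; lra.
  have rab : a < r < b by lra.
  by have [_ e] := wP r rab; rewrite /G -e.
(* Differences of times between [w t1] and [w t2] fill an interval [0, q], and a subgroup that
   contains it is all of R. *)
have [q q0 Gq] : exists2 q, 0 < q & forall v, 0 <= v <= q -> G v.
  exists `|w t1 - w t2|; first by rewrite normr_gt0 subr_eq0.
  move=> v; case: (leP (w t2) (w t1)) => h vq.
    rewrite ger0_norm ?subr_ge0 // in vq.
    have -> : v = (w t2 + v) - w t2 by ring.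
    by apply: GD; [apply: GI; right; lra|apply: GN; apply: GI; right; lra].
  rewrite ltr0_norm ?subr_lt0 // in vq.
  have -> : v = (w t1 + v) - w t1 by ring.
  by apply: GD; [apply: GI; left; lra|apply: GN; apply: GI; left; lra].
have Gpos v : 0 <= v -> G v.
  move=> vp; pose n := Num.bound (v / q).
  have nq : v / q < n%:R by have := archi_boundP (divr_ge0 vp (ltW q0)).
  have n0 : 0 < n%:R :> R by apply: le_lt_trans nq; exact: divr_ge0 (ltW q0).
  have Gm m : G (m%:R * (v / n%:R)).
    elim: m => [|m IH]; first by rewrite mul0r /G fl0; exact: rst_refl.
    rewrite -addn1 natrD mulrDl; apply: GD => //; rewrite mul1r; apply: Gq.
    rewrite divr_ge0 ?(ltW n0) //= ler_pdivrMr // mulrC -ler_pdivrMr //; exact: ltW.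
  by have := Gm n; rewrite mulrC divfK // lt0r_neq0.
by case: (leP 0 v0) => [/Gpos //|w0]; rewrite /G -[v0]opprK; apply: GN; apply: Gpos; lra.
Qed.

Section BoxFlow.
Variables (c : fchart3 R X) (hc : xbox c).

Lemma box_fl y a b : (forall t, a < t < b -> dom c (phi' t y)) ->
  forall s t, a < s < b -> a < t < b ->
    (c (phi' s y)).1.1 = (c (phi' t y)).1.1 /\ (c (phi' s y)).2 = (c (phi' t y)).2.
Proof.
move=> dy s t sab tab; split.
  apply: (@box_S c hc (fun t => phi' t y) (p y) a b) => // [|r rab]; first exact: flt_cts.
  by split; [exact: orbit_leafS|exact: dy].
apply: (@box_U c hc (fun t => phi' t y) (p y) a b) => // [|r rab]; first exact: flt_cts.
by split; [apply: leaf_proj; exact: fl_leafU|exact: dy].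
Qed.

Lemma box_eq y z : dom c y -> dom c z -> (c y).1.1 = (c z).1.1 -> (c y).1.2 = (c z).1.2 ->
  (c y).2 = (c z).2 -> y = z.
Proof.
move=> dy dz e1 e2 e3; rewrite -(cmapK dy) -(cmapK dz); congr (cinv c _).
by rewrite [c y]surjective_pairing [(c y).1]surjective_pairing e1 e2 e3 -!surjective_pairing.
Qed.

Lemma inj_between (f : R -> R) a m b : a < m < b ->
  (forall r, a <= r <= b -> {for r, continuous f}) ->
  (forall r s, a <= r <= b -> a <= s <= b -> f r = f s -> r = s) ->
  f a < f m < f b \/ f b < f m < f a.
Proof.
move=> amb cf inj.
have am : f a != f m by apply/eqP => /inj; lra.
have bm : f b != f m by apply/eqP => /inj; lra.
have ab : f a != f b by apply/eqP => /inj; lra.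
have no1 : ~ (f a <= f b <= f m \/ f m <= f b <= f a).
  move=> h; have [|||r rab e] := @ivt R f a m (f b) => //; [lra|by move=> r ?; apply: cf; lra|].
  by have := inj _ b _ _ e; lra.
have no2 : ~ (f m <= f a <= f b \/ f b <= f a <= f m).
  move=> h; have [|||r rab e] := @ivt R f m b (f a) => //; [lra|by move=> r ?; apply: cf; lra|].
  by have := inj _ a _ _ e; lra.
have [h1|h1] := leP (f a) (f m); have [h2|h2] := leP (f b) (f m).
- have [h3|h3] := leP (f a) (f b); first by case: no1; left; rewrite h3.
  by case: no2; right; rewrite ltW.
- by left; apply/andP; split=> //; rewrite lt_neqAle am.
- by right; apply/andP; split=> //; rewrite lt_neqAle bm.
- have [h3|h3] := leP (f a) (f b); first by case: no2; left; rewrite h3 ltW.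
  by case: no1; right; rewrite !ltW.
Qed.

Lemma uf_dom (y : nat -> X) x : dom c x -> y @ uf --> x -> \forall n \near uf, dom c (y n).
Proof. by move=> dx yx; apply: uf_open yx; exact: chart_nbhs. Qed.

Lemma uf_chart (y : nat -> X) x : dom c x -> y @ uf --> x ->
  [/\ (fun n => (c (y n)).1.1) @ uf --> (c x).1.1, (fun n => (c (y n)).1.2) @ uf --> (c x).1.2 &
    (fun n => (c (y n)).2) @ uf --> (c x).2].
Proof.
move=> dx yx; have h := cts_uf (chart_at dx) yx.
by split; [exact: uf_fst (uf_fst h)|exact: uf_snd (uf_fst h)|exact: uf_snd h].
Qed.

Lemma box_time x (h0 : R) : dom c x -> 0 < h0 -> exists2 h, 0 < h < h0 &
  forall t, `|t| <= h -> dom c (phi' t x).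
Proof.
move=> dx h00; have /nbhsRP[e e0 eP] : nbhs 0 ((fun t => phi' t x) @^-1` dom c).
  by apply: (@flt_cts x 0); rewrite fl0; exact: chart_nbhs.
exists (Num.min e h0 / 2); first by case: (leP e h0) => ?; lra.
move=> t te; apply: eP; rewrite subr0; apply: le_lt_trans te _.
by case: (leP e h0) => ?; lra.
Qed.

Lemma uf_tube x (y : nat -> X) h : (forall t, `|t| <= h -> dom c (phi' t x)) -> y @ uf --> x ->
  \forall n \near uf, forall t, `|t| <= h -> dom c (phi' t (y n)).
Proof.
move=> dt yx; apply: contrapT => /ufN nd.
have /choice[t tP] : forall n, exists t, ~ (forall t, `|t| <= h -> dom c (phi' t (y n))) ->
    `|t| <= h /\ ~ dom c (phi' t (y n)).
  move=> n; have [ad|] := pselect (forall t, `|t| <= h -> dom c (phi' t (y n))); first by exists 0.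
  by move=> /existsNP[t /not_implyP[th nd']]; exists t.
have [s sh ts] : exists2 l, - h <= l <= h & t @ uf --> l.
  by apply: uf_bounded; apply: filterS nd => n /tP [+ _]; rewrite ler_norml.
have ds : dom c (phi' s x) by apply: dt; rewrite ler_norml.
have [n [[_ nd'] d']] := filter_ex (filterI (filterS (fun n => tP n) nd) (uf_dom ds (uf_fl ts yx))).
exact: nd' d'.
Qed.

(** Along an orbit inside the box a and b are constant and the middle coordinate is injective, hence
    monotone. The orbit segment of z n over [-h, h] therefore passes the middle coordinate of y n,
    and there all three coordinates agree. *)
Lemma box_same_line x (y z : nat -> X) (h0 : R) : dom c x -> y @ uf --> x -> z @ uf --> x -> 0 < h0 ->
  (\forall n \near uf, (c (y n)).1.1 = (c (z n)).1.1 /\ (c (y n)).2 = (c (z n)).2) ->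
  \forall n \near uf, exists2 u, `|u| < h0 & y n = phi' u (z n).
Proof.
move=> dx yx zx h00 same; have [H HH0 dH] := box_time dx h00.
pose h := H / 2; have hH : 0 < h < H by rewrite /h; lra.
have hI r : - h <= r <= h -> `|r| <= H by rewrite ler_norml; lra.
have hI' r : - h <= r <= h -> - H < r < H by lra.
have HI r : - H < r < H -> `|r| <= H by rewrite ler_norml; lra.
have hh0 r : - h <= r <= h -> `|r| < h0 by rewrite ltr_norml; lra.
have [m0 p0 z0 mp] : [/\ - h <= - h <= h, - h <= h <= h, - h <= 0 <= h & - h <= h] by split; lra.
have ct (w : X) r : (forall t, `|t| <= H -> dom c (phi' t w)) -> - h <= r <= h ->
    {for r, continuous (fun t => (c (phi' t w)).1.2)}.
  move=> dw rh; apply: (@ccompat R X R (fun t => phi' t w) (fun y => (c y).1.2)); first exact: flt_cts.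
  have dr : dom c (phi' r w) by apply: dw; exact: hI.
  by apply: cvg_comp (chart_fst dr) _; exact: cvg_snd.
have ab (w : X) r s : (forall t, `|t| <= H -> dom c (phi' t w)) -> - h <= r <= h -> - h <= s <= h ->
    (c (phi' r w)).1.1 = (c (phi' s w)).1.1 /\ (c (phi' r w)).2 = (c (phi' s w)).2.
  by move=> dw rh sh; apply: (@box_fl w (- H) H); [move=> t tH; exact: dw (HI _ tH)|exact: hI'|exact: hI'].
have inj (w : X) r s : (forall t, `|t| <= H -> dom c (phi' t w)) -> - h <= r <= h -> - h <= s <= h ->
    (c (phi' r w)).1.2 = (c (phi' s w)).1.2 -> r = s.
  move=> dw rh sh e; have [e1 e2] := ab _ _ _ dw rh sh; apply: (@fl_inj w).
  by apply: box_eq => //; apply: dw; exact: hI.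
have hb : - h < 0 < h by lra.
have btw := inj_between hb (fun r => ct x r dH) (fun r s => inj x r s dH).
have cv t (w : nat -> X) : - h <= t <= h -> w @ uf --> x ->
    (fun n => (c (phi' t (w n))).1.2) @ uf --> (c (phi' t x)).1.2.
  move=> th wx; have dt : dom c (phi' t x) by apply: dH; exact: hI.
  by have [_ + _] := uf_chart dt (uf_fl (@uf_const _ t) wx).
rewrite fl0 in btw.
have cy : (fun n => (c (y n)).1.2) @ uf --> (c x).1.2 by have [_ + _] := uf_chart dx yx.
have lo : \forall n \near uf, (c (phi' (- h) (z n))).1.2 <= (c (y n)).1.2 <= (c (phi' h (z n))).1.2 \/
    (c (phi' h (z n))).1.2 <= (c (y n)).1.2 <= (c (phi' (- h) (z n))).1.2.
  have cm := cv (- h) z m0 zx; have cp := cv h z p0 zx.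
  case: btw => /andP[b1 b2].
    by apply: filterS2 (uf_lt cm cy b1) (uf_lt cy cp b2) => n h1 h2; left; rewrite !ltW.
  by apply: filterS2 (uf_lt cp cy b1) (uf_lt cy cm b2) => n h1 h2; right; rewrite !ltW.
have tube := uf_tube dH zx; have dy := uf_dom dx yx.
near=> n.
have dz : forall t, `|t| <= H -> dom c (phi' t (z n)) by near: n.
have lon : (c (phi' (- h) (z n))).1.2 <= (c (y n)).1.2 <= (c (phi' h (z n))).1.2 \/
    (c (phi' h (z n))).1.2 <= (c (y n)).1.2 <= (c (phi' (- h) (z n))).1.2 by near: n.
have [e1 e2] : (c (y n)).1.1 = (c (z n)).1.1 /\ (c (y n)).2 = (c (z n)).2 by near: n.
have [|u uh e] := @ivt R (fun t => (c (phi' t (z n))).1.2) (- h) h (c (y n)).1.2 mp _ lon.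
  by move=> r rh; exact: ct.
exists u; first exact: hh0.
have [a1 a2] := ab (z n) u 0 dz uh z0; rewrite fl0 in a1 a2.
apply: box_eq; rewrite ?a1 ?a2 //; first by near: n.
by apply: dz; exact: hI.
Unshelve. all: by end_near. Qed.

End BoxFlow.

Tactic Notation "keep" hyp(a) := clear - a hM hcov hmet hanosov hphi hadapt.
Tactic Notation "keep" hyp(a) hyp(b) := clear - a b hM hcov hmet hanosov hphi hadapt.
Tactic Notation "keep" hyp(a) hyp(b) hyp(c) := clear - a b c hM hcov hmet hanosov hphi hadapt.
Tactic Notation "keep" hyp(a) hyp(b) hyp(c) hyp(d) := clear - a b c d hM hcov hmet hanosov hphi hadapt.

(** ** Leafwise coordinates are a local homeomorphism *)

Lemma itv0 : 0 <= (0 : R) <= 1. Proof. by rewrite lexx ler01. Qed.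
Lemma itv1 : 0 <= (1 : R) <= 1. Proof. by rewrite lexx ler01. Qed.
Lemma itv02 : -1 < (0 : R) < 2. Proof. by lra. Qed.
Lemma itv12 : -1 < (1 : R) < 2. Proof. by lra. Qed.

Lemma below2 (a b : R) : 0 < a -> 0 < b -> exists2 r, 0 < r < 1 & r < a /\ r < b.
Proof.
move=> a0 b0; exists (Num.min (Num.min a b) 1 / 2); case: (leP a b) => ?.
- by case: (leP a 1) => ?; lra.
- by case: (leP b 1) => ?; lra.
- by case: (leP a 1) => ?; lra.
- by case: (leP b 1) => ?; lra.
Qed.

(** Compares the hyperbolic coordinates with a box. A slice over fixed t is joined by segments
    inside its leaf, so b is constant on it by [box_U]; b separates the slices because the base
    curve is a transversal. *)
Lemma F_box F c : fol_coord F -> xbox c -> dom c (F ((0, 1), 0)) -> exists2 r : R, 0 < r < 1 &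
  (forall q t, `|q.1| <= r -> `|q.2 - 1| <= r -> `|t| <= r ->
     [/\ half_plane q, dom c (F (q, t)) & (c (F (q, t))).2 = (c (F ((0, 1), t))).2]) /\
  (forall s t, `|s| <= r -> `|t| <= r -> (c (F ((0, 1), s))).2 = (c (F ((0, 1), t))).2 -> s = t).
Proof.
move=> hF hc d0; have h01 := @half_plane01 R.
have t0 : -1 < (0 : R) < 1 by lra.
have cF : {for ((0, 1), 0), continuous F} by exact: F_cts.
have z1 : (`]-1, 1[%classic : set R) 0 by rewrite /= in_itv.
have [_ [_ /(_ 0 z1) [c' [c0 Wc0 cc0] [e e0 inj]]] _] := hF.
have [cs [cu [_ Cu dP _]]] := hc.
have d0' : dom c' (F ((0, 1), 0)).
  by have [||] := inj 0; rewrite ?subrr ?normr0 //= in_itv.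
have [_ du _ _] := dP _ d0; have [du0 _] := cc0 _ d0'.
have [U nU UP] := Cu _ Wc0 _ du du0.
have pF := cover_cts hcov.
have [e1 e10 e1P] : exists2 e1 : R, 0 < e1 & forall z, ball (((0, 1), 0) : (R * R) * R) e1 z ->
    dom c (F z) /\ U (p (F z)).
  have : nbhs (((0, 1), 0) : (R * R) * R) (F @^-1` (dom c `&` p @^-1` U)).
    apply: cF; apply: filterI; first exact: chart_nbhs.
    by apply: pF.
  by move=> /nbhs_ballP[e1 e10 h]; exists e1.
have [r r01 [re re1]] := below2 e0 e10; have r0 : 0 < r by case/andP: r01.
have near q t : `|q.1| <= r -> `|q.2 - 1| <= r -> `|t| <= r -> ball (((0, 1), 0) : (R * R) * R) e1 (q, t).
  by move=> q1 q2 tr; split; [split|]; rewrite /ball /= distrC ?subr0; exact: le_lt_trans re1.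
have hp q : `|q.2 - 1| <= r -> half_plane q by keep r01; rewrite /half_plane /= ler_norml; lra.
have t1 t : `|t| <= r -> -1 < t < 1 by keep r01; rewrite ler_norml; lra.
exists r => //.
split=> [q t q1 q2 tr|s t sr tr].
  have hq := hp _ q2; have [dq _] := e1P _ (near _ _ q1 q2 tr); split=> //.
  pose k (s : R) := (clamp s * q.1, 1 + clamp s * (q.2 - 1)).
  have small (a b : R) : 0 <= a <= 1 -> `|b| <= r -> `|a * b| <= r.
    move=> /andP[a0 a1] br; rewrite normrM ger0_norm //.
    by apply: le_trans br; rewrite -[leRHS]mul1r ler_wpM2r.
  have kr s : [/\ `|(k s).1| <= r, `|(k s).2 - 1| <= r & half_plane (k s)].
    have k2 : `|(k s).2 - 1| <= r by rewrite /= addrC addKr; apply: small => //; exact: clamp_itv.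
    by split=> //; [apply: small => //; exact: clamp_itv|exact: hp].
  have ck : continuous (fun s => F (k s, t)).
    move=> s; have [_ _ hk] := kr s.
    apply: (@ccompat R ((R * R) * R)%type X (fun s => (k s, t)) F); last exact: F_cts (t1 _ tr).
    apply: (@cpairat R (R * R)%type R); last exact: cvg_cst.
    apply: (@cpairat R R R); first by apply: cvgM; [exact: (@clamp_continuous R s)|exact: cvg_cst].
    by apply: cvgD; [exact: cvg_cst|apply: cvgM; [exact: (@clamp_continuous R s)|exact: cvg_cst]].
  have h : forall s, -1 < s < 2 -> leaf Wu (p (F ((0, 1), t))) (p (F (k s, t))) /\ dom c (F (k s, t)).
    move=> s _; have [k1 k2 hk] := kr s; split; last by have [] := e1P _ (near _ _ k1 k2 tr).
    by apply: leaf_proj; apply: F_leaf => //; exact: t1.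
  have := @box_U c hc (fun s => F (k s, t)) _ (-1) 2 ck h 1 0.
  rewrite /k clamp0 clamp1 !mul0r !mul1r addr0 [1 + _]addrC subrK -surjective_pairing.
  by move=> /(_ itv12 itv02).
have n1 : `|1 - 1 : R| <= r by rewrite subrr normr0 ltW.
have n0 : `|0 : R| <= r by rewrite normr0 ltW.
have [ds Us] := e1P _ (near (0, 1) s n0 n1 sr); have [dt Ut] := e1P _ (near (0, 1) t n0 n1 tr).
have [_ _ -> _] := dP _ ds; have [_ _ -> _] := dP _ dt.
have pre v : `|v| <= r -> (`]-1, 1[%classic : set R) v /\ `|v - 0| < e.
  by move=> vr; rewrite subr0 /= in_itv; split; [exact: t1|exact: le_lt_trans re].
have [Is s0] := pre _ sr; have [It t0'] := pre _ tr.
have [ds' is_] := inj s Is s0; have [dt' _] := inj t It t0'.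
have [_ _ [h _]] := UP _ _ Us Ut.
move=> /h e'; apply: is_ => //.
by have [_ ->] := cc0 _ ds'; have [_ ->] := cc0 _ dt'.
Qed.

Lemma uf_hgeod (m : R -> R * R) (s : nat -> R) (s0 : R) : hgeod m -> s @ uf --> s0 ->
  (fun n => m (s n)) @ uf --> m s0.
Proof.
move=> hm ss; have [hp _] := hm; have h := hp s0.
have E : \forall n \near uf, mki (lin (expR (s n)) (nplus m) (expR (- s n)) (nminus m)) = m (s n).
  by apply: nearW => n; rewrite -hgeodE // mkK.
apply: uf_congr E _; rewrite -(mkK h) (hgeodE s0 hm); apply: uf_mki.
  by rewrite -hgeodE //=; apply: invr_neq0; exact: lt0r_neq0.
apply: uf_lin; try exact: uf_const; first exact: uf_expR.
by apply: uf_expR; exact: cvgN.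
Qed.

Lemma os_onto x s : exists t, os x t = s.
Proof. by have [[_ _ h] _ _ _] := osP x. Qed.

Lemma F_orbit F z : fol_coord F -> leaf A (F ((0, 1), 0)) z -> exists k, [/\ hgeod k,
  F (k 0, 0) = z, forall u, phi' u z = F (k (os z u), 0) & forall r, exists u, F (k r, 0) = phi' u z].
Proof.
move=> hF lz; have [_ _ z0 ogE] := osP z.
have [||k [hk kE]] := F_geod (g := og z) hF (t := 0); [lra|by rewrite z0|].
exists k; split=> //; first by rewrite -kE z0.
  by move=> u; rewrite -kE ogE.
by move=> r; have [u <-] := os_onto z r; exists u; rewrite -kE ogE.
Qed.

Lemma F_transverse F c : fol_coord F -> xbox c -> dom c (F ((0, 1), 0)) -> exists m, [/\ hgeod m,
  m 0 = (0, 1) & exists2 s0 : R, 0 < s0 & forall s s', `|s| <= s0 -> `|s'| <= s0 ->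
    dom c (F (m s, 0)) /\ ((c (F (m s, 0))).1.1 = (c (F (m s', 0))).1.1 -> s = s')].
Proof.
move=> hF hc d0; have [r r01 [rP _]] := F_box hF hc d0; have t1 : -1 < (0 : R) < 1 by lra.
have h01 := @half_plane01 R.
have [k [hk k0 kE kE']] := F_orbit hF (leaf_refl A _); have e0 : k 0 = (0, 1).
  by apply: (F_inj hF t1) => //; case: hk.
have [m [hm m0 mk']] := transverse_geod hk; rewrite e0 in m0; exists m; split=> //.
have [||s0 s00 sP] := @eps_seq R (R * R)%type (fun z => `|z.1| + `|z.2|)
    (fun z => dom c (F (m z.1, 0)) /\ ((c (F (m z.1, 0))).1.1 = (c (F (m z.2, 0))).1.1 -> z.1 = z.2)).
- by move=> z; rewrite addr_ge0.
- move=> u u0 nu.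
  have u1 : (fun n => (u n).1) @ uf --> (0 : R).
    apply/ufRP => e e_gt0; move/ufRP: u0 => /(_ e e_gt0); apply: filterS => n.
    by rewrite !subr0 ger0_norm ?addr_ge0 //; apply: le_lt_trans; rewrite lerDl.
  have u2 : (fun n => (u n).2) @ uf --> (0 : R).
    apply/ufRP => e e_gt0; move/ufRP: u0 => /(_ e e_gt0); apply: filterS => n.
    by rewrite !subr0 ger0_norm ?addr_ge0 //; apply: le_lt_trans; rewrite lerDr.
  have m1 := uf_hgeod hm u1; have m2 := uf_hgeod hm u2; rewrite m0 in m1 m2.
  have y1 := F_uf hF h01 t1 m1 (@uf_const _ (0 : R)); have y2 := F_uf hF h01 t1 m2 (@uf_const _ (0 : R)).
  have r0 : 0 < r by case/andP: r01.
  have near0 (q : nat -> R * R) : q @ uf --> ((0, 1) : R * R) -> \forall n \near uf,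
      (c (F (q n, 0))).2 = (c (F ((0, 1), 0))).2.
    move=> qq; have /ufRP/(_ r r0) q1 := uf_fst qq; have /ufRP/(_ r r0) q2 := uf_snd qq.
    apply: filterS2 q1 q2 => n q1 q2; have [|||_ _ //] := rP (q n) 0; last by rewrite normr0 ltW.
      by rewrite -[X in `|X|]subr0 ltW.
    exact: ltW.
  have dd := uf_dom d0 y1.
  have same : \forall n \near uf, (c (F (m (u n).1, 0))).1.1 = (c (F (m (u n).2, 0))).1.1 /\
      (c (F (m (u n).1, 0))).2 = (c (F (m (u n).2, 0))).2.
    near=> n; split; last first.
      by transitivity (c (F ((0, 1), 0))).2; [near: n; exact: near0|apply/esym; near: n; exact: near0].
    apply: contrapT => na; apply: (nu n); split; first by near: n.
    by move=> /na.
  have [n [[w _ e] dn]] := filter_ex (filterI (box_same_line hc d0 y1 y2 ltr01 same) dd).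
  have ne : (u n).1 != (u n).2 by apply/eqP => E; apply: (nu n).
  have hm' s : half_plane (m s) by case: hm.
  have [k' [hk' k'0 k'E k'E']] := F_orbit hF (F_leaf hF t1 (hm' (u n).2)).
  have hh' s : half_plane (k' s) by case: hk'.
  have E2 := F_inj hF t1 (hh' 0) (hm' _) k'0.
  have E1 : m (u n).1 = k' (os (F (m (u n).2, 0)) w).
    by apply: (F_inj hF t1) => //; rewrite e k'E.
  (* m has two points on this orbit and runs inside it, so the orbit passes through the base point,
     against the choice of m. *)
  have [r' e'] := hgeod_meet hk' hm E1 (esym E2) ne 0.
  have [v ev] := k'E' r'; rewrite -e' m0 in ev.
  have z2 : F (m (u n).2, 0) = phi' (- v) (F ((0, 1), 0)) by rewrite ev flK.
  have z1 : F (m (u n).1, 0) = phi' (w - v) (F ((0, 1), 0)) by rewrite e z2 flD.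
  have hk0 s : half_plane (k s) by case: hk.
  rewrite kE in z1; rewrite kE in z2.
  have /mk' g1 := F_inj hF t1 (hm' _) (hk0 _) z1; have /mk' g2 := F_inj hF t1 (hm' _) (hk0 _) z2.
  by rewrite g1 g2 eqxx in ne.
exists (s0 / 3); first by rewrite divr_gt0.
move=> s s' h h'; apply: (sP (s, s')) => /=; keep h h' s00; lra.
Unshelve. all: by end_near. Qed.

Lemma path_length_cat (g1 g2 g : R -> X) : g1 1 = g2 0 ->
  (forall t, 0 <= t <= 1 -> g t = if t <= 2^-1 then g1 (2 * t) else g2 (2 * t - 1)) ->
  (path_length g <= path_length g1 + path_length g2)%E.
Proof.
move=> e gE; apply: ge_ereal_sup => _ [n [s [hs s01 ->]]].
(* The subdivision is split into one of each half; points outside a half are moved to its end, where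
   they add no length. *)
pose a (i : nat) : R := Num.min (2 * s i) 1; pose b (i : nat) : R := Num.max (2 * s i - 1) 0.
have gab i j : (i <= j)%N ->
    mdist (g (s i)) (g (s j)) <= mdist (g1 (a i)) (g1 (a j)) + mdist (g2 (b i)) (g2 (b j)).
  move=> /hs ij; rewrite !gE // /a /b.
  have lo (x : R) : x <= 2^-1 -> Num.min (2 * x) 1 = 2 * x /\ Num.max (2 * x - 1) 0 = 0.
    by keep x => h; split; [apply/min_idPl|apply/max_idPr]; lra.
  have hi (x : R) : 2^-1 < x -> [/\ Num.min (2 * x) 1 = 1, Num.max (2 * x - 1) 0 = 2 * x - 1 & 2^-1 < x].
    by keep x => h; split; [apply/min_idPr|apply/max_idPl|]; lra.
  have [li|/hi[-> -> gi]] := leP (s i) 2^-1; have [lj|/hi[-> -> gj]] := leP (s j) 2^-1.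
  - by have [-> ->] := lo _ li; have [-> ->] := lo _ lj; rewrite mdistxx addr0.
  - by have [-> ->] := lo _ li; rewrite -e; exact: metric_triangle.
  - by have := lt_le_trans (lt_le_trans gi ij) lj; rewrite ltxx.
  - by rewrite mdistxx add0r.
apply: le_trans (_ : ((\sum_(i < n) mdist (g1 (a i)) (g1 (a i.+1)))%:E +
    (\sum_(i < n) mdist (g2 (b i)) (g2 (b i.+1)))%:E <= _)%E); last first.
  apply: leeD; apply: ereal_sup_ubound.
  - exists n, a; split=> // [i j /hs ij|i]; rewrite /a; last by case/andP: (s01 i) => ? ?; rewrite le_min ge_min lexx orbT; apply/andP; split=> //; apply/andP; split; lra.
    by rewrite le_min !ge_min lexx orbT andbT ler_pM2l ?ij.
  - exists n, b; split=> // [i j /hs ij|i]; rewrite /b; last by case/andP: (s01 i) => ? ?; rewrite le_max ge_max lexx orbT; apply/andP; split=> //; apply/andP; split; lra.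
    by rewrite ge_max !le_max lexx orbT andbT lerD2r ler_pM2l ?ij.
rewrite -EFinD lee_fin -big_split /=; apply: ler_sum => i _; exact: gab.
Qed.

Lemma ld_tri x y z (r s t : R) : leaf_dist A x y = r%:E -> leaf_dist A y z = s%:E ->
  leaf_dist A x z = t%:E -> t <= r + s.
Proof.
move=> er es et; apply/ler_addgt0Pr => e e0.
have near x' y' (v : R) : leaf_dist A x' y' = v%:E -> exists2 g : R -> X,
    [/\ {within `[0, 1], continuous g}, g 0 = x', g 1 = y' & forall t, 0 <= t <= 1 -> leaf A x' (g t)] &
    (path_length g < (v + e / 2)%:E)%E.
  move=> ev; have : (leaf_dist A x' y' < (v + e / 2)%:E)%E by rewrite ev lte_fin ltrDl divr_gt0.
  by move=> /ereal_inf_lt [_ [g gP <-] lt]; exists g.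
have [g1 [c1 g10 g11 l1] L1] := near _ _ _ er; have [g2 [c2 g20 g21 l2] L2] := near _ _ _ es.
pose g t := if t <= 2^-1 then g1 (clamp (2 * t)) else g2 (clamp (2 * t - 1)).
have two : 2 * 2^-1 = 1 :> R by rewrite divff.
have gE v : 0 <= v <= 1 -> g v = if v <= 2^-1 then g1 (2 * v) else g2 (2 * v - 1).
  by rewrite /g; keep g1 g2; case: (leP v 2^-1) => h v01; rewrite clamp_id //; lra.
have cg : continuous g.
  have ca : continuous (fun t : R => 2 * t) by move=> v; apply: cvgM; [exact: cvg_cst|exact: cvg_id].
  have cb : continuous (fun t : R => 2 * t - 1) by move=> v; apply: cvgB; [exact: ca|exact: cvg_cst].
  apply: (@pw_continuous R X (fun t => g1 (clamp (2 * t))) (fun t => g2 (clamp (2 * t - 1)))).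
  - exact: (@ccomp R R X (fun t => 2 * t) (g1 \o clamp) ca (within_clamp c1)).
  - exact: (@ccomp R R X (fun t => 2 * t - 1) (g2 \o clamp) cb (within_clamp c2)).
  by rewrite two subrr clamp0 clamp1 g11 g20.
have : (leaf_dist A x z <= path_length g)%E.
  apply: ereal_inf_lbound; exists g => //; split.
  - exact: continuous_subspaceT.
  - by rewrite gE ?itv0 // mulr0 invr_ge0 ler0n.
  - rewrite gE ?itv1 // mulr1 (_ : 2 - 1 = 1 :> R) ?g21; last by ring.
    by rewrite leNgt invf_lt1 // ltr1n.
  - move=> v _; rewrite /g; case: ifP => _; first by apply: l1; exact: clamp_itv.
    apply: leaf_trans (ld_leaf er) _; apply: l2; exact: clamp_itv.
rewrite et => h; have := le_lt_trans (le_trans h (path_length_cat _ gE)) (lteD L1 L2).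
by rewrite g11 g20 -EFinD lte_fin => /(_ erefl) /ltW; keep e; lra.
Qed.

Lemma ld_hyp x y : leaf A x y -> exists2 r : R, 0 <= r & leaf_dist A x y = r%:E.
Proof.
move=> l; have [F [hF F0]] := fol_coordP x; have t1 : -1 < (0 : R) < 1 by lra.
rewrite -F0 in l *; have [q hq <-] := F_onto hF t1 l.
by exists (hyp_dist (0, 1) q); [apply: hyp_dist_ge0 => //; exact: half_plane01|rewrite F_ld //; exact: half_plane01].
Qed.

Lemma ld_sym x y : leaf A x y -> leaf_dist A x y = leaf_dist A y x.
Proof.
move=> l; have [F [hF F0]] := fol_coordP x; have t1 : -1 < (0 : R) < 1 by lra.
rewrite -F0 in l *; have [q hq <-] := F_onto hF t1 l.
have h01 := @half_plane01 R.
by rewrite (F_ld hF t1 h01 hq) (F_ld hF t1 hq h01) hyp_distC.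
Qed.

Lemma hyp_tri F (q1 q2 q3 : R * R) : fol_coord F -> half_plane q1 -> half_plane q2 -> half_plane q3 ->
  hyp_dist q1 q3 <= hyp_dist q1 q2 + hyp_dist q2 q3.
Proof.
move=> hF h1 h2 h3; have t1 : -1 < (0 : R) < 1 by lra.
exact: ld_tri (F_ld hF t1 h1 h2) (F_ld hF t1 h2 h3) (F_ld hF t1 h1 h3).
Qed.

Lemma F_lim F (q : nat -> R * R) (t : nat -> R) q0 (C : R) : fol_coord F -> half_plane q0 ->
  t @ uf --> (0 : R) -> (fun n => F (q n, t n)) @ uf --> F (q0, 0) ->
  (\forall n \near uf, half_plane (q n) /\ hyp_dist (q n) (0, 1) <= C) -> q @ uf --> q0.
Proof.
move=> hF h0 t0 FF /hcompact [l hl ql]; have t1 : -1 < (0 : R) < 1 by lra.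
by have := uf_uniqM FF (F_uf hF hl t1 ql t0) => /(F_inj hF t1 h0 hl) ->.
Qed.

Lemma os_cts x : continuous (os x). Proof. by have [[]] := osP x. Qed.
Lemma os_mono x s t : s < t -> os x s < os x t. Proof. by have [[_ h _] _ _ _] := osP x; exact: h. Qed.
Lemma os0 x : os x 0 = 0. Proof. by have [] := osP x. Qed.
Lemma og0 x : og x 0 = x. Proof. by have [] := osP x. Qed.
Lemma ogE x t : og x (os x t) = phi' t x. Proof. by have [_ _ _ ->] := osP x. Qed.

Lemma os_ivt x u (L : R) : 0 <= L -> L <= `|os x u| -> exists2 v, `|v| <= `|u| /\ 0 <= v * u & `|os x v| = L.
Proof.
move=> L0 Lu; have c r (_ : 0 <= r <= u) : {for r, continuous (os x)} by exact: os_cts.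
have [u0|u0] := leP 0 u.
  have ou : 0 <= os x u.
    by move: u0; rewrite le_eqVlt => /orP[/eqP <-|/(os_mono x)]; rewrite os0 //; exact: ltW.
  have [|v v1 v2] := @ivt R (os x) 0 u L u0 c; first by left; rewrite os0 L0 -(ger0_norm ou).
  exists v; last by rewrite v2 ger0_norm.
  by case/andP: v1 => v1 v3; rewrite !ger0_norm // mulr_ge0.
have ou : os x u < 0 by rewrite -(os0 x); exact: os_mono.
have [||v v1 v2] := @ivt R (os x) u 0 (- L) (ltW u0); first by move=> r _; exact: os_cts.
  by left; rewrite os0 oppr_le0 L0 andbT lerNr -(ltr0_norm ou).
exists v; last by rewrite v2 normrN ger0_norm.
case/andP: v1 => v1 v3; rewrite (ler0_norm v3) (ltr0_norm u0) lerN2 -mulrNN; split=> //.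
by rewrite mulr_ge0 // oppr_ge0 // ltW.
Qed.

(** Openness of F is obtained from the intermediate value theorem instead of invariance of domain: t
    n is found from the coordinate b, then a point of m in that leaf from the coordinate a, then the
    flow time that remains. *)
Lemma F_open F (y : nat -> X) : fol_coord F -> y @ uf --> F ((0, 1), 0) ->
  exists (q : nat -> R * R) (t : nat -> R), [/\ q @ uf --> ((0, 1) : R * R), t @ uf --> (0 : R) &
    \forall n \near uf, [/\ y n = F (q n, t n), half_plane (q n) & -1 < t n < 1]].
Proof.
move=> hF yx; have h01 := @half_plane01 R; have t1 : -1 < (0 : R) < 1 by lra.
have [c hc d0] := xboxP (F ((0, 1), 0)).
have [r r01 [rP rinj]] := F_box hF hc d0; have [m [hm m0 [s0 s00 sP]]] := F_transverse hF hc d0.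
have r0 : 0 < r by case/andP: r01.
have rI t : - r <= t <= r -> `|t| <= r by keep r0; rewrite ler_norml.
have rI' t : - r <= t <= r -> -1 < t < 1 by keep r01; lra.
have hm' s : half_plane (m s) by case: hm.
have n1 : `|1 - 1 : R| <= r by rewrite subrr normr0 ltW.
have n0 : `|0 : R| <= r by rewrite normr0 ltW.
have dF q t (qn : nat -> R * R) (tn : nat -> R) : half_plane q -> -1 < t < 1 -> dom c (F (q, t)) ->
    qn @ uf --> q -> tn @ uf --> t -> (fun n => (c (F (qn n, tn n))).1.1) @ uf --> (c (F (q, t))).1.1 /\
    (fun n => (c (F (qn n, tn n))).2) @ uf --> (c (F (q, t))).2.
  by move=> hq ht dq ql tl; have [] := uf_chart dq (F_uf hF hq ht ql tl).
pose b t := (c (F ((0, 1), t))).2; pose a s t := (c (F (m s, t))).1.1.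
have cb t : - r <= t <= r -> {for t, continuous b}.
  move=> tr; have [_ dt _] := rP (0, 1) t n0 n1 (rI _ tr).
  apply: uf_cts => u uv.
  exact: (dF _ _ _ _ h01 (rI' _ tr) dt (@uf_const _ _) uv).2.
have r0r : - r < 0 < r by keep r0; lra.
have lr : - r <= r by keep r0; lra.
have btw := inj_between r0r cb (fun s t sr tr => rinj s t (rI _ sr) (rI _ tr)).
have [_ yc1 yc2] := uf_chart d0 yx; have [ya _ _] := uf_chart d0 yx.
(* 0 is a default for the indices at which y n is not yet between the two extreme leaves. *)
have /choice[t tP] : forall n, exists t, - r <= t <= r /\
    (b (- r) < (c (y n)).2 < b r \/ b r < (c (y n)).2 < b (- r) -> b t = (c (y n)).2).
  move=> n; have [h|h] := pselect (b (- r) < (c (y n)).2 < b r \/ b r < (c (y n)).2 < b (- r)).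
    have [|v vr <-] := @ivt R b (- r) r (c (y n)).2 lr cb; last by exists v.
    by case: h => /andP[h1 h2]; [left|right]; rewrite !ltW.
  by exists 0; split=> //; keep r0; lra.
have bt : \forall n \near uf, b (t n) = (c (y n)).2.
  have : \forall n \near uf, b (- r) < (c (y n)).2 < b r \/ b r < (c (y n)).2 < b (- r).
    by case: btw => h; apply: filterS (uf_between yc2 h) => n; [left|right].
  by apply: filterS => n; apply: (tP n).2.
have [tt ttr tl] : exists2 l, - r <= l <= r & t @ uf --> l.
  by apply: uf_bounded; apply: nearW => n; case: (tP n).
have t0 : t @ uf --> (0 : R).
  suff <- : tt = 0 by [].
  apply: rinj => //; first exact: rI.
  have h1 := cts_uf (cb _ ttr) tl; apply: uf_uniq h1 _; exact: uf_congr (filterS (fun n => @esym _ _ _) bt) yc2.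
have [s1 s10 s1P] : exists2 s1 : R, 0 < s1 & forall s, `|s| < s1 -> `|(m s).1| <= r /\ `|(m s).2 - 1| <= r.
  apply: eps_seq => [s|u u0 nu]; first by [].
  have u0' : u @ uf --> (0 : R).
    by apply/ufRP => e e0; move/ufRP: u0 => /(_ e e0); apply: filterS => n; rewrite !subr0 normr_id.
  have mu := uf_hgeod hm u0'; rewrite m0 in mu.
  have /ufRP/(_ r r0) q1 := uf_fst mu; have /ufRP/(_ r r0) q2 := uf_snd mu.
  have [n [q1' q2']] := filter_ex (filterI q1 q2); apply: (nu n); split; last exact: ltW.
  by rewrite -[X in `|X|]subr0 ltW.
have [s /andP[s_gt0 _] [ss0 ss1]] := below2 s00 s10.
have sI v : - s <= v <= s -> `|v| <= s0 by keep ss0 s_gt0; rewrite ler_norml; lra.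
have sI1 v : - s <= v <= s -> `|v| < s1 by keep ss1 s_gt0; rewrite ltr_norml; lra.
have dms v t' : - s <= v <= s -> - r <= t' <= r -> dom c (F (m v, t')) /\ (c (F (m v, t'))).2 = b t'.
  by move=> vs tr; have [q1 q2] := s1P _ (sI1 _ vs); have [] := rP _ _ q1 q2 (rI _ tr).
have ca t' v : - r <= t' <= r -> - s <= v <= s -> {for v, continuous (a ^~ t')}.
  move=> tr vs; have [dv _] := dms _ _ vs tr.
  by apply: uf_cts => u uv; exact: (dF _ _ _ _ (hm' _) (rI' _ tr) dv (uf_hgeod hm uv) (@uf_const _ t')).1.
have s0s : - s < 0 < s by keep s_gt0; lra.
have ls : - s <= s by keep s_gt0; lra.
have zr : - r <= 0 <= r by keep r0; lra.
have [se1 se2] : - s <= - s <= s /\ - s <= s <= s by keep s_gt0; lra.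
have btwa := inj_between s0s (fun v => ca 0 v zr) (fun v v' vs vs' => (sP v v' (sI _ vs) (sI _ vs')).2).
have a0 : a 0 0 = (c (F ((0, 1), 0))).1.1 by rewrite /a m0.
have alim (v : nat -> R) v0 : - s <= v0 <= s -> v @ uf --> v0 -> (fun n => a (v n) (t n)) @ uf --> a v0 0.
  move=> vs vv; have [dv _] := dms _ _ vs zr.
  exact: (dF _ _ _ _ (hm' _) (rI' _ zr) dv (uf_hgeod hm vv) t0).1.
have am := alim _ _ se1 (@uf_const _ (- s)); have ap := alim _ _ se2 (@uf_const _ s).
have /choice[v vP] : forall n, exists v, - s <= v <= s /\
    (a (- s) (t n) < (c (y n)).1.1 < a s (t n) \/ a s (t n) < (c (y n)).1.1 < a (- s) (t n) ->
     a v (t n) = (c (y n)).1.1).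
  move=> n; have [h|h] := pselect (a (- s) (t n) < (c (y n)).1.1 < a s (t n) \/
     a s (t n) < (c (y n)).1.1 < a (- s) (t n)).
    have [|w wr <-] := @ivt R (a ^~ (t n)) (- s) s (c (y n)).1.1 ls (fun v => ca _ v (tP n).1); last by exists w.
    by case: h => /andP[h1 h2]; [left|right]; rewrite !ltW.
  by exists 0; split=> //; keep s_gt0; lra.
have av : \forall n \near uf, a (v n) (t n) = (c (y n)).1.1.
  have : \forall n \near uf, a (- s) (t n) < (c (y n)).1.1 < a s (t n) \/
      a s (t n) < (c (y n)).1.1 < a (- s) (t n).
    rewrite a0 in btwa; case: btwa => /andP[h1 h2].
      by apply: filterS2 (uf_lt am ya h1) (uf_lt ya ap h2) => n h h'; left; rewrite h h'.
    by apply: filterS2 (uf_lt ap ya h1) (uf_lt ya am h2) => n h h'; right; rewrite h h'.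
  by apply: filterS => n; apply: (vP n).2.
have [vv vvs vl] : exists2 l, - s <= l <= s & v @ uf --> l.
  by apply: uf_bounded; apply: nearW => n; case: (vP n).
have zs : - s <= 0 <= s by keep s_gt0; lra.
have v0 : v @ uf --> (0 : R).
  suff <- : vv = 0 by [].
  apply: (sP vv 0 (sI _ vvs) (sI _ zs)).2; rewrite -/(a vv 0) -/(a 0 0) a0.
  by apply: uf_uniq (alim _ _ vvs vl) _; exact: uf_congr (filterS (fun n => @esym _ _ _) av) ya.
(* z n has the coordinates a and b of y n, so y n is reached from it by a short flow time u n. *)
pose z n := F (m (v n), t n).
have mv := uf_hgeod hm v0; rewrite m0 in mv.
have zx : z @ uf --> F ((0, 1), 0) := F_uf hF h01 t1 mv t0.
have same : \forall n \near uf, (c (y n)).1.1 = (c (z n)).1.1 /\ (c (y n)).2 = (c (z n)).2.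
  apply: filterS2 bt av => n e1 e2; rewrite -e1 -e2; split=> //.
  by have [_ ->] := dms _ _ (vP n).1 (tP n).1.
have /choice[u uP] : forall n, exists u, (exists u', y n = phi' u' (z n)) -> y n = phi' u (z n).
  by move=> n; have [[u' e]|ne] := pselect (exists u', y n = phi' u' (z n)); [exists u'|exists 0].
have uE : \forall n \near uf, y n = phi' (u n) (z n).
  by apply: filterS (box_same_line hc d0 yx zx ltr01 same) => n [u' _ e]; apply: uP; exists u'.
have u0 : u @ uf --> (0 : R).
  apply/ufRP => e e0; apply: filterS2 (box_same_line hc d0 yx zx e0 same) uE => n [u' u'e e1] e2.
  by rewrite subr0 (fl_inj (etrans (esym e2) e1)).
have tn n : -1 < t n < 1 by apply: rI'; case: (tP n).
have lz n w : leaf A (F ((0, 1), t n)) (phi' w (z n)).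
  by apply: leaf_trans (fl_leafU _ _); exact: F_leaf.
have /choice[q qP] : forall n, exists q, half_plane q /\ F (q, t n) = phi' (u n) (z n).
  by move=> n; have [q hq e] := F_onto hF (tn n) (lz n (u n)); exists q.
(* If this piece of orbit had leafwise length above 1, an initial piece of length exactly 1 would
   also shrink to a point in X, which [F_lim] excludes. *)
have bd : \forall n \near uf, `|os (z n) (u n)| <= 1.
  apply: contrapT => /ufN nb.
  have /choice[w wP] : forall n, exists w, 1 <= `|os (z n) (u n)| -> `|w| <= `|u n| /\ `|os (z n) w| = 1.
    move=> n; have [h|h] := pselect (1 <= `|os (z n) (u n)|); last by exists 0 => /h.
    by have [w [w1 _] w2] := os_ivt ler01 h; exists w.
  have nb1 : \forall n \near uf, `|w n| <= `|u n| /\ `|os (z n) (w n)| = 1.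
    by apply: filterS nb => n /negP; rewrite -ltNge => /ltW /wP.
  have w0 : w @ uf --> (0 : R).
    apply/ufRP => e e0; move/ufRP: u0 => /(_ e e0) u0; apply: filterS2 nb1 u0 => n [h _].
    by rewrite !subr0; exact: le_lt_trans.
  have /choice[q' q'P] : forall n, exists q, half_plane q /\ F (q, t n) = phi' (w n) (z n).
    by move=> n; have [q' hq e] := F_onto hF (tn n) (lz n (w n)); exists q'.
  have d1 : \forall n \near uf, hyp_dist (m (v n)) (q' n) = 1.
    apply: filterS nb1 => n [_ h]; have [hq e] := q'P n.
    have := F_ld hF (tn n) (hm' (v n)) hq; rewrite e -{1}(fl0 (F _)) ld_fl os0 sub0r normrN h.
    by case.
  have q'l : q' @ uf --> ((0, 1) : R * R).
    apply: (@F_lim F q' t (0, 1) (1 + 2 * s) hF h01 t0).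
      have E : \forall n \near uf, phi' (w n) (z n) = F (q' n, t n) by apply: nearW => n; case: (q'P n).
      by apply: uf_congr E _; rewrite -[X in _ --> X]fl0; exact: uf_fl.
    apply: filterS d1 => n e; have [hq _] := q'P n; split=> //; rewrite hyp_distC -m0.
    have := @hyp_tri F (m 0) (m (v n)) (q' n) hF (hm' _) (hm' _) hq; rewrite e hm.2.
    have := (vP n).1; rewrite sub0r normrN -ler_norml; keep s_gt0 => h1 h2; apply: le_trans h2 _; lra.
  have hh : \forall n \near uf, half_plane (m (v n)) /\ half_plane (q' n).
    by apply: nearW => n; split; [exact: hm'|case: (q'P n)].
  have := uf_hyp_dist h01 h01 mv q'l hh.
  rewrite hyp_distxx // => h0; have e10 : 1 = 0 :> R.
    by apply: uf_uniq h0; apply: uf_congr (@uf_const _ (1 : R)); apply: filterS d1 => n ->.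
  by move/eqP: e10; rewrite oner_eq0.
exists q, t; split=> //.
  apply: (@F_lim F q t (0, 1) (1 + 2 * s) hF h01 t0).
    by apply: uf_congr yx; apply: filterS uE => n ->; case: (qP n).
  apply: filterS bd => n e; have [hq eq] := qP n; split=> //; rewrite hyp_distC -m0.
  have := F_ld hF (tn n) (hm' (v n)) hq; rewrite eq -{1}(fl0 (F _)) ld_fl os0 sub0r normrN => -[e'].
  have := @hyp_tri F (m 0) (m (v n)) (q n) hF (hm' _) (hm' _) hq; rewrite -e' hm.2.
  have := (vP n).1; rewrite sub0r normrN -ler_norml; keep s_gt0 e => h1 h2; apply: le_trans h2 _; lra.
by apply: filterS uE => n ->; have [? ?] := qP n.
Qed.

(** Meaningful only within a leaf: [fine] turns the value +oo between distinct leaves into 0. *)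
Definition ld x y : R := fine (leaf_dist A x y).

Lemma ldE x y : leaf A x y -> leaf_dist A x y = (ld x y)%:E.
Proof. by move=> /ld_hyp[r _ e]; rewrite /ld e. Qed.

Lemma ldC x y : leaf A x y -> ld x y = ld y x.
Proof. by move=> l; rewrite /ld ld_sym. Qed.

Lemma ldD x y z : leaf A x y -> leaf A y z -> ld x z <= ld x y + ld y z.
Proof. by move=> xy yz; apply: ld_tri (ldE xy) (ldE yz) (ldE (leaf_trans xy yz)). Qed.

Lemma ld_os x s t : ld (phi' s x) (phi' t x) = `|os x s - os x t|.
Proof. by rewrite /ld ld_fl. Qed.

Lemma ld_os0 x t : ld x (phi' t x) = `|os x t|.
Proof. by rewrite -{1}(fl0 x) ld_os os0 sub0r normrN. Qed.

Lemma deck_leaf g x y : deck p g -> leaf A x y -> leaf A (g x) (g y).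
Proof.
move=> dg /leaf_joined[f [cf f0 f1 fl]]; have [cg _ _] := dg; rewrite -f0 -f1.
apply: (@leaf_lift R M X p hM hcov Wu atlasWu (fun t => g (f t))); first exact: ccomp.
by move=> t; rewrite !(deck_p _ dg) f0.
Qed.

Lemma deck_leaf_dist_le g x y : deck p g -> (leaf_dist A (g x) (g y) <= leaf_dist A x y)%E.
Proof.
move=> dg; apply: le_ereal_inf_tmp => _ [f [cf f0 f1 fl] <-].
have cg : continuous g by case: dg.
apply: ereal_inf_lbound; exists (g \o f).
  split=> /=; rewrite ?f0 ?f1 //; last by move=> t /fl; exact: deck_leaf.
  apply/subspace_continuousP => z z01; move/subspace_continuousP: cf => /(_ z z01) cf.
  by apply: cvg_comp cf _; exact: cg.
congr ereal_sup; apply/seteqP; split=> _ [n [s [hs s01 ->]]]; exists n, s; split=> //;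
  by congr (_%:E); apply: eq_bigr => i _; rewrite /= (deck_iso hmet dg).
Qed.

Lemma deck_ld g x y : deck p g -> ld (g x) (g y) = ld x y.
Proof.
move=> dg; congr fine; apply/eqP; rewrite eq_le deck_leaf_dist_le //=.
have [g' [dg' gK _]] := deck_inv dg.
by have := deck_leaf_dist_le (g x) (g y) dg'; rewrite !gK.
Qed.

(** In the coordinates around the leaf of l, the bound C keeps the second points in a compact part
    of the half plane, so they converge inside the limit leaf. *)
Lemma ld_lim (x y : nat -> X) l (C : R) : x @ uf --> l ->
  (\forall n \near uf, leaf A (x n) (y n) /\ ld (x n) (y n) <= C) ->
  exists l', [/\ y @ uf --> l', leaf A l l' & (fun n => ld (x n) (y n)) @ uf --> ld l l'].
Proof.
move=> xl xy; have [F [hF F0]] := fol_coordP l; rewrite -F0 in xl *.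
have h01 := @half_plane01 R; have t1 : -1 < (0 : R) < 1 by lra.
have [q [t [ql t0 xE]]] := F_open hF xl.
have /choice[q' qP] : forall n, exists q', x n = F (q n, t n) -> half_plane (q n) -> -1 < t n < 1 ->
    leaf A (x n) (y n) -> [/\ half_plane q', y n = F (q', t n) & hyp_dist (q n) q' = ld (x n) (y n)].
  move=> n; have [[e hq tn ln]|h] := pselect [/\ x n = F (q n, t n), half_plane (q n), -1 < t n < 1 &
      leaf A (x n) (y n)]; last by exists (0, 1) => *; case: h.
  have [|q' hq' e'] := F_onto hF tn (y := y n).
    by apply: leaf_trans ln; rewrite e; exact: F_leaf.
  by exists q' => _ _ _ _; split=> //; rewrite e -e' /ld F_ld.
have q'P : \forall n \near uf, [/\ half_plane (q n), half_plane (q' n), y n = F (q' n, t n) & hyp_dist (q n) (q' n) = ld (x n) (y n)].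
  by apply: filterS2 xy xE => n [ln _] [e hq tn]; have [] := qP n e hq tn ln.
have near1 : \forall n \near uf, hyp_dist (q n) (0, 1) < 1.
  have hh : \forall n \near uf, half_plane (q n) /\ half_plane ((0, 1) : R * R).
    by apply: filterS q'P => n [? ? _ _].
  have := uf_hyp_dist h01 h01 ql (@uf_const _ ((0, 1) : R * R)) hh; rewrite hyp_distxx //.
  by move=> /(ufRP _ _).1 /(_ 1 ltr01); apply: filterS => n; rewrite subr0; apply: le_lt_trans; exact: ler_norm.
have [|l' hl' q'l] := @hcompact R q' (C + 1).
  apply: filterS3 q'P xy near1 => n [hq hq' _ e] [_ Cn] n1; split=> //.
  apply: (le_trans (hyp_tri hF hq' hq h01)); rewrite hyp_distC e; apply: lerD => //; exact: ltW.
exists (F (l', 0)); split.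
- have E : \forall n \near uf, F (q' n, t n) = y n by apply: filterS q'P => n [].
  by apply: uf_congr E _; exact: F_uf.
- exact: F_leaf.
- have E : \forall n \near uf, hyp_dist (q n) (q' n) = ld (x n) (y n) by apply: filterS q'P => n [].
  apply: uf_congr E _; rewrite /ld F_ld //=; apply: uf_hyp_dist => //.
  by apply: filterS q'P => n [].
Qed.

(** By [ld_lim] counterexamples would converge to a pair of equal points with leafwise distance at
    least k. This replaces a uniform embedding of leaves, at the price of the bound C. *)
Lemma ld_small (C k : R) : 0 < k -> exists2 e : R, 0 < e & forall x y,
  leaf A x y -> ld x y <= C -> mdist x y < e -> ld x y < k.
Proof.
move=> k0; have [||e e0 eP] := @eps_seq R (X * X)%type (fun z => mdist z.1 z.2)
    (fun z => leaf A z.1 z.2 -> ld z.1 z.2 <= C -> ld z.1 z.2 < k).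
- by move=> z; exact: mdist_ge0.
- move=> u u0 nu.
  have nu' n : [/\ leaf A (u n).1 (u n).2, ld (u n).1 (u n).2 <= C & ~ ld (u n).1 (u n).2 < k].
    by split; [apply: contrapT => h|apply: contrapT => h|move=> h]; apply: (nu n).
  have [g [l [dg gl]]] := cocompact hM hcov hmet (fun n => (u n).1).
  have gl2 : (fun n => g n (u n).2) @ uf --> l.
    by apply: uf_close gl; apply: uf_congr u0; apply: nearW => n; rewrite (deck_iso hmet).
  have [|l' [gl' _ lim]] := @ld_lim (fun n => g n (u n).1) (fun n => g n (u n).2) l C gl.
    apply: nearW => n; have [h1 h2 _] := nu' n; split; first exact: deck_leaf.
    by rewrite deck_ld.
  have El : l' = l := uf_uniqM gl' gl2; subst l'.
  have ll0 : ld l l = 0 by rewrite -{2}(fl0 l) ld_os0 os0 normr0.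
  rewrite ll0 in lim.
  have [n h] := filter_ex ((ufRP _ _).1 lim k k0).
  have [l1 _] := nu' n; apply; move: h; rewrite deck_ld // subr0; apply: le_lt_trans; exact: ler_norm.
by exists e => // x y l h h'; exact: (eP (x, y)).
Qed.

Lemma os_pos x t : (0 < os x t) = (0 < t).
Proof.
case: (ltgtP 0 t) => [/(os_mono x)|/(os_mono x)|<-]; rewrite os0 ?ltxx //.
by move=> h; apply/negbTE; rewrite -leNgt ltW.
Qed.

Lemma os_le x s t : s <= t -> os x s <= os x t.
Proof. by rewrite le_eqVlt => /orP[/eqP -> //|/(os_mono x)/ltW]. Qed.

Lemma os_norm_le x v t : `|v| <= `|t| -> 0 <= v * t -> `|os x v| <= `|os x t|.
Proof.
have os_ge s : 0 <= s -> 0 <= os x s by move=> h; rewrite -(os0 x) os_le.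
have os_ge' s : s <= 0 -> os x s <= 0 by move=> h; rewrite -(os0 x) os_le.
have [t0|t0] := leP 0 t.
  move=> v1 v2; have v0 : 0 <= v.
    move: t0; rewrite le_eqVlt => /orP[/eqP e|t0]; last by rewrite -(pmulr_lge0 _ t0).
    by move: v1; rewrite -e normr0 normr_le0 => /eqP ->.
  by move: v1; rewrite (ger0_norm v0) (ger0_norm t0) (ger0_norm (os_ge _ v0)) (ger0_norm (os_ge _ t0)); exact: os_le.
move=> v1 v2; have v0 : v <= 0 by rewrite -(nmulr_lge0 _ t0).
move: v1; rewrite (ler0_norm v0) (ltr0_norm t0) (ler0_norm (os_ge' _ v0)) (ler0_norm (os_ge' _ (ltW t0))) !lerN2.
exact: os_le.
Qed.

(** [ld_lim] yields the limit of the leafwise distance once it is bounded. For the bound, t n is cut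
    back to a time at which the distance is exactly L, one more than the expected limit; in the
    limit this contradicts monotonicity of [os x0]. *)
Lemma os_lim (x : nat -> X) x0 (t : nat -> R) (t0 : R) : x @ uf --> x0 -> t @ uf --> t0 ->
  (fun n => os (x n) (t n)) @ uf --> os x0 t0.
Proof.
move=> xx; have lf n (v : R) : leaf A (x n) (phi' v (x n)) by exact: fl_leafU.
have main (v : nat -> R) (v0 : R) C : v @ uf --> v0 -> (\forall n \near uf, `|os (x n) (v n)| <= C) ->
    (fun n => `|os (x n) (v n)|) @ uf --> `|os x0 v0|.
  move=> vv bd; have [|l' [vl _ lim]] := @ld_lim x (fun n => phi' (v n) (x n)) x0 C xx.
    by apply: filterS bd => n h; split; rewrite ?ld_os0.
  rewrite (uf_uniqM vl (uf_fl vv xx)) in lim; rewrite ld_os0 in lim.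
  by apply: uf_congr lim; apply: nearW => n; rewrite ld_os0.
move=> tt; set L := `|os x0 t0| + 1.
have L0 : 0 <= L by rewrite /L addr_ge0.
have bd : \forall n \near uf, `|os (x n) (t n)| <= L.
  apply: contrapT => /ufN nb.
  have /choice[v vP] : forall n, exists v, L <= `|os (x n) (t n)| ->
      [/\ `|v| <= `|t n|, 0 <= v * t n & `|os (x n) v| = L].
    move=> n; have [h|h] := pselect (L <= `|os (x n) (t n)|); last by exists 0 => /h.
    by have [v [v1 v2] v3] := os_ivt L0 h; exists v.
  have nb1 : \forall n \near uf, [/\ `|v n| <= `|t n|, 0 <= v n * t n & `|os (x n) (v n)| = L].
    by apply: filterS nb => n /negP; rewrite -ltNge => /ltW /vP.
  have tbd : \forall n \near uf, `|t n| < `|t0| + 1.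
    move/ufRP: tt => /(_ 1 ltr01); apply: filterS => n; have := ler_normB (t n) t0.
    have := ler_dist_dist (t n) t0; rewrite ler_norml; lra.
  have [v0 _ vv] : exists2 l, - (`|t0| + 1) <= l <= `|t0| + 1 & v @ uf --> l.
    apply: uf_bounded; apply: filterS2 nb1 tbd => n [h _ _] h'; rewrite -ler_norml.
    by apply: le_trans h _; exact: ltW.
  have lim : (fun n => `|os (x n) (v n)|) @ uf --> `|os x0 v0|.
    by apply: (main v v0 L vv); apply: filterS nb1 => n [_ _ ->].
  have E : L = `|os x0 v0|.
    apply: uf_uniq lim; apply: uf_congr (@uf_const _ L); by apply: filterS nb1 => n [_ _ ->].
  have v1 : `|v0| <= `|t0|.
    by apply: (uf_le (cvg_norm vv) (cvg_norm tt)); apply: filterS nb1 => n [].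
  have v2 : 0 <= v0 * t0.
    by apply: (uf_le (@uf_const _ (0 : R)) (cvgM vv tt)); apply: filterS nb1 => n [].
  have := os_norm_le x0 v1 v2.
  by rewrite -E /L; lra.
have lim := main t t0 L tt bd.
have [t00|t00|t00] := ltgtP 0 t0.
- rewrite gtr0_norm ?os_pos // in lim; apply: uf_congr lim.
  by apply: filterS (uf_lt (@uf_const _ (0 : R)) tt t00) => n h; rewrite gtr0_norm ?os_pos.
- have neg y s : s < 0 -> os y s < 0 by rewrite -{2}(os0 y); exact: os_mono.
  rewrite (ltr0_norm (neg _ _ t00)) in lim.
  have E : \forall n \near uf, - `|os (x n) (t n)| = os (x n) (t n).
    by apply: filterS (uf_lt tt (@uf_const _ (0 : R)) t00) => n h; rewrite ltr0_norm ?opprK ?neg.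
  by rewrite -[os x0 t0]opprK; apply: uf_congr E _; exact: cvgN.
- rewrite -t00 os0 normr0 in lim *; apply/ufRP => e e0; move/ufRP: lim => /(_ e e0).
  by apply: filterS => n; rewrite !subr0 normr_id.
Qed.

Lemma og_lim (x : nat -> X) x0 (s : nat -> R) (s0 : R) : x @ uf --> x0 -> s @ uf --> s0 ->
  (fun n => og (x n) (s n)) @ uf --> og x0 s0.
Proof.
move=> xx ss; have /choice[t tP] : forall n, exists t, os (x n) t = s n by move=> n; exact: os_onto.
have [t0 t0P] := os_onto x0 s0.
have tt : t @ uf --> t0.
  apply/ufRP => e e0.
  have lo : os x0 (t0 - e) < s0 by rewrite -t0P; apply: os_mono; rewrite ltrBlDr ltrDl.
  have hi : s0 < os x0 (t0 + e) by rewrite -t0P; apply: os_mono; rewrite ltrDl.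
  apply: filterS2 (uf_lt (os_lim xx (@uf_const _ (t0 - e))) ss lo) (uf_lt ss (os_lim xx (@uf_const _ (t0 + e))) hi) => n.
  rewrite -(tP n) => h1 h2; rewrite ltr_norml.
  have k1 : t0 - e < t n by rewrite ltNge; apply/negP => /(os_le (x n)); rewrite leNgt h1.
  have k2 : t n < t0 + e by rewrite ltNge; apply/negP => /(os_le (x n)); rewrite leNgt h2.
  by keep k1 k2; lra.
have := uf_fl tt xx; rewrite -ogE t0P; apply: uf_congr.
by apply: nearW => n; rewrite -ogE tP.
Qed.

(** ** Local product structure *)

(* b = true refers to the stable foliation, b = false to the unstable one; cb b c is the coordinate
   of a box c that is transverse to the foliation Wf b. *)
Definition Wf (b : bool) := if b then Ws else Wu.
Definition cb (b : bool) (c : fchart3 R X) (y : X) : R := if b then (c y).1.1 else (c y).2.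
Definition Rel (b : bool) (e : R) (x y : X) := exists g : R -> X, [/\ continuous g, g 0 = x, g 1 = y &
  forall t, leaf (Wf b) (p x) (p (g t)) /\ mdist x (g t) < e].
(* The closure of Rel b e; unlike Rel it allows a compactness argument (unif_Rel). *)
Definition Rel' (b : bool) (e : R) (x y : X) := exists u v : nat -> X,
  [/\ u @ uf --> x, v @ uf --> y & \forall n \near uf, Rel b e (u n) (v n)].

Lemma Rel_mdist b e x y : Rel b e x y -> mdist x y < e.
Proof. by move=> [g [_ _ <- /(_ 1) []]]. Qed.

Lemma Rel_le b e e' x y : e <= e' -> Rel b e x y -> Rel b e' x y.
Proof.
by move=> ee [g [cg g0 g1 gP]]; exists g; split=> // t; have [h1 h2] := gP t; split=> //; exact: lt_le_trans ee.
Qed.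

Lemma RelW b e x y : Rel b e x y -> Rel' b e x y.
Proof. by move=> h; exists (fun=> x), (fun=> y); split; [exact: uf_const|exact: uf_const|exact: nearW]. Qed.

Lemma Rel_deck b e g x y : deck p g -> Rel b e x y -> Rel b e (g x) (g y).
Proof.
move=> dg [f [cf f0 f1 fP]]; have [cg _ _] := dg; exists (fun t => g (f t)); rewrite f0 f1.
by split=> // [|t]; [exact: ccomp|rewrite !(deck_p _ dg) (deck_iso hmet dg)].
Qed.

Lemma Rel_unfold b e x y : Rel b e x y -> forall c, xbox c -> (forall w, mdist x w < e -> dom c w) ->
  cb b c x = cb b c y.
Proof.
move=> [g [cg g0 g1 gP]] c hc dc; have h t : dom c (g t) by apply: dc; case: (gP t).
rewrite -g0 -g1; move: gP; rewrite /cb /Wf; case: b => gP.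
  by apply: (@box_S c hc g (p x) (-1) 2 cg _ 0 1); [move=> t _; case: (gP t)|exact: itv02|exact: itv12].
by apply: (@box_U c hc g (p x) (-1) 2 cg _ 0 1); [move=> t _; case: (gP t)|exact: itv02|exact: itv12].
Qed.

Definition seg (c : fchart3 R X) y z (t : R) : X :=
  cinv c (((c y).1.1 + clamp t * ((c z).1.1 - (c y).1.1), (c y).1.2 + clamp t * ((c z).1.2 - (c y).1.2)),
    (c y).2 + clamp t * ((c z).2 - (c y).2)).

Lemma seg_dom c y z t : dom c (seg c y z t). Proof. exact: cinv_dom. Qed.

Lemma seg_cts c y z : continuous (seg c y z).
Proof.
move=> t; apply: uf_cts => u ut; apply: (@cts_uf _ _ (cinv c)); first exact: cinv_continuous.
have h (a b : R) : (fun n => a + clamp (u n) * b) @ uf --> a + clamp t * b.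
  apply: cvgD; first exact: uf_const.
  by apply: cvgM; [exact: cts_uf (@clamp_continuous R t) ut|exact: uf_const].
by apply: uf_pair; [apply: uf_pair|]; exact: h.
Qed.

Lemma cE (c : fchart3 R X) (y : X) : c y = (((c y).1.1, (c y).1.2), (c y).2).
Proof. by rewrite -!surjective_pairing. Qed.

Lemma seg0 c y z : dom c y -> seg c y z 0 = y.
Proof. by move=> dy; rewrite /seg clamp0 !mul0r !addr0 -cE cmapK. Qed.

Lemma seg1 c y z : dom c z -> seg c y z 1 = z.
Proof. by move=> dz; rewrite /seg clamp1 !mul1r !subrKC -cE cmapK. Qed.

Lemma seg_cb b c y z t : cb b c (seg c y z t) = cb b c y + clamp t * (cb b c z - cb b c y).
Proof. by rewrite /cb /seg cinvK; case: b. Qed.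

Lemma seg_leaf b c y z : xbox c -> cb b c y = cb b c z -> dom c y -> forall t, leaf (Wf b) (p y) (p (seg c y z t)).
Proof.
move=> hc e dy t; rewrite -{1}(seg0 z dy).
have h s : dom c (seg c y z s) /\ cb b c (seg c y z s) = cb b c (seg c y z 0).
  by split; [exact: seg_dom|rewrite !seg_cb e subrr !mulr0].
rewrite /Wf; move: h; rewrite /cb; case: b {e} => h.
  exact: (@box_leafS c hc _ (@seg_cts c y z) h).
exact: (@box_leafU c hc _ (@seg_cts c y z) h).
Qed.

Lemma seg_lim c (y z : nat -> X) l (t : nat -> R) : dom c l -> y @ uf --> l -> z @ uf --> l ->
  (fun n => seg c (y n) (z n) (t n)) @ uf --> l.
Proof.
move=> dl yl zl; have [a1 b1 c1] := uf_chart dl yl; have [a2 b2 c2] := uf_chart dl zl.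
have [k _ tk] : exists2 k, 0 <= k <= 1 & (fun n => clamp (t n)) @ uf --> (k : R).
  by apply: uf_bounded; apply: nearW => n; exact: clamp_itv.
have h (u v : nat -> R) (w : R) : u @ uf --> w -> v @ uf --> w ->
    (fun n => u n + clamp (t n) * (v n - u n)) @ uf --> w.
  move=> uw vw; have -> : w = w + k * (w - w) by rewrite subrr mulr0 addr0.
  by apply: cvgD => //; apply: cvgM => //; apply: cvgB.
rewrite -[X in _ --> X](cmapK dl); apply: (@cts_uf _ _ (cinv c)); first exact: cinv_continuous.
by rewrite cE; apply: uf_pair; [apply: uf_pair|]; exact: h.
Qed.

Lemma Rel_of_box b c l (y z : nat -> X) e : xbox c -> dom c l -> y @ uf --> l -> z @ uf --> l -> 0 < e ->
  (\forall n \near uf, cb b c (y n) = cb b c (z n)) -> \forall n \near uf, Rel b e (y n) (z n).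
Proof.
move=> hc dl yl zl e0 yz.
have /choice[t tP] : forall n, exists t, (exists s, ~ mdist (y n) (seg c (y n) (z n) s) < e) ->
    ~ mdist (y n) (seg c (y n) (z n) t) < e.
  by move=> n; have [[s h]|h] := pselect (exists s, ~ mdist (y n) (seg c (y n) (z n) s) < e); [exists s|exists 0].
have lim := uf_mdist yl (seg_lim t dl yl zl); rewrite mdistxx in lim.
have lim' := (ufRP _ _).1 lim e e0.
near=> n.
have dy : dom c (y n) by near: n; exact: uf_dom dl yl.
have dz : dom c (z n) by near: n; exact: uf_dom dl zl.
exists (seg c (y n) (z n)); split; [exact: seg_cts|exact: seg0|exact: seg1|move=> s; split].
  by apply: seg_leaf => //; near: n.
apply: contrapT => ns; apply: (tP n); first by exists s.
have : `|mdist (y n) (seg c (y n) (z n) (t n)) - 0| < e by near: n.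
by rewrite subr0; apply: le_lt_trans; exact: ler_norm.
Unshelve. all: by end_near. Qed.

Lemma unif_close (P : X -> X -> Prop) : (forall g x y, deck p g -> P (g x) (g y) -> P x y) ->
  (forall (l : X) (x y : nat -> X), x @ uf --> l -> y @ uf --> l -> \forall n \near uf, P (x n) (y n)) ->
  exists2 e : R, 0 < e & forall x y, mdist x y < e -> P x y.
Proof.
move=> inv H; have [||e e0 eP] := @eps_seq R (X * X)%type (fun z => mdist z.1 z.2) (fun z => P z.1 z.2).
- by move=> z; exact: mdist_ge0.
- move=> u u0 nu; have [g [l [dg gl]]] := cocompact hM hcov hmet (fun n => (u n).1).
  have gl2 : (fun n => g n (u n).2) @ uf --> l.
    by apply: uf_close gl; apply: uf_congr u0; apply: nearW => n; rewrite (deck_iso hmet).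
  have [n /(inv _ _ _ (dg n)) h] := filter_ex (H _ _ _ gl gl2); exact: (nu n).
by exists e => // x y h; exact: (eP (x, y)).
Qed.

Lemma Rel'_mdist b e x y : Rel' b e x y -> mdist x y <= e.
Proof.
move=> [u [v [ux vy uv]]]; apply: (uf_le (uf_mdist ux vy) (@uf_const _ e)).
by apply: filterS uv => n /Rel_mdist/ltW.
Qed.

Lemma Rel'_deck b e g x y : deck p g -> Rel' b e x y -> Rel' b e (g x) (g y).
Proof.
move=> dg [u [v [ux vy uv]]]; have [cg _ _] := dg; exists (g \o u), (g \o v); split.
- by apply: (@cts_uf _ _ g u); [exact: cg|].
- by apply: (@cts_uf _ _ g v); [exact: cg|].
by apply: filterS uv => n; exact: Rel_deck.
Qed.

Lemma Rel'_box b e x y c (r : R) l : xbox c -> (forall w, mdist l w < r -> dom c w) ->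
  mdist l x + e < r -> Rel' b e x y -> cb b c x = cb b c y.
Proof.
move=> hc rc lx xy; have [u [v [ux vy uv]]] := xy.
have dx : dom c x by apply: rc; apply: le_lt_trans lx; rewrite lerDl; apply: le_trans (Rel'_mdist xy); exact: mdist_ge0.
have dy : dom c y.
  by apply: rc; apply: le_lt_trans (metric_triangle l x y) _; apply: le_lt_trans lx; rewrite lerD2l; exact: Rel'_mdist xy.
have h (w : nat -> X) w0 : dom c w0 -> w @ uf --> w0 -> (fun n => cb b c (w n)) @ uf --> cb b c w0.
  by move=> dw ww; have [? _ ?] := uf_chart dw ww; rewrite /cb; case: b {xy uv}.
have nearu := uf_lt (uf_mdist (@uf_const _ l) ux) (@uf_const _ (r - e)).
apply: uf_uniq (h _ _ dx ux) _; apply: uf_congr (h _ _ dy vy).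
have lt : mdist l x < r - e by rewrite ltrBrDr.
apply: filterS2 (nearu lt) uv => n h1 /Rel_unfold h2; apply/esym/h2 => // w h3.
by apply: rc; apply: le_lt_trans (metric_triangle l (u n) w) _; lra.
Qed.

(** Pairs related at scales tending to 0 can be moved to converge to one point l, and a box about l
    gives them equal transverse coordinates. Only such pairs have to be examined. *)
Lemma unif_Rel b (P : R -> X -> X -> Prop) : (forall g e x y, deck p g -> P e (g x) (g y) -> P e x y) ->
  (forall c l x y (e : nat -> R), xbox c -> dom c l -> x @ uf --> l -> y @ uf --> l -> e @ uf --> (0 : R) ->
    (forall n, 0 < e n) -> (\forall n \near uf, cb b c (x n) = cb b c (y n)) -> \forall n \near uf, P (e n) (x n) (y n)) ->
  exists2 e0 : R, 0 < e0 & forall e, 0 < e < e0 -> forall x y, Rel' b e x y -> P e x y.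
Proof.
move=> inv H; have [||e0 e00 eP] := @eps_seq R (R * (X * X))%type (fun z => `|z.1|)
   (fun z => 0 < z.1 -> Rel' b z.1 z.2.1 z.2.2 -> P z.1 z.2.1 z.2.2).
- by [].
- move=> u u0 nu.
  have nu' n : [/\ 0 < (u n).1, Rel' b (u n).1 (u n).2.1 (u n).2.2 & ~ P (u n).1 (u n).2.1 (u n).2.2].
    by split; [apply: contrapT => h|apply: contrapT => h|move=> h]; apply: (nu n).
  have [g [l [dg gl]]] := cocompact hM hcov hmet (fun n => (u n).2.1).
  have e0 : (fun n => (u n).1) @ uf --> (0 : R).
    apply/ufRP => e eg; move/ufRP: u0 => /(_ e eg); apply: filterS => n.
    by rewrite !subr0 normr_id.
  have gl2 : (fun n => g n (u n).2.2) @ uf --> l.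
    apply: uf_close gl; apply: uf_squeeze e0; apply: nearW => n.
    by rewrite mdist_ge0 (deck_iso hmet) //; have [_ /Rel'_mdist] := nu' n.
  have [c hc dl] := xboxP l; have /nbhsMP[r r0 rc] := chart_nbhs dl.
  have same : \forall n \near uf, cb b c (g n (u n).2.1) = cb b c (g n (u n).2.2).
    have lim : (fun n => mdist l (g n (u n).2.1) + (u n).1) @ uf --> mdist l l + 0.
      by apply: cvgD => //; exact: uf_mdist (@uf_const _ l) gl.
    rewrite mdistxx addr0 in lim.
    apply: filterS (uf_lt lim (@uf_const _ r) r0) => n h.
    by apply: (Rel'_box hc rc h); apply: Rel'_deck => //; case: (nu' n).
  have [n /(inv _ _ _ _ (dg n)) h] := filter_ex (H c l _ _ _ hc dl gl gl2 e0 (fun n => let: And3 h _ _ := nu' n in h) same).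
  by case: (nu' n).
exists e0 => // e /andP[eg ee] x y h; apply: (eP (e, (x, y))) => //=.
by rewrite gtr0_norm.
Qed.

Lemma deck_back g x y (P : X -> X -> Prop) : (forall g x y, deck p g -> P x y -> P (g x) (g y)) ->
  deck p g -> P (g x) (g y) -> P x y.
Proof. by move=> H dg h; have [g' [dg' gK _]] := deck_inv dg; rewrite -(gK x) -(gK y); exact: H. Qed.

Lemma Rel_closed b (e : R) : 0 < e -> exists2 d : R, 0 < d & forall x y, Rel' b d x y -> Rel b e x y.
Proof.
move=> e0; have [||d d0 dP] := @unif_Rel b (fun _ => Rel b e).
- by move=> g _ x y dg; apply: deck_back => // *; exact: Rel_deck.
- by move=> c l x y _ hc dl xl yl _ _ same; exact: Rel_of_box hc dl xl yl e0 same.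
by exists (d / 2) => [|x y]; [lra|apply: dP; lra].
Qed.

(** In a box, the point with the coordinates (a, tau) of x and b of y serves as w. *)
Lemma local_product (e : R) : 0 < e -> exists2 d : R, 0 < d & forall x y, mdist x y < d ->
  exists w, Rel true e x w /\ Rel false e w y.
Proof.
move=> e0; apply: unif_close => [g x y dg [w [h1 h2]]|l x y xl yl].
  have [g' [dg' gK g'K]] := deck_inv dg; exists (g' w); rewrite -(gK x) -(gK y).
  by split; exact: Rel_deck.
have [c hc dl] := xboxP l.
pose w n := cinv c (((c (x n)).1.1, (c (x n)).1.2), (c (y n)).2).
have wE n : c (w n) = (((c (x n)).1.1, (c (x n)).1.2), (c (y n)).2) by rewrite /w cinvK.
have wl : w @ uf --> l.
  rewrite -[X in _ --> X](cmapK dl); apply: (@cts_uf _ _ (cinv c)); first exact: cinv_continuous.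
  have [a1 b1 _] := uf_chart dl xl; have [_ _ c2] := uf_chart dl yl.
  by rewrite cE; apply: uf_pair => //; exact: uf_pair.
have h1 : \forall n \near uf, Rel true e (x n) (w n).
  by apply: (Rel_of_box hc dl xl wl e0); apply: nearW => n; rewrite /cb wE.
have h2 : \forall n \near uf, Rel false e (w n) (y n).
  by apply: (Rel_of_box hc dl wl yl e0); apply: nearW => n; rewrite /cb wE.
by apply: filterS2 h1 h2 => n; exists (w n).
Qed.

Lemma Rel_leafA e x y : Rel false e x y -> leaf A x y.
Proof.
move=> [g [cg <- <- gP]]; apply: (leaf_lift hM hcov atlasWu) => // t.
by case: (gP t); rewrite /Wf.
Qed.

(** In hyperbolic coordinates around a limit leaf, equal b means equal t by [F_box]. Both points
    then lie in one half plane, where convergence to the same point makes their distance small. *)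
Lemma Rel_ld (k : R) : 0 < k -> exists2 e : R, 0 < e & forall x y, Rel false e x y -> leaf A x y /\ ld x y < k.
Proof.
move=> k0; have [||d d0 dP] := @unif_Rel false (fun _ x y => leaf A x y -> ld x y < k).
- move=> g _ x y dg h l; rewrite -(deck_ld _ _ dg); apply: h; exact: deck_leaf.
- move=> c l x y _ hc dl xl yl _ _ same.
  have [F [hF F0]] := fol_coordP l; have h01 := @half_plane01 R.
  rewrite -F0 in dl xl yl; have t1 : -1 < (0 : R) < 1 by lra.
  have [r /andP[r0 r1] [rP rinj]] := F_box hF hc dl.
  have [q [t [q0 t0 E]]] := F_open hF xl; have [q' [t' [q'0 t'0 E']]] := F_open hF yl.
  have small (v : nat -> R) (v0 : R) : v @ uf --> v0 -> \forall n \near uf, `|v n - v0| <= r.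
    by move=> /ufRP /(_ r r0); apply: filterS => n /ltW.
  have hh : \forall n \near uf, half_plane (q n) /\ half_plane (q' n).
    by apply: filterS2 E E' => n [_ ? _] [_ ? _].
  have := uf_hyp_dist h01 h01 q0 q'0 hh; rewrite hyp_distxx // => /ufRP/(_ k k0) dist.
  near=> n => _.
  have [e hq tn] : [/\ x n = F (q n, t n), half_plane (q n) & -1 < t n < 1] by near: n.
  have [e' hq' tn'] : [/\ y n = F (q' n, t' n), half_plane (q' n) & -1 < t' n < 1] by near: n.
  have tr : `|t n| <= r by rewrite -[t n]subr0; near: n; exact: small t0.
  have tr' : `|t' n| <= r by rewrite -[t' n]subr0; near: n; exact: small t'0.
  have [|//|_ _ b1] := rP (q n) (t n) _ _ tr.
  + by rewrite -[(q n).1]subr0; near: n; exact: small (uf_fst q0).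
  + by near: n; exact: small (uf_snd q0).
  have [|//|_ _ b2] := rP (q' n) (t' n) _ _ tr'.
  + by rewrite -[(q' n).1]subr0; near: n; exact: small (uf_fst q'0).
  + by near: n; exact: small (uf_snd q'0).
  have same' : (c (x n)).2 = (c (y n)).2 by near: n.
  rewrite e e' b1 b2 in same'; have tt := rinj _ _ tr tr' same'.
  rewrite e e' -tt /ld F_ld //=; apply: le_lt_trans (ler_norm _) _; rewrite -[hyp_dist _ _]subr0.
  by near: n.
exists (d / 2) => [|x y h]; first lra.
by have l := Rel_leafA h; split=> //; apply: (dP (d / 2) _ x y (RelW h) l); lra.
Unshelve. all: by end_near. Qed.

(** ** Expansivity *)

(** Expansivity only speaks of increasing homeomorphisms of R. This one follows sigma in positive
    time and passes through the tracking times [- r n] at [- (h * n)]; the bounds on the increments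
    make it increasing and onto. *)
Lemma glue_homeo (r : nat -> R) (h : R) (sigma : R -> R) : r 0%N = 0 -> 0 < h ->
  (forall n, h / 2 <= r n.+1 - r n <= 3 * h / 2) -> incr_homeo sigma -> sigma 0 = 0 ->
  exists s, [/\ incr_homeo s, forall t, 0 <= t -> s t = sigma t & forall t, 0 <= t -> s (- (h * t)) = - pl r t].
Proof.
move=> r0 h0 inc [cs ms os_] s0.
have pl00 : pl r 0 = 0 by rewrite pl0.
have plm s t : 0 <= s -> s <= t -> h / 2 * (t - s) <= pl r t - pl r s.
  by move=> s_0 st; have /andP[] := pl_incr inc s_0 st.
pose q t : R := Num.max (- t / h) 0.
have q0 t : 0 <= q t by rewrite /q le_max lexx orbT.
have qE t : t <= 0 -> q t = - t / h.
  by move=> t0; apply/max_idPl; rewrite divr_ge0 ?oppr_ge0 // ltW.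
have qc (u : nat -> R) (t : R) : u @ uf --> t -> (fun n => q (u n)) @ uf --> q t.
  move=> ut; apply: cvg_maxr; last exact: uf_const.
  by apply: cvgM; [exact: cvgN|exact: uf_const].
have cf : continuous (fun t => - pl r (q t)).
  move=> t; apply: uf_cts => u ut; apply: cvgN.
  by apply: (@uf_pl _ (fun=> r) r) => // [k|]; [exact: uf_const|exact: qc].
pose f t := if t <= 0 then - pl r (q t) else sigma t.
have q00 : q 0 = 0 by rewrite qE // oppr0 mul0r.
have pos s t : 0 <= s -> s < t -> pl r s < pl r t.
  move=> s_0 st; rewrite -subr_gt0; apply: lt_le_trans (plm _ _ s_0 (ltW st)).
  by rewrite mulr_gt0 ?subr_gt0 // divr_gt0.
have fneg t : t <= 0 -> f t <= 0.
  move=> t0; rewrite /f t0 oppr_le0 -pl00; case: (ltgtP 0 (q t)) (q0 t) => // [/(pos _ _ (lexx _))/ltW //|<- //].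
have spos t : 0 < t -> 0 < sigma t by rewrite -{2}s0; exact: ms.
exists f; split.
- split.
  + by apply: (pw_continuous cf cs); rewrite q00 pl00 oppr0 s0.
  + move=> s t st; have [t0|t0] := leP t 0.
      have s0' : s < 0 by exact: lt_le_trans t0.
      rewrite /f t0 (ltW s0') ltrN2 !qE ?(ltW s0') //; apply: pos.
        by rewrite divr_ge0 ?oppr_ge0 // ltW.
      by rewrite ltr_pM2r ?invr_gt0 // ltrN2.
    have -> : f t = sigma t by rewrite /f leNgt t0.
    have [s0'|s0'] := leP s 0; last by rewrite /f leNgt s0' /=; exact: ms.
    exact: le_lt_trans (fneg _ s0') (spos _ t0).
  + move=> y; have [y0|y0] := leP y 0; last first.
      have [x e] := os_ y; exists x; rewrite /f; case: leP => // x0.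
      suff : y <= 0 by rewrite leNgt y0.
      rewrite -e -s0; move: x0; rewrite le_eqVlt => /orP[/eqP -> //|/ms/ltW //].
    (* The interpolated part has slope at least 1/2, so y is attained between the times 2 y and
       0. *)
    have b0 : 2 * y <= 0 by rewrite pmulr_rle0.
    have [|||x x0 <-] := @ivt R (fun t => - pl r (q t)) (2 * y) 0 y; [by []|by move=> x _; exact: cf| |].
      left; rewrite q00 pl00 oppr0 y0 andbT lerNl qE //.
      have := plm 0 (- (2 * y) / h); rewrite pl00 !subr0 => hh.
      have h1 : 0 <= - (2 * y) / h by rewrite divr_ge0 ?oppr_ge0 // ltW.
      apply: le_trans (hh (lexx _) h1); rewrite le_eqVlt; apply/orP; left; apply/eqP; field.
      exact: lt0r_neq0.
    by exists x; rewrite /f; case/andP: x0 => _ ->.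
- move=> t; rewrite le_eqVlt => /orP[/eqP <-|t0]; last by rewrite /f leNgt t0.
  by rewrite /f lexx q00 pl00 oppr0 s0.
- move=> t t0; have ht : - (h * t) <= 0 by rewrite oppr_le0 mulr_ge0 // ltW.
  by rewrite /f ht qE // opprK [h * t]mulrC mulfK // lt0r_neq0.
Qed.

(* psi b is the direction of the flow that contracts the leaves of Wf b. *)
Definition sg (b : bool) (t : R) := if b then t else - t.
Definition psi b t (x : X) := phi' (sg b t) x.

Lemma psi0 b x : psi b 0 x = x. Proof. by rewrite /psi /sg; case: b; rewrite ?oppr0 fl0. Qed.
Lemma psiD b s t x : psi b (s + t) x = psi b s (psi b t x).
Proof. by rewrite /psi /sg; case: b; rewrite ?opprD flD. Qed.
Lemma sgK b : involutive (sg b). Proof. by move=> t; rewrite /sg; case: b; rewrite ?opprK. Qed.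
Lemma norm_sg b t : `|sg b t| = `|t|. Proof. by rewrite /sg; case: b; rewrite ?normrN. Qed.
Lemma sg_psi b t x : phi' t x = psi b (sg b t) x. Proof. by rewrite /psi sgK. Qed.
Lemma uf_psi b (t : nat -> R) (x : nat -> X) (t0 : R) (x0 : X) : t @ uf --> t0 -> x @ uf --> x0 ->
  (fun n => psi b (t n) (x n)) @ uf --> psi b t0 x0.
Proof. by move=> tt xx; apply: uf_fl => //; rewrite /sg; case: b => //; exact: cvgN. Qed.
Lemma psi_deck b g t x : deck p g -> psi b t (g x) = g (psi b t x). Proof. exact: deck_fl. Qed.

Lemma stable_psi b : exists2 e0 : R, 0 < e0 & forall e, 0 < e < e0 ->
  stable_at_scale (fun t => phi (sg b t)) (leaf (Wf b)) e.
Proof.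
have [_ _ _ _ [e0 e00 eP]] := hanosov; exists e0 => // e /eP [h1 h2].
by rewrite /sg /Wf; case: b.
Qed.

Lemma local_leafP (L : M -> set M) e x y : local_leaf L e x y <->
  exists C, [/\ C x, C y, connected C & forall w, C w -> L x w /\ mdist x w < e].
Proof.
split=> [[C [Cx CL cC] Cy]|[C [Cx Cy cC CL]]].
  by exists C; split=> // w /CL [].
by exists C => //; split=> // w /CL.
Qed.

(** The counterpart of [countable_const] for connected sets, since a local leaf is a connected
    component and not known to be joined by paths. *)
Lemma conn_const (C : set M) (f : M -> R) (B : set R) : connected C ->
  (forall w, C w -> {for w, continuous f}) -> countable B -> (forall w, C w -> B (f w)) ->
  forall w w', C w -> C w' -> f w = f w'.
Proof.
move=> cC cf cB fB.
have cf' : {within C, continuous f}.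
  apply/subspace_continuousP => w Cw; apply: cvg_trans (cf w Cw); exact: cvg_app (cvg_within _).
have /connected_intervalP I : connected (f @` C) by exact: connected_continuous_connected.
have main w w' : C w -> C w' -> f w < f w' -> False.
  move=> Cw Cw' lt; apply: (countable_itvN cB lt) => v vI.
  by have [z Cz <-] : (f @` C) v; [apply: (I (f w) (f w')); [exists w|exists w'|]|exact: fB].
move=> w w' Cw Cw'; case: (ltgtP (f w) (f w')) => // h; [case: (main w w')|case: (main w' w)] => //.
Qed.

(** On a connected subset of one orbit, in one stable and one unstable leaf, both transverse
    coordinates take countably many values and are constant; [box_same_line] then gives a short flow
    time. *)
Lemma orbit_component b (h : R) : 0 < h -> exists2 e0 : R, 0 < e0 & forall e, 0 < e < e0 -> forall x y,
  Rel' b e x y -> local_leaf (on_orbit phi) e (p x) (p y) -> exists2 u, `|u| < h & y = phi' u x.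
Proof.
move=> h0; apply: (@unif_Rel b (fun e x y => local_leaf (on_orbit phi) e (p x) (p y) ->
  exists2 u, `|u| < h & y = phi' u x)).
- move=> g e x y dg H lx; have [g' [_ gK _]] := deck_inv dg.
  have [|u uh e'] := H; first by rewrite !(deck_p _ dg).
  by exists u => //; rewrite -(gK y) e' deck_fl // gK.
- move=> c l x y e hc dl xl yl e0 eg _; have [cs [cu [Cs Cu dP _]]] := hc.
  have cp := cover_cts hcov; have [ds du _ _] := dP _ dl.
  have /nbhsMP[r r0 rc] : nbhs (p l) (dom cs `&` dom cu) by apply: filterI; exact: chart_nbhs.
  have px : (fun n => p (x n)) @ uf --> p l := cts_uf (cp l) xl.
  have lim : (fun n => mdist (p l) (p (x n)) + e n) @ uf --> mdist (p l) (p l) + 0.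
    by apply: cvgD => //; exact: uf_mdist (@uf_const _ (p l)) px.
  rewrite mdistxx addr0 in lim.
  pose Q n := local_leaf (on_orbit phi) (e n) (p (x n)) (p (y n)).
  apply: contrapT => /ufN bad.
  have Qn : \forall n \near uf, Q n.
    by apply: filterS bad => n nq; apply: contrapT => nQ; apply: nq.
  have same : \forall n \near uf, (c (y n)).1.1 = (c (x n)).1.1 /\ (c (y n)).2 = (c (x n)).2.
    near=> n.
    have /local_leafP[C [Cx Cy cC CL]] : Q n by near: n.
    have near_ : mdist (p l) (p (x n)) + e n < r by near: n; exact: uf_lt lim (@uf_const _ r) r0.
    have dC w : C w -> dom cs w /\ dom cu w.
      move=> /CL [_ h1]; apply: rc; apply: le_lt_trans (metric_triangle _ (p (x n)) _) _.
      by apply: lt_trans near_; rewrite ltrD2l.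
    have dx : dom c (x n) by near: n; exact: uf_dom dl xl.
    have dy : dom c (y n) by near: n; exact: uf_dom dl yl.
    have [_ _ ex ax] := dP _ dx; have [_ _ ey ay] := dP _ dy; rewrite -ax -ay ey ex; split.
      have h1 w : C w -> {for w, continuous (fun w => (cs w).2)} by move=> /dC[d _]; exact: chart_snd.
      have h2 w : C w -> [set v | exists y, [/\ leaf Ws (p (x n)) y, dom cs y & (cs y).2 = v]] (cs w).2.
        move=> Cw; exists w; split=> //; last by case: (dC w Cw).
        by have [[t ->] _] := CL _ Cw; rewrite -pfl; exact: orbit_leafS.
      exact: (conn_const cC h1 (leaf_countable atlasWs compactM (p (x n)) Cs) h2 Cy Cx).
    have h1 w : C w -> {for w, continuous (fun w => (cu w).2)} by move=> /dC[_ d]; exact: chart_snd.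
    have h2 w : C w -> [set v | exists y, [/\ leaf Wu (p (x n)) y, dom cu y & (cu y).2 = v]] (cu w).2.
      move=> Cw; exists w; split=> //; last by case: (dC w Cw).
      by have [[t ->] _] := CL _ Cw; rewrite -pfl; apply: leaf_proj; exact: fl_leafU.
    exact: (conn_const cC h1 (leaf_countable atlasWu compactM (p (x n)) Cu) h2 Cy Cx).
  have [n [ex nex]] := filter_ex (filterI (box_same_line hc dl yl xl h0 same) bad).
  by apply: nex.
Unshelve. all: by end_near. Qed.

Lemma no_short_return (h T : R) : 0 < h -> exists2 e : R, 0 < e &
  forall u x, `|u| <= T -> mdist x (phi' u x) < e -> `|u| < h.
Proof.
move=> h0; have [||e e0 eP] := @eps_seq R (R * X)%type (fun z => mdist z.2 (phi' z.1 z.2))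
  (fun z => `|z.1| <= T -> `|z.1| < h).
- by move=> z; exact: mdist_ge0.
- move=> u u0 nu; have nu' n : `|(u n).1| <= T /\ ~ `|(u n).1| < h.
    by split; [apply: contrapT => hh|move=> hh]; apply: (nu n).
  have [g [l [dg gl]]] := cocompact hM hcov hmet (fun n => (u n).2).
  have [t _ ut] : exists2 t, - T <= t <= T & (fun n => (u n).1) @ uf --> t.
    by apply: uf_bounded; apply: nearW => n; rewrite -ler_norml; case: (nu' n).
  have lim : (fun n => mdist (g n (u n).2) (phi' (u n).1 (g n (u n).2))) @ uf --> (0 : R).
    by apply: uf_congr u0; apply: nearW => n; rewrite deck_fl // (deck_iso hmet).
  have e0 := uf_mdist0 gl (uf_fl ut gl) lim; rewrite -{1}(fl0 l) in e0.
  have t0 := fl_inj e0; rewrite -t0 in ut.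
  have [n hn] := filter_ex ((ufRP _ _).1 ut h h0); case: (nu' n) => _; apply.
  by rewrite -[X in `|X|]subr0.
by exists e => // u x uT h1; exact: (eP (u, x)).
Qed.

(** Stands in for compactness of small closed balls of X: the limit exists in M and is lifted by the
    local isometry at l. *)
Lemma ball_lim (eta e : R) (x y : nat -> X) (l : X) : (forall x, local_iso p eta x) -> e < eta -> x @ uf --> l ->
  (\forall n \near uf, mdist (x n) (y n) <= e) -> exists l' : X, y @ uf --> l'.
Proof.
move=> iso ee xl xy; have [n0 hn0] := filter_ex xy.
have e0 : 0 <= e by apply: le_trans hn0; exact: mdist_ge0.
have eta0 : 0 < eta by exact: le_lt_trans ee.
have [m _ ym] : exists2 m, [set: M] m & (fun n => p (y n)) @ uf --> m.
  by apply: compact_uf; [exact: compactM|exact: nearW].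
have px := cts_uf (@cover_cts _ _ _ _ hcov l) xl.
have [_ /(_ m)[|y0 ly0 e1]] := iso l.
  apply: le_lt_trans (ee); apply: (uf_le (uf_mdist px ym) (@uf_const _ e)).
  apply: filterS xy => n xy; have [/(_ (x n) (y n)) -> //] := iso (x n); first by rewrite mdistxx.
  exact: le_lt_trans xy ee.
exists y0; apply/ufMP.
have lim := uf_mdist ym (@uf_const _ m); rewrite mdistxx in lim.
have xl0 := uf_mdist (@uf_const _ l) xl; rewrite mdistxx in xl0.
have ee0 : 0 < eta - e by rewrite subr_gt0.
apply: uf_congr lim; apply: filterS2 xy ((ufRP _ _).1 xl0 _ ee0) => n h1 h2.
rewrite -e1; have [-> //] := iso l; apply: le_lt_trans (metric_triangle l (x n) _) _.
by move: h2; rewrite subr0 ltr_norml; lra.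
Qed.

Lemma p_iso (eta : R) x y : (forall x, local_iso p eta x) -> mdist x y < eta -> mdist (p x) (p y) = mdist x y.
Proof.
move=> iso h; have [-> //] := iso x; rewrite mdistxx; apply: le_lt_trans h; exact: mdist_ge0.
Qed.

Lemma Rel_local b (eta e : R) x y : (forall x, local_iso p eta x) -> e <= eta -> Rel b e x y ->
  local_leaf (leaf (Wf b)) e (p x) (p y).
Proof.
move=> iso ee [g [cg g0 g1 gP]]; have pg := ccomp cg (cover_cts hcov).
apply/local_leafP; exists ((fun t => p (g t)) @` setT); split.
- by exists 0 => //; rewrite g0.
- by exists 1 => //; rewrite g1.
- apply: connected_continuous_connected; last by apply: continuous_subspaceT; exact: pg.
  by apply/connected_intervalP.
- move=> _ [t _ <-]; have [h1 h2] := gP t; split=> //.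
  have [-> //] := iso x; last exact: lt_le_trans ee.
  rewrite mdistxx; apply: lt_le_trans ee; apply: le_lt_trans h2; exact: mdist_ge0.
Qed.

(* If the conclusion failed for all N, a limit would be two points of a common local leaf of Wf b
   that stay close in the expanding direction without lying on the same local orbit. *)
Lemma unique_shadowing b : exists2 h0 : R, 0 < h0 & forall h, 0 < h < h0 -> exists2 d : R, 0 < d & forall e' : R, 0 < e' ->
  exists N : nat, forall x y (r : nat -> R), r 0%N = 0 -> (forall n, h / 2 <= r n.+1 - r n <= 3 * h / 2) ->
    (forall n, (n <= N)%N -> mdist (psi b (- (h * n%:R)) x) (psi b (- r n) y) <= d) -> Rel b d x y ->
    exists2 u, `|u| < h / 2 & mdist x (psi b u y) < e'.
Proof.
have [eta eta0 iso] := cover_eta hM hcov hmet.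
have [e1 e10 e1P] := orbit_component b ltr01; have [e2 e20 e2P] := stable_psi b.
have [e3 /andP[e30 _] [e31 e32]] := below2 e10 e20; have [e /andP[eg _] [e_3 e_eta]] := below2 e30 eta0.
have e_1 : 0 < e < e1 by rewrite eg (lt_trans e_3).
have [st1 [dl dl0 st2]] : stable_at_scale (fun t => phi (sg b t)) (leaf (Wf b)) e.
  by apply: e2P; rewrite eg (lt_trans e_3).
have [delta /andP[delta0 _] [dd1 dd2]] := below2 dl0 eta0.
have delta3 : 0 < delta / 3 by rewrite divr_gt0.
have [h0 h00 disp] := displacement delta3.
have [e4 e40 e4P] := Rel_closed b eg.
exists h0 => // h /andP[hg hh].
have h2 : 0 < h / 2 by rewrite divr_gt0.
have [e5 e50 e5P] := no_short_return 1 h2; have [e6 e60 e6P] := fl_unif h delta3.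
have [a /andP[a0 _] [a4 a5]] := below2 e40 e50; have [d /andP[d0 _] [da d6]] := below2 a0 e60.
have [d' /andP[d'0 _] [d'd d'e]] := below2 d0 eta0.
exists d' => // e' e'0; apply: contrapT => nN.
have /choice[z zP] : forall N : nat, exists z : X * X * (nat -> R), [/\ z.2 0%N = 0,
    (forall n, h / 2 <= z.2 n.+1 - z.2 n <= 3 * h / 2),
    (forall n, (n <= N)%N -> mdist (psi b (- (h * n%:R)) z.1.1) (psi b (- z.2 n) z.1.2) <= d'),
    Rel b d' z.1.1 z.1.2 & forall u, `|u| < h / 2 -> ~ mdist z.1.1 (psi b u z.1.2) < e'].
  move=> N; apply: contrapT => nz; apply: nN; exists N => x y r r0 inc tr xy.
  apply: contrapT => nu; apply: nz; exists ((x, y), r); split=> // u uh ue.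
  by apply: nu; exists u.
have [g [x [dg gx]]] := cocompact hM hcov hmet (fun n => (z n).1.1).
have Rg n : Rel b d' (g n (z n).1.1) (g n (z n).1.2) by apply: Rel_deck => //; case: (zP n).
have [|y gy] := @ball_lim eta d' (fun n => g n (z n).1.1) (fun n => g n (z n).1.2) x iso d'e gx.
  by apply: nearW => n; apply: ltW; exact: Rel_mdist (Rg n).
(* Bounded increments make the tracking times converge at every step; the limit pair tracks at all
   steps and not only up to N. *)
have /choice[r rl] : forall k, exists r : R, (fun n => (z n).2 k) @ uf --> r.
  elim=> [|k [r rl]]; first by exists 0; apply: uf_congr (@uf_const _ (0 : R)); apply: nearW => n; case: (zP n).
  have [r' _ rl'] : exists2 r', h / 2 <= r' <= 3 * h / 2 & (fun n => (z n).2 k.+1 - (z n).2 k) @ uf --> r'.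
    by apply: uf_bounded; apply: nearW => n; case: (zP n).
  exists (r + r'); have E : \forall n \near uf, (z n).2 k + ((z n).2 k.+1 - (z n).2 k) = (z n).2 k.+1.
    by apply: nearW => n; rewrite subrKC.
  by apply: uf_congr E _; exact: cvgD.
have r0 : r 0%N = 0.
  by apply: uf_uniq (rl 0%N) _; apply: uf_congr (@uf_const _ (0 : R)); apply: nearW => n; case: (zP n).
have inc k : h / 2 <= r k.+1 - r k <= 3 * h / 2.
  have lim : (fun n => (z n).2 k.+1 - (z n).2 k) @ uf --> r k.+1 - r k by apply: cvgB.
  apply/andP; split.
    by apply: (uf_le (@uf_const _ (h / 2)) lim); apply: nearW => n; have [_ /(_ k)/andP[]] := zP n.
  by apply: (uf_le lim (@uf_const _ (3 * h / 2))); apply: nearW => n; have [_ /(_ k)/andP[]] := zP n.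
have tr k : mdist (psi b (- (h * k%:R)) x) (psi b (- r k) y) <= d'.
  have rk : (fun n => - (z n).2 k) @ uf --> - r k by apply: cvgN.
  have lim := uf_mdist (@uf_psi b _ _ _ _ (@uf_const _ (- (h * k%:R) : R)) gx) (@uf_psi b _ _ _ _ rk gy).
  apply: (uf_le lim (@uf_const _ (d' : R))).
  apply: filterS (uf_ge k) => n kn; rewrite !psi_deck // (deck_iso hmet) //.
  by case: (zP n) => _ _ + _ _; apply.
have xy : Rel b e x y.
  apply: e4P; exists (fun n => g n (z n).1.1), (fun n => g n (z n).1.2); split=> //.
  by apply: nearW => n; apply: Rel_le (Rg n); apply: ltW; apply: lt_trans d'd (lt_trans da a4).
(* The common local leaf supplies sigma. Glued to the tracking times it is still asymptotic, but
   never separates the orbits by delta in the expanding direction. *)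
have [sigma sP] := st1 _ _ (Rel_local iso (ltW e_eta) xy).
have [hs s0 _] := sP; have [s [hs' sE sE']] := glue_homeo r0 hg inc hs s0.
have comp : local_leaf (on_orbit (fun t => phi (sg b t))) e (p x) (p y).
  apply: contrapT => nc; have sP' : fwd_asymptotic (fun t => phi (sg b t)) s (p x) (p y).
    split=> //; first by rewrite sE.
    have [_ _ lim] := sP; apply: cvg_trans lim; apply: near_eq_cvg.
    by near=> t; rewrite sE //; near: t; exact: nbhs_pinfty_ge.
  have [t t0 ht] := st2 _ _ (Rel_local iso (ltW e_eta) xy) nc _ sP'.
  pose q := - t / h; have q0 : 0 <= q by rewrite divr_ge0 ?oppr_ge0 ?(ltW hg) ?(ltW t0).
  have tq : t = - (h * q) by rewrite /q [h * _]mulrC divfK ?opprK // lt0r_neq0.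
  have [n [v [v01 v1 qE]]] := natP q0.
  move: ht; rewrite tq sE' // qE plE // -!pfl -!/(psi b _ _) => ht.
  set w := r n.+1 - r n in ht.
  (* Between two steps both times are compared with the preceding step. An increment differs from h
     by at most h / 2, so the remaining shift moves points by less than delta / 3. *)
  have E1 : - (h * (n%:R + v)) = - (h * v) + - (h * n%:R) by ring.
  have E2 : - (r n + v * w) = - (v * w - h * v) + (- (h * v) + - r n) by ring.
  rewrite E1 E2 !psiD in ht.
  have hv : `|sg b (- (h * v))| <= h.
    rewrite norm_sg normrN normrM !ger0_norm ?(ltW hg) //; last by case/andP: v01.
    by rewrite -[leRHS]mulr1 ler_wpM2l ?(ltW hg) //; case/andP: v01.
  have c1 : mdist (psi b (- (h * v)) (psi b (- (h * n%:R)) x)) (psi b (- (h * v)) (psi b (- r n) y)) < delta / 3.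
    by apply: e6P => //; apply: le_lt_trans (tr n) _; exact: lt_trans d'd d6.
  have c2 : mdist (psi b (- (h * v)) (psi b (- r n) y)) (psi b (- (v * w - h * v)) (psi b (- (h * v)) (psi b (- r n) y))) < delta / 3.
    apply: disp; rewrite norm_sg normrN.
    have := inc n; rewrite -/w; keep v01 hg hh => hw.
    rewrite [h * v]mulrC -mulrBr normrM; apply: le_lt_trans hh.
    have : `|w - h| <= h / 2 by rewrite ler_norml; lra.
    have : `|v| <= 1 by rewrite ler_norml; lra.
    move=> k1 k2; apply: le_trans (ler_pM _ _ k1 k2) _ => //; lra.
  have c3 := le_lt_trans (metric_triangle _ _ _) (ltrD c1 c2).
  have c4 : delta / 3 + delta / 3 < eta by keep dd2 delta0; lra.
  rewrite (p_iso iso (lt_trans c3 c4)) in ht.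
  have := lt_trans ht c3; keep dd1 delta0; lra.
have comp' : local_leaf (on_orbit phi) e (p x) (p y).
  have [C [Cx Cy cC CL]] := (local_leafP _ _ _ _).1 comp; apply/local_leafP; exists C; split=> // w /CL[[t ->] ?].
  by split=> //; exists (sg b t).
have [u u1 yE] := e1P e e_1 _ _ (RelW xy) comp'.
(* The local orbit gives only |u| < 1; closeness of x and y improves this by [no_short_return]. *)
have uh : `|u| < h / 2.
  apply: (e5P u x (ltW u1)); rewrite -yE; apply: le_lt_trans (lt_trans d'd (lt_trans da a5)).
  by have := tr 0%N; rewrite mulr0 r0 oppr0 !psi0; apply.
have lim := uf_mdist gx (@uf_psi b _ _ _ _ (@uf_const _ (sg b (- u))) gy).
rewrite yE -sg_psi flK mdistxx in lim.
have [n hn] := filter_ex ((ufRP _ _).1 lim e' e'0).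
have [_ _ _ _ nu] := zP n; apply: (nu (sg b (- u))); first by rewrite norm_sg normrN.
move: hn; rewrite subr0 ger0_norm ?mdist_ge0 //.
by rewrite psi_deck // (deck_iso hmet).
Unshelve. all: by end_near. Qed.

(** ** Asymptotic arcs *)

Lemma leaf_psi b c s t x y : leaf (Wf b) (p x) (p y) -> leaf (Wf b) (p (psi c s x)) (p (psi c t y)).
Proof.
have orb u z : leaf (Wf b) (p z) (p (phi' u z)).
  by rewrite /Wf; case: b; [exact: orbit_leafS|apply: leaf_proj; exact: fl_leafU].
move=> l; apply: (rst_trans _ _ _ (p x)); first by apply: rst_sym; exact: orb.
by apply: (rst_trans _ _ _ (p y)) => //; exact: orb.
Qed.

Lemma close_sym (e : R) (P x : X) : mdist P x < e -> mdist x P < e. Proof. by rewrite metric_sym. Qed.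

(** The admissible times S t need not form an interval, so their convex hull C t is used for
    [selection]. Since orbits have no short returns, the hull is shorter than k, and moving inside
    it costs little. *)
Lemma select_close b (h e1 : R) : 0 < h -> 0 < e1 -> exists2 e : R, 0 < e & forall P (z : R -> X),
  continuous z -> z 0 = P -> (forall t, exists2 u, `|u| < h / 2 & mdist P (psi b u (z t)) < e) ->
  exists u : R -> R, [/\ continuous u, u 0 = 0 &
    forall t, 0 <= t <= 1 -> `|u t| < h / 2 /\ mdist P (psi b (u t) (z t)) < e1].
Proof.
move=> h0 e10; have e12 : 0 < e1 / 2 by rewrite divr_gt0.
have [k k0 disp] := displacement e12; have [e2 e20 nsr] := no_short_return h k0.
have [e /andP[e0 _] [ea eb]] := below2 e12 (divr_gt0 e20 (ltr0Sn R 1)).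
exists e => // P z cz zP zS.
pose S t v := `|v| < h / 2 /\ mdist P (psi b v (z t)) < e.
pose C t u := exists v v', [/\ v <= u <= v', S t v & S t v'].
have [||||u [cu u0 uC]] := @selection R C 0 _ _ _ _ 1.
- exists 0, 0; split; first by rewrite lexx.
    by split; rewrite ?normr0 ?divr_gt0 // psi0 zP mdistxx.
  by split; rewrite ?normr0 ?divr_gt0 // psi0 zP mdistxx.
- by move=> t; have [u uh ue] := zS t; exists u, u, u; split=> //; rewrite lexx.
- move=> t u [v [v' [vv Sv Sv']]].
  have Sopen w : S t w -> exists2 d, 0 < d & forall t', `|t' - t| < d -> S t' w.
    move=> [wh we]; have : nbhs t [set t' | mdist P (psi b w (z t')) < e].
      apply: nbhs_seq => s st nS.
      have lim := uf_mdist (@uf_const _ P) (@uf_psi b _ _ _ _ (@uf_const _ w) (cts_uf (cz t) st)).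
      by have [n /nS] := filter_ex (uf_lt lim (@uf_const _ e) we).
    by move=> /nbhsRP[d d0 dP]; exists d => // t' /dP.
  have [d d0 dP] := Sopen _ Sv; have [d' d'0 dP'] := Sopen _ Sv'.
  have [a /andP[a0 _] [ad ad']] := below2 d0 d'0; exists a => // t' ht.
  exists v, v'; split=> //; [apply: dP|apply: dP']; exact: lt_trans ht _.
- move=> t u v w [a [a' [/andP[ua _] Sa _]]] [c [c' [/andP[_ cw] _ Sc]]] /andP[uv vw].
  by exists a, c'; split=> //; rewrite (le_trans ua uv) (le_trans vw cw).
exists u; split=> // t t01; have [v [v' [/andP[vu uv'] [vh ve] [vh' ve']]]] := uC t t01.
split; first by move: vh vh'; rewrite !ltr_norml; keep vu uv'; lra.
have vv : `|v' - v| < k.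
  rewrite -(norm_sg b); apply: (nsr _ (psi b v (z t))).
    rewrite norm_sg; apply: le_trans (ler_normB _ _) _; keep vh vh'; lra.
  rewrite -/(psi b (v' - v) _) -psiD subrK; apply: le_lt_trans (metric_triangle _ P _) _.
  have := close_sym ve; keep eb ve'; lra.
have uv : `|u t - v| < k.
  by apply: le_lt_trans vv; rewrite !ger0_norm ?subr_ge0 ?(le_trans vu uv') // lerD2r.
apply: le_lt_trans (metric_triangle _ (psi b v (z t)) _) _.
have := disp (sg b (u t - v)) (psi b v (z t)); rewrite norm_sg -/(psi b _ _) -psiD subrK => /(_ uv).
keep ve ea; lra.
Qed.

(* The orbits of the points of the arc g stay e1-close to the orbit of g 0 after the times r n t,
   and from the step N e on they are e-close up to a small shift u; N does not depend on g. *)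
Definition fan b (h e1 : R) (N : R -> nat) (g : R -> X) (r : nat -> R -> R) :=
  [/\ (forall n, continuous (r n)) /\ (forall t, r 0%N t = 0), forall n, r n 0 = h * n%:R,
      forall n t, 0 <= t <= 1 -> h / 2 <= r n.+1 t - r n t <= 3 * h / 2,
      forall n t, 0 <= t <= 1 -> mdist (psi b (h * n%:R) (g 0)) (psi b (r n t) (g t)) < e1 &
      forall e n, 0 < e -> (N e <= n)%N -> exists u : R -> R, [/\ continuous u, u 0 = 0 &
        forall t, 0 <= t <= 1 -> `|u t| < h / 2 /\
          mdist (psi b (h * n%:R) (g 0)) (psi b (r n t + u t) (g t)) < e]].

(** The times are built step by step. Adding h to the last time tracks within the coarse constant d;
    the backward history then satisfies [unique_shadowing], which yields a small shift that restores
    the fine constant e3, chosen continuously in t by [select_close]. Thus errors do not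
    accumulate. *)
Lemma fanP b : exists2 h0 : R, 0 < h0 & forall h, 0 < h < h0 -> forall e1 : R, 0 < e1 ->
  exists2 d : R, 0 < d & exists N, forall g : R -> X, continuous g ->
    (forall t, leaf (Wf b) (p (g 0)) (p (g t)) /\ mdist (g 0) (g t) < d) -> exists r, fan b h e1 N g r.
Proof.
have [h0 h00 hkey] := unique_shadowing b; exists h0 => // h hh e1 e10; have hg : 0 < h by case/andP: hh.
have [d d0 keyP] := hkey h hh.
have [w w0 wP] := fl_unif h d0.
have [e2 /andP[e20 _] [e21 e2d]] := below2 e10 d0; have [e3 /andP[e30 _] [e32 e3w]] := below2 e20 w0.
have [es es0 selP] := select_close b hg e30.
have [N0 N0P] := keyP es es0.
have selN e : exists N : nat, 0 < e -> exists e', [/\ 0 < e', (forall P (z : R -> X),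
  continuous z -> z 0 = P -> (forall t, exists2 u, `|u| < h / 2 & mdist P (psi b u (z t)) < e') ->
  exists u : R -> R, [/\ continuous u, u 0 = 0 &
    forall t, 0 <= t <= 1 -> `|u t| < h / 2 /\ mdist P (psi b (u t) (z t)) < e]) &
  forall x y (r : nat -> R), r 0%N = 0 -> (forall n, h / 2 <= r n.+1 - r n <= 3 * h / 2) ->
    (forall n, (n <= N)%N -> mdist (psi b (- (h * n%:R)) x) (psi b (- r n) y) <= d) -> Rel b d x y ->
    exists2 u, `|u| < h / 2 & mdist x (psi b u y) < e'].
  have [e0|e0] := ltP 0 e; last by exists 0%N.
  have [e' e'0 e'P] := select_close b hg e0; have [N NP] := keyP e' e'0.
  by exists N => _; exists e'.
have [N NP] := choice selN.
have [del del0 delP] := fl_unif (h * N0.+1%:R) e30.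
exists del => //; exists N => g cg gP.
have hn : 0 <= h by exact: ltW.
pose I (e : R) n (r : nat -> R -> R) := [/\ (forall k, (k <= n)%N -> continuous (r k)) /\ (forall t, r 0%N t = 0),
   forall k, (k <= n)%N -> r k 0 = h * k%:R,
   forall k t, (k < n)%N -> 0 <= t <= 1 -> h / 2 <= r k.+1 t - r k t <= 3 * h / 2 &
   forall k t, (k <= n)%N -> 0 <= t <= 1 -> mdist (psi b (h * k%:R) (g 0)) (psi b (r k t) (g t)) < e].
have hb : h / 2 <= h <= 3 * h / 2 by keep hg; lra.
have natS (k : nat) : h * k.+1%:R = h + h * k%:R by rewrite -natr1 mulrDr mulr1 addrC.
have track n r M' (e' : R) : I d n r -> (M' <= n)%N ->
   (forall x y (r : nat -> R), r 0%N = 0 -> (forall n, h / 2 <= r n.+1 - r n <= 3 * h / 2) ->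
    (forall n, (n <= M')%N -> mdist (psi b (- (h * n%:R)) x) (psi b (- r n) y) <= d) -> Rel b d x y ->
    exists2 u, `|u| < h / 2 & mdist x (psi b u y) < e') ->
   forall t, 0 <= t <= 1 -> exists2 u, `|u| < h / 2 &
     mdist (psi b (h * n%:R) (g 0)) (psi b u (psi b (r n t) (g t))) < e'.
  move=> [[cr r0] r1 r2 r3] Mn K t t01.
  (* The history read backwards from step n, continued by steps of length h to be defined for all
     k. *)
  pose q k := if (k <= n)%N then r n t - r (n - k)%N t else r n t + h * (k - n)%:R.
  apply: (K _ _ q).
  - by rewrite /q leq0n subn0 subrr.
  - move=> k; rewrite /q; have [kn|kn] := ltnP k n.
      rewrite (ltnW kn) opprD addrACA subrr add0r opprK addrC -subnSK //.
      by apply: r2 => //; rewrite ltn_subLR // addSnnS leq_addl.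
    have [kn'|kn'] := leqP k n.
      have -> : k = n by apply/eqP; rewrite eqn_leq kn'.
      by rewrite subSn // subnn r0 subr0 mulr1 addrAC subrr add0r.
    by rewrite subSn ?(ltnW kn') // natS opprD addrACA subrr add0r addrK.
  - move=> k kM; have kn := leq_trans kM Mn; rewrite /q kn -!psiD opprB subrK.
    have -> : - (h * k%:R) + h * n%:R = h * (n - k)%:R by rewrite natrB //; ring.
    by apply: ltW; apply: r3 => //; exact: leq_subr.
  - exists (fun s => psi b (r n (t * clamp s)) (g (t * clamp s))).
    have ct : continuous (fun s : R => t * clamp s).
      by move=> s; apply: cvgM; [exact: cvg_cst|exact: (@clamp_continuous R s)].
    split.
    + move=> s; apply: uf_cts => v vs; have hv := cts_uf (ct s) vs.
      by apply: uf_psi; [exact: cts_uf (cr _ (leqnn n) _) hv|exact: cts_uf (cg _) hv].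
    + by rewrite clamp0 mulr0 r1.
    + by rewrite clamp1 mulr1.
    + move=> s; split; last first.
        apply: r3 => //; move: t01 => /andP[t0 t1]; have /andP[c0 c1] := clamp_itv s.
        by rewrite mulr_ge0 //= mulr_ile1.
      by apply: leaf_psi; case: (gP (t * clamp s)).
have Iweak e e' n r : e <= e' -> I e n r -> I e' n r.
  by move=> ee [i1 i2 i3 i4]; split=> // k t kn t01; apply: lt_le_trans ee; exact: i4.
have e3d : e3 <= d by apply: ltW; exact: lt_trans e32 e2d.
have zc n r (a : R) : I e3 n r -> continuous (fun t => psi b (a + r n (clamp t)) (g (clamp t))).
  move=> [[cr _] _ _ _] t; apply: uf_cts => v vt; have hv := cts_uf (@clamp_continuous R t) vt.
  apply: uf_psi; last exact: cts_uf (cg _) hv.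
  by apply: cvgD; [exact: uf_const|exact: cts_uf (cr _ (leqnn n) _) hv].
pose ext n (r : nat -> R -> R) (f : R -> R) k := if (k <= n)%N then r k else f.
have extI (e : R) n r (f : R -> R) : I e3 n r -> e3 <= e -> continuous f -> f 0 = h * n.+1%:R ->
    (forall t, 0 <= t <= 1 -> h / 2 <= f t - r n t <= 3 * h / 2) ->
    (forall t, 0 <= t <= 1 -> mdist (psi b (h * n.+1%:R) (g 0)) (psi b (f t) (g t)) < e) ->
    I e n.+1 (ext n r f).
  move=> [[cr r0] r1 r2 r3] ee cf f0 f1 f2; split.
  - split; last by move=> t; rewrite /ext leq0n.
    by move=> k _; rewrite /ext; case: ifP => // kn; exact: cr.
  - move=> k kn; rewrite /ext; case: (leqP k n) => kn'; first exact: r1.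
    by have -> : k = n.+1 by apply/eqP; rewrite eqn_leq kn.
  - move=> k t kn t01; rewrite /ext; have -> : (k <= n)%N by []; case: (leqP k.+1 n) => kn'; first exact: r2.
    have -> : k = n by apply/eqP; rewrite eqn_leq -(ltnS k) kn -ltnS.
    exact: f1.
  - move=> k t kn t01; rewrite /ext; case: (leqP k n) => kn'; first by apply: lt_le_trans ee; exact: r3.
    by have -> : k = n.+1; [apply/eqP; rewrite eqn_leq kn|exact: f2].
have step n r : I e3 n r -> (forall k, (k <= n)%N -> (k <= N0)%N -> r k = fun=> h * k%:R) ->
    exists r', [/\ I e3 n.+1 r', (forall k, (k <= n)%N -> r' k = r k) &
      (forall k, (k <= n.+1)%N -> (k <= N0)%N -> r' k = fun=> h * k%:R)].
  move=> Ir rN; have [[cr r0] r1 r2 r3] := Ir.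
  (* During the first N0 steps there is too little history, but the arc is so short that the plain
     times h k do. *)
  have [nN|Nn] := ltnP n N0.
    exists (ext n r (fun=> h * n.+1%:R)); split.
    - apply: extI => //; first by move=> ?; exact: cvg_cst.
        by move=> t t01; rewrite rN // ?(ltnW nN) // natS addrK.
      move=> t t01; apply: delP; last by case: (gP t).
      by rewrite norm_sg ger0_norm ?mulr_ge0 // ler_wpM2l // ler_nat ltnS ltnW.
    - by move=> k kn; rewrite /ext kn.
    - move=> k kn kN; rewrite /ext; case: (leqP k n) => kn'; first exact: rN.
      by have -> : k = n.+1 by apply/eqP; rewrite eqn_leq kn.
  (* The uncorrected step tracks only within d, which is just what unique shadowing asks for. *)
  have Jr : I d n.+1 (ext n r (fun t => h + r n t)).
    apply: extI => //.
    - by move=> t; apply: cvgD; [exact: cvg_cst|exact: cr].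
    - by rewrite r1 // natS.
    - by move=> t t01; rewrite addrK.
    - move=> t t01; rewrite natS !psiD; apply: wP; first by rewrite norm_sg ger0_norm.
      by apply: lt_trans e3w; exact: r3.
  have [||u [cu u0 uP]] := selP (psi b (h * n.+1%:R) (g 0)) (fun t => psi b (h + r n (clamp t)) (g (clamp t))) (zc _ _ _ Ir).
  - by rewrite clamp0 r1 // natS.
  - move=> t; have [v vh] := track _ _ _ _ Jr (leqW Nn) N0P (clamp t) (clamp_itv t).
    by rewrite /ext ltnn; exists v.
  exists (ext n r (fun t => u t + (h + r n t))); split.
  - apply: extI => //.
    + by move=> t; apply: cvgD; [exact: cu|apply: cvgD; [exact: cvg_cst|exact: cr]].
    + by rewrite u0 add0r r1 // natS.
    + move=> t t01; have [+ _] := uP t t01; rewrite addrA addrK ltr_norml; keep hg; lra.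
    + by move=> t t01; have [_] := uP t t01; rewrite -psiD clamp_id.
  - by move=> k kn; rewrite /ext kn.
  - move=> k kn kN; rewrite /ext; case: (leqP k n) => kn'; first exact: rN.
    by have := leq_trans kn' (leq_trans kN Nn); rewrite ltnn.
have /choice[nxt nxtP] : forall z : nat * (nat -> R -> R), exists r', I e3 z.1 z.2 ->
    (forall k, (k <= z.1)%N -> (k <= N0)%N -> z.2 k = fun=> h * k%:R) ->
    [/\ I e3 z.1.+1 r', (forall k, (k <= z.1)%N -> r' k = z.2 k) &
      (forall k, (k <= z.1.+1)%N -> (k <= N0)%N -> r' k = fun=> h * k%:R)].
  move=> [n r]; have [[h1 h2]|nh] := pselect (I e3 n r /\ (forall k, (k <= n)%N -> (k <= N0)%N -> r k = fun=> h * k%:R)).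
    by have [r' r'P] := step n r h1 h2; exists r'.
  by exists r => h1 h2; case: nh.
pose f := fix f n := if n is m.+1 then nxt (m, f m) else (fun k _ => h * k%:R).
have fI n : I e3 n (f n) /\ (forall k, (k <= n)%N -> (k <= N0)%N -> f n k = fun=> h * k%:R).
  elim: n => [|n [h1 h2]]; last by have [] := nxtP (n, f n) h1 h2.
  split=> //; split=> //=.
  - by split=> [k _ ?|t]; [exact: cvg_cst|rewrite mulr0].
  - move=> k t; rewrite leqn0 => /eqP -> _; rewrite mulr0 !psi0.
    have := delP 0 (g 0) (g t); rewrite normr0 !fl0; apply; first by rewrite mulr_ge0.
    by case: (gP t).
have fS n k : (k <= n)%N -> f n.+1 k = f n k by have [h1 h2] := fI n; have [_ + _] := nxtP (n, f n) h1 h2; apply.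

exists (fun n => f n n); split.
- split; first by move=> n; have [[[c _] _ _ _] _] := fI n; exact: c.
  by move=> t; have [[[_ ->] _ _ _] _] := fI 0%N.
- by move=> n; have [[_ + _ _] _] := fI n; apply.
- move=> n t t01; have [[_ _ /(_ n t (ltnSn n) t01) + _] _] := fI n.+1.
  by rewrite (fS n n (leqnn n)).
- move=> n t t01; have [[_ _ _ /(_ n t (leqnn n) t01) c] _] := fI n.
  exact: lt_trans c (lt_trans e32 e21).
- move=> e n e0 Nn; have [e' [e'0 sel KP]] := NP e e0; have [In _] := fI n.
  have [[cr r0] r1 r2 r3] := In.
  have [||u [cu u0 uP]] := sel (psi b (h * n%:R) (g 0)) (fun t => psi b (0 + f n n (clamp t)) (g (clamp t))) (zc _ _ _ In).
  + by rewrite clamp0 r1 // add0r.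
  + move=> t; have [v vh ve] := track _ _ _ _ (Iweak _ _ _ _ e3d In) Nn KP (clamp t) (clamp_itv t).
    by exists v => //; rewrite add0r.
  exists u; split=> // t t01; have [u1 u2] := uP t t01; split=> //.
  by rewrite [_ + u t]addrC psiD; move: u2; rewrite add0r clamp_id.
Qed.

(** ** The endpoint maps *)

Lemma null_par_trans (a b c : R * R * R) : null a -> null b -> null c -> mform a b = 0 -> mform b c = 0 -> mform a c = 0.
Proof.
move=> na nb nc ab bc; have [x x0 ->] := null_prop nb nc bc.
by rewrite nplus_lin0 ab mulr0.
Qed.

Lemma ends_asym F (k k' : R -> R * R) : fol_coord F -> hgeod k -> hgeod k' ->
  (exists C, forall s, 0 <= s -> hyp_dist (k s) (k' s) <= C) <-> mform (nplus k) (nplus k') = 0.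
Proof.
move=> hF hk hk'; have [h _] := hk; have [h' d'] := hk'; split=> [[C CP]|e].
  apply: (@asym_of_bounded _ k k' (fun n => n%:R) (fun n => n%:R) C) => //.
    move=> c; apply: filterS (uf_ge (Num.bound c)) => n cn.
    have [c0|c0] := ltP c 0; first by apply: ltW; apply: lt_le_trans c0 _; rewrite addr_ge0.
    apply: ltW; apply: lt_le_trans (archi_boundP c0) _.
    by apply: le_trans (_ : n%:R <= _); rewrite ?ler_nat // lerDl.
  by apply: nearW => n; apply: CP.
have [c c0 [_ cP]] := asym_close hk hk' e.
pose m := mform (nminus k) (nminus k'); pose C := ch 0 + c * `|m|.
pose D := hyp_dist (k 0) (k' (0 - ln c)).
have [C1 C10 C1P] : exists2 C1, 0 <= C1 & 1 + c * `|m| <= ch C1.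
  have le1 : 1 <= 1 + c * `|m| by rewrite lerDl mulr_ge0 // ltW.
  by have [h1 h2] := arch le1; exists (ln (1 + c * `|m| + Num.sqrt ((1 + c * `|m|) ^+ 2 - 1))) => //; rewrite h2.
exists (C1 + `|ln c|) => s s0.
apply: (le_trans (hyp_tri hF (h s) (h' (s - ln c)) (h' s))).
apply: lerD; last by rewrite d' addrAC subrr add0r normrN.
rewrite hyp_dist_le // cP; apply: le_trans C1P; rewrite lerD2l -/m.
apply: le_trans (ler_norm _) _; rewrite !normrM ger0_norm ?expR_ge0 // (ger0_norm (ltW c0)).
rewrite -[leRHS]mul1r -mulrA ler_wpM2r ?mulr_ge0 ?(ltW c0) //.
by rewrite -(@expR0 R) ler_expR oppr_le0 mulr_ge0.
Qed.

(** The product of the backward vector with the common point is 1/2 for both geodesics, so the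
    backward vectors agree and not only their directions. What remains of the point is the forward
    vector. *)
Lemma line_end (k k' : R -> R * R) : hgeod k -> hgeod k' -> k 0 = k' 0 ->
  mform (nminus k) (nminus k') = 0 -> mform (nplus k) (nplus k') = 0.
Proof.
move=> hk hk' e0 em; have [np nm pm] := hgeod_null hk; have [np' nm' pm'] := hgeod_null hk'.
have [c c0 cE] := null_prop nm nm' em.
have E (q : R -> R * R) : hgeod q -> mk (q 0) = lin 1 (nplus q) 1 (nminus q).
  by move=> hq; rewrite (hgeodE 0 hq) oppr0 expR0.
have f1 : mform (nminus k) (mk (k 0)) = 1 / 2.
  by rewrite (E _ hk) form_lin2 (mformC (nminus k) (nplus k)) pm null_form //; ring.
have f2 : mform (nminus k') (mk (k' 0)) = 1 / 2.
  by rewrite (E _ hk') form_lin2 (mformC (nminus k') (nplus k')) pm' null_form //; ring.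
have c1 : c = 1.
  move: f2; rewrite cE -e0 mformC nplus_lin0 mformC f1 => h; lra.
have m_eq : nminus k' = nminus k.
  by rewrite cE c1; case: (nminus k) => -[a b] d; rewrite /lin /= !mul1r !mul0r !addr0.
have : mform (nplus k) (lin 1 (nplus k') 1 (nminus k')) = mform (nplus k) (lin 1 (nplus k) 1 (nminus k)).
  by rewrite -!E // e0.
rewrite (form_lin2 1 (nplus k') 1 (nminus k') (nplus k)) (form_lin2 1 (nplus k) 1 (nminus k) (nplus k)).
by rewrite m_eq (null_form np); lra.
Qed.

Lemma ld_fin x y (C : R) : (leaf_dist A x y <= C%:E)%E -> leaf A x y.
Proof.
move=> le; apply: contrapT => nl; suff e : leaf_dist A x y = +oo%E by rewrite e in le.
rewrite /leaf_dist (_ : [set _ | _ in _] = set0) ?ereal_inf0 //.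
apply/seteqP; split=> // l [g [_ _ g1 gl] _]; apply: nl; rewrite -g1; apply: gl; lra.
Qed.

Lemma ld_leP x y (C : R) : (leaf_dist A x y <= C%:E)%E <-> leaf A x y /\ ld x y <= C.
Proof.
split=> [h|[l h]]; last by rewrite ldE.
by have l := ld_fin h; split=> //; move: h; rewrite ldE.
Qed.

Lemma asymptotic_equiv (g h : geod A) : clos_refl_sym_trans _ (@asymptotic R X A) g h -> asymptotic g h.
Proof.
elim=> [x y //|x|x y _ [C CP]|x y z _ [C CP] _ [D DP]].
- by exists 0 => t _; rewrite geodP subrr normr0.
- by exists C => t /CP /ld_leP [l h']; apply/ld_leP; split; [exact: leaf_sym|rewrite ldC //; exact: leaf_sym].
- exists (C + D) => t t0; have /ld_leP[l1 h1] := CP t t0; have /ld_leP[l2 h2] := DP t t0.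
  apply/ld_leP; split; first exact: leaf_trans l2.
  by apply: le_trans (ldD l1 l2) _; exact: lerD.
Qed.

Lemma endptP (g h : geod A) : endpt g = endpt h <-> asymptotic g h.
Proof.
split=> [/eqmodP/asboolP/asymptotic_equiv //|gh].
by apply/eqmodP/asboolP; exact: rst_step.
Qed.

Lemma endpt_leaf (g h : geod A) : endpt g = endpt h -> leaf A (g 0) (h 0).
Proof. by move=> /endptP [C /(_ 0 (lexx _)) /ld_fin]. Qed.

Lemma geod_leaf (g : geod A) s t : leaf A (g s) (g t). Proof. exact: ld_leaf (geodP g s t). Qed.

Lemma endpt_coord F t (g h : geod A) k k' : fol_coord F -> -1 < t < 1 -> hgeod k -> hgeod k' ->
  (forall s, g s = F (k s, t)) -> (forall s, h s = F (k' s, t)) ->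
  endpt g = endpt h <-> mform (nplus k) (nplus k') = 0.
Proof.
move=> hF t1 hk hk' gk hk'E; rewrite -(ends_asym hF hk hk').
have E s : (leaf_dist A (g s) (h s)) = (hyp_dist (k s) (k' s))%:E.
  by rewrite gk hk'E F_ld //; [case: hk|case: hk'].
split=> [/endptP[C CP]|[C CP]]; last by apply/endptP; exists C => s s0; rewrite E lee_fin; exact: CP.
by exists C => s s0; rewrite -lee_fin -E; exact: CP.
Qed.

Lemma rev_geod (g : geod A) : exists h : geod A, forall t, h t = g (- t).
Proof.
have hP : geodesic A (fun t => g (- t)) by move=> s t; rewrite geodP; rewrite -normrN; congr (`|_|%:E); ring.
by exists (exist _ (fun t => g (- t)) (mem_set hP)).
Qed.

Definition rg (g : geod A) : geod A := sval (cid (rev_geod g)).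
Lemma rgE g t : rg g t = g (- t). Proof. exact: (svalP (cid (rev_geod g))). Qed.

Definition fwd x := endpt (og x).
Definition bwd x := endpt (rg (og x)).

(** k is the orbit of y seen in the half plane of the leaf with parameter t. *)
Definition okey (F : (R * R) * R -> X) (t : R) (y : X) (k : R -> R * R) :=
  [/\ hgeod k, F (k 0, t) = y, forall s, og y s = F (k s, t) &
      forall s, phi' s y = F (k (os y s), t)].

Lemma okeyP F t y : fol_coord F -> -1 < t < 1 -> leaf A (F ((0, 1), t)) y -> exists k, okey F t y k.
Proof.
move=> hF t1 l; have [|k [hk kE]] := F_geod (g := og y) hF t1; first by rewrite og0.
by exists k; split=> //; [rewrite -kE og0|move=> s; rewrite -ogE kE].
Qed.

Lemma fwd_coord F t y k (g : geod A) k' : fol_coord F -> -1 < t < 1 -> okey F t y k -> hgeod k' ->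
  (forall s, g s = F (k' s, t)) -> fwd y = endpt g <-> mform (nplus k) (nplus k') = 0.
Proof. by move=> hF t1 [hk _ kE _] hk' gE; exact: endpt_coord hF t1 hk hk' kE gE. Qed.

Lemma bwd_coord F t y k (g : geod A) k' : fol_coord F -> -1 < t < 1 -> okey F t y k -> hgeod k' ->
  (forall s, g s = F (k' s, t)) -> bwd y = endpt g <-> mform (nminus k) (nplus k') = 0.
Proof.
move=> hF t1 [hk _ kE _] hk' gE; have [e1 _] := nplus_opp hk; rewrite -e1.
by apply: endpt_coord hF t1 (hgeod_opp hk) hk' _ gE => s; rewrite rgE kE.
Qed.

Lemma fan_Rel b h e1 N g r n t : fan b h e1 N g r -> continuous g ->
  (forall t, leaf (Wf b) (p (g 0)) (p (g t))) -> 0 <= t <= 1 ->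
  Rel b e1 (psi b (h * n%:R) (g 0)) (psi b (r n t) (g t)).
Proof.
move=> [[cr _] r0 _ cl _] cg gl t01; exists (fun s => psi b (r n (t * clamp s)) (g (t * clamp s))).
have ct : continuous (fun s : R => t * clamp s).
  by move=> s; apply: cvgM; [exact: cvg_cst|exact: (@clamp_continuous R s)].
split.
- move=> s; apply: uf_cts => v vs; have hv := cts_uf (ct s) vs.
  by apply: uf_psi; [exact: cts_uf (cr n _) hv|exact: cts_uf (cg _) hv].
- by rewrite clamp0 mulr0 r0.
- by rewrite clamp1 mulr1.
- move=> s; split; last first.
    apply: cl; move: t01 => /andP[t0 t1]; have /andP[c0 c1] := clamp_itv s.
    by rewrite mulr_ge0 //= mulr_ile1.
  by apply: leaf_psi.
Qed.

Lemma fan_time b h e1 N g r n t : 0 < h -> fan b h e1 N g r -> 0 <= t <= 1 -> h / 2 * n%:R <= r n t <= 3 * h / 2 * n%:R.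
Proof.
move=> h0 [[_ r0] _ inc _ _] t01; elim: n => [|n /andP[IH1 IH2]]; first by rewrite r0 !mulr0 lexx.
by have := inc n t t01; rewrite -[n.+1%:R]natr1 !mulrDr !mulr1; keep IH1 IH2; lra.
Qed.

Lemma os_up x (c : R) : exists2 T : R, 0 <= T & forall t, T <= t -> c <= os x t.
Proof.
have [T e] := os_onto x c; exists (Num.max T 0); first by rewrite le_max lexx orbT.
by move=> t; rewrite ge_max -e => /andP[/(os_le x)].
Qed.

Lemma os_down x (c : R) : exists2 T : R, 0 <= T & forall t, T <= t -> os x (- t) <= c.
Proof.
have [T e] := os_onto x c; exists (Num.max (- T) 0); first by rewrite le_max lexx orbT.
by move=> t; rewrite ge_max -e lerNl => /andP[/(os_le x)].
Qed.

(** The fan in the direction [psi false] keeps the two orbits within leafwise distance 1 at times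
    tending to minus infinity, and [asym_of_bounded] applies to the reversed geodesics. *)
Lemma bwd_local : exists2 d : R, 0 < d & forall x y, Rel false d x y -> bwd x = bwd y.
Proof.
have [h0 h00 fP] := fanP false; have [e e0 eP] := Rel_ld ltr01.
have hh : 0 < h0 / 2 < h0 by keep h00; lra.
have [d d0 [N NP]] := fP _ hh e e0; set h := h0 / 2 in hh NP; have hg : 0 < h by case/andP: hh.
exists d => // x y [g [cg g0 g1 gP]]; rewrite -g0 in gP.
have [r rP] := NP g cg gP; have gl t : leaf (Wf false) (p (g 0)) (p (g t)) by case: (gP t).
have xy n := eP _ _ (fan_Rel n rP cg gl itv1); rewrite g0 g1 in xy.
have [F [hF F0]] := fol_coordP x; have t1 : -1 < (0 : R) < 1 by lra.
have lx : leaf A (F ((0, 1), 0)) x by rewrite F0; exact: leaf_refl.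
have ly : leaf A (F ((0, 1), 0)) y.
  rewrite F0; have [l _] := xy 0%N; have [[_ r0] _ _ _ _] := rP.
  by move: l; rewrite mulr0 r0 !psi0.
have [k kP] := okeyP hF t1 lx; have [k' k'P] := okeyP hF t1 ly.
have [hk _ _ kE] := kP; have [hk' _ k'og k'E] := k'P.
apply/(bwd_coord hF t1 kP (hgeod_opp hk')); first by move=> s; rewrite rgE k'og.
have [<- _] := nplus_opp hk.
apply: (@asym_of_bounded _ _ _ (fun n => - os x (- (h * n%:R))) (fun n => - os y (- r n 1)) 1 (hgeod_opp hk) (hgeod_opp hk')).
  move=> c; have [T T0 TP] := os_down x (- c); have [T' T'0 T'P] := os_down y 0.
  apply: filterS2 (uf_ge (Num.bound (T / h))) (uf_ge (Num.bound (T' / (h / 2)))) => n n1 n2.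
  have h2 : 0 < h / 2 by keep hg; lra.
  have k1 : T <= h * n%:R.
    rewrite mulrC -ler_pdivrMr //; apply: ltW; apply: lt_le_trans (archi_boundP (divr_ge0 T0 (ltW hg))) _.
    by rewrite ler_nat.
  have k2 : T' <= r n 1.
    have /andP[rn _] := fan_time n hg rP itv1; apply: le_trans rn.
    rewrite mulrC -ler_pdivrMr //; apply: ltW; apply: lt_le_trans (archi_boundP (divr_ge0 T'0 (ltW h2))) _.
    by rewrite ler_nat.
  have := TP _ k1; have := T'P _ k2; move: (os x _) (os y _) => a b; keep k1; lra.
apply: nearW => n; rewrite !opprK; have [_ dn] := xy n; apply: ltW.
by move: dn; rewrite /psi /= kE k'E /ld F_ld //=; [case: hk|case: hk'].
Qed.

Lemma convex_lt (a b c e : R) : `|a| < e -> `|b| < e -> 0 <= c <= 1 -> `|a + c * (b - a)| < e.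
Proof.
move=> ae be /andP[c0 c1]; have me : Num.max `|a| `|b| < e by rewrite gt_max ae be.
apply: le_lt_trans me; have -> : a + c * (b - a) = (1 - c) * a + c * b by ring.
apply: le_trans (ler_normD _ _) _; rewrite !normrM (ger0_norm c0) ger0_norm ?subr_ge0 //.
set m := Num.max _ _; have am : `|a| <= m by rewrite le_max lexx.
have bm : `|b| <= m by rewrite le_max lexx orbT.
have h1 : (1 - c) * `|a| <= (1 - c) * m by rewrite ler_wpM2l ?subr_ge0.
have h2 : c * `|b| <= c * m by rewrite ler_wpM2l.
by apply: le_trans (lerD h1 h2) _; rewrite -mulrDl subrK mul1r.
Qed.

Lemma path_Rel b (f : R -> X) (d : R) t : continuous f -> (forall s, leaf (Wf b) (p (f 0)) (p (f s))) -> 0 < d ->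
  exists2 e : R, 0 < e & forall s s', `|s - t| < e -> `|s' - t| < e -> Rel b d (f s) (f s').
Proof.
move=> cf fl d0; have d2 : 0 < d / 2 by keep d0; lra.
have /nbhsRP[e e0 eP] : nbhs t [set s | mdist (f t) (f s) < d / 2].
  have nb : nbhs (f t) [set y | mdist (f t) y < d / 2] by apply/nbhsMP; exists (d / 2).
  exact: cf nb.
exists e => // s s' st s't; exists (fun v => f (s + clamp v * (s' - s))); split.
- apply: (@ccomp R R X (fun v => s + clamp v * (s' - s)) f) => //.
  move=> v; apply: cvgD; first exact: cvg_cst.
  by apply: cvgM; [exact: (@clamp_continuous R v)|exact: cvg_cst].
- by rewrite clamp0 mul0r addr0.
- by rewrite clamp1 mul1r subrKC.
move=> v; split; first by apply: (rst_trans _ _ _ (p (f 0))); [exact: rst_sym (fl s)|exact: fl].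
have h : `|s + clamp v * (s' - s) - t| < e.
  by rewrite addrAC (_ : s' - s = s' - t - (s - t)); [apply: convex_lt => //; exact: clamp_itv|ring].
apply: le_lt_trans (metric_triangle _ (f t) _) _; rewrite [d]splitr; apply: ltrD.
  by rewrite metric_sym; exact: eP.
exact: eP.
Qed.

Lemma bwd_leaf x y : leaf A x y -> bwd x = bwd y.
Proof.
move=> /leaf_joined[f [cf <- <- fl]]; have [d d0 dP] := bwd_local.
apply: (@loc_const R (fun t => bwd (f 0) = bwd (f t)) _ 0 1) => // t.
have [|e e0 eP] := @path_Rel false f d t cf _ d0; first by [].
by exists e => // s s' st s't ->; exact: dP (eP _ _ st s't).
Qed.

Lemma fwd_inj x y : fwd x = fwd y -> on_orbit phi' x y.
Proof.
move=> e; have l := endpt_leaf e; rewrite !og0 in l.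
have [F [hF F0]] := fol_coordP x; have t1 : -1 < (0 : R) < 1 by lra.
have lx : leaf A (F ((0, 1), 0)) x by rewrite F0; exact: leaf_refl.
have ly : leaf A (F ((0, 1), 0)) y by rewrite F0.
have [k kP] := okeyP hF t1 lx; have [k' k'P] := okeyP hF t1 ly.
have [hk _ kog _] := kP; have [hk' _ k'og _] := k'P.
have ep := (fwd_coord hF t1 kP hk' k'og).1 e.
have em : mform (nminus k) (nminus k') = 0.
  have [<- _] := nplus_opp hk'; apply/(bwd_coord hF t1 kP (hgeod_opp hk')); last exact: bwd_leaf l.
  by move=> s; rewrite rgE k'og.
have [c cP] := same_ends hk hk' ep em.
have [u uE] := os_onto x c; exists u; rewrite -ogE uE -(og0 y) k'og kog.
by rewrite cP add0r.
Qed.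

Lemma fwd_bwd x y : fwd x = bwd y -> False.
Proof.
move=> e; have l := endpt_leaf e; rewrite og0 rgE oppr0 og0 in l.
rewrite -(bwd_leaf l) in e.
have [F [hF F0]] := fol_coordP x; have t1 : -1 < (0 : R) < 1 by lra.
have lx : leaf A (F ((0, 1), 0)) x by rewrite F0; exact: leaf_refl.
have [k kP] := okeyP hF t1 lx; have [hk _ kog _] := kP.
have [_ _ f] := hgeod_null hk; have [e1 _] := nplus_opp hk.
have := (fwd_coord hF t1 kP (hgeod_opp hk) _).1 e; rewrite e1 f => h.
have : 1 / 2 = 0 :> R by apply: h => s; rewrite rgE kog.
lra.
Qed.

Lemma os_shift x t u : os (phi' t x) u = os x (u + t) - os x t.
Proof.
have := ld_os (phi' t x) 0 u; rewrite os0 sub0r normrN -!flD add0r ld_os => e.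
have [u0|u0|<-] := ltgtP 0 u; last by rewrite os0 add0r subrr.
  have h : os x t < os x (u + t) by apply: os_mono; rewrite ltrDr.
  have h' : 0 < os (phi' t x) u by rewrite os_pos.
  by move: e; rewrite distrC !gtr0_norm ?subr_gt0.
have h : os x (u + t) < os x t by apply: os_mono; rewrite gtrDr.
have h' : os (phi' t x) u < 0 by rewrite -(os0 (phi' t x)); exact: os_mono.
by move: e; rewrite distrC !ltr0_norm ?subr_lt0 // => /oppr_inj.
Qed.

Lemma fwd_fl x t : fwd (phi' t x) = fwd x.
Proof.
apply/endptP; exists `|os x t| => s _.
have [u <-] := os_onto (phi' t x) s; rewrite ogE os_shift -flD -ogE geodP lee_fin.
by rewrite opprB addrC subrK.
Qed.

Lemma fwd_orbit x y : on_orbit phi' x y -> fwd y = fwd x.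
Proof. by move=> [t ->]; exact: fwd_fl. Qed.

(* The forward end of the geodesic k of the leaf is the endpoint of the orbit that joins
   the common backward end of the leaf to it. *)
Definition join_geod (k k0 : R -> R * R) : R -> R * R :=
  let N := nplus k in let N' := nminus k0 in geod_of (lin (2 * mform N N')^-1 N 0 N) N'.

Lemma join_geodP F t y0 k0 k (g : geod A) : fol_coord F -> -1 < t < 1 -> okey F t y0 k0 -> hgeod k ->
  (forall s, g s = F (k s, t)) -> mform (nplus k) (nminus k0) != 0 ->
  [/\ hgeod (join_geod k k0), leaf A y0 (F (join_geod k k0 0, t)) & fwd (F (join_geod k k0 0, t)) = endpt g].
Proof.
move=> hF t1 k0P hk gE f0; have [hk0 y0E _ _] := k0P.
have [np nm _] := hgeod_null hk; have [np0 nm0 _] := hgeod_null hk0.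
rewrite /join_geod; set N := nplus k in np f0 *; set N' := nminus k0 in nm0 f0 *.
have fp : 0 < mform N N' by rewrite lt_neqAle eq_sym f0 null_form_ge0.
set c := (2 * mform N N')^-1; have c0 : 0 < c by rewrite invr_gt0; keep fp; lra.
have nc := null_scale np c0.
have E : mform (lin c N 0 N) N' = 1 / 2 by rewrite mformC nplus_lin0 mformC /c; field; keep fp; lra.
have hm := geod_ofP nc nm0 E; have [e1 e2] := nplus_geod_of nc nm0 E; set m := geod_of _ _ in hm e1 e2 *.
have hm0 s : half_plane (m s) by case: hm.
have hk00 s : half_plane (k0 s) by case: hk0.
have ly : leaf A y0 (F (m 0, t)).
  rewrite -y0E; apply: leaf_trans (F_leaf hF t1 (hm0 0)).
  by apply: leaf_sym; exact: F_leaf.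
split=> //.
have lF : leaf A (F ((0, 1), t)) (F (m 0, t)) by exact: F_leaf.
have [q qP] := okeyP hF t1 lF; have [hq qE qog _] := qP.
apply/(fwd_coord hF t1 qP hk gE).
have q0 : q 0 = m 0 by apply: (F_inj hF t1) => //; case: hq.
have [nq nq' _] := hgeod_null hq.
have bq : mform (nminus q) (nminus m) = 0.
  rewrite e2 /N'; have [<- _] := nplus_opp hk0.
  apply/(bwd_coord hF t1 qP (hgeod_opp hk0)); last by apply/esym; exact: bwd_leaf ly.
  by move=> s; rewrite rgE; case: k0P => _ _ ->.
have := line_end hq hm q0 bq; rewrite e1 => h; apply: (null_par_trans nq nc np h).
by rewrite mformC nplus_lin0 null_form // mulr0.
Qed.

Lemma fwd_onto (g : geod A) : endpt g <> bwd (g 0) -> exists2 y, leaf A (g 0) y & fwd y = endpt g.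
Proof.
move=> ne; have [F [hF F0]] := fol_coordP (g 0); have t1 : -1 < (0 : R) < 1 by lra.
have lx : leaf A (F ((0, 1), 0)) (g 0) by rewrite F0; exact: leaf_refl.
have [k0 k0P] := okeyP hF t1 lx; have [k [hk kE]] := F_geod hF t1 lx.
have [|hm ly e] := join_geodP hF t1 k0P hk kE; last by exists (F (join_geod k k0 0, 0)).
apply/eqP => h; apply: ne; apply/esym/(bwd_coord hF t1 k0P hk kE).
by rewrite mformC.
Qed.

(** ** Continuity and openness of the forward end *)

(** Bad points in the compact set K would converge along [uf], against convergence at moving
    times. *)
Lemma co_uf (g : nat -> R -> X) (g0 : R -> X) :
  (forall (s : nat -> R) s0, s @ uf --> s0 -> (fun n => g n (s n)) @ uf --> g0 s0) ->
  (fun n => (g n : {compact-open, R -> X})) @ uf --> (g0 : {compact-open, R -> X}).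
Proof.
move=> H; apply/compact_open_cvgP => K O cK oO gKO.
have main : \forall n \near uf, g n @` K `<=` O.
  apply: contrapT => /ufN bad.
  have /choice[s sP] : forall n, exists s, ~ (g n @` K `<=` O) -> K s /\ ~ O (g n s).
    move=> n; have [h|h] := pselect (g n @` K `<=` O); first by exists 0.
    by move/existsNP: h => [y /not_implyP[[s Ks <-] nO]]; exists s.
  have bad' : \forall n \near uf, K (s n) /\ ~ O (g n (s n)) by apply: filterS bad => n; exact: sP.
  have [s0 Ks0 ss0] : exists2 l, K l & s @ uf --> l by apply: compact_uf cK _; apply: filterS bad' => n [].
  have Og : nbhs (g0 s0) O by apply: open_nbhs_nbhs; split => //; apply: gKO; exists s0.
  by have [n [[_ nO] yO]] := filter_ex (filterI bad' (uf_open Og (H _ _ ss0))).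
exact: main.
Qed.

Lemma co_eval_open (W : set X) (t : R) : open W -> open [set h : {compact-open, R -> X} | W (h t)].
Proof.
move=> oW; rewrite openE => h Wh.
have /compact_open_cvgP h1 : nbhs h --> h by exact: cvg_id.
have := h1 [set t] W (@compact_set1 _ t) oW; rewrite image_set1 => h2.
have /h2 : [set h t] `<=` W by move=> _ ->.
by apply: filterS => f /= fW; apply: fW; exists t.
Qed.

Lemma uf_nplus (k : nat -> R -> R * R) (k0 : R -> R * R) : hgeod k0 ->
  (fun n => k n 0) @ uf --> k0 0 -> (fun n => k n 1) @ uf --> k0 1 ->
  (fun n => nplus (k n)) @ uf --> nplus k0 /\ (fun n => nminus (k n)) @ uf --> nminus k0.
Proof.
move=> [h _] k00 k01; have m0 := uf_mk (h 0) k00; have m1 := uf_mk (h 1) k01.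
by split; apply: uf_lin => //; exact: uf_const.
Qed.

Lemma uf_geod_of (N N' : nat -> R * R * R) (a a' : R * R * R) (s : nat -> R) (s0 : R) :
  null a -> null a' -> mform a a' = 1 / 2 -> N @ uf --> a -> N' @ uf --> a' -> s @ uf --> s0 ->
  (fun n => geod_of (N n) (N' n) (s n)) @ uf --> geod_of a a' s0.
Proof.
move=> na na' e Na Na' ss; rewrite /geod_of; apply: uf_mki; last first.
  by apply: uf_lin => //; apply: uf_expR => //; exact: cvgN.
have [h <-] := geod_of_mk s0 na na' e; apply: invr_neq0; exact: lt0r_neq0.
Qed.

Lemma geo_lim F (k : nat -> R -> R * R) (t s : nat -> R) (s0 : R) (k0 : R -> R * R) : fol_coord F ->
  t @ uf --> (0 : R) -> hgeod k0 -> (\forall n \near uf, hgeod (k n)) ->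
  (fun n => k n 0) @ uf --> k0 0 -> s @ uf --> s0 -> (fun n => F (k n (s n), t n)) @ uf --> F (k0 s0, 0) ->
  (fun n => k n (s n)) @ uf --> k0 s0.
Proof.
move=> hF t0 [h0 _] hk kk ss FF; have h01 := @half_plane01 R.
have hh : \forall n \near uf, half_plane (k n 0) /\ half_plane ((0, 1) : R * R).
  by apply: filterS hk => n [].
have dl := uf_hyp_dist (h0 0) h01 kk (@uf_const _ ((0, 1) : R * R)) hh.
apply: (@F_lim F (fun n => k n (s n)) t (k0 s0) (`|s0| + 1 + (hyp_dist (k0 0) (0, 1) + 1)) hF (h0 s0) t0 FF).
have l1 : `|s0| < `|s0| + 1 by rewrite ltrDl.
have l2 : hyp_dist (k0 0) (0, 1) < hyp_dist (k0 0) (0, 1) + 1 by rewrite ltrDl.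
have ss' : (fun n => `|s n|) @ uf --> `|s0| by exact: cvg_norm ss.
apply: filterS3 hk (uf_lt ss' (@uf_const _ _) l1) (uf_lt dl (@uf_const _ _) l2) => n [hn dn] a b.
split=> //; apply: (le_trans (hyp_tri hF (hn (s n)) (hn 0) h01)).
by rewrite dn subr0; apply: lerD; exact: ltW.
Qed.

Lemma okey_lim0 F (x : nat -> X) x0 (q : nat -> R * R) (t : nat -> R) : fol_coord F -> F ((0, 1), 0) = x0 ->
  q @ uf --> ((0, 1) : R * R) -> t @ uf --> (0 : R) ->
  (\forall n \near uf, [/\ x n = F (q n, t n), half_plane (q n) & -1 < t n < 1]) ->
  exists (k : nat -> R -> R * R) (k0 : R -> R * R), [/\
    okey F 0 x0 k0, (\forall n \near uf, -1 < t n < 1 /\ okey F (t n) (x n) (k n)) &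
    forall (s : nat -> R) s0, s @ uf --> s0 -> (fun n => k n (s n)) @ uf --> k0 s0].
Proof.
move=> hF F0 q0 t0 E; have h01 := @half_plane01 R; have t1 : -1 < (0 : R) < 1 by lra.
have xx : x @ uf --> x0.
  have E' : \forall n \near uf, F (q n, t n) = x n by apply: filterS E => n [].
  by apply: uf_congr E' _; rewrite -F0; exact: F_uf.
have lx : leaf A (F ((0, 1), 0)) x0 by rewrite F0; exact: leaf_refl.
have [k0 k0P] := okeyP hF t1 lx; have [hk0 k0E kog _] := k0P.
have /choice[k kP] : forall n, exists k, [/\ x n = F (q n, t n), half_plane (q n) & -1 < t n < 1] -> okey F (t n) (x n) k.
  move=> n; have [[e hq tn]|h] := pselect [/\ x n = F (q n, t n), half_plane (q n) & -1 < t n < 1]; last by exists k0.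
  have [|k kP] := @okeyP F (t n) (x n) hF tn; first by rewrite e; exact: F_leaf.
  by exists k.
have kk : \forall n \near uf, okey F (t n) (x n) (k n) by apply: filterS E => n; exact: kP.
have hk : \forall n \near uf, hgeod (k n) by apply: filterS kk => n [].
have k00 : k0 0 = (0, 1).
  by apply: (F_inj hF t1) => //; [case: hk0|rewrite k0E F0].
have kq : (fun n => k n 0) @ uf --> k0 0.
  rewrite k00; apply: uf_congr q0; apply: filterS2 E kk => n [e hq tn] [[h _] e' _ _].
  by apply: (F_inj hF tn) => //; rewrite e' e.
exists k, k0; split=> //; first by apply: filterS2 E kk => n [].
move=> s s0 ss; apply: (geo_lim hF t0 hk0 hk kq ss); rewrite -kog.
by apply: uf_congr (og_lim xx ss); apply: filterS kk => n [_ _ -> _].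
Qed.

Lemma okey_lim F (x : nat -> X) x0 : fol_coord F -> F ((0, 1), 0) = x0 -> x @ uf --> x0 ->
  exists (t : nat -> R) (k : nat -> R -> R * R) (k0 : R -> R * R), [/\ t @ uf --> (0 : R),
    okey F 0 x0 k0, (\forall n \near uf, -1 < t n < 1 /\ okey F (t n) (x n) (k n)) &
    forall (s : nat -> R) s0, s @ uf --> s0 -> (fun n => k n (s n)) @ uf --> k0 s0].
Proof.
move=> hF F0 xx; have [|q [t [q0 t0 E]]] := @F_open F x hF; first by rewrite F0.
have [k [k0 [h1 h2 h3]]] := okey_lim0 hF F0 q0 t0 E.
by exists t, k, k0.
Qed.

(** The shift by 1/2 puts the base leaf t = 0 in the interior of the arc, so nearby leaves meet it
    as well. *)
Lemma F_tau F : fol_coord F -> Defs.transversal A `[0, 1] (fun t => F ((0, 1), t - 1 / 2)).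
Proof.
move=> hF; have [_ [_ tr] _] := hF; have h01 := @half_plane01 R.
have I01 t : (`[0, 1]%classic : set R) t -> -1 < t - 1 / 2 < 1 by rewrite /= in_itv /=; lra.
split.
  apply/subspace_continuousP => t t01; apply: cvg_trans (cvg_app _ (cvg_within _)) _.
  apply: uf_cts => u ut; apply: F_uf => //; [exact: I01|exact: uf_const|].
  by apply: cvgB => //; exact: uf_const.
move=> t /I01 t1; have [|c Ac [e e0 eP]] := tr (t - 1 / 2); first by rewrite /= in_itv.
exists c => //; exists e => // s /I01 s1 st.
have E (v : R) : v - 1 / 2 - (t - 1 / 2) = v - t by ring.
have [||d inj] := eP (s - 1 / 2); [by rewrite /= in_itv|by rewrite E|].
split=> // s' /I01 s'1 s't e'.
have h : s - 1 / 2 = s' - 1 / 2 by apply: inj => //; rewrite /= ?in_itv ?E.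
by apply: addIr h.
Qed.

Lemma ray_null (q : R * R) N : half_plane q -> null N ->
  [/\ null (ray_plus q N), null (ray_minus q N) & mform (ray_plus q N) (ray_minus q N) = 1 / 2].
Proof.
move=> hq nN; have hP := mk_hyperboloid hq; have f := form_pos nN hP.
pose c := (2 * mform N (mk q))^-1; have c0 : 0 < c by rewrite invr_gt0; keep f; lra.
have cf : c * mform N (mk q) = 1 / 2 by rewrite /c; field; keep f; lra.
have nc : null (ray_plus q N) := null_scale nN c0.
have E0 : mform (ray_minus q N) (ray_minus q N) = 0.
  rewrite /ray_minus -/c form_lin !form_lin2 (mformC (mk q) N) (null_form nN) form_hyperboloid //.
  by transitivity (1 - 2 * (c * mform N (mk q))); [ring|rewrite cf; field].
have E1 : mform (ray_minus q N) (mk q) = 1 / 2.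
  by rewrite /ray_minus -/c form_lin form_hyperboloid // mulNr cf; field.
split=> //; first by apply: (null_cone E0 hP); rewrite E1.
rewrite /ray_plus /ray_minus -/c form_lin !form_lin2 (null_form nN).
by transitivity (c * mform N (mk q)); [ring|rewrite cf].
Qed.

(** The null vectors of the orbits through x n converge. [rho] sends each of them to the geodesic
    with that end issuing from the base curve, and these geodesics converge in the compact-open
    topology. *)
Lemma fwd_open_pre (U : set (Einf A)) : open U -> open (fwd @^-1` U).
Proof.
move=> oU; rewrite openE => x0 Ux0; apply: nbhs_seq => x xx nU.
have [F [hF F0]] := fol_coordP x0; have h01 := @half_plane01 R; have t1 : -1 < (0 : R) < 1 by lra.
have [t [k [k0 [t0 k0P kP klim]]]] := okey_lim hF F0 xx.
have [hk0 _ _ _] := k0P; have [np0 _ _] := hgeod_null hk0.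
have [nl _] := uf_nplus hk0 (klim _ _ (@uf_const _ (0 : R))) (klim _ _ (@uf_const _ (1 : R))).
have [V oV VP] := oU _ (F_tau hF).
pose rho (N : R * R * R) s := geod_of (ray_plus ((0, 1) : R * R) N) (ray_minus (0, 1) N) s.
(* Einf is topologized through geodesics that start on a transversal, so the forward end of an
   orbit has to be represented by such a geodesic. *)
have gen y v q : -1 < v < 1 -> okey F v y q -> exists g : geod A,
    (forall s, g s = F (rho (nplus q) s, v)) /\ fwd y = endpt g.
  move=> v1 qP; have [hq _ _ _] := qP; have [nq _ _] := hgeod_null hq.
  have [h1 h2 h3 h4] := ray_to h01 nq; have [g gE] := geod_F hF v1 h1.
  exists g; split=> //; apply/(fwd_coord hF v1 qP h1 gE).
  by rewrite h3 mformC.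
have [g0 [g0E e0]] := gen _ _ _ t1 k0P.
have /choice[g gP] : forall n, exists g : geod A, -1 < t n < 1 /\ okey F (t n) (x n) (k n) ->
    (forall s, g s = F (rho (nplus (k n)) s, t n)) /\ fwd (x n) = endpt g.
  move=> n; have [[h1 h2]|h] := pselect (-1 < t n < 1 /\ okey F (t n) (x n) (k n)); last by exists g0.
  by have [g gP] := gen _ _ _ h1 h2; exists g.
have gP' : \forall n \near uf, (forall s, g n s = F (rho (nplus (k n)) s, t n)) /\ fwd (x n) = endpt (g n).
  by apply: filterS kP => n; exact: gP.
have rho0 N : null N -> rho N 0 = (0, 1) by move=> nN; have [] := ray_to h01 nN.
have conv : (fun n => (gval (g n) : {compact-open, R -> X})) @ uf --> (gval g0 : {compact-open, R -> X}).
  apply: co_uf => s s0 ss; rewrite g0E.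
  have E : \forall n \near uf, F (rho (nplus (k n)) (s n), t n) = g n (s n).
    by apply: filterS gP' => n [-> _].
  apply: uf_congr E _; apply: F_uf => //.
    by have [hr _ _ _] := ray_to h01 np0; case: hr => hr _; exact: hr.
  have [fp cl] : 0 < mform (nplus k0) (mk ((0, 1) : R * R)) /\
      (fun n => mform (nplus (k n)) (mk ((0, 1) : R * R))) @ uf --> mform (nplus k0) (mk ((0, 1) : R * R)).
    by split; [apply: form_pos => //; exact: mk_hyperboloid|apply: uf_form => //; exact: uf_const].
  have inv : (fun n => (2 * mform (nplus (k n)) (mk ((0, 1) : R * R)))^-1) @ uf --> (2 * mform (nplus k0) (mk ((0, 1) : R * R)))^-1.
    apply: uf_inv; first by rewrite mulf_neq0 ?pnatr_eq0 // lt0r_neq0.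
    by apply: cvgM => //; exact: uf_const.
  have [r1 r2 r3] := ray_null h01 np0; apply: uf_geod_of => //.
    by apply: uf_lin => //; exact: uf_const.
  by apply: uf_lin => //; try exact: uf_const; exact: cvgN.
have Vg0 : V (gval g0).
  apply/VP; last by rewrite -e0.
  by exists (1 / 2); [rewrite /= in_itv /=; lra|rewrite subrr g0E rho0].
have Vg := uf_open (open_nbhs_nbhs (conj oV Vg0)) conv.
have t2 : - (1 / 2) < (0 : R) < 1 / 2 by lra.
have [n [[Vn [gn en]] [tn [_ [hk _ _ _]]]]] := filter_ex (filterI (filterI Vg gP') (filterI (uf_between t0 t2) kP)).
have [nn _ _] := hgeod_null hk.
apply: (nU n); rewrite /= en; apply/VP => //; exists (t n + 1 / 2); last by rewrite addrK gn rho0.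
by rewrite /= in_itv /=; lra.
Qed.

(** A geodesic close to g0 at the times 0 and 1 has a null vector close to that of g0. Joining it to
    the backward end of its leaf gives an orbit through a point close to the one for g0, hence a
    point of U. *)
Lemma fwd_image_open (U : set X) : open U -> (forall x y, on_orbit phi' x y -> U x -> U y) ->
  open (fwd @` U).
Proof.
move=> oU satU; change (Einf_open (fwd @` U)) => tau _.
(* The witness is the union of all open sets of curves that work, for every tau at once; it remains
   to find one containing g0. *)
pose S := [set W : set {compact-open, R -> X} | open W /\ forall g : geod A, W (gval g) -> (fwd @` U) (endpt g)].
exists (\bigcup_(W in S) W); first by apply: bigcup_open => W [].
move=> g0 _; split=> [Ug|[W [_ WP] Wg]]; last exact: WP.
have [F [hF F0]] := fol_coordP (g0 0); have h01 := @half_plane01 R; have t1 : -1 < (0 : R) < 1 by lra.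
pose B e := [set h : {compact-open, R -> X} | mdist (g0 0) (h 0) < e /\ mdist (g0 1) (h 1) < e].
have Bo (e : R) : 0 < e -> open (B e).
  move=> e0; have ob (x : X) : open [set y | mdist x y < e].
    rewrite openE => y ye; apply/nbhsMP; exists (e - mdist x y); first by rewrite subr_gt0.
    by move=> z yz; apply: le_lt_trans (metric_triangle _ y _) _; rewrite -ltrBrDl.
  exact: openI (co_eval_open 0 (ob _)) (co_eval_open 1 (ob _)).
suff [e e0 eP] : exists2 e : R, 0 < e & forall g : geod A, mdist (g0 0) (g 0) + mdist (g0 1) (g 1) < e -> (fwd @` U) (endpt g).
  have e2 : 0 < e / 2 by rewrite divr_gt0.
  exists (B (e / 2)); last by split; rewrite mdistxx.
  by split=> [|g [h1 h2]]; [exact: Bo|apply: eP; rewrite [e]splitr; exact: ltrD].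
apply: eps_seq => [g|g gg nU]; first by rewrite addr_ge0 ?mdist_ge0.
have g0l : (fun n => g n 0) @ uf --> g0 0.
  apply/ufMP; apply: uf_squeeze gg; apply: nearW => n.
  by rewrite mdist_ge0 metric_sym lerDl mdist_ge0.
have g1l : (fun n => g n 1) @ uf --> g0 1.
  apply/ufMP; apply: uf_squeeze gg; apply: nearW => n.
  by rewrite mdist_ge0 metric_sym lerDr mdist_ge0.
have lg : leaf A (F ((0, 1), 0)) (g0 0) by rewrite F0; exact: leaf_refl.
have [k [hk kE]] := F_geod hF t1 lg.
have k0 : k 0 = (0, 1) by apply: (F_inj hF t1) => //; [case: hk|rewrite -kE F0].
have [q [t [q0 t0 E]]] : exists (q : nat -> R * R) (t : nat -> R), [/\ q @ uf --> ((0, 1) : R * R), t @ uf --> (0 : R) &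
    \forall n \near uf, [/\ g n 0 = F (q n, t n), half_plane (q n) & -1 < t n < 1]].
  by apply: (@F_open F (fun n => g n 0)) => //; rewrite F0.
(* All orbits of a leaf have the same backward end, so it can be read off any of them. *)
have xl : (fun n => F ((0, 1), t n)) @ uf --> g0 0.
  by rewrite -F0; apply: F_uf => //; exact: uf_const.
have [|k' [k'0 [k'0P k'P k'lim]]] := okey_lim0 hF F0 (@uf_const _ ((0, 1) : R * R)) t0 (x := fun n => F ((0, 1), t n)).
  by apply: filterS E => n [].
have [hk'0 _ _ _] := k'0P.
have /choice[kn knP] : forall n, exists kn, -1 < t n < 1 -> leaf A (F ((0, 1), t n)) (g n 0) ->
    hgeod kn /\ forall s, g n s = F (kn s, t n).
  move=> n; have [[h1 h2]|h] := pselect (-1 < t n < 1 /\ leaf A (F ((0, 1), t n)) (g n 0)); last by exists k => h1 h2; case: h.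
  by have [kn knP] := F_geod hF h1 h2; exists kn.
have knP' : \forall n \near uf, hgeod (kn n) /\ forall s, g n s = F (kn n s, t n).
  by apply: filterS E => n [e hq tn]; apply: knP => //; rewrite e; exact: F_leaf.
have hkn : \forall n \near uf, hgeod (kn n) by apply: filterS knP' => n [].
have kn0 : (fun n => kn n 0) @ uf --> k 0.
  rewrite k0; apply: uf_congr q0; apply: filterS2 E knP' => n [e hq tn] [[h _] e'].
  by apply: (F_inj hF tn) => //; rewrite -e -e'.
have kn1 : (fun n => kn n 1) @ uf --> k 1.
  apply: (geo_lim hF t0 hk hkn kn0 (@uf_const _ (1 : R))); rewrite -kE.
  by apply: uf_congr g1l; apply: filterS knP' => n [_ ->].
have [Nl _] := uf_nplus hk kn0 kn1.
have [_ Tl] := uf_nplus hk'0 (k'lim _ _ (@uf_const _ (0 : R))) (k'lim _ _ (@uf_const _ (1 : R))).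
have [u Uu ue] := Ug.
have ne : mform (nplus k) (nminus k'0) != 0.
  apply/eqP => h; apply: (@fwd_bwd u (g0 0)); rewrite ue; apply/esym/(bwd_coord hF t1 k'0P hk kE).
  by rewrite mformC.
have [hj lj ej] := join_geodP hF t1 k'0P hk kE ne.
have Uj : U (F (join_geod k k'0 0, 0)) by apply: satU Uu; apply: fwd_inj; rewrite ej.
have fl := uf_form Nl Tl; have [nN _ _] := hgeod_null hk; have [_ nT _] := hgeod_null hk'0.
have fp : 0 < mform (nplus k) (nminus k'0) by rewrite lt_neqAle eq_sym ne null_form_ge0.
have jl : (fun n => F (join_geod (kn n) (k' n) 0, t n)) @ uf --> F (join_geod k k'0 0, 0).
  apply: F_uf => //; first by case: hj.
  have c0 : 0 < (2 * mform (nplus k) (nminus k'0))^-1 by rewrite invr_gt0 mulr_gt0.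
  have Ej : mform (lin (2 * mform (nplus k) (nminus k'0))^-1 (nplus k) 0 (nplus k)) (nminus k'0) = 1 / 2.
    by rewrite mformC nplus_lin0 (mformC (nminus k'0) (nplus k)); field; exact: lt0r_neq0.
  apply: uf_geod_of => //; [exact: null_scale| |exact: uf_const].
  apply: uf_lin => //; last exact: uf_const.
  apply: uf_inv; first by rewrite lt0r_neq0 // mulr_gt0.
  by apply: cvgM => //; exact: uf_const.
have [n [[Un fn] [[h1 h2] [tn k'n]]]] := filter_ex (filterI
  (filterI (uf_open (open_nbhs_nbhs (conj oU Uj)) jl) (uf_lt (@uf_const _ (0 : R)) fl fp)) (filterI knP' k'P)).
have [|_ _ en] := join_geodP hF tn k'n h1 h2; first exact: lt0r_neq0.
by apply: (nU n); rewrite -en; exists (F (join_geod (kn n) (k' n) 0, t n)).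
Qed.

(** ** Orbits do not return *)

Lemma deck_os g x t : deck p g -> os (g x) t = os x t.
Proof.
move=> dg; have e : `|os (g x) t| = `|os x t| by rewrite -!ld_os0 deck_fl // deck_ld.
have [t0|t0|<-] := ltgtP 0 t; last by rewrite !os0.
  by move: e; rewrite !gtr0_norm ?os_pos.
have neg y : os y t < 0 by rewrite -(os0 y); exact: os_mono.
by move: e; rewrite !ltr0_norm // => /oppr_inj.
Qed.

(** The leafwise length of a unit of time is positive, continuous and invariant under the deck
    group, hence bounded below. *)
Lemma os_grow : exists2 c : R, 0 < c & forall x (n : nat), c * n%:R <= os x n%:R.
Proof.
have [||c c0 cP] := @eps_seq R X (fun x => os x 1) (fun=> False).
- by move=> x; apply: ltW; rewrite os_pos.
- move=> x x0 _; have [g [l [dg gl]]] := cocompact hM hcov hmet x.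
  have lim := os_lim gl (@uf_const _ (1 : R)).
  have e0 : os l 1 = 0 by apply: uf_uniq lim _; apply: uf_congr x0; apply: nearW => n; rewrite deck_os.
  by have := os_pos l 1; rewrite e0 ltxx ltr01.
exists c => // x; elim=> [|n IH]; first by rewrite mulr0 os0.
have := os_shift x n%:R 1; rewrite [1 + _]addrC natr1 => e.
have h : c <= os (phi' n%:R x) 1 by rewrite leNgt; apply/negP => /cP.
by rewrite -[n.+1%:R]natr1 mulrDr mulr1 natr1; keep IH h e; lra.
Qed.

Lemma between_steps (r : nat -> R) (a T : R) : r 0%N = 0 -> 0 < a -> (forall n, a <= r n.+1 - r n) -> 0 <= T ->
  exists n, r n <= T < r n.+1.
Proof.
move=> r0 a0 inc T0.
have lb n : a * n%:R <= r n.
  elim: n => [|n IH]; first by rewrite mulr0 r0.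
  by have := inc n; rewrite -[n.+1%:R]natr1 mulrDr mulr1; keep IH; lra.
have ex : exists n, T < r n.
  exists (Num.bound (T / a)); apply: lt_le_trans (lb _).
  by rewrite mulrC -ltr_pdivrMr //; apply: archi_boundP; rewrite divr_ge0 // ltW.
case: (ex_minnP ex) => -[|n]; first by rewrite r0 ltNge T0.
move=> h1 h2; exists n; rewrite h1 andbT leNgt; apply/negP => /h2; by rewrite ltnn.
Qed.

Lemma no_return_arith (a b v w h : R) : - (h / 2) < b < h / 2 -> - (2 * h) <= v <= 2 * h ->
  w + 5 * h / 2 <= a -> w <= v + (a + b).
Proof. by lra. Qed.

(** A closing argument. A stable arc through w n on which b varies is contracted by the long flow,
    so its image near l has almost constant b. By the intermediate value theorem some point returns
    with its own b, that is, to its own small unstable plaque; but its orbit is a leafwise geodesic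
    and has gone far in the leaf. *)
Lemma no_return_seq (w : nat -> X) (T : nat -> R) (l : X) : w @ uf --> l -> (fun n => phi' (T n) (w n)) @ uf --> l ->
  (forall C, \forall n \near uf, C < T n) -> False.
Proof.
move=> wl Tl Tinf; have [c hc dl] := xboxP l.
have [h0 h00 fP] := fanP true; have hh : 0 < h0 / 2 < h0 by keep h00; lra.
have [d d0 [N NP]] := fP _ hh 1 ltr01; set h := h0 / 2 in hh NP; have hg : 0 < h by case/andP: hh.
have d2 : 0 < d / 2 by rewrite divr_gt0.
pose E (z : (R * R) * R) := cinv c z.
have cE_ : continuous E by exact: cinv_continuous.
have [rho rho0 rhoP] : exists2 rho : R, 0 < rho & forall z, ball (c l) rho z -> mdist l (E z) < d / 2.
  have : nbhs (c l) (E @^-1` [set y | mdist l y < d / 2]).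
    by apply: cE_; rewrite /E cmapK //; apply/nbhsMP; exists (d / 2).
  by move=> /nbhs_ballP[rho rho0 h']; exists rho.
pose k := rho / 2; have k0 : 0 < k by rewrite divr_gt0.
(* An arc in the stable plaque of w n on which b runs through an interval of radius k about its
   value at w n. *)
pose g n (t : R) := E (((c (w n)).1.1, (c (w n)).1.2), (c (w n)).2 + (2 * clamp t - 1) * k).
have [al tl bl] := uf_chart dl wl.
have gE n t : c (g n t) = (((c (w n)).1.1, (c (w n)).1.2), (c (w n)).2 + (2 * clamp t - 1) * k).
  by rewrite /g cinvK.
have gd n t : dom c (g n t) by exact: cinv_dom.
have gc n : continuous (g n).
  move=> t; apply: uf_cts => s st; apply: (@cts_uf _ _ E); first exact: cE_.
  apply: uf_pair; first exact: uf_const.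
  have cs := cts_uf (@clamp_continuous R t) st.
  apply: cvgD; [exact: uf_const|apply: cvgM; [|exact: uf_const]].
  by apply: cvgB; [apply: cvgM => //|]; exact: uf_const.
have gl n t : leaf (Wf true) (p (g n 0)) (p (g n t)).
  by apply: (@box_leafS c hc (g n) (gc n)) => s; split; [exact: gd|rewrite !gE].
have good : \forall n \near uf, dom c (w n) /\ forall t, mdist l (g n t) < d / 2.
  apply: filterS3 (uf_dom dl wl) ((ufRP _ _).1 al _ rho0) (filterI ((ufRP _ _).1 tl _ rho0) ((ufRP _ _).1 bl _ k0)).
  move=> n dw an [tn bn]; split=> // t; apply: rhoP; split; [split|]; rewrite /ball /= distrC //.
  move: bn; have := clamp_itv t; rewrite /k !ltr_norml; move: (clamp t) => v; keep rho0; nra.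
have /choice[r rP] : forall n, exists r, (forall t, mdist l (g n t) < d / 2) -> fan true h 1 N (g n) r.
  move=> n; have [near_|nn] := pselect (forall t, mdist l (g n t) < d / 2); last by exists (fun _ _ => 0).
  have [|r rP] := NP (g n) (gc n); last by exists r.
  move=> t; split=> //; apply: le_lt_trans (metric_triangle _ l _) _.
  by rewrite [d]splitr; apply: ltrD => //; rewrite metric_sym.
have hf : 0 <= (1 / 2 : R) <= 1 by lra.
have h2 : 0 < h / 2 by rewrite divr_gt0.
(* the fan is cut at the time m n closest to T n, and straightened there *)
have /choice[m mP] : forall n, exists m, fan true h 1 N (g n) (r n) -> 0 <= T n -> r n m (1 / 2) <= T n < r n m.+1 (1 / 2).
  move=> n; have [[f T0]|nf] := pselect (fan true h 1 N (g n) (r n) /\ 0 <= T n); last by exists 0%N => f T0; case: nf.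
  have [[_ r0] _ inc _ _] := f.
  have [|m mP] := @between_steps (fun m => r n m (1 / 2)) (h / 2) (T n) (r0 _) h2 _ T0; last by exists m.
  by move=> m; have /andP[] := inc m _ hf.
have fan_n : \forall n \near uf, fan true h 1 N (g n) (r n) by apply: filterS good => n [_ gn]; exact: rP.
have T0 : \forall n \near uf, 0 <= T n by apply: filterS (Tinf 0) => n /ltW.
have m_n : \forall n \near uf, r n (m n) (1 / 2) <= T n < r n (m n).+1 (1 / 2).
  by apply: filterS2 fan_n T0 => n; exact: mP.
have minf M' : \forall n \near uf, (M' <= m n)%N.
  apply: filterS3 fan_n m_n (Tinf (3 * h / 2 * M'.+1%:R)) => n f /andP[_ mn] Tn.
  rewrite -ltnS ltnNge; apply/negP => le.
  have /andP[_ ub] := fan_time (m n).+1 hg f hf; have := lt_trans Tn (lt_le_trans mn ub).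
  rewrite ltNge ler_wpM2l //; first by keep hg; lra.
  by rewrite ler_nat; exact: leqW.
have [e_ e_0 e_P] := Rel_ld ltr01; have [cg cg0 cgP] := os_grow.
have [||e1 e10 e1P] := @eps_seq R (X * X)%type (fun z => mdist l z.1 + mdist l z.2)
    (fun z => cb false c z.1 = cb false c z.2 -> Rel false e_ z.1 z.2).
- by move=> z; rewrite addr_ge0 ?mdist_ge0.
- move=> z z0 nz.
  have z1 : (fun n => (z n).1) @ uf --> l.
    apply/ufMP; apply: uf_squeeze z0; apply: nearW => n; rewrite mdist_ge0 metric_sym lerDl mdist_ge0 //.
  have z2 : (fun n => (z n).2) @ uf --> l.
    apply/ufMP; apply: uf_squeeze z0; apply: nearW => n; rewrite mdist_ge0 metric_sym lerDr mdist_ge0 //.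
  have [|n Rn] := filter_ex (@Rel_of_box false c l _ _ e_ hc dl z1 z2 e_0 _); last by apply: (nz n).
  by apply: nearW => n; apply: contrapT => nb; apply: (nz n) => /nb.
have e12 : 0 < e1 / 2 by rewrite divr_gt0.
have [rho' rho'0 rho'P] : exists2 rho' : R, 0 < rho' & forall z, ball (c l) rho' z -> mdist l (E z) < e1 / 2.
  have : nbhs (c l) (E @^-1` [set y | mdist l y < e1 / 2]).
    by apply: cE_; rewrite /E cmapK //; apply/nbhsMP; exists (e1 / 2).
  by move=> /nbhs_ballP[rho' rho'0 h']; exists rho'.
have [k' /andP[k'0 _] [k'r k'k]] := below2 rho'0 (divr_gt0 k0 (ltr0Sn R 1)).
have [e3 e30 e3P] : exists2 e3 : R, 0 < e3 & forall y, mdist l y < e3 -> dom c y /\ `|(c y).2 - (c l).2| < k'.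
  have n1 : nbhs (c l).2 [set v : R | `|v - (c l).2| < k'] by apply/nbhsRP; exists k'.
  have /nbhsMP[e3 e30 e3P] : nbhs l (dom c `&` [set y | `|(c y).2 - (c l).2| < k']).
    by apply: filterI; [exact: chart_nbhs|exact: (chart_snd dl n1)].
  by exists e3.
have [e5 /andP[e50 _] [e53 e51]] := below2 (divr_gt0 e30 (ltr0Sn R 1)) (divr_gt0 e12 (ltr0Sn R 1)).
have [e6 e60 e6P] := fl_unif (2 * h) e50; have e62 : 0 < e6 / 2 by rewrite divr_gt0.
have M0 : 0 <= (1 / cg + 1 + 5 * h / 2) / (h / 2).
  have icg : 0 < 1 / cg by rewrite divr_gt0.
  by apply: divr_ge0; [keep icg hg; lra|exact: ltW].
have Tl' : (fun n => mdist l (phi' (T n) (w n))) @ uf --> (0 : R).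
  by have := uf_mdist (@uf_const _ l) Tl; rewrite mdistxx.
have [n [[[dw gn] [f mn]] [[am tm] [bm [Tn [N1 N2]]]]]] := filter_ex (filterI (filterI good (filterI fan_n m_n))
  (filterI (filterI ((ufRP _ _).1 al _ rho'0) ((ufRP _ _).1 tl _ rho'0))
   (filterI ((ufRP _ _).1 bl _ (divr_gt0 k0 (ltr0Sn R 1))) (filterI ((ufRP _ _).1 Tl' _ e50)
    (filterI (minf (N (e6 / 2))) (minf (Num.bound ((1 / cg + 1 + 5 * h / 2) / (h / 2))))))))).
rewrite subr0 ger0_norm ?mdist_ge0 // in Tn.
have [[cr r0] _ inc _ decay] := f; have [u [cu u0 uP]] := decay _ _ e62 N1.
(* The constant shift that makes the corrected time at the middle of the arc, which is w n, equal to
   T n. *)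
pose sh := T n - (r n (m n) (1 / 2) + u (1 / 2)).
have shP : `|sh| <= 2 * h.
  have [u1 _] := uP _ hf; have := inc (m n) _ hf.
  move: u1 mn; rewrite /sh ltr_norml ler_norml; keep hg.
  by move: (r n (m n).+1 _) (r n (m n) _) (u _) (T n) => a b v t; lra.
pose S t := sh + (r n (m n) t + u t); pose P t := phi' (S t) (g n t).
have wE : g n (1 / 2) = w n.
  apply: box_eq => //; rewrite gE //= clamp_id // (_ : 2 * (1 / 2) - 1 = 0) ?mul0r ?addr0 //; by field.
have PT : P (1 / 2) = phi' (T n) (w n) by rewrite /P /S subrK wE.
have Pl t : 0 <= t <= 1 -> mdist l (P t) < 2 * e5.
  move=> t01; apply: le_lt_trans (metric_triangle _ (P (1 / 2)) _) _.
  rewrite mulr_natl mulr2n; apply: ltrD; first by rewrite PT.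
  rewrite /P /S !(flD sh); apply: e6P => //; have [_ h1] := uP _ t01; have [_ h3] := uP _ hf.
  apply: le_lt_trans (metric_triangle _ (psi true (h * (m n)%:R) (g n 0)) _) _.
  by rewrite [e6]splitr; apply: ltrD => //; rewrite metric_sym.
have Pe3 t : 0 <= t <= 1 -> mdist l (P t) < e3.
  by move=> /Pl h1; apply: lt_trans h1 _; keep e53; lra.

(* The displacement of b under the return: positive at the start of the arc and negative at its end,
   since b is nearly constant on the image. *)
pose q t := (c (P t)).2 - (c (g n t)).2.
have cq t : 0 <= t <= 1 -> {for t, continuous q}.
  move=> t01; have [dP _] := e3P _ (Pe3 _ t01).
  apply: uf_cts => s st; have gs := cts_uf (gc n t) st.
  have Ss : (fun i => S (s i)) @ uf --> S t.
    by apply: cvgD; [exact: uf_const|apply: cvgD; [exact: cts_uf (cr _ t) st|exact: cts_uf (cu t) st]].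
  have [_ _ l1] := uf_chart dP (uf_fl Ss gs); have [_ _ l2] := uf_chart (gd n t) gs.
  exact: cvgB.
have bP t : 0 <= t <= 1 -> `|(c (P t)).2 - (c l).2| < k' by move=> /Pe3 /e3P [].
have [|t t01 qt] := @ivt R q 0 1 0 ler01 cq.
  right; rewrite /q !gE clamp0 clamp1 /=.
  move: (bP 0 itv0) (bP 1 itv1) bm; rewrite !ltr_norml; keep k'k k0.
  by move: ((c (P 0)).2) ((c (P 1)).2) ((c l).2) ((c (w n)).2) => a b v z; lra.
have bE : (c (P t)).2 = (c (g n t)).2 by move/eqP: qt; rewrite subr_eq0 => /eqP.
have gl1 : mdist l (g n t) < e1 / 2.
  apply: rho'P; split; [split|]; rewrite /ball /= distrC //.
  by have := bP t t01; rewrite bE gE /= => h1; apply: lt_trans h1 k'r.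
have Pl1 : mdist l (P t) < e1 / 2.
  apply: lt_trans (Pl t t01) _; keep e51; lra.
have : Rel false e_ (g n t) (P t).
  by apply: (e1P (g n t, P t)) => /=; [rewrite [e1]splitr; exact: ltrD|rewrite /cb /= bE].
move=> /e_P [_]; rewrite /P ld_os0.
have St : 1 / cg + 1 <= S t.
  have [u1 _] := uP _ t01; have /andP[rm _] := fan_time (m n) hg f t01.
  have mM : 1 / cg + 1 + 5 * h / 2 <= h / 2 * (m n)%:R.
    rewrite [h / 2 * _]mulrC -ler_pdivrMr //; apply: ltW; apply: lt_le_trans (archi_boundP M0) _.
    by rewrite ler_nat.
  have := le_trans mM rm; move: u1 shP; rewrite /S ltr_norml ler_norml.
  exact: no_return_arith.
have S0 : 0 <= S t by apply: le_trans St; rewrite addr_ge0 // divr_ge0 // ltW.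
have [j [v [v01 v1 Sj]]] := natP S0.
move=> os1; have a3 := cgP (g n t) j.
have a2 : os (g n t) j%:R <= os (g n t) (S t) by apply: os_le; rewrite Sj lerDl; case/andP: v01.
have a1 : 1 <= cg * j%:R.
  rewrite mulrC -ler_pdivrMr //; move: St; rewrite Sj; keep v1; lra.
by have := le_trans (le_trans a1 a3) a2; rewrite leNgt (le_lt_trans (ler_norm _) os1).
Qed.

(** Negative times are reversed; bounded times are settled by [no_short_return] and unbounded ones
    by [no_return_seq]. *)
Lemma no_return (h : R) : 0 < h -> exists2 e : R, 0 < e & forall x T, mdist x (phi' T x) < e -> `|T| < h.
Proof.
move=> h0.
suff [e e0 eP] : exists2 e : R, 0 < e & forall z : R * X, mdist z.2 (phi' z.1 z.2) < e -> 0 <= z.1 -> z.1 < h.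
  exists e => // x T d; have [T0|T0] := leP 0 T; first by rewrite ger0_norm //; exact: (eP (T, x)).
  rewrite ltr0_norm //; apply: (eP (- T, phi' T x)) => /=; last by rewrite oppr_ge0 ltW.
  by rewrite flK metric_sym.
apply: eps_seq => [z|z z0 nz]; first exact: mdist_ge0.
have nz' n : 0 <= (z n).1 /\ h <= (z n).1.
  by split; [apply: contrapT => k; apply: (nz n)|rewrite leNgt; apply/negP => k; apply: (nz n)].
have [C|nC] := pselect (exists C, \forall n \near uf, (z n).1 <= C).
  have [D DP] := C; have [e e0 eP] := no_short_return D h0.
  have [n [h1 h2]] := filter_ex (filterI DP ((ufRP _ _).1 z0 e e0)).
  have [k1 k2] := nz' n; have := eP (z n).1 (z n).2.
  rewrite ger0_norm // => /(_ h1); rewrite subr0 ger0_norm ?mdist_ge0 // in h2.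
  by move=> /(_ h2); rewrite ltNge k2.
have [g [l [dg gl]]] := cocompact hM hcov hmet (fun n => (z n).2).
apply: (@no_return_seq (fun n => g n (z n).2) (fun n => (z n).1) l gl).
  apply: uf_close gl; apply: uf_congr z0; apply: nearW => n.
  by rewrite deck_fl // (deck_iso hmet).
move=> C; have : ~ (\forall n \near uf, (z n).1 <= C) by move=> h1; apply: nC; exists C.
by move=> /ufN; apply: filterS => n /negP; rewrite -ltNge.
Qed.

(** ** Stable leaves are asymptotic *)

Lemma Rel_trans b e e' x y z : Rel b e x y -> Rel b e' y z -> Rel b (e + e') x z.
Proof.
move=> xy; have dxy := Rel_mdist xy; case: xy => f [cf f0 f1 fP] [g [cg g0 g1 gP]].
have e'0 : 0 < e' by have [_ h] := gP 0; apply: le_lt_trans h; exact: mdist_ge0.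
exists (fun t => if t <= 2^-1 then f (clamp (2 * t)) else g (clamp (2 * t - 1))); split.
- apply: (@pw_continuous R X (fun t => f (clamp (2 * t))) (fun t => g (clamp (2 * t - 1)))).
  + apply: (@ccomp R R X (fun t => clamp (2 * t)) f) => //.
    apply: (@ccomp R R R (fun t => 2 * t) (@clamp R)); last exact: clamp_continuous.
    by move=> v; apply: cvgM; [exact: cvg_cst|exact: cvg_id].
  + apply: (@ccomp R R X (fun t => clamp (2 * t - 1)) g) => //.
    apply: (@ccomp R R R (fun t => 2 * t - 1) (@clamp R)); last exact: clamp_continuous.
    by move=> v; apply: cvgB; [apply: cvgM; [exact: cvg_cst|exact: cvg_id]|exact: cvg_cst].
  + by rewrite divff // subrr clamp1 clamp0 f1 g0.
- by rewrite invr_ge0 ler0n mulr0 clamp0.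
- rewrite leNgt invf_lt1 // ltr1n /= mulr1 (_ : 2 - 1 = 1 :> R) ?clamp1 //; by ring.
move=> t; case: ifP => _.
  by have [h1 h2] := fP (clamp (2 * t)); split=> //; apply: lt_le_trans h2 _; rewrite lerDl ltW.
have [h1 h2] := gP (clamp (2 * t - 1)); split.
  by apply: (rst_trans _ _ _ (p y)) => //; have [] := fP 1; rewrite f1.
by apply: le_lt_trans (metric_triangle _ y _) _; exact: ltrD.
Qed.

Lemma Rel_flow b (T e : R) : 0 < e -> exists2 d : R, 0 < d & forall t x y, `|t| <= T ->
  Rel b d x y -> Rel b e (phi' t x) (phi' t y).
Proof.
move=> e0; have [d d0 dP] := fl_unif T e0; exists d => // t x y tT [g [cg g0 g1 gP]].
exists (fun s => phi' t (g s)); rewrite g0 g1; split=> //.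
  exact: (@ccomp R X X g (phi' t) cg (@flx_cts t)).
move=> s; have [h1 h2] := gP s; split; last exact: dP.
exact: (@leaf_psi b true t t).
Qed.

Lemma Rel_time b (e u : R) x : (forall v, `|v| <= `|u| -> 0 <= v * u -> mdist x (phi' v x) < e) -> Rel b e x (phi' u x).
Proof.
move=> uP; exists (fun s => phi' (clamp s * u) x); split.
- apply: (@ccomp R R X (fun s => clamp s * u) (fun t => phi' t x)); last exact: flt_cts.
  by move=> s; apply: cvgM; [exact: (@clamp_continuous R s)|exact: cvg_cst].
- by rewrite clamp0 mul0r fl0.
- by rewrite clamp1 mul1r.
move=> s; split; last first.
  have /andP[c0 c1] := clamp_itv s; apply: uP; first by rewrite normrM ger0_norm // ler_piMl.
  by rewrite -mulrA mulr_ge0 // -expr2 sqr_ge0.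
rewrite -{1}(fl0 x); exact: (@leaf_psi b true 0 (clamp s * u) x x (rst_refl _ _ _)).
Qed.

Lemma Rel_refl b (e : R) x : 0 < e -> Rel b e x x.
Proof.
move=> e0; rewrite -{2}(fl0 x); apply: Rel_time => v; rewrite normr0 normr_le0 => /eqP -> _.
by rewrite fl0 mdistxx.
Qed.

Lemma fan_decay b h e1 N g r n (e : R) : fan b h e1 N g r -> continuous g ->
  (forall t, leaf (Wf b) (p (g 0)) (p (g t))) -> 0 < e -> (N e <= n)%N ->
  exists2 u, `|u| < h / 2 & Rel b e (psi b (h * n%:R) (g 0)) (psi b (r n 1 + u) (g 1)).
Proof.
move=> [[cr _] r0 _ _ decay] cg gl e0 Nn; have [u [cu u0 uP]] := decay _ _ e0 Nn.
exists (u 1); first by have [] := uP 1 itv1.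
exists (fun s => psi b (r n (clamp s) + u (clamp s)) (g (clamp s))); split.
- move=> s; apply: uf_cts => v vs; have hv := cts_uf (@clamp_continuous R s) vs.
  apply: uf_psi; last exact: cts_uf (cg _) hv.
  by apply: cvgD; [exact: cts_uf (cr n _) hv|exact: cts_uf (cu _) hv].
- by rewrite clamp0 r0 u0 addr0.
- by rewrite clamp1.
by move=> s; split; [apply: leaf_psi|have [_] := uP _ (clamp_itv s)].
Qed.

(* B keeps T' from staying bounded, so that y is approached in forward time. *)
Definition converge x y := forall d B : R, 0 < d -> exists C, forall T, C <= T ->
  exists2 T', B <= T' & Rel true d (phi' T x) (phi' T' y).

Lemma converge_trans x y z : converge x y -> converge y z -> converge x z.
Proof.
move=> xy yz d B d0; have d2 : 0 < d / 2 by rewrite divr_gt0.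
have [C CP] := yz _ B d2; have [C' C'P] := xy _ C d2; exists C' => T /C'P [T' /CP [T'' T''B h2] h1].
by exists T'' => //; rewrite [d]splitr; exact: Rel_trans h2.
Qed.

Lemma converge_local : exists2 d : R, 0 < d & forall x y, Rel true d x y -> converge x y.
Proof.
have [h0 h00 fP] := fanP true; have hh : 0 < h0 / 2 < h0 by keep h00; lra.
have [d d0 [N NP]] := fP _ hh 1 ltr01; set h := h0 / 2 in hh NP; have hg : 0 < h by case/andP: hh.
exists d => // x y [g [cg g0 g1 gP]] e B e0; rewrite -g0 in gP.
have [r rP] := NP g cg gP; have gl t : leaf (Wf true) (p (g 0)) (p (g t)) by case: (gP t).
have [e' e'0 e'P] := Rel_flow true h e0.
have h2 : 0 < h / 2 by rewrite divr_gt0.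
(* The first summand makes the orbits close, the second pushes the time of y beyond B; its successor
   absorbs the shift u. *)
pose n1 := (N e' + (Num.bound (`|B| / (h / 2))).+1)%N.
exists (h * n1%:R) => T hT.
have hT0 : 0 <= T / h - n1%:R by rewrite subr_ge0 ler_pdivlMr // mulrC.
have [j [v [v01 v1 jv]]] := natP hT0.
have TE : T = h * v + h * (n1 + j)%:R.
  by rewrite natrD -mulrDr -[T](divfK (lt0r_neq0 hg)) mulrC; congr (_ * _); move/eqP: jv; rewrite subr_eq => /eqP ->; ring.
have [|u uh Ru] := @fan_decay true h 1 N g r (n1 + j) e' rP cg gl e'0 _.
  by rewrite /n1 -!addnA leq_addr.
exists (h * v + (r (n1 + j)%N 1 + u)).
  have /andP[rn _] := fan_time (n1 + j) hg rP itv1.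
  have nB : `|B| / (h / 2) <= (n1 + j)%:R - 1.
    apply: ltW; apply: lt_le_trans (archi_boundP (divr_ge0 (normr_ge0 B) (ltW h2))) _.
    rewrite lerBrDr natr1 ler_nat /n1 addnAC; exact: leq_addl.
  rewrite ler_pdivrMr // mulrC mulrBr mulr1 in nB.
  have vh : 0 <= h * v by apply: mulr_ge0; [exact: ltW|case/andP: v01].
  apply: le_trans (ler_norm B) _; apply: le_trans nB _.
  move: uh; rewrite ltr_norml => /andP[u1 _].
  move: u1 rn vh; move: (r _ _) => a; move: (h * v) (h / 2 * _) => b c; move: (h / 2) => k u1 rn vh; keep u1 rn vh; lra.
rewrite TE (flD (h * v) (h * _)) (flD (h * v) (_ + u)) -g0 -g1; apply: e'P => //.
rewrite normrM !ger0_norm ?(ltW hg) //; last by case/andP: v01.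
by rewrite -[leRHS]mulr1 ler_wpM2l ?(ltW hg) // ltW.
Qed.

Notation As := (lift_atlas p Ws).

Lemma converge_leaf x y : leaf As x y -> converge x y.
Proof.
move=> /leaf_joined[f [cf <- <- fl]]; have [d d0 dP] := converge_local.
apply: (@loc_const R (fun t => converge (f 0) (f t)) _ 0 1) => [t|].
  have [|e e0 eP] := @path_Rel true f d t cf _ d0; first by [].
  by exists e => // s s' st s't h; exact: converge_trans h (dP _ _ (eP _ _ st s't)).
move=> e B e0; exists B => T TB; exists T => //; exact: Rel_refl.
Qed.

(** ** Markers from short stable arcs *)

Lemma Rel_of_chart c l (y z : nat -> X) e : A c -> dom c l -> y @ uf --> l -> z @ uf --> l -> 0 < e ->
  (\forall n \near uf, (c (y n)).2 = (c (z n)).2) -> \forall n \near uf, Rel false e (y n) (z n).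
Proof.
move=> [c0 Wc0 c0P] dl yl zl e0 same; have [c' hc' dl'] := xboxP l.
apply: (Rel_of_box hc' dl' yl zl e0); have [cs [cu [_ Cu dP _]]] := hc'.
have [dl0 cl] := c0P _ dl; have [_ du _ _] := dP _ dl'.
have [U nU UP] := Cu _ Wc0 _ du dl0.
have pU (x : nat -> X) : x @ uf --> l -> \forall n \near uf, [/\ U (p (x n)), dom c (x n) & dom c' (x n)].
  move=> xl; have h : (fun n => p (x n)) @ uf --> p l by apply: cts_uf xl; exact: (cover_cts hcov).
  have h1 := uf_dom dl xl; have h2 := uf_dom dl' xl; have h3 := uf_open nU h.
  by near do split.
near=> n; have [uy dy dy'] : [/\ U (p (y n)), dom c (y n) & dom c' (y n)] by near: n; exact: pU.
have [uz dz dz'] : [/\ U (p (z n)), dom c (z n) & dom c' (z n)] by near: n; exact: pU.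
have [_ _ E _] := dP _ dy'; have [_ _ E' _] := dP _ dz'.
rewrite /cb E E'; have [_ _ h] := UP _ _ uy uz; apply/h.
have [_ <-] := c0P _ dy; have [_ <-] := c0P _ dz; near: n; exact: same.
Unshelve. all: by end_near.
Qed.

(* A short stable arc whose forward orbits will be the rays of a marker: the third condition makes
   the marker injective, the fourth makes its vertical curves transverse to the unstable leaves. *)
Definition seed (g : R -> X) (d : R) := [/\ continuous g,
  forall t, leaf (Wf true) (p (g 0)) (p (g t)) /\ mdist (g 0) (g t) < d,
  forall t t', 0 <= t <= 1 -> 0 <= t' <= 1 -> on_orbit phi' (g t) (g t') -> t = t' &
  exists2 e : R, 0 < e & forall t t', 0 <= t <= 1 -> 0 <= t' <= 1 -> Rel false e (g t) (g t') -> t = t'].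

(** An error eps / 12 from the fan and one from the interpolation put a point of the marker within
    eps / 6 of a reference point, and two such points within the height eps / 3 allowed for a
    marker. *)
Lemma twelfths (a b e : R) : a < e / 12 -> b < e / 12 -> a + b < e / 6. Proof. lra. Qed.
Lemma sixths (a b e : R) : a < e / 6 -> b < e / 6 -> a + b < e / 3. Proof. lra. Qed.

Section SeedMarker.
Variables (eps h d k nr : R) (N : R -> nat) (g : R -> X) (r : nat -> R -> R).
Hypotheses (e0 : 0 < eps) (h0 : 0 < h) (gs : seed g d) (rP : fan true h (eps / 12) N g r)
  (kP : forall t x, `|t| < k -> mdist x (phi' t x) < eps / 12) (hk : 3 * h / 2 < k)
  (nrP : forall x T, mdist x (phi' T x) < nr -> `|T| < 1) (dn : d + d <= nr).

(** Fan times interpolated between integer heights, so that the points over one height stay close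
    together; the absolute value makes the function total. *)
Let rho (t s : R) := pl (fun n => r n t) `|s|.
Let m (z : R * R) := phi' (rho z.1 z.2) (g z.1).

Let uf_rho (t s : nat -> R) (t0 s0 : R) : t @ uf --> t0 -> s @ uf --> s0 ->
  (fun n => rho (t n) (s n)) @ uf --> rho t0 s0.
Proof.
move=> tt ss; have [[cr _] _ _ _ _] := rP; apply: uf_pl => [j|n|].
- exact: cts_uf (cr j _) tt.
- exact: normr_ge0.
- apply: (@cts_uf _ _ (fun s : R => `|s|)) ss; exact: norm_continuous.
Qed.

Let rho_incr (t s s' : R) : 0 <= t <= 1 -> 0 <= s -> s <= s' ->
  h / 2 * (s' - s) <= rho t s' - rho t s <= 3 * h / 2 * (s' - s).
Proof.
move=> t01 s0 ss; have [_ _ h2 _ _] := rP.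
rewrite /rho !ger0_norm ?(le_trans s0 ss) //; apply: pl_incr => // n; exact: h2.
Qed.

Let rho0 t : rho t 0 = 0.
Proof. by have [[_ h1] _ _ _ _] := rP; rewrite /rho normr0 pl0 h1. Qed.

Let rho_inj (t s s' : R) : 0 <= t <= 1 -> 0 <= s -> 0 <= s' -> rho t s = rho t s' -> s = s'.
Proof.
move=> t01; wlog ss : s s' / s <= s'.
  by move=> H a b c; have [?|/ltW ?] := leP s s'; [exact: H|apply/esym; exact: H].
move=> a b e; have /andP[] := rho_incr t01 a ss; rewrite e subrr => q _.
have q' : h / 2 * (s' - s) <= 0 by [].
by apply/eqP; rewrite eq_le ss -subr_le0 -(pmulr_rle0 _ (divr_gt0 h0 (ltr0Sn R 1))).
Qed.

Let m_cts : continuous m.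
Proof.
move=> z; apply: uf_cts => u uz; have [cg _ _ _] := gs.
apply: uf_fl; first by apply: uf_rho; [exact: uf_fst|exact: uf_snd].
exact: cts_uf (cg _) (uf_fst uz).
Qed.

Let m_inj (t s t' s' : R) : 0 <= t <= 1 -> 0 <= t' <= 1 -> 0 <= s -> 0 <= s' -> m (t, s) = m (t', s') ->
  (t, s) = (t', s').
Proof.
move=> t01 t'01 s0 s'0 e; have [_ _ inj _] := gs.
have tt : t = t'.
  apply: inj => //; exists (- rho t' s' + rho t s).
  by rewrite flD; move: e; rewrite /m /= => ->; rewrite flK.
by rewrite -tt in e *; congr (_, _); apply: (rho_inj t01) => //; exact: fl_inj e.
Qed.

Let D : set (R * R) := `[0, 1] `*` [set s : R | 0 <= s].

(* Continuity of the inverse: orbits of the arc that came back close to it would contradict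
   no_return, so the heights of convergent points of the marker are bounded. *)
Let m_open O : open O -> exists2 V, open V & D `&` O = D `&` m @^-1` V.
Proof.
move=> oO; exists (interior [set x | forall z, D z -> m z = x -> O z]); first exact: open_interior.
rewrite eqEsubset; split=> z [Dz]; last by move=> /nbhs_singleton hz; split=> //; exact: hz.
move=> Oz; split=> //; rewrite /preimage /= /interior /=.
apply: nbhs_seq => x xl nx.
have /choice[w wP] : forall n, exists w, [/\ D w, m w = x n & ~ O w].
  by move=> n; have /existsNP[w /not_implyP[h1 /not_implyP[h2 h3]]] := nx n; exists w.
case: z Dz Oz xl => t0 s0 [/= t01 s00] Oz xl; rewrite in_itv /= in t01.
have w1 n : 0 <= (w n).1 <= 1 by have [[]] := wP n; rewrite /= in_itv.
have w2 n : 0 <= (w n).2 by have [[]] := wP n.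
have [t1 t101 tl] := uf_bounded (nearW _ w1).
have [cg gd _ _] := gs; have gl := cts_uf (cg _) tl.
have xl' : (fun n => phi' (- rho t0 s0 + rho (w n).1 (w n).2) (g (w n).1)) @ uf --> g t0.
  have H := uf_fl (@uf_const _ (- rho t0 s0 : R)) xl; rewrite /m /= flK in H.
  apply: uf_congr H; apply: nearW => n; have [_ <- _] := wP n.
  by rewrite flD.
have dl : mdist (g t1) (g t0) < nr.
  apply: lt_le_trans dn; apply: le_lt_trans (metric_triangle _ (g 0) _) _.
  by rewrite metric_sym; apply: ltrD; case: (gd t1); case: (gd t0).
have bd := uf_lt (uf_mdist gl xl') (@uf_const _ nr) dl.
have [s1 /andP[s10 _] sl] : exists2 l, 0 <= l <= (rho t0 s0 + 1) / (h / 2) & (fun n => (w n).2) @ uf --> l.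
  apply: uf_bounded; apply: filterS bd => n /nrP; rewrite ltr_norml w2 /= => /andP[_ b].
  have /andP[b' _] := rho_incr (w1 n) (lexx 0) (w2 n); rewrite rho0 !subr0 in b'.
  rewrite ler_pdivlMr ?divr_gt0 // mulrC; apply: le_trans b' _.
  by rewrite ltW // -ltrBlDl addrC.
have wl : w @ uf --> (t1, s1).
  by apply: uf_congr (uf_pair tl sl); apply: nearW => n; rewrite -surjective_pairing.
have E : (t1, s1) = (t0, s0).
  apply: m_inj => //; apply: (@uf_uniqM R X (fun n => m (w n))).
    exact: cts_uf (@m_cts _) wl.
  by apply: uf_congr xl; apply: nearW => n; have [_ ->] := wP n.
rewrite E in wl; have [n nO] := filter_ex (uf_open (open_nbhs_nbhs (conj oO Oz)) wl).
by have [] := wP n.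
Qed.

Let m_ray t : 0 <= t <= 1 -> ray (fun s => m (t, s)) = ray (og (g t)).
Proof.
move=> t01; have [[inc cts sur] _ _ osE] := osP (g t).
rewrite eqEsubset; split=> x [s /= s0 <-].
  exists (os (g t) (rho t s)) => /=; last by rewrite /m /= osE.
  have /andP[b _] := rho_incr t01 (lexx 0) s0; rewrite rho0 !subr0 in b.
  by rewrite -(os0 (g t)); apply: os_le; apply: le_trans b; rewrite mulr_ge0 // ltW // divr_gt0.
have [T TE] := sur s; rewrite -TE -osE.
have T0 : 0 <= T by rewrite leNgt; apply/negP => /cts; rewrite os0 TE ltNge s0.
have S0 : 0 <= T / (h / 2) by rewrite divr_ge0 // ltW // divr_gt0.
have /andP[b _] := rho_incr t01 (lexx 0) S0; rewrite rho0 !subr0 mulrC divfK ?gt_eqF ?divr_gt0 // in b.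
have [||s' /andP[s'0 _] <-] := @ivt R (rho t) 0 (T / (h / 2)) T S0; last by exists s'.
  by move=> v _; apply: uf_cts => u uv; apply: uf_rho uv; exact: uf_const.
by left; rewrite rho0 T0 b.
Qed.

(** If two points at height s share a plaque, flowing both back by the time of the first relates the
    points of the arc along the unstable leaf at scale e, and the last condition of [seed]
    identifies them. *)
Let m_trans s : 0 <= s -> Defs.transversal A `[0, 1] (fun t => m (t, s)).
Proof.
move=> s0; have cm : continuous (fun t => m (t, s)).
  move=> t; apply: uf_cts => u ut; apply: cts_uf (@m_cts _) _.
  by apply: uf_pair ut _; exact: uf_const.
split; first exact: continuous_subspaceT.
move=> t; rewrite /= in_itv /= => t01; have [_ [c [_ Ac _ dc _]]] := lift_atlasP hcov atlasWu (m (t, s)).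
exists c => //; have [_ _ _ [e e_0 eP]] := gs; have e2 : 0 < e / 2 by rewrite divr_gt0.
have [||e' e'0 e'P] := @eps_seq R (R * R)%type (fun z => `|z.1 - t| + `|z.2 - t|) (fun z =>
    0 <= z.1 <= 1 -> 0 <= z.2 <= 1 -> dom c (m (z.1, s)) /\ ((c (m (z.1, s))).2 = (c (m (z.2, s))).2 -> z.1 = z.2)).
- by move=> z; rewrite addr_ge0.
- move=> z zl nz.
  have nz' n : [/\ 0 <= (z n).1 <= 1, 0 <= (z n).2 <= 1 &
      ~ (dom c (m ((z n).1, s)) /\ ((c (m ((z n).1, s))).2 = (c (m ((z n).2, s))).2 -> (z n).1 = (z n).2))].
    by have /not_implyP[h1 /not_implyP[h2 h3]] := nz n.
  have l1 : (fun n => (z n).1) @ uf --> t.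
    apply/ufRP => e1 e10; move/ufRP: zl => /(_ e1 e10); apply: filterS => n.
    rewrite subr0 ger0_norm ?addr_ge0 //; apply: le_lt_trans; by rewrite lerDl.
  have l2 : (fun n => (z n).2) @ uf --> t.
    apply/ufRP => e1 e10; move/ufRP: zl => /(_ e1 e10); apply: filterS => n.
    rewrite subr0 ger0_norm ?addr_ge0 //; apply: le_lt_trans; by rewrite lerDr.
  have m1 := cts_uf (cm _) l1; have m2 := cts_uf (cm _) l2.
  have [w w0 wP] := displacement e2.
  have [q q0 qP] := Rel_flow false (`|rho t s| + 1) e2.
  have d1 := uf_dom dc m1.
  have same : \forall n \near uf, (c (m ((z n).1, s))).2 = (c (m ((z n).2, s))).2.
    by apply: filterS d1 => n dn'; have [_ _ h3] := nz' n; apply: contrapT => h4; apply: h3.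
  have Rl := Rel_of_chart Ac dc m1 m2 q0 same.
  have r1 := uf_rho l1 (@uf_const _ s); have r2 := uf_rho l2 (@uf_const _ s).
  move/ufRP: (r1) => /(_ 1 ltr01) r1b.
  have : (fun n => rho (z n).2 s - rho (z n).1 s) @ uf --> rho t s - rho t s by apply: cvgB.
  rewrite subrr => /ufRP /(_ w w0) r12.
  have [n [[[h1 h2] h3] h4]] := filter_ex (filterI (filterI (filterI Rl r1b) r12) d1).
  have [b1 b2 b3] := nz' n; apply: b3; split=> // _; apply: eP => //.
  have nb : `|- rho (z n).1 s| <= `|rho t s| + 1.
    rewrite normrN -[rho (z n).1 s](subrKC (rho t s)); apply: le_trans (ler_normD _ _) _.
    by rewrite lerD2l ltW.
  have := qP _ _ _ nb h1; rewrite /m /= flK -flD => h5.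
  rewrite [e]splitr; apply: Rel_trans h5 _.
  rewrite -{2}(flK (- rho (z n).1 s + rho (z n).2 s) (g (z n).2)); apply: Rel_time => v; rewrite normrN => vh _.
  by apply: wP; apply: le_lt_trans vh _; rewrite [- _ + _]addrC -[rho (z n).2 s - _]subr0.
exists (e' / 2); first by rewrite divr_gt0.
move=> s1; rewrite /= in_itv /= => s101 s1t; split.
  by have [|//] := e'P (s1, s1) _ s101 s101; rewrite /= [ltRHS]splitr; exact: ltrD.
move=> s2; rewrite /= in_itv /= => s201 s2t.
by have [|//] := e'P (s1, s2) _ s101 s201; rewrite /= [ltRHS]splitr; exact: ltrD.
Qed.

Let m_close s t : 0 <= s -> 0 <= t <= 1 ->
  exists n, mdist (phi' (h * n%:R) (g 0)) (m (t, s)) < eps / 6 /\ forall t', 0 <= t' <= 1 ->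
    mdist (phi' (h * n%:R) (g 0)) (m (t', s)) < eps / 6.
Proof.
move=> s0 t01; have [n [v [v01 v1 sE]]] := natP s0; exists n.
suff H t' : 0 <= t' <= 1 -> mdist (phi' (h * n%:R) (g 0)) (m (t', s)) < eps / 6 by split; [exact: H|].
move=> t'01; have [_ _ h2 h3 _] := rP; have c3 := h3 n t' t'01.
apply: le_lt_trans (metric_triangle _ (phi' (r n t') (g t')) _) _.
have E : m (t', s) = phi' (v * (r n.+1 t' - r n t')) (phi' (r n t') (g t')).
  by rewrite -flD /m /= /rho ger0_norm // sE plE // addrC.
have sm : `|v * (r n.+1 t' - r n t')| < k.
  have /andP[a b] := h2 n t' t'01; have a0 : 0 <= r n.+1 t' - r n t' by apply: le_trans a; rewrite ltW // divr_gt0.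
  apply: le_lt_trans hk; apply: le_trans b; case/andP: v01 => v0 v1'.
  by rewrite ger0_norm ?mulr_ge0 // ler_piMl.
have := kP (phi' (r n t') (g t')) sm; rewrite -E => c4.
exact: twelfths c3 c4.
Qed.

Lemma seed_fan_marker : exists m', marker A eps m' /\ forall t, 0 <= t <= 1 -> marker_end (A := A) m' t (fwd (g t)).
Proof.
exists m; split; last by move=> t t01; exists (og (g t)); [exact: m_ray|].
split=> [|t t01|s s0|s t t' s0 t01 t'01].
- split; last exact: m_open.
    by apply: continuous_subspaceT; exact: m_cts.
  move=> [t s] [t' s']; rewrite !inE /= => -[/= + s0] [/= + s'0]; rewrite !in_itv /= => t01 t'01 e.
  exact: m_inj.
- by exists (og (g t)); exact: m_ray.
- exact: m_trans.
- have [n [c1 /(_ _ t'01) c2]] := m_close s0 t01.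
  apply: le_lt_trans (metric_triangle _ (phi' (h * n%:R) (g 0)) _) _.
  exact: sixths (close_sym c1) c2.
Qed.

End SeedMarker.

Lemma seed_marker (eps : R) : 0 < eps -> exists2 d : R, 0 < d & forall g, seed g d ->
  exists m, marker A eps m /\ forall t, 0 <= t <= 1 -> marker_end (A := A) m t (fwd (g t)).
Proof.
move=> e0; have e12 : 0 < eps / 12 by rewrite divr_gt0.
have [k k0 kP] := displacement e12; have [h0 h00 fP] := fanP true.
have [h /andP[hg _] [hh0 hk]] := below2 h00 (divr_gt0 k0 (ltr0Sn R 1)).
have [|d1 d10 [N NP]] := fP h _ _ e12; first by rewrite hg.
have [nr nr0 nrP] := no_return ltr01.
have [d /andP[dg _] [dd1 dnr]] := below2 d10 (divr_gt0 nr0 (ltr0Sn R 1)).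
exists d => // g gs; have [cg gP _ _] := gs.
have [|r rP] := NP g cg.
  by move=> t; have [l1 l2] := gP t; split=> //; exact: lt_trans l2 dd1.
apply: (@seed_fan_marker eps h d k nr N g r) => //; first by keep hk hg; lra.
by keep dnr; lra.
Qed.

Lemma uf_all (T : pointedType) (Q : nat -> T -> Prop) : (forall t : nat -> T, \forall n \near uf, Q n (t n)) ->
  \forall n \near uf, forall t, Q n t.
Proof.
move=> H; apply: contrapT => /ufN nQ.
have /choice[t tP] : forall n, exists t, ~ (forall t, Q n t) -> ~ Q n t.
  move=> n; have [h|/existsNP[t h]] := pselect (forall t, Q n t); first by exists point.
  by exists t.
by have [n [h1 h2]] := filter_ex (filterI (H t) nQ); apply: (tP n h2).
Qed.

Lemma seed_deck g f d : deck p f -> seed g d -> seed (f \o g) d.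
Proof.
move=> df [cg gP inj [e e0 eP]]; have [f' [df' fK f'K]] := deck_inv df; split.
- apply: (@ccomp R X X g f) => //; by case: df.
- by move=> t; rewrite /= !(deck_p _ df) (deck_iso hmet).
- move=> t t' t01 t'01 [T TE]; apply: inj => //; exists T; apply: (can_inj fK).
  by rewrite -(deck_fl _ _ df).
- by exists e => // t t' t01 t'01 h; apply: eP => //; rewrite -(fK (g t)) -(fK (g t')); exact: Rel_deck.
Qed.

(** Along the segment b is affine and not constant, hence injective, while points on one short orbit
    or one small unstable path have equal b. [no_return] reduces the orbit condition to short
    orbits. *)
Lemma seg_seed c l (x y : nat -> X) d : xbox c -> dom c l -> x @ uf --> l -> y @ uf --> l -> 0 < d ->
  (forall n, cb true c (x n) = cb true c (y n) /\ cb false c (x n) != cb false c (y n)) ->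
  \forall n \near uf, seed (seg c (x n) (y n)) d.
Proof.
move=> hc dl xl yl d0 xy; have lim t := @seg_lim c x y l t dl xl yl.
have [h /andP[h0 _] hd] := box_time dl (@ltr01 R); have [nr nr0 nrP] := no_return h0.
have /nbhsMP[r r0 rc] := chart_nbhs dl; have r2 : 0 < r / 2 by rewrite divr_gt0.
have inj n t t' : 0 <= t <= 1 -> 0 <= t' <= 1 ->
    cb false c (seg c (x n) (y n) t) = cb false c (seg c (x n) (y n) t') -> t = t'.
  move=> t01 t'01; rewrite !seg_cb !clamp_id // => /addrI /(mulIf _) -> //.
  by rewrite subr_eq0 eq_sym; case: (xy n).
have c1 : \forall n \near uf, forall t, mdist (x n) (seg c (x n) (y n) t) < d.
  apply: (@uf_all R) => t; apply: uf_lt (uf_mdist xl (lim t)) (@uf_const _ d) _.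
  by rewrite mdistxx.
have c2 : \forall n \near uf, forall t : R * R, 0 <= t.1 <= 1 -> 0 <= t.2 <= 1 ->
    on_orbit phi' (seg c (x n) (y n) t.1) (seg c (x n) (y n) t.2) -> t.1 = t.2.
  apply: uf_all => t; have l1 := lim (fun n => (t n).1); have l2 := lim (fun n => (t n).2).
  have cl := uf_lt (uf_mdist l1 l2) (@uf_const _ nr); rewrite mdistxx in cl.
  apply: filterS2 (cl nr0) (uf_tube hd l1) => n /= close tube t1 t2 [T TE].
  apply: (inj n) => //; rewrite TE in close *; have := nrP _ _ close; rewrite ltr_norml => Th.
  rewrite -{1}[seg _ _ _ _]fl0; have hh : - h < 0 < h by rewrite oppr_lt0 h0.
  have tb s : - h < s < h -> dom c (phi' s (seg c (x n) (y n) (t n).1)).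
    by move=> /andP[s1 s2]; apply: tube; rewrite ler_norml !ltW.
  by have [_] := box_fl hc tb hh Th.
have c3 : \forall n \near uf, forall t : R * R, 0 <= t.1 <= 1 -> 0 <= t.2 <= 1 ->
    Rel false (r / 2) (seg c (x n) (y n) t.1) (seg c (x n) (y n) t.2) -> t.1 = t.2.
  apply: uf_all => t; have l1 := lim (fun n => (t n).1).
  have cl := uf_lt (uf_mdist (@uf_const _ l) l1) (@uf_const _ (r / 2)); rewrite mdistxx in cl.
  apply: filterS (cl r2) => n close t1 t2 Rl; apply: (inj n) => //; apply: (Rel_unfold Rl) => // w lw.
  by apply: rc; apply: le_lt_trans (metric_triangle _ (seg c (x n) (y n) (t n).1) _) _; rewrite [r]splitr ltrD.
have c4 := uf_dom dl xl.
near=> n; have dx : dom c (x n) by near: n.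
split.
- exact: seg_cts.
- move=> t; rewrite seg0 //; split; first by apply: seg_leaf => //; case: (xy n).
  by move: t; near: n.
- move=> t t'; have H : forall t : R * R, 0 <= t.1 <= 1 -> 0 <= t.2 <= 1 ->
    on_orbit phi' (seg c (x n) (y n) t.1) (seg c (x n) (y n) t.2) -> t.1 = t.2 by near: n.
  exact: (H (t, t')).
- exists (r / 2) => // t t'; have H : forall t : R * R, 0 <= t.1 <= 1 -> 0 <= t.2 <= 1 ->
    Rel false (r / 2) (seg c (x n) (y n) t.1) (seg c (x n) (y n) t.2) -> t.1 = t.2 by near: n.
  exact: (H (t, t')).
Unshelve. all: by end_near.
Qed.

Lemma seed_join (d : R) : 0 < d -> exists2 e : R, 0 < e & forall x y, Rel true e x y ->
  exists2 g, seed g d & g 0 = x /\ (g 1 = y \/ on_orbit phi' x y).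
Proof.
move=> d0; have [||e e0 eP] := @unif_Rel true (fun _ x y => exists2 g, seed g d & g 0 = x /\ (g 1 = y \/ on_orbit phi' x y)).
- move=> f _ x y df [g gs [gx gy]]; have [f' [df' fK f'K]] := deck_inv df.
  exists (f' \o g); first exact: seed_deck.
  rewrite /= gx fK; split=> //; case: gy => [->|[T TE]]; [by left; rewrite fK|right].
  by exists T; rewrite -(fK y) TE -(deck_fl _ _ df') fK.
- move=> c l x y _ hc dl xl yl _ _ same.
  (* If y n has the coordinate b of x n, both lie on one orbit and no seed joins them; the arc then
     leads to an auxiliary point displaced in b. *)
  pose z n := if (c (y n)).2 == (c (x n)).2 then
    cinv c (((c (x n)).1.1, (c (x n)).1.2), (c (x n)).2 + n.+1%:R^-1) else
    cinv c (((c (x n)).1.1, (c (y n)).1.2), (c (y n)).2).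
  have [x1 x2 x3] := uf_chart dl xl; have [y1 y2 y3] := uf_chart dl yl.
  have zE1 : (fun n => cinv c (((c (x n)).1.1, (c (x n)).1.2), (c (x n)).2 + n.+1%:R^-1)) @ uf --> l.
    rewrite -[X in _ --> X](cmapK dl); apply: (@cts_uf _ _ (cinv c)); first exact: cinv_continuous.
    rewrite cE; apply: uf_pair; first exact: uf_pair.
    by rewrite -[(c l).2]addr0; apply: cvgD => //; exact: uf_invn.
  have zE2 : (fun n => cinv c (((c (x n)).1.1, (c (y n)).1.2), (c (y n)).2)) @ uf --> l.
    rewrite -[X in _ --> X](cmapK dl); apply: (@cts_uf _ _ (cinv c)); first exact: cinv_continuous.
    by rewrite cE; apply: uf_pair => //; exact: uf_pair.
  have zl : z @ uf --> l.
    move=> U nU; have e1 : \forall n \near uf, U _ := zE1 U nU.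
    have e2 : \forall n \near uf, U _ := zE2 U nU.
    have : \forall n \near uf, U (z n) by apply: filterS2 e1 e2 => n; rewrite /z; case: ifP.
    by [].
  have zP n : cb true c (x n) = cb true c (z n) /\ cb false c (x n) != cb false c (z n).
    rewrite /cb /z; case: ifP => [/eqP e|ne]; rewrite cinvK; split=> //.
      by rewrite /= -subr_eq0 opprD addNKr oppr_eq0 invr_eq0 pnatr_eq0.
    by rewrite eq_sym ne.
  have hs := seg_seed hc dl xl zl d0 zP; have dx := uf_dom dl xl; have dy := uf_dom dl yl.
  have hl := box_same_line hc dl yl xl (@ltr01 R).
  have hl2 : \forall n \near uf, (c (y n)).2 = (c (x n)).2 -> on_orbit phi' (x n) (y n).
    have [nb|b] := pselect (\forall n \near uf, (c (y n)).2 = (c (x n)).2).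
      have sb : \forall n \near uf, (c (y n)).1.1 = (c (x n)).1.1 /\ (c (y n)).2 = (c (x n)).2.
        by apply: filterS2 same nb => n e1 e2; split=> //; apply/esym.
      by apply: filterS (hl sb) => n [u _ ->] _; exists u.
    by apply: filterS (ufN b) => n.
  near=> n; exists (seg c (x n) (z n)); first by near: n.
  have dxn : dom c (x n) by near: n.
  have dyn : dom c (y n) by near: n.
  have sn : cb true c (x n) = cb true c (y n) by near: n.
  have on : (c (y n)).2 = (c (x n)).2 -> on_orbit phi' (x n) (y n) by near: n.
  rewrite seg0 //; split=> //; have [/on h|/eqP/negPf ne] := pselect ((c (y n)).2 = (c (x n)).2); [by right|left].
  rewrite /z ne seg1; last exact: cinv_dom.
  by move: sn; rewrite /cb => ->; rewrite -cE cmapK.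
exists (e / 2) => [|x y]; first by rewrite divr_gt0.
by move=> /RelW; apply: eP; keep e0; lra.
Unshelve. all: by end_near.
Qed.

(** ** Ends of markers *)

Lemma within_comp (S T U : topologicalType) (D : set T) (f : T -> U) (k : S -> T) :
  {within D, continuous f} -> continuous k -> (forall x, D (k x)) -> continuous (f \o k).
Proof.
move=> /subspace_continuousP cf ck Dk x W nW.
have h := cf _ (Dk x) W nW; have H := ck x _ h.
have H' : \forall y \near x, D (k y) -> W (f (k y)) := H.
have : \forall y \near x, W (f (k y)) by apply: filterS H' => y Hy; exact: Hy.
by [].
Qed.

Lemma ld_mdist x y : leaf A x y -> mdist x y <= ld x y.
Proof. by move=> l; exact: mdist_ld (ldE l). Qed.

Lemma geod_ld (g : geod A) s t : ld (g s) (g t) = `|s - t|.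
Proof. by rewrite /ld geodP. Qed.

Lemma geod_inj (g : geod A) s t : g s = g t -> s = t.
Proof.
move=> e; have := geod_ld g s t; rewrite e geod_ld subrr normr0 => /esym/eqP.
by rewrite normr_eq0 subr_eq0 => /eqP.
Qed.

Lemma geod_projU (g : geod A) s t : leaf (Wf false) (p (g s)) (p (g t)).
Proof. by apply: leaf_proj; exact: geod_leaf. Qed.

Lemma marker_cts eps m (k : R -> R * R) : marker A eps m -> continuous k ->
  (forall s, 0 <= (k s).1 <= 1 /\ 0 <= (k s).2) -> continuous (fun s => m (k s)).
Proof.
move=> [[cm _ _] _ _ _] ck kD; apply: (within_comp cm ck) => s.
by have [h1 h2] := kD s; split=> //=; rewrite in_itv.
Qed.

(** A ray of a marker is given only as a set. rho recovers arclength along it: continuity comes from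
    leafwise closeness of nearby points, and injectivity makes it monotone. *)
Lemma marker_rho eps m t (g : geod A) : marker A eps m -> 0 <= t <= 1 -> ray (fun s => m (t, s)) = ray g ->
  exists rho : R -> R, [/\ forall s, 0 <= s -> 0 <= rho s /\ m (t, s) = g (rho s),
    forall u, 0 <= u -> exists2 s, 0 <= s & rho s = u &
    forall s s', 0 <= s -> s < s' -> rho s < rho s'].
Proof.
move=> mk t01 rE; have [[cm injm _] _ _ _] := mk.
have /choice[rho rhoP] : forall s, exists r, 0 <= s -> 0 <= r /\ m (t, s) = g r.
  move=> s; have [s0|s0] := leP 0 s; last by exists 0.
  have : ray (fun s => m (t, s)) (m (t, s)) by exists s.
  by rewrite rE => -[r r0 e]; exists r.
have sur u : 0 <= u -> exists2 s, 0 <= s & rho s = u.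
  move=> u0; have : ray g (g u) by exists u.
  by rewrite -rE => -[s /= s0 e]; exists s => //; apply: (@geod_inj g); rewrite -e; have [_ ->] := rhoP s s0.
have inj s s' : 0 <= s -> 0 <= s' -> rho s = rho s' -> s = s'.
  move=> s0 s'0 e; have [_ e1] := rhoP s s0; have [_ e2] := rhoP s' s'0.
  have : m (t, s) = m (t, s') by rewrite e1 e2 e.
  by move/(injm (t, s) (t, s')); rewrite !inE /= in_itv /= t01 => /(_ (conj isT s0) (conj isT s'0)) [].
have cf : continuous (fun s : R => m (t, `|s|)).
  apply: (marker_cts mk) => [s|s]; last by rewrite /= normr_ge0.
  by apply: uf_cts => u us; apply: uf_pair (@uf_const _ t) _; apply: cts_uf us; exact: norm_continuous.
have crho : continuous (fun s : R => rho `|s|).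
  move=> s; apply/(@cvgrPdist_lt _ R^o) => k k0; have [d d0 dP] := Rel_ld k0.
  have [|e e0 eP] := @path_Rel false (fun s => m (t, `|s|)) d s cf _ d0.
    move=> v; have [_ ->] := rhoP _ (normr_ge0 (0 : R)); have [_ ->] := rhoP _ (normr_ge0 v); exact: geod_projU.
  apply/nbhsRP; exists e => // v vs; have [|_] := dP _ _ (eP s v _ vs); first by rewrite subrr normr0.
  by have [_ ->] := rhoP _ (normr_ge0 s); have [_ ->] := rhoP _ (normr_ge0 v); rewrite geod_ld.
have btw a c b : 0 <= a -> a < c < b -> rho a < rho c < rho b \/ rho b < rho c < rho a.
  move=> a0 /andP[ac cb]; have c0 := le_trans a0 (ltW ac); have b0 := le_trans c0 (ltW cb).
  have [||||] := @inj_between (fun s => rho `|s|) a c b.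
  - by rewrite ac.
  - by move=> v _; exact: crho.
  - move=> u v /andP[au _] /andP[av _]; have u0 := le_trans a0 au; have v0 := le_trans a0 av.
    by rewrite !ger0_norm //; exact: inj.
  - by rewrite !ger0_norm //; left.
  - by rewrite !ger0_norm //; right.
exists rho; split=> // s s' s0 ss'; have s'0 := le_trans s0 (ltW ss').
rewrite ltNge le_eqVlt; apply/negP => /orP[/eqP e|lt].
  by have := inj _ _ s'0 s0 e => e'; rewrite e' ltxx in ss'.
(* A point farther out than both [rho 0] and [rho s] excludes that rho decreases. *)
have [w w0 wE] := sur (rho 0 + rho s + 1) (addr_ge0 (addr_ge0 (rhoP 0 (lexx 0)).1 (rhoP s s0).1) ler01).
have w_1 : rho 0 < rho w by rewrite wE; have := (rhoP s s0).1; keep s0; lra.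
have w_2 : rho s < rho w by rewrite wE; have := (rhoP 0 (lexx 0)).1; keep s0; lra.
have [sw|ws|e] := ltgtP s w; last by rewrite e ltxx in w_2.
  have [s'w|ws'|e] := ltgtP s' w; last by rewrite e in lt; have := lt_trans lt w_2; rewrite ltxx.
    have [|/andP[h1 h2]|/andP[h1 h2]] := btw s s' w s0; first by rewrite ss'.
      by have := lt_trans h1 lt; rewrite ltxx.
    by have := lt_trans (lt_trans h1 h2) w_2; rewrite ltxx.
  have [|/andP[h1 h2]|/andP[h1 h2]] := btw s w s' s0; first by rewrite sw.
    by have := lt_trans (lt_trans h1 h2) lt; rewrite ltxx.
  by have := lt_trans h2 w_2; rewrite ltxx.
have [w00|w00|e] := ltgtP 0 w; [|by rewrite leNgt w00 in w0|by rewrite -e ltxx in w_1].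
have [|/andP[h1 h2]|/andP[h1 h2]] := btw 0 w s (lexx 0); first by rewrite w00.
  by have := lt_trans h2 w_2; rewrite ltxx.
by have := lt_trans h2 w_1; rewrite ltxx.
Qed.

Lemma endpt_leaf2 (g g' : geod A) s t : endpt g = endpt g' -> leaf A (g s) (g' t).
Proof.
move=> e; apply: leaf_trans (geod_leaf g s 0) _; apply: leaf_trans (endpt_leaf e) _; exact: geod_leaf.
Qed.

(** After the shift of [asym_close], the hyperbolic cosine of the distance is 1 plus a nonnegative
    constant times e^(-2 s). *)
Lemma asym_conv (g g' : geod A) : endpt g = endpt g' -> exists a : R,
  (forall s s', s <= s' -> ld (g s') (g' (s' + a)) <= ld (g s) (g' (s + a))) /\
  forall k : R, 0 < k -> exists S, forall s, S <= s -> ld (g s) (g' (s + a)) < k.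
Proof.
move=> e; have [F [hF F0]] := fol_coordP (g 0); have t1 : -1 < (0 : R) < 1 by lra.
have lg : leaf A (F ((0, 1), 0)) (g 0) by rewrite F0; exact: leaf_refl.
have lg' : leaf A (F ((0, 1), 0)) (g' 0) by rewrite F0; exact: endpt_leaf2.
have [k [hk kE]] := F_geod hF t1 lg; have [k' [hk' k'E]] := F_geod hF t1 lg'.
have ep := (endpt_coord hF t1 hk hk' kE k'E).1 e.
have [c c0 [_ cP]] := asym_close hk hk' ep; exists (- ln c).
have [_ nm _] := hgeod_null hk; have [_ nm' _] := hgeod_null hk'.
have f0 := null_form_ge0 nm nm'; set f := mform (nminus k) _ in cP f0.
have [hk0 _] := hk; have [hk'0 _] := hk'.
have E s : ld (g s) (g' (s - ln c)) = hyp_dist (k s) (k' (s - ln c)).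
  by rewrite /ld kE k'E F_ld.
have cf : 0 <= c * f by rewrite mulr_ge0 // ltW.
split=> [s s' ss'|q q0].
  rewrite !E hyp_dist_le ?hyp_dist_ge0 // ch_hyp_dist // !cP lerD2l -!mulrA ler_wpM2r //.
  by rewrite ler_expR lerN2 ler_pM2l.
have q1 : 0 < ch q - 1 by rewrite subr_gt0 (_ : 1 = ch 0) ?ch_lt // /ch oppr0 expR0; field.
exists ((c * f) / (ch q - 1)) => s sS.
suff : mform (mk (k s)) (mk (k' (s - ln c))) < ch q.
  rewrite E -ch_hyp_dist // => lt; rewrite ltNge; apply/negP => le; move: lt; rewrite ltNge ch_le ?le //.
    exact: ltW.
  exact: hyp_dist_ge0.
rewrite cP -ltrBrDl -mulrA.
have s0 : 0 <= s by apply: le_trans sS; rewrite divr_ge0 // ltW.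
have e2 : 1 + s <= expR (2 * s) by apply: le_trans (expR_ge1Dx _) _; rewrite ler_expR; keep s0; lra.
rewrite expRN mulrC ltr_pdivrMr ?expR_gt0 //; rewrite ler_pdivrMr // in sS.
apply: le_lt_trans sS _; rewrite mulrC ltr_pM2l //; apply: lt_le_trans e2; keep s0; lra.
Qed.

(** Far out the shifted distance is below k, so the triangle inequality bounds the shift by 2 k. The
    initial shifted distance is then at most 3 k, and it does not increase. *)
Lemma shadow (g g' : geod A) (k : R) : 0 < k -> endpt g = endpt g' -> ld (g 0) (g' 0) <= k ->
  exists a : R, `|a| <= 2 * k /\ forall s, 0 <= s -> ld (g s) (g' (s + a)) <= 3 * k.
Proof.
move=> k0 e d0; have [a [mono lim]] := asym_conv e; have [S SP] := lim k k0.
have lf s t := endpt_leaf2 s t e.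
have ak : `|a| <= 2 * k.
  pose s := Num.max S (Num.max 0 (- a)).
  have sS : S <= s by rewrite /s le_max lexx.
  have s0 : 0 <= s by rewrite /s !le_max lexx orbT.
  have sa : 0 <= s + a by rewrite -[a]opprK subr_ge0 /s !le_max lexx !orbT.
  have e0 := ldC (lf 0 0); have es := ldC (lf s 0); have ea := ldC (lf s (s + a)).
  have d1 := SP s sS; have t1 := ldD (lf s (s + a)) (geod_leaf g' (s + a) 0).
  have t2 := ldD (lf s 0) (leaf_sym (lf 0 0)); have t3 := ldD (geod_leaf g s 0) (lf 0 0).
  have t4 := ldD (leaf_sym (lf s (s + a))) (lf s 0).
  rewrite geod_ld subr0 ger0_norm // in t1; rewrite geod_ld subr0 ger0_norm // -e0 in t2.
  rewrite geod_ld subr0 ger0_norm // in t3; rewrite geod_ld subr0 -ea ger0_norm // in t4.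
  rewrite ler_norml; apply/andP; split; [keep t1 t2 d1 d0; lra|keep t3 t4 d1 d0; lra].
exists a; split=> // s s0; apply: le_trans (mono _ _ s0) _; rewrite add0r.
apply: le_trans (ldD (lf 0 0) (geod_leaf g' 0 a)) _; rewrite geod_ld sub0r normrN; keep ak d0; lra.
Qed.

Lemma os_bound (c : R) : 0 < c -> exists2 w : R, 0 < w & forall x u, `|u| <= w -> `|os x u| < c.
Proof.
move=> c0; have [e e0 eP] := Rel_ld c0; have [d d0 dP] := displacement e0.
exists (d / 2) => [|x u ud]; first by rewrite divr_gt0.
rewrite -ld_os0; suff : Rel false e x (phi' u x) by move=> /eP[].
apply: Rel_time => v vu _; apply: dP; apply: le_lt_trans vu _; apply: le_lt_trans ud _; keep d0; lra.
Qed.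

Lemma Rel_leafS e x y : Rel true e x y -> leaf As x y.
Proof.
move=> [g [cg <- <- gP]]; apply: (leaf_lift hM hcov atlasWs) => // t.
by case: (gP t).
Qed.

Lemma fl_leafS x t : leaf As x (phi' t x).
Proof.
have := @leaf_lift R M X p hM hcov Ws atlasWs (fun s => phi' (s * t) x) _ _ 1; rewrite mul0r fl0 mul1r; apply.
  apply: (@ccomp R R X (fun s => s * t) (fun t => phi' t x)); last exact: flt_cts.
  by move=> s; apply: cvgM; [exact: cvg_id|exact: cvg_cst].
by move=> s; exact: orbit_leafS.
Qed.

Lemma hyp_bound (a b k e es : R) : a < es / 4 -> b < es / 4 + k -> k < es / 4 -> e < es / 4 -> a + (b + e) < es.
Proof. lra. Qed.

(* The ray of m over t0 follows the orbit of x0. The local product structure gives an orbit in the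
   stable leaf of x0 that starts next to the ray over t; it stays close to the first ray in X, hence
   to the second one, and closeness in X keeps the leafwise distance below 1 once it is. *)
Lemma marker_fwd : exists2 eps0 : R, 0 < eps0 & forall eps m t0 t (g0 g : geod A) x0, eps <= eps0 ->
  marker A eps m -> 0 <= t0 <= 1 -> 0 <= t <= 1 -> ray (fun s => m (t0, s)) = ray g0 ->
  ray (fun s => m (t, s)) = ray g -> endpt g0 = fwd x0 -> exists2 y, leaf As x0 y & endpt g = fwd y.
Proof.
(* The constants of a bootstrap: in one step a leafwise distance below 1 grows to at most 2, and
   closeness in X within es brings it back below 1. *)
have [w w0 wP] := os_bound ltr01; have [es es0 esP] := ld_small 2 (@ltr01 R).
have es4 : 0 < es / 4 by rewrite divr_gt0.
have [hd hd0 hdP] := displacement es4; have [h0 h00 fP] := fanP true.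
have [h1 /andP[h10 _] [h1d h1h]] := below2 hd0 h00.
have [h /andP[hg _] [hh1 hw]] := below2 h10 (divr_gt0 w0 (ltr0Sn R 1)).
have hhd := lt_trans hh1 h1d.
have [|d1 d10 [N NP]] := fP h _ _ es4; first by rewrite hg (lt_trans hh1 h1h).
have [eld eld0 eldP] := Rel_ld (@ltr01 R).
have [el /andP[el0 _] [eld1 elld]] := below2 d10 eld0.
have [d2 d20 lpP] := local_product el0.
have [k /andP[k0 _] [ke kd]] := below2 es4 (divr_gt0 d20 (ltr0Sn R 1)).
exists k => // eps m t0 t g0 g x0 epsk mk t00 t01 rE0 rE e.
have [_ _ _ mclose] := mk.
have eps3 s : 0 <= s -> mdist (m (t0, s)) (m (t, s)) < k.
  move=> s0; have := mdist_ge0 (m (t0, s)) (m (t, s)); have := mclose s t0 t s0 t00 t01; keep epsk k0; lra.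
have [rho0 [r0P sur0 mono0]] := marker_rho mk t00 rE0; have [rho [rP sur mono]] := marker_rho mk t01 rE.
have rle s s' : 0 <= s -> s <= s' -> rho0 s <= rho0 s'.
  by move=> s0; rewrite le_eqVlt => /orP[/eqP ->//|lt]; apply: ltW; exact: mono0.
have [a [_ lim]] := asym_conv e; have [S SP] := lim k k0.
have [v v0 vP] := os_up x0 (Num.max S 0 + a); pose z := phi' v x0.
have hn n : 0 <= h * n%:R by rewrite mulr_ge0 // ltW.
have natS (n : nat) : h * n.+1%:R = h * n%:R + h by rewrite -natr1 mulrDr mulr1.
(* The arclength on g0 that faces [phi' (h * n) z]; v is so large that the two points are k-close
   from then on. *)
pose sig n := os x0 (v + h * n%:R) - a.
have sigM n : Num.max S 0 <= sig n by rewrite /sig lerBrDr; apply: vP; rewrite lerDl.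
have sig0 n : 0 <= sig n by apply: le_trans (sigM n); rewrite le_max lexx orbT.
have sigS n : S <= sig n by apply: le_trans (sigM n); rewrite le_max lexx.
have sigI n : sig n <= sig n.+1 by rewrite /sig lerD2r os_le // lerD2l natS lerDl ltW.
have /choice[s sP] : forall n, exists s, 0 <= s /\ rho0 s = sig n.
  by move=> n; have [s s0 sE] := sur0 _ (sig0 n); exists s.
have sI n : s n <= s n.+1.
  have [s0 E] := sP n; have [s0' E'] := sP n.+1; rewrite leNgt; apply/negP => lt.
  by have := mono0 _ _ s0' lt; rewrite E E' ltNge sigI.
have asy r : S <= rho0 r -> 0 <= r -> forall q, os x0 q = rho0 r + a -> mdist (phi' q x0) (m (t0, r)) < k.
  move=> Sr rr q qE; have [_ ->] := r0P r rr; rewrite -ogE qE metric_sym.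
  by apply: le_lt_trans (ld_mdist (endpt_leaf2 _ _ e)) _; exact: SP.
have CL n r : s n <= r <= s n.+1 -> mdist (phi' (h * n%:R) z) (m (t0, r)) < es / 4 + k.
  move=> /andP[r1 r2]; have [s0 E] := sP n; have [s0' E'] := sP n.+1; have rr := le_trans s0 r1.
  have b1 := rle _ _ s0 r1; have b2 := rle _ _ rr r2; rewrite E in b1; rewrite E' in b2.
  have [|||q /andP[q1 q2] qE] := @ivt R (os x0) (v + h * n%:R) (v + h * n.+1%:R) (rho0 r + a).
  - by rewrite lerD2l natS lerDl ltW.
  - by move=> *; exact: os_cts.
  - by left; rewrite -!lerBlDr b1 -/(sig _) -lerBrDr b2.
  apply: le_lt_trans (metric_triangle _ (phi' q x0) _) _; apply: ltrD; last first.
    by apply: asy => //; apply: le_trans b1.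
  have -> : phi' q x0 = phi' (q - (v + h * n%:R)) (phi' (h * n%:R) z).
    by rewrite /z -!flD; congr (phi' _ x0); ring.
  apply: hdP; rewrite ger0_norm ?subr_ge0 //; apply: le_lt_trans hhd.
  by move: q2; rewrite natS; move: (h * n%:R) => b q2; keep q2; lra.
have [s00 s0E] := sP 0%N.
have d0 : mdist z (m (t, s 0%N)) < d2.
  apply: le_lt_trans (metric_triangle _ (m (t0, s 0%N)) _) _; rewrite [d2]splitr.
  apply: ltrD; last by apply: lt_trans kd; exact: eps3.
  apply: lt_trans kd; apply: asy => //; first by rewrite s0E.
  by rewrite s0E /sig mulr0 addr0 subrK.
have [y [zy ym]] := lpP _ _ d0; have [gg [cg gg0 gg1 ggP]] := zy; rewrite -gg0 in ggP.
have [|r fr] := NP gg cg.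
  by move=> u; have [l1 l2] := ggP u; split=> //; exact: lt_trans l2 eld1.
have [[_ fr0] _ frI frc _] := fr.
pose Rn n := r n 1; have yc n : mdist (phi' (h * n%:R) z) (phi' (Rn n) y) < es / 4.
  by have := frc n 1 itv1; rewrite gg0 gg1.
have ly u u' : 0 <= u' -> leaf A (m (t, u')) (phi' u y).
  move=> u'0; apply: leaf_trans (fl_leafU y u); apply: leaf_sym; apply: leaf_trans (Rel_leafA ym) _.
  by have [_ ->] := rP _ s00; have [_ ->] := rP _ u'0; exact: geod_leaf.
have small n u : s n <= u <= s n.+1 -> ld (m (t, u)) (phi' (Rn n) y) <= 2 -> ld (m (t, u)) (phi' (Rn n) y) < 1.
  move=> un le2; have u0 : 0 <= u by case/andP: un => un _; apply: le_trans un; case: (sP n).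
  apply: esP => //; first exact: ly.
  rewrite metric_sym; apply: le_lt_trans (metric_triangle _ (phi' (h * n%:R) z) _) _.
  have c1 := close_sym (yc n); have c2 := CL n u un; have c3 := eps3 u u0.
  apply: le_lt_trans (hyp_bound c1 c2 ke (lt_trans c3 ke)); rewrite lerD2l; exact: metric_triangle.
(* A step is taken first along the ray of m, in small pieces by [loc_const], and then along the
   orbit of y; each time [small] restores the bound. *)
have ind n : ld (m (t, s n)) (phi' (Rn n) y) < 1.
  elim: n => [|n IH].
    rewrite /Rn fr0 fl0 (ldC (leaf_sym (Rel_leafA ym))).
    by have [_] := eldP _ _ (Rel_le (ltW elld) ym).
  have [sn0 _] := sP n; have [sn0' _] := sP n.+1.
  pose f u := m (t, s n + clamp u * (s n.+1 - s n)).
  have dif : 0 <= s n.+1 - s n by rewrite subr_ge0.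
  have fI u : s n <= s n + clamp u * (s n.+1 - s n) <= s n.+1.
    have /andP[c0 c1] := clamp_itv u; rewrite lerDl mulr_ge0 //= -lerBrDl.
    by rewrite -[leRHS]mul1r ler_wpM2r.
  have f0 u : 0 <= s n + clamp u * (s n.+1 - s n) by have /andP[b _] := fI u; exact: le_trans b.
  have cf : continuous f.
    apply: (marker_cts mk) => [u|u] //=.
    apply: uf_cts => b bu; apply: uf_pair; first exact: uf_const.
    apply: cvgD; first exact: uf_const.
    by apply: cvgM; [exact: cts_uf (@clamp_continuous R u) bu|exact: uf_const].
  have Q : ld (f 1) (phi' (Rn n) y) < 1.
    apply: (@loc_const R (fun u => ld (f u) (phi' (Rn n) y) < 1) _ 0 1); last first.
      by rewrite /f clamp0 mul0r addr0.
    move=> u; have [|e1 e10 e1P] := @path_Rel false f eld u cf _ eld0.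
      by move=> u'; rewrite /f; have [_ ->] := rP _ (f0 0); have [_ ->] := rP _ (f0 u'); exact: geod_projU.
    exists e1 => // u1 u2 h1' h2' lt1; apply: small; first exact: fI.
    have [l12 lt2] := eldP _ _ (e1P _ _ h2' h1').
    by apply: le_trans (ldD l12 (ly _ _ (f0 u1))) _; apply: ltW; rewrite (_ : 2 = 1 + 1 :> R) ?ltrD //; ring.
  rewrite /f clamp1 mul1r addrC subrK in Q.
  apply: small; first by rewrite lexx sI.
  have lo : leaf A (phi' (Rn n) y) (phi' (Rn n.+1) y) by rewrite -(subrK (Rn n) (Rn n.+1)) flD; exact: fl_leafU.
  apply: le_trans (ldD (ly (Rn n) _ sn0') lo) _; apply: ltW; rewrite (_ : 2 = 1 + 1 :> R); last by ring.
  apply: ltrD => //; rewrite -(subrK (Rn n) (Rn n.+1)) flD ld_os0; apply: wP.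
  have /andP[i1 i2] := frI n 1 itv1; rewrite ger0_norm; last by apply: le_trans i1; rewrite ltW // divr_gt0.
  apply: le_trans i2 _; keep hw hg; lra.
exists y; first by apply: leaf_trans (fl_leafS x0 v) _; exact: Rel_leafS zy.
have [F [hF F0]] := fol_coordP y; have t1 : -1 < (0 : R) < 1 by rewrite oppr_lt0 ltr01.
have lF : leaf A (F ((0, 1), 0)) y by rewrite F0; exact: leaf_refl.
have lg : leaf A (F ((0, 1), 0)) (g 0).
  rewrite F0; have := ly 0 0 (lexx 0); rewrite fl0; have [_ ->] := rP 0 (lexx 0) => l.
  by apply: leaf_trans (leaf_sym l) _; exact: geod_leaf.
have [q qP] := okeyP hF t1 lF; have [q' [hq' q'E]] := F_geod hF t1 lg; have [hq _ _ qfl] := qP.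
apply/esym/(fwd_coord hF t1 qP hq' q'E).
apply: (@asym_of_bounded R q q' (fun n => os y (Rn n)) (fun n => rho (s n)) 1) => //.
  move=> c; have [T T0 TP] := os_up y c.
  have : \forall n \near uf, (Num.bound (T / (h / 2)) <= n)%N by exact: uf_ge.
  apply: filterS => n nb; have [s0n _] := sP n; have [r0n _] := rP _ s0n.
  apply: le_trans (_ : os y (Rn n) <= _); last by rewrite lerDl.
  apply: TP; have /andP[b _] := fan_time n hg fr itv1; apply: le_trans b.
  rewrite mulrC -ler_pdivrMr ?divr_gt0 //; apply: ltW.
  apply: lt_le_trans (archi_boundP (divr_ge0 T0 (ltW (divr_gt0 hg (ltr0Sn R 1))))) _.
  by rewrite ler_nat.
have : forall n, hyp_dist (q (os y (Rn n))) (q' (rho (s n))) <= 1.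
  move=> n; have [s0n _] := sP n; have [_ E] := rP _ s0n; have l := ly (Rn n) _ s0n.
  have := ind n; rewrite (ldC l) E q'E qfl /ld F_ld //; first exact: ltW.
    by case: hq.
  by case: hq'.
exact: nearW.
Qed.

Lemma orbit_closed x y (c : R) : (forall e : R, 0 < e -> exists2 u, `|u| <= c & mdist x (phi' u y) < e) ->
  on_orbit phi' y x.
Proof.
move=> H; have /choice[u uP] : forall n : nat, exists u, `|u| <= c /\ mdist x (phi' u y) < n.+1%:R^-1.
  by move=> n; have [|u u1 u2] := H n.+1%:R^-1; [rewrite invr_gt0|exists u].
have [|u0 _ ul] := @uf_bounded R u (- c) c; first by apply: nearW => n; rewrite -ler_norml; case: (uP n).
exists u0; apply: (@uf_uniqM R X (fun n => phi' (u n) y)); last exact: uf_fl ul (@uf_const _ y).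
apply: (uf_close _ (@uf_const _ x)); apply: uf_squeeze (@uf_invn R).
by apply: nearW => n; rewrite mdist_ge0 ltW //; case: (uP n).
Qed.

Lemma ray_unique (g g' : geod A) : endpt g = endpt g' -> g 0 = g' 0 -> forall s, 0 <= s -> g s = g' s.
Proof.
move=> e e0 s s0; apply: mdist_positivity; apply/eqP; rewrite eq_le mdist_ge0 andbT; apply/ler_addgt0Pr => k k0.
have k5 : 0 < k / 5 by rewrite divr_gt0.
have [|a [a1 a2]] := shadow k5 e; first by rewrite e0 geod_ld subrr normr0 ltW.
rewrite add0r; apply: le_trans (ld_mdist (endpt_leaf2 s s e)) _.
apply: le_trans (ldD (endpt_leaf2 s (s + a) e) (geod_leaf g' (s + a) s)) _.
rewrite geod_ld [s + a]addrC addrK; have := a2 s s0; rewrite [s + a]addrC; keep a1; lra.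
Qed.

(** In a single leaf the transverse coordinate would be constant near 0 by [leaf_path_const], yet on
    a transversal it is injective there. *)
Lemma transversal_not_leaf (tau : R -> X) x : Defs.transversal A `[0, 1] tau ->
  (forall t, 0 <= t <= 1 -> leaf A x (tau t)) -> False.
Proof.
move=> [ct tr] lt; have [|c [c0 Wc0 c0P] [e e0 eP]] := tr 0; first by rewrite /= in_itv /= lexx ler01.
have I01 (t : R) : `[0, 1]%classic (clamp t) by rewrite /= in_itv /=; exact: clamp_itv.
have cc : continuous (fun t : R => p (tau (clamp t))).
  apply: (@ccomp R X M (fun t => tau (clamp t)) p); last exact: cover_cts hcov.
  exact: (within_comp ct (@clamp_continuous R) I01).
have [d /andP[d0 d1] [de _]] := below2 e0 ltr01.
have close t : `|t| < d -> `|clamp t - 0| < e.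
  move=> td; rewrite subr0; apply: lt_trans de; apply: le_lt_trans td.
  have /andP[b0 b1] := clamp_itv t; rewrite ger0_norm //.
  have [t0|t0] := leP t 0; first by rewrite clamp_le0.
  have [t1|t1] := leP t 1; first by rewrite clamp_id ?ler_norm // (ltW t0).
  by rewrite clamp_ge1 ?(ltW t1) //; apply: le_trans (ltW t1) (ler_norm _).
have inside t : - d < t < d -> `|t| < d by rewrite ltr_norml.
have E : (c0 (p (tau (clamp 0)))).2 = (c0 (p (tau (clamp (d / 2))))).2.
  apply: (@leaf_path_const R M Wu atlasWu compactM c0 (fun t => p (tau (clamp t))) (p x) (- d) d) => //.
  - by move=> c' Wc'; exact: atlasWu.2.
  - move=> t /inside td; split; first by apply: leaf_proj; apply: lt; have := I01 t; rewrite /= in_itv.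
    by have [/c0P[]] := eP _ (I01 t) (close t td).
  - by rewrite oppr_lt0 d0.
  - by keep d0; lra.
have z0 : `|0 : R| < d by rewrite normr0.
have z1 : `|d / 2| < d by rewrite ger0_norm; keep d0; lra.
have [/c0P[_ E0] inj] := eP _ (I01 0) (close 0 z0); have [/c0P[_ E1] _] := eP _ (I01 (d / 2)) (close _ z1).
have := inj _ (I01 (d / 2)) (close _ z1); rewrite E0 E1 => /(_ E).
rewrite clamp0 clamp_id; last by keep d0 d1; lra.
by move=> /eqP; rewrite eq_sym gt_eqF // divr_gt0.
Qed.

Lemma os_mdist x u v : `|v| <= `|u| -> 0 <= v * u -> mdist x (phi' v x) <= `|os x u|.
Proof.
move=> vu v0; apply: le_trans (ld_mdist (fl_leafU x v)) _; rewrite ld_os0; exact: os_norm_le.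
Qed.

Lemma step_arith (a b c h : R) : `|c - (a - h)| < h / 2 -> h / 2 <= (b - c) - (b - a) <= 3 * h / 2.
Proof. by rewrite ltr_norml => /andP[h1 h2]; apply/andP; split; lra. Qed.

Lemma shadow_arith (a b e k : R) : a < e / 2 -> b <= 3 * k -> k < e / 6 -> a + b < e.
Proof. lra. Qed.

(* Otherwise all rays of m are backward orbits that stay close to each other, so by expansivity they
   start in one unstable leaf, although the initial points form a transversal. *)
Lemma marker_not_bwd : exists2 eps0 : R, 0 < eps0 & forall eps m, eps <= eps0 -> marker A eps m ->
  exists t (g : geod A), [/\ 0 <= t <= 1, ray (fun s => m (t, s)) = ray g & endpt g <> bwd (g 0)].
Proof.
have [h0 h00 kP] := unique_shadowing true; have hh : 0 < h0 / 2 < h0 by keep h00; lra.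
have [d d0 keyP] := kP _ hh; set h := h0 / 2 in hh keyP; have hg : 0 < h by case/andP: hh.
have h2 : 0 < h / 2 by rewrite divr_gt0.
have [nr nr0 nrP] := no_return h2; have nr2 : 0 < nr / 2 by rewrite divr_gt0.
have [w w0 wP] := fl_unif h nr2.
have [de1 /andP[de10 _] [de1w de1n]] := below2 w0 nr2.
have [de /andP[de0 _] [dede ded]] := below2 de10 d0.
have [k /andP[k0 _] [kd kde]] := below2 (divr_gt0 d0 (ltr0Sn R 3)) (divr_gt0 de0 (ltr0Sn R 5)).
have [el eld_ elP] := Rel_ld k0.
have [el' /andP[el'0 _] [el'd el'l]] := below2 (divr_gt0 d0 (ltr0Sn R 1)) eld_.
have [d2 d20 lpP] := local_product el'0.
have [eps0 /andP[eps00 _] [epsd epsde]] := below2 d20 (divr_gt0 de0 (ltr0Sn R 1)).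
exists eps0 => // eps m epsk mk; apply: contrapT => nex.
have [_ mg mt mclose] := mk.
have bw t (g : geod A) : 0 <= t <= 1 -> ray (fun s => m (t, s)) = ray g -> endpt g = bwd (g 0).
  by move=> t01 rE; apply: contrapT => ne; apply: nex; exists t, g.
have itv0' : 0 <= (0 : R) <= 1 by rewrite lexx ler01.
have start t (g : geod A) rho : (forall s, 0 <= s -> 0 <= rho s /\ m (t, s) = g (rho s)) ->
    (forall u, 0 <= u -> exists2 s, 0 <= s & rho s = u) -> (forall s s', 0 <= s -> s < s' -> rho s < rho s') ->
    rho 0 = 0.
  move=> rP sur mono; have [s s0 sE] := sur 0 (lexx 0); have [r0 _] := rP 0 (lexx 0).
  move: s0; rewrite le_eqVlt => /orP[/eqP s0|s0]; [by rewrite {1}s0|have := mono _ _ (lexx 0) s0].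
  by rewrite sE ltNge r0.
apply: (@transversal_not_leaf (fun t => m (t, 0)) (m (0, 0)) (mt 0 (lexx 0))) => t t01.
have eps3 s : 0 <= s -> mdist (m (0, s)) (m (t, s)) < eps0.
  move=> s0; have := mdist_ge0 (m (0, s)) (m (t, s)); have := mclose s 0 t s0 itv0' t01; keep epsk eps00; lra.
have [g0 rE0] := mg 0 itv0'; have [g rE] := mg t t01.
have [rho0 [r0P sur0 mono0]] := marker_rho mk itv0' rE0; have [rho [rP sur mono]] := marker_rho mk t01 rE.
have rho00 := start _ _ _ r0P sur0 mono0; have rho_0 := start _ _ _ rP sur mono.
set x0 := m (0, 0); set P := m (t, 0).
have g00 : g0 0 = x0 by rewrite /x0; have [_ ->] := r0P 0 (lexx 0); rewrite rho00.
have g_0 : g 0 = P by rewrite /P; have [_ ->] := rP 0 (lexx 0); rewrite rho_0.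
have e0 := bw _ _ itv0' rE0; have e1 := bw _ _ t01 rE; rewrite g00 in e0; rewrite g_0 in e1.
have back := ray_unique e0; rewrite rgE oppr0 og0 in back.
have hn (n : nat) : 0 <= h * n%:R by rewrite mulr_ge0 // ltW.
(* Parameters at which the ray over 0, which is the backward orbit of x0, passes the times - h n. *)
have /choice[s sP] : forall n : nat, exists s, 0 <= s /\ m (0, s) = phi' (- (h * n%:R)) x0.
  move=> n; have o0 : 0 <= - os x0 (- (h * n%:R)) by rewrite oppr_ge0 -[leRHS](os0 x0) os_le // oppr_le0.
  have [s s0 sE] := sur0 _ o0; exists s; split=> //.
  by have [r0 ->] := r0P s s0; rewrite back // rgE sE opprK ogE.
(* y lies in the stable leaf of x0 and the unstable leaf of P. The ray g ends at the backward end of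
   that leaf, so it is shadowed by the backward orbit of y, at the times T n. *)
have Pd := eps3 0 (lexx 0); have [y [xy yP]] := lpP _ _ (lt_trans Pd epsd).
have [yPl yPk] := elP _ _ (Rel_le (ltW el'l) yP).
have e1' : endpt g = endpt (rg (og y)) by rewrite e1 -(bwd_leaf yPl).
have [|a [ak shP]] := shadow k0 e1'; first by rewrite rgE oppr0 og0 g_0 (ldC (leaf_sym yPl)) ltW.
have /choice[T TP] : forall n : nat, exists T, os y T = - (rho (s n) + a) by move=> n; exact: os_onto.
have s_0 : rho (s 0%N) = 0.
  have [s00 E] := sP 0%N; rewrite mulr0 oppr0 fl0 in E; suff -> : s 0%N = 0 by [].
  have [_ E'] := r0P _ s00; have : g0 (rho0 (s 0%N)) = g0 0 by rewrite -E' E g00.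
  move/geod_inj => E2; move: s00; rewrite le_eqVlt => /orP[/eqP <-//|/(mono0 _ _ (lexx 0))].
  by rewrite rho00 E2 ltxx.
have close n : mdist (phi' (- (h * n%:R)) x0) (phi' (T n) y) < de.
  have [sn E] := sP n; have [rn E'] := rP _ sn; rewrite -E -ogE TP -rgE.
  apply: le_lt_trans (metric_triangle _ (m (t, s n)) _) _; rewrite [in X in _ + X]E'.
  have c1 := lt_trans (eps3 _ sn) epsde; have c2 := shP _ rn.
  apply: le_lt_trans (shadow_arith c1 c2 kde); rewrite lerD2l; apply: ld_mdist.
  exact: endpt_leaf2.
(* The times [T n - h] and [T n.+1] bring y next to the same point of the orbit of x0, so
   [no_return] makes them differ by less than h / 2. *)
have step n : h / 2 <= (T 0%N - T n.+1) - (T 0%N - T n) <= 3 * h / 2.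
  apply: step_arith; apply: (nrP (phi' (T n - h) y)); rewrite -flD subrK.
  apply: le_lt_trans (metric_triangle _ (phi' (- (h * n.+1%:R)) x0) _) _; rewrite [nr]splitr.
  apply: ltrD; last by apply: lt_trans (close n.+1) _; exact: lt_trans dede de1n.
  apply: close_sym.
  have -> : - (h * n.+1%:R) = - h + - (h * n%:R) by rewrite -natr1 mulrDr mulr1 opprD addrC.
  rewrite [T n - h]addrC !flD; apply: wP; first by rewrite normrN gtr0_norm.
  apply: lt_trans (close n) _; exact: lt_trans dede de1w.
pose P0 := phi' (T 0%N) y.
have RP : Rel true d x0 P0.
  rewrite [d]splitr; apply: Rel_trans (Rel_le (ltW el'd) xy) _.
  have nT : `|os y (T 0%N)| < d / 2 by rewrite TP s_0 add0r normrN; apply: le_lt_trans ak _; keep kd; lra.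
  apply: Rel_time => v vT v0; exact: le_lt_trans (os_mdist _ vT v0) nT.
(* Tracking holds at every step, so unique shadowing gives every precision e', and x0 lies on the
   orbit of y. *)
have key_ e' : 0 < e' -> exists2 u, `|u| <= h / 2 & mdist x0 (phi' u P0) < e'.
  move=> e'0; have [N NP] := keyP e' e'0.
  have cl (n : nat) : (n <= N)%N -> mdist (psi true (- (h * n%:R)) x0) (psi true (- (T 0%N - T n)) P0) <= d.
    by rewrite /psi /sg /P0 -flD opprB subrK => _; apply: ltW; apply: lt_trans (close n) ded.
  by have [u /ltW uh ux] := NP x0 P0 (fun n => T 0%N - T n) (subrr _) step cl RP; exists u.
have [v vE] := orbit_closed key_.
apply: leaf_trans (Rel_leafA yP); apply: leaf_sym; rewrite vE /P0.
by apply: leaf_trans (fl_leafU y _) (fl_leafU _ v).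
Qed.

(** ** The stitching map *)

Lemma rst_orbit x y : clos_refl_sym_trans X (on_orbit phi') x y -> on_orbit phi' x y.
Proof.
elim=> {x y} [//|x|x y _ [t ->]|x y z _ [s ->] _ [t ->]].
- by exists 0; rewrite fl0.
- by exists (- t); rewrite flK.
- by exists (t + s); rewrite flD.
Qed.

Lemma quot_mapP (T : topologicalType) (r : T -> T -> Prop) x y :
  quot_map r x = quot_map r y <-> clos_refl_sym_trans T r x y.
Proof.
by split=> [/eqmodP|h]; [move=> /asboolP|apply/eqmodP/asboolP].
Qed.

Let Theta := quot_map (on_orbit phi').

Lemma ThetaP x y : Theta x = Theta y <-> on_orbit phi' x y.
Proof.
by split=> [/quot_mapP/rst_orbit//|h]; apply/quot_mapP; exact: rst_step.
Qed.

Lemma leaf_spaceP x y : quot_map (same_plaque A) x = quot_map (same_plaque A) y <-> leaf A x y.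
Proof. exact: quot_mapP. Qed.

Definition stitch (o : orbit_space phi') : Einf A := fwd (repr o).
Definition nonmarker (l : leaf_space A) : Einf A := bwd (repr l).

Lemma stitchE x : stitch (Theta x) = fwd x.
Proof.
rewrite /stitch; apply: fwd_orbit; apply/ThetaP; apply/esym; exact: reprK.
Qed.

Lemma nonmarkerE x : nonmarker (quot_map (same_plaque A) x) = bwd x.
Proof.
rewrite /nonmarker; apply: bwd_leaf; apply/leaf_spaceP; exact: reprK.
Qed.

Lemma Theta_onto o : exists x, Theta x = o.
Proof. by exists (repr o); exact: reprK. Qed.

Lemma stitch_homeo : homeo_onto stitch (~` range nonmarker).
Proof.
split.
- apply/continuousP => U oU; rewrite /open /= /quotient_open /=.
  change (open (Theta @^-1` (stitch @^-1` U))).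
  have -> : Theta @^-1` (stitch @^-1` U) = fwd @^-1` U.
    by rewrite eqEsubset; split=> x; rewrite /preimage /= -stitchE.
  exact: fwd_open_pre.
- move=> o o'; have [x <-] := Theta_onto o; have [x' <-] := Theta_onto o'; rewrite !stitchE.
  by move=> /fwd_inj h; apply/ThetaP.
- rewrite eqEsubset; split=> e.
    move=> [q _ <-] [l _]; have [x <-] := Theta_onto q; rewrite stitchE => h.
    by apply: (@fwd_bwd x (repr l)); rewrite -h.
  move=> ne; have [g gE] : exists g, endpt g = e by exists (repr e); exact: reprK.
  have [|y _ yE] := @fwd_onto g; last by exists (Theta y) => //; rewrite stitchE yE.
  by move=> h; apply: ne; exists (quot_map (same_plaque A) (g 0)) => //; rewrite nonmarkerE -h.
- move=> U oU; exists (stitch @` U).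
    have -> : stitch @` U = fwd @` (Theta @^-1` U).
      rewrite eqEsubset; split=> e [x]; last by move=> Ux <-; exists (Theta x) => //; exact: stitchE.
      by have [y <-] := Theta_onto x; move=> Uy <-; exists y => //; rewrite stitchE.
    apply: fwd_image_open; first exact: oU.
    by move=> x y /ThetaP; rewrite /preimage /= => ->.
  rewrite eqEsubset; split=> e; last by case.
  move=> [q Uq <-]; split; first by exists q.
  move=> [l _]; have [x <-] := Theta_onto q; rewrite stitchE => h.
  by apply: (@fwd_bwd x (repr l)); rewrite -h.
Qed.

Lemma stitch_equivariant f x (c c' : geod A) : deck p f -> (forall t, c' t = f (c t)) ->
  stitch (Theta x) = endpt c -> stitch (Theta (f x)) = endpt c'.
Proof.
rewrite !stitchE => df cE /endptP [C CP]; apply/endptP; exists C => t t0.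
have [u uE] := os_onto x t; have -> : og (f x) t = f (og x t).
  by rewrite -uE -{1}(deck_os _ _ df) !ogE (deck_fl _ _ df).
by rewrite cE; apply: le_trans (deck_leaf_dist_le _ _ df) _; exact: CP.
Qed.

Lemma stitch_unstable : identifies stitch (orbit_space_leaves phi' A)
  [set circle_at_infinity l `\` [set nonmarker l] | l in setT].
Proof.
have main x : stitch @` (quot_map (on_orbit phi') @` leaf A x) =
    circle_at_infinity (quot_map (same_plaque A) x) `\` [set nonmarker (quot_map (same_plaque A) x)].
  rewrite eqEsubset; split=> e.
    move=> [_ [y ly <-] <-]; rewrite stitchE nonmarkerE; split; last first.
      by rewrite /= (bwd_leaf ly) => /fwd_bwd.
    exists (og y) => //; apply/leaf_spaceP; rewrite og0; exact: ly.
  move=> [[g /leaf_spaceP lg ->]]; rewrite /= nonmarkerE (bwd_leaf lg) => ne.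
  have [y ly yE] := fwd_onto ne; exists (Theta y); last by rewrite stitchE.
  by exists y => //; exact: leaf_trans lg ly.
rewrite /identifies eqEsubset; split=> K.
  by move=> [_ [x _ <-] <-]; rewrite main; exists (quot_map (same_plaque A) x).
move=> [l _ <-]; have [x <-] : exists x, quot_map (same_plaque A) x = l by exists (repr l); exact: reprK.
by rewrite -main; exists (quot_map (on_orbit phi') @` leaf A x) => //; exists x.
Qed.

Lemma leafS_orbit x y z : leaf As x y -> on_orbit phi' y z -> leaf As x z.
Proof. by move=> l [t ->]; apply: leaf_trans l _; exact: fl_leafS. Qed.

Lemma marker_leaf : exists2 eps0 : R, 0 < eps0 & forall eps m, eps < eps0 -> marker A eps m ->
  exists x, forall t e, 0 <= t <= 1 -> marker_end (A := A) m t e -> exists2 y, leaf As x y & e = fwd y.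
Proof.
have [e1 e10 e1P] := marker_fwd; have [e2 e20 e2P] := marker_not_bwd.
have [e0 /andP[e00 _] [e01 e02]] := below2 e10 e20; exists e0 => // eps m lt mk.
have [t0 [g0 [t01 rE0 ne]]] := e2P eps m (ltW (lt_trans lt e02)) mk.
have [x _ xE] := fwd_onto ne; exists x => t e t01' [g rE ->].
have [y ly yE] := e1P eps m t0 t g0 g x (ltW (lt_trans lt e01)) mk t01 t01' rE0 rE (esym xE).
by exists y.
Qed.

(** Arcs glued at b belong to one stable leaf, because b is the forward end of a single orbit. *)
Lemma amalgam_leaf : exists2 eps0 : R, 0 < eps0 & forall eps a b K, eps < eps0 -> amalgam (A := A) eps a b K ->
  [/\ K a, K b & exists x, forall e, K e -> exists2 y, leaf As x y & e = fwd y].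
Proof.
have [e0 e00 eP] := marker_leaf; exists e0 => // eps a b K lt; elim=> {a b K}.
  move=> m a b mk ma mb; have i0 : 0 <= (0 : R) <= 1 by rewrite lexx ler01.
  have i1 : 0 <= (1 : R) <= 1 by rewrite lexx ler01.
  split; [by exists 0|by exists 1|].
  by have [x xP] := eP _ _ lt mk; exists x => e [t t01 me]; exact: xP me.
move=> a b c K L _ [Ka Kb [x xP]] _ [Lb Lc [x' x'P]] _; split; [by left|by right|].
exists x => e [/xP//|/x'P [y ly eE]]; have [z lz bE] := xP b Kb; have [z' lz' bE'] := x'P b Lb.
exists y => //; apply: leaf_trans ly; apply: leaf_trans (leaf_sym lz').
by apply: leafS_orbit lz _; apply: fwd_inj; rewrite -bE.
Qed.

Lemma stitch_stable : exists2 eps0 : R, 0 < eps0 & forall eps, 0 < eps < eps0 ->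
  identifies stitch (orbit_space_leaves phi' As) (maximal_markers A eps).
Proof.
have [e0 e00 eP] := amalgam_leaf; exists e0 => // eps /andP[eps0 lt].
have [d d0 sm] := seed_marker eps0; have [d' d'0 sj] := seed_join d0.
have arc x y : leaf As x y -> exists K, [/\ K (fwd x), K (fwd y) & exists a b, amalgam (A := A) eps a b K].
  move=> /converge_leaf cv; have [C CP] := cv d' 0 d'0; have [T' _ Rl] := CP C (lexx C).
  have [g gs [gx gy]] := sj _ _ Rl; have [m [mk me]] := sm g gs.
  have i0 : 0 <= (0 : R) <= 1 by rewrite lexx ler01.
  have i1 : 0 <= (1 : R) <= 1 by rewrite lexx ler01.
  have K0 : marker_arc (A := A) m (fwd x) by exists 0 => //; rewrite -(fwd_fl x C) -gx; exact: me.
  exists (marker_arc (A := A) m); split=> //.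
    case: gy => [gy|on]; first by exists 1 => //; rewrite -(fwd_fl y T') -gy; exact: me.
    by rewrite -(fwd_fl y T') (fwd_orbit on) fwd_fl.
  by exists (fwd (g 0)), (fwd (g 1)); apply: amalgam_marker => //; exact: me.
have main x : stitch @` (quot_map (on_orbit phi') @` leaf As x) =
    \bigcup_(K in amalgams_through (A := A) eps (fwd x)) K.
  rewrite eqEsubset; split=> e.
    move=> [_ [y ly <-] <-]; rewrite stitchE.
    by have [K [Kx Ky [a [b ab]]]] := arc x y ly; exists K => //; split=> //; exists a, b.
  move=> [K [Kx [a [b ab]]] Ke]; have [_ _ [x' x'P]] := eP _ _ _ _ lt ab.
  have [z lz xE] := x'P _ Kx; have [y ly eE] := x'P _ Ke.
  exists (Theta y); last by rewrite stitchE.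
  exists y => //; apply: leaf_trans ly; apply: leaf_sym; apply: leafS_orbit lz _.
  by apply: fwd_inj; rewrite xE.
rewrite /identifies eqEsubset; split=> S.
  move=> [_ [x _ <-] <-]; rewrite main; exists (fwd x) => //=.
  have [K [Kx _ [a [b ab]]]] := arc x x (leaf_refl _ _); exists K; split=> //.
  by exists a, b.
move=> [e [K [Ke [a [b ab]]]] <-]; have [_ _ [x xP]] := eP _ _ _ _ lt ab.
have [y _ eE] := xP _ Ke; rewrite eE -main; exists (quot_map (on_orbit phi') @` leaf As y) => //.
by exists y.
Qed.

Lemma forward_end_fwd x : forward_end phi' x (fwd x).
Proof. by exists (og x) => //; have [inc _ _ e] := osP x; exists (os x). Qed.

Lemma backward_end_bwd x : backward_end phi' x (bwd x).
Proof.
exists (og x), (rg (og x)); split=> [|t|//]; last exact: rgE.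
by have [inc _ _ e] := osP x; exists (os x).
Qed.

Lemma stitching : exists (s_nm : leaf_space A -> Einf A) (Phi : orbit_space phi' -> Einf A),
  [/\ (forall x, backward_end phi' x (s_nm (quot_map (same_plaque A) x))) /\
      (forall x, forward_end phi' x (Phi (quot_map (on_orbit phi') x))),
      homeo_onto Phi (~` range s_nm),
      (forall g, deck p g -> forall x (c c' : geod A), (forall t, c' t = g (c t)) ->
         Phi (quot_map (on_orbit phi') x) = endpt c -> Phi (quot_map (on_orbit phi') (g x)) = endpt c'),
      (exists2 eps0 : R, 0 < eps0 & forall eps, 0 < eps < eps0 ->
         identifies Phi (orbit_space_leaves phi' As) (maximal_markers A eps)) &
      identifies Phi (orbit_space_leaves phi' A)
        [set circle_at_infinity l `\` [set s_nm l] | l in setT]].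
Proof.
exists nonmarker, stitch; split.
- by split=> x; [rewrite nonmarkerE; exact: backward_end_bwd|rewrite stitchE; exact: forward_end_fwd].
- exact: stitch_homeo.
- by move=> g dg x c c' cc'; exact: stitch_equivariant.
- exact: stitch_stable.
- exact: stitch_unstable.
Qed.

End Main.

Theorem theorem5p3 (R : realType) (M X : metricType R) (p : X -> M)
    (phi : R -> M -> M) (phi' : R -> X -> X) (Ws Wu : set (fchart3 R M))
    (hM : closed_manifold M (R * R * R)%type)
    (hor : @orientable_manifold R M (R * R * R)%type)
    (hirr : @irreducible_3manifold R M)
    (hcov : @universal_cover R X M p)
    (hmet : lifted_metric p)
    (hator : atoroidal p)
    (hanosov : topological_anosov phi Ws Wu)
    (hWs : orientable_foliation Ws)
    (hWu : orientable_foliation Wu)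
    (hphi : lifted_flow p phi phi')
    (hadapt : adapted p phi phi' Wu) :
  let Ws' := lift_atlas p Ws in
  let Wu' := lift_atlas p Wu in
  let Theta := quot_map (on_orbit phi') in
  exists (s_nm : leaf_space Wu' -> Einf Wu')
         (Phi : orbit_space phi' -> Einf Wu'),
    [/\ (forall x, backward_end phi' x (s_nm (quot_map (same_plaque Wu') x))) /\
        (forall x, forward_end phi' x (Phi (Theta x))),
        homeo_onto Phi (~` range s_nm),
        (forall g, deck p g -> forall x (c c' : geod Wu'),
           (forall t, c' t = g (c t)) ->
           Phi (Theta x) = endpt c -> Phi (Theta (g x)) = endpt c'),
        (exists2 eps0 : R, 0 < eps0 & forall eps, 0 < eps < eps0 ->
           identifies Phi (orbit_space_leaves phi' Ws')
             (maximal_markers Wu' eps)) &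
        identifies Phi (orbit_space_leaves phi' Wu')
          [set circle_at_infinity l `\` [set s_nm l] | l in setT]].
Proof. exact: (stitching hM hcov hmet hanosov hphi hadapt). Qed.
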